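(* Let $m\ge1$ and let $u\in\dot H^{1/2}(\mathbb{R},S^{m-1})$ be a weak $1/2$-harmonic map. Then $u\in C^{0,\alpha}(\mathbb{R},S^{m-1})$ for some $\alpha\in(0,1)$.
   Context: $\Delta^{1/4}$ is the Fourier multiplier with symbol $|\xi|^{1/2}$ on $\mathbb{R}$. $\dot H^{1/2}(\mathbb{R},\mathbb{R}^m)$ is the homogeneous Sobolev space with seminorm $\|u\|_{\dot H^{1/2}}=\|\Delta^{1/4}u\|_{L^2}$ (equivalent to $(\int\int|u(x)-u(y)|^2/|x-y|^2\,dx\,dy)^{1/2}$), and $\dot H^{1/2}(\mathbb{R},S^{m-1})=\{u\in\dot H^{1/2}(\mathbb{R},\mathbb{R}^m):u(x)\in S^{m-1}\text{ a.e.}\}$, with $S^{m-1}$ the unit sphere of $\mathbb{R}^m$. $L(u)=\int_{\mathbb{R}}|\Delta^{1/4}u|^2dx$, and $\pi(y)=y/|y|$ is the orthogonal projection onto $S^{m-1}$. A map $u\in\dot H^{1/2}(\mathbb{R},S^{m-1})$ is a weak $1/2$-harmonic map if $\frac{d}{dt}L(\pi(u+t\phi))\big|_{t=0}=0$ for every $\phi\in C_0^\infty(\mathbb{R},\mathbb{R}^m)$. *)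

(* Defs.v *)
From HB Require Import structures.
From mathcomp Require Import all_boot all_order all_algebra.
From mathcomp Require Import all_classical all_reals all_analysis.
From mathcomp Require Import complex.

Set Implicit Arguments.
Unset Strict Implicit.
Unset Printing Implicit Defensive.

Import Order.TTheory GRing.Theory Num.Theory.
Import numFieldNormedType.Exports.

Local Open Scope classical_set_scope.
Local Open Scope complex_scope.
Local Open Scope ring_scope.

Section FourierMultiplier.
Context {R : realType}.

Local Notation mu := (@lebesgue_measure R).

Definition cintegral (f : R -> R[i]) : R[i] :=
  (\int[mu]_x complex.Re (f x)) +i* (\int[mu]_x complex.Im (f x)).

Definition expi (t : R) : R[i] := cos t +i* sin t.

Definition fourier (f : R -> R[i]) (xi : R) : R[i] :=
  cintegral (fun x => f x * expi (- (x * xi))).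

Definition inverse_fourier (g : R -> R[i]) (x : R) : R[i] :=
  ((2 * pi)^-1)%:C * cintegral (fun xi => g xi * expi (x * xi)).

Definition fourier_multiplier (sigma : R -> R) (f : R -> R[i]) : R -> R[i] :=
  inverse_fourier (fun xi => (sigma xi)%:C * fourier f xi).

Definition is_test_function (V : normedModType R) (phi : R -> V) : Prop :=
  (forall (n : nat) (x : R), derivable (derive1n n phi) x 1) /\
  compact (closure [set x | phi x != 0]).

(* The value of the multiplier is real, because the symbol is real and even;
   'Re' only changes the type. *)
Definition quarter_laplacian_test (phi : R -> R) (x : R) : R :=
  complex.Re (fourier_multiplier (fun xi => `|xi| `^ 2^-1)
                                 (fun y => (phi y)%:C) x).

(* f is the image of u under the multiplier |xi|^(1/2) in the sense of
   distributions: the multiplier is symmetric and is moved to the test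
   function.  The image of a test function decays like |x|^(-3/2), so the
   pairing makes sense for every u in homogeneous H^(1/2) although u need not
   be integrable. *)
Definition is_quarter_laplacian (u f : R -> R) : Prop :=
  forall phi : R -> R, is_test_function (phi : R -> R^o) ->
    [/\ mu.-integrable setT (EFin \o (u \* quarter_laplacian_test phi)),
        mu.-integrable setT (EFin \o (f \* phi)) &
        \int[mu]_x (u x * quarter_laplacian_test phi x) =
        \int[mu]_x (f x * phi x)].

Definition L2_quarter_laplacians (u : R -> R) : set (R -> R) :=
  [set f | f \in Lfun mu 2%:E /\ is_quarter_laplacian u f].

(* Elements of L2_quarter_laplacians u agree almost everywhere; the default
   value 0 is only taken when there is none. *)
Definition quarter_laplacian (u : R -> R) : R -> R :=
  xget (cst 0) (L2_quarter_laplacians u).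

End FourierMultiplier.

Section HalfHarmonic.
Context {R : realType} {m : nat}.

Local Notation mu := (@lebesgue_measure R).

(* The library norm on 'rV[R]_m is the sup norm. *)
Definition enorm (y : 'rV[R]_m) : R := Num.sqrt (\sum_i y ord0 i ^+ 2).

Definition sphere : set 'rV[R]_m := [set y | enorm y = 1].

Definition sphere_proj (y : 'rV[R]_m) : 'rV[R]_m := (enorm y)^-1 *: y.

Definition component (u : R -> 'rV[R]_m) (i : 'I_m) (x : R) : R := u x ord0 i.

Definition homogeneous_Hhalf (u : R -> 'rV[R]_m) : Prop :=
  forall i : 'I_m, measurable_fun setT (component u i) /\
    L2_quarter_laplacians (component u i) !=set0.

Definition homogeneous_Hhalf_sphere (u : R -> 'rV[R]_m) : Prop :=
  homogeneous_Hhalf u /\ {ae mu, forall x, sphere (u x)}.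

Definition vquarter_laplacian (u : R -> 'rV[R]_m) (x : R) : 'rV[R]_m :=
  \row_i quarter_laplacian (component u i) x.

(* Meaningful on homogeneous_Hhalf only. *)
Definition energy (u : R -> 'rV[R]_m) : R :=
  \int[mu]_x (enorm (vquarter_laplacian u x) ^+ 2).

(* For small t, u + t *: phi stays away from 0 almost everywhere and its
   projection is again in homogeneous_Hhalf, so the derivative at 0 does not
   depend on the default values of sphere_proj and energy. *)
Definition weak_half_harmonic (u : R -> 'rV[R]_m) : Prop :=
  homogeneous_Hhalf_sphere u /\
  forall phi : R -> 'rV[R]_m, is_test_function phi ->
    is_derive (0 : R) (1 : R)
      (fun t : R => energy (fun x => sphere_proj (u x + t *: phi x)) : R^o) 0.

(* Boundedness is automatic for sphere-valued maps. *)
Definition holder_sphere (alpha : R) (v : R -> 'rV[R]_m) : Prop :=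
  (forall x, sphere (v x)) /\
  exists C : R, forall x y : R, enorm (v x - v y) <= C * `|x - y| `^ alpha.

End HalfHarmonic.

(* Main.v *)
From HB Require Import structures.
Require Import Defs.
From mathcomp Require Import all_boot all_order all_algebra.
From mathcomp Require Import all_classical all_reals all_analysis.
From mathcomp Require Import measurable_realfun complex ring lra.

(** Write Lambda for the multiplier |xi|^(1/2), D u (x, y) = (u x - u y) / (x - y), and N = sum_i (D U_i)^2 for
    the energy density of a field U on the plane.  The proof has two halves.

    Half one turns the definition into an equation.  On test functions Lambda is a singular integral with
    kernel |h|^(-3/2) against second differences ([quarter_laplacian_testE]), and Lambda^2 is the one with
    kernel h^(-2).  Hence the energy int |Lambda u|^2 is a multiple of the Gagliardo integral of (D u)^2
    ([lap_pair], [lap_finite], [lap_exists]).  Along the projected variation the energy is E(0) + 2 t <DU, D psi>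
    + O(t^2) with psi the tangential part of the test function, and therefore
        int DU_k D phi = int N U_k(x) phi(x)
    for all bounded phi of finite energy ([euler_lagrange], [harmonic_ext], [weak_harmonic_field]).

    Half two is the regularity of solutions with |U| = 1.  Let P be the Poisson kernel at height t and
    F(x, t) = int N cutoff_t, the energy seen at scale t around x; it increases with t, with derivative twice
    int N cutoff_rate_t.  The Poisson extension of U solves d/dt = - (operator of order 1), so that its derivative
    is, by the equation, int N U_k P.  The crux is the bound of this source term by the rate int N cutoff_rate_t,
    with no smallness: test the equation with P times the tangential field U_i (U - c) - (1 - U.c) e_i, which
    kills the right-hand side and reproduces the source on the left, up to errors that are quadratic in U - c
    ([source_le_mean_dist]), then average over constants c taken from U itself ([source_le]).  Integrating in t,
        |extension at height t - extension at height s| <= C F(x, s)   for t < s    ([poisson_ext_dist]).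
    So the extension has a limit at every point, which represents U ([bdry_ae]), and oscillation is controlled
    by energy at the same scale ([poisson_ext_slide]).

    It remains to show that F(x, r) = O(sqrt r).  F is small at small scales, uniformly in x ([cut_energy_small]),
    so U stays near a constant vector c on a fixed interval; testing the equation for U.c with the cutoff gives
    F(x, r) <= C int |U - c|^2 P + O(r^2) ([cut_energy_decay]).  If F = O(sqrt r) is known above some scale T, the
    oscillation bound makes the right-hand side smaller by a definite factor at scale q^2 T, which
    propagates the estimate to all scales ([improve], [power_decay]).  Comparing the values at two points with the
    extension at the height of their distance gives the exponent 1/4 ([bdry_holder]). *)

Set Implicit Arguments.
Unset Strict Implicit.
Unset Printing Implicit Defensive.

Import Order.TTheory GRing.Theory Num.Theory.
Import numFieldNormedType.Exports.

Local Open Scope classical_set_scope.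
Local Open Scope ring_scope.

(** * Integrable and square integrable functions *)

Notation intg m f := (integrable m setT (EFin \o f)).

Lemma cvg_sub0 (R : realType) (u : nat -> R) l :
  (u n - l) @[n --> \oo] --> 0 -> u n @[n --> \oo] --> l.
Proof.
move=> /cvgrPdist_le h; apply/cvgrPdist_le => e /h.
by apply: filterS => n; rewrite sub0r opprB.
Qed.

Section Toolkit.
Context d (T : measurableType d) (R : realType) (m : {measure set T -> \bar R}).
Implicit Types f g : T -> R.

Lemma intg_meas f : intg m f -> measurable_fun setT f.
Proof. by case/integrableP => /measurable_EFinP. Qed.

Lemma intg_le f g : measurable_fun setT f -> intg m g ->
  (forall x, `|f x| <= g x) -> intg m f.
Proof.
move=> mf ig fg; apply: (@le_integrable _ _ _ m setT measurableT (EFin \o f) (EFin \o g)) => //.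
  exact/measurable_EFinP.
by move=> x _ /=; rewrite lee_fin (le_trans (fg x))// ler_norm.
Qed.

Lemma intgD f g : intg m f -> intg m g -> intg m (fun x => f x + g x).
Proof. by move=> iF ig; have := integrableD measurableT iF ig; apply: eq_integrable. Qed.

Lemma intgB f g : intg m f -> intg m g -> intg m (fun x => f x - g x).
Proof. by move=> iF ig; have := integrableB measurableT iF ig; apply: eq_integrable. Qed.

Lemma intgZ k f : intg m f -> intg m (fun x => k * f x).
Proof. by move=> iF; have := integrableZl measurableT k iF; apply: eq_integrable. Qed.

Lemma intg0 : intg m (fun=> 0).
Proof. exact: integrable0. Qed.

Lemma intg_sum (I : Type) (s : seq I) (h : I -> T -> R) :
  (forall i, intg m (h i)) -> intg m (fun x => \sum_(i <- s) h i x).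
Proof.
move=> ih; elim: s => [|i s IH].
  by under eq_fun do rewrite big_nil; exact: intg0.
by under eq_fun do rewrite big_cons; exact: intgD.
Qed.

Lemma intg_abs f : intg m f -> intg m (fun x => `|f x|).
Proof. exact: integrable_norm. Qed.

Lemma RiE f : intg m f -> (\int[m]_x (f x)%:E = (\int[m]_x f x)%R%:E)%E.
Proof. by move=> iF; rewrite /Rintegral fineK// integrable_fin_num. Qed.

Lemma intg_ge0 f : measurable_fun setT f -> (forall x, 0 <= f x) ->
  (\int[m]_x (f x)%:E < +oo)%E -> intg m f.
Proof.
move=> mf f0 foo; apply/integrableP; split; first exact/measurable_EFinP.
by under eq_integral => x _ do rewrite /= ger0_norm//.
Qed.

Lemma intg_lty f : intg m f -> (\int[m]_x (f x)%:E < +oo)%E.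
Proof. by move=> iF; rewrite RiE// ltry. Qed.

Lemma Ri_bound f C : measurable_fun setT f -> (forall x, 0 <= f x) ->
  (\int[m]_x (f x)%:E <= C%:E)%E -> intg m f /\ (\int[m]_x f x)%R <= C.
Proof.
move=> mf f0 fC; have iF : intg m f by apply: intg_ge0 => //; rewrite (le_lt_trans fC)// ltry.
by split => //; rewrite -lee_fin -RiE.
Qed.

Lemma RiD f g : intg m f -> intg m g ->
  (\int[m]_x (f x + g x) = \int[m]_x f x + \int[m]_x g x)%R.
Proof. by move=> iF ig; rewrite RintegralD. Qed.

Lemma RiB f g : intg m f -> intg m g ->
  (\int[m]_x (f x - g x) = \int[m]_x f x - \int[m]_x g x)%R.
Proof. by move=> iF ig; rewrite RintegralB. Qed.

Lemma RiZ k f : intg m f -> (\int[m]_x (k * f x) = k * \int[m]_x f x)%R.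
Proof. by move=> iF; rewrite RintegralZl. Qed.

Lemma RiN f : intg m f -> (\int[m]_x (- f x) = - \int[m]_x f x)%R.
Proof. by move=> iF; under eq_Rintegral do rewrite -mulN1r; rewrite RiZ// mulN1r. Qed.

Lemma Ri_sum (I : Type) (s : seq I) (h : I -> T -> R) :
  (forall i, intg m (h i)) ->
  (\int[m]_x (\sum_(i <- s) h i x) = \sum_(i <- s) \int[m]_x h i x)%R.
Proof.
move=> ih; elim: s => [|i s IH].
  by rewrite big_nil; under eq_Rintegral do rewrite big_nil; rewrite /Rintegral integral0.
rewrite big_cons -IH -RiD//; last exact: intg_sum.
by under eq_Rintegral do rewrite big_cons.
Qed.

Lemma Ri_ge0 f : (forall x, 0 <= f x) -> 0 <= (\int[m]_x f x)%R.
Proof. by move=> f0; apply: Rintegral_ge0. Qed.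

Lemma Ri_le f g : intg m f -> intg m g -> (forall x, f x <= g x) ->
  (\int[m]_x f x <= \int[m]_x g x)%R.
Proof. by move=> iF ig fg; apply: le_Rintegral. Qed.

Lemma Ri_abs f : intg m f -> (`|\int[m]_x f x| <= \int[m]_x `|f x|)%R.
Proof. by move=> iF; apply: le_normr_Rintegral. Qed.

Lemma Ri_abs_le f g : intg m f -> intg m g -> (forall x, `|f x| <= g x) ->
  (`|\int[m]_x f x| <= \int[m]_x g x)%R.
Proof.
move=> iF ig fg; apply: le_trans (Ri_abs iF) _.
by apply: Ri_le => //; exact: intg_abs.
Qed.

Lemma Ri_eq f g : (forall x, f x = g x) -> (\int[m]_x f x = \int[m]_x g x)%R.
Proof. by move=> /funext->. Qed.

Lemma ae_intg f g : measurable_fun setT g -> {ae m, forall x, f x = g x} -> intg m f -> intg m g.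
Proof.
move=> mg fg /integrableP[/measurable_EFinP mf foo]; apply/integrableP; split.
  exact/measurable_EFinP.
apply: le_lt_trans foo; rewrite le_eqVlt; apply/orP; left; apply/eqP.
apply: ae_eq_integral => //.
- by apply/measurableT_comp => //; exact/measurable_EFinP.
- by apply/measurableT_comp => //; exact/measurable_EFinP.
- by apply: filterS fg => x /= -> .
Qed.

Lemma ae_Ri f g : measurable_fun setT f -> measurable_fun setT g ->
  {ae m, forall x, f x = g x} -> (\int[m]_x f x = \int[m]_x g x)%R.
Proof.
move=> mf mg fg; rewrite /Rintegral; congr fine.
apply: ae_eq_integral => //; [exact/measurable_EFinP|exact/measurable_EFinP|].
by apply: filterS fg => x /= -> .
Qed.

Lemma Ri_ae_le f g : intg m f -> intg m g -> {ae m, forall x, f x <= g x} ->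
  (\int[m]_x f x <= \int[m]_x g x)%R.
Proof.
move=> iF ig fg.
have mf := intg_meas iF; have mg := intg_meas ig.
have mM : measurable_fun setT (fun x => Num.max (f x) (g x)) by exact: measurable_maxr.
have e : {ae m, forall x, g x = Num.max (f x) (g x)}.
  by apply: filterS fg => x h; rewrite max_r.
rewrite (ae_Ri mg mM e); apply: Ri_le => //; first exact: ae_intg e ig.
by move=> x; rewrite le_max lexx.
Qed.

Lemma Ri_dct (f_ : nat -> T -> R) f g :
  (forall n, measurable_fun setT (f_ n)) -> measurable_fun setT f -> intg m g ->
  {ae m, forall x, f_ n x @[n --> \oo] --> f x} ->
  (forall n x, `|f_ n x| <= g x) ->
  intg m f /\ (\int[m]_x f_ n x)%R @[n --> \oo] --> (\int[m]_x f x)%R.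
Proof.
move=> mf_ mf ig cf fg.
have h1 n : measurable_fun setT (EFin \o f_ n) by exact/measurable_EFinP.
have h2 : measurable_fun setT (EFin \o f) by exact/measurable_EFinP.
have h3 : {ae m, forall x, setT x -> (EFin \o f_ n) x @[n --> \oo] --> (EFin \o f) x}.
  by apply: filterS cf => x cx _; apply: cvg_EFin => //; exact: nearW.
have h4 : {ae m, forall x n, setT x -> (`|(EFin \o f_ n) x| <= (EFin \o g) x)%E}.
  by apply: aeW => x n _ /=; rewrite lee_fin.
have [i1 _ i2] := dominated_convergence measurableT h1 h2 h3 ig h4.
split => //; rewrite /Rintegral.
by apply: fine_cvg; rewrite fineK ?integrable_fin_num.
Qed.

Lemma Ri_fatou (f_ : nat -> T -> R) f C :
  (forall n, measurable_fun setT (f_ n)) -> measurable_fun setT f ->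
  (forall n x, 0 <= f_ n x) -> (forall x, 0 <= f x) ->
  {ae m, forall x, f_ n x @[n --> \oo] --> f x} ->
  (forall n, (\int[m]_x (f_ n x)%:E <= C%:E)%E) ->
  intg m f /\ (\int[m]_x f x)%R <= C.
Proof.
move=> mf_ mf f0_ f0 cf fC; apply: Ri_bound => //.
have := @fatou _ _ _ m setT measurableT (fun n => EFin \o f_ n).
move=> /(_ (fun n => (measurable_EFinP setT (f_ n)).2 (mf_ n))) /(_ (fun n x _ => f0_ n x)) fa.
apply: le_trans (le_trans fa _).
- rewrite le_eqVlt; apply/orP; left; apply/eqP; apply: ae_eq_integral => //.
  + exact/measurable_EFinP.
  + rewrite (_ : (fun x => limn_einf _) = -%E \o (fun x => limn_esup (fun n => - (f_ n x)%:E)%E)).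
      apply: measurableT_comp => //; apply: measurable_fun_limn_esup => n.
      by apply: measurableT_comp => //; exact/measurable_EFinP.
    apply/funext => x /=; rewrite -[RHS]/(- limn_esup (-%E \o (fun n => (f_ n x)%:E)))%E.
    by rewrite limn_esupN oppeK.
  + apply: filterS cf => x cx _ /=.
    have cE : (f_ n x)%:E @[n --> \oo] --> (f x)%:E.
      by apply: cvg_EFin => //; exact: nearW.
    by rewrite is_cvg_limn_einfE; [apply/esym/cvg_lim|apply/cvg_ex; exists (f x)%:E].
- rewrite limn_einf_lim; apply: lime_le; first exact: is_cvg_einfs.
  apply: nearW => n; apply: le_trans (fC n).
  by apply: ereal_inf_lbound; exists n => /=.
Qed.

Lemma intg_Mb f g C : measurable_fun setT f -> intg m g -> (forall x, `|f x| <= C) ->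
  intg m (fun x => f x * g x).
Proof.
move=> mf ig fC; apply: (@intg_le _ (fun x => C * `|g x|)).
- by apply: measurable_funM => //; exact: intg_meas ig.
- by apply: intgZ; exact: intg_abs.
- by move=> x; rewrite normrM ler_wpM2r.
Qed.

Definition sqi f := measurable_fun setT f /\ intg m (fun x => f x ^+ 2).

Lemma sqiM f g : sqi f -> sqi g -> intg m (fun x => f x * g x).
Proof.
move=> [mf f2] [mg g2]; apply: (@intg_le _ (fun x => f x ^+ 2 + g x ^+ 2)).
- exact: measurable_funM.
- exact: intgD.
- move=> x; rewrite ler_norml; apply/andP; split.
    by have := sqr_ge0 (f x + g x); have := sqr_ge0 (f x); have := sqr_ge0 (g x); nra.
  by have := sqr_ge0 (f x - g x); have := sqr_ge0 (f x); have := sqr_ge0 (g x); nra.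
Qed.

Lemma sqiD f g : sqi f -> sqi g -> sqi (fun x => f x + g x).
Proof.
move=> sf sg; split; first by apply: measurable_funD; [exact: sf.1|exact: sg.1].
under eq_fun do rewrite sqrrD -mulr_natl.
apply: intgD; last exact: sg.2.
by apply: intgD; [exact: sf.2|apply/intgZ/sqiM].
Qed.

Lemma sqiZ k f : sqi f -> sqi (fun x => k * f x).
Proof.
move=> sf; split; first by apply: measurable_funM => //; exact: sf.1.
by under eq_fun do rewrite exprMn; apply: intgZ; exact: sf.2.
Qed.

Lemma sqiB f g : sqi f -> sqi g -> sqi (fun x => f x - g x).
Proof.
move=> sf sg; have := sqiD sf (sqiZ (-1) sg).
by under eq_fun do rewrite mulN1r.
Qed.

Lemma sqi_le f g : measurable_fun setT f -> sqi g -> (forall x, `|f x| <= `|g x|) -> sqi f.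
Proof.
move=> mf [mg g2] fg; split => //; apply: intg_le g2 _; first exact: measurable_funX.
by move=> x; rewrite normrX -[leRHS]real_normK ?num_real// lerXn2r ?nnegrE.
Qed.

Lemma cauchy_schwarz f g : sqi f -> sqi g ->
  ((\int[m]_x (f x * g x)) ^+ 2 <= (\int[m]_x (f x ^+ 2)) * (\int[m]_x (g x ^+ 2)))%R.
Proof.
move=> sf sg; set a := (\int[m]_x (f x ^+ 2))%R; set b := (\int[m]_x (g x ^+ 2))%R.
set c := (\int[m]_x (f x * g x))%R.
have a0 : 0 <= a by apply: Ri_ge0 => x; exact: sqr_ge0.
have b0 : 0 <= b by apply: Ri_ge0 => x; exact: sqr_ge0.
have key s t : 0 <= s ^+ 2 * a - (2 * s * t) * c + t ^+ 2 * b.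
  have <- : (\int[m]_x ((s * f x - t * g x) ^+ 2))%R = s ^+ 2 * a - (2 * s * t) * c + t ^+ 2 * b.
    rewrite /a /b /c -!RiZ//; [|exact: sg.2|exact: sqiM|exact: sf.2].
    rewrite -RiB; [|by apply/intgZ/sf.2|by apply/intgZ/sqiM].
    rewrite -RiD; last by apply/intgZ/sg.2.
      by apply: Ri_eq => x; ring.
    by apply: intgB; [apply/intgZ/sf.2|apply/intgZ/sqiM].
  by apply: Ri_ge0 => x; exact: sqr_ge0.
have [b1|b1] := leP b 0.
  have be : b = 0 by apply/eqP; rewrite eq_le b1.
  have h1 := key (c) (a + 1).
  have h2 : c = 0.
    have := key 1 ((a + 1) * c); have := key c (a+1).
    have [//|c0] := eqVneq c 0.
    have : 0 < c ^+ 2 by rewrite exprn_even_gt0.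
    by rewrite be; nra.
  by rewrite h2 be mulr0 expr0n.
have := key b c.
have -> : b ^+ 2 * a - 2 * b * c * c + c ^+ 2 * b = b * (a * b - c ^+ 2) by ring.
by rewrite pmulr_rge0// subr_ge0.
Qed.

Lemma Ri_sqrD f g : sqi f -> sqi g -> (\int[m]_x ((f x + g x) ^+ 2) =
  \int[m]_x (f x ^+ 2) + 2 * \int[m]_x (f x * g x) + \int[m]_x (g x ^+ 2))%R.
Proof.
move=> sf sg; rewrite -RiZ; last exact: sqiM.
rewrite -RiD; [|exact: sf.2|by apply/intgZ/sqiM].
rewrite -RiD; [|apply: intgD; [exact: sf.2|by apply/intgZ/sqiM]|exact: sg.2].
by apply: Ri_eq => x; ring.
Qed.

Lemma Ri_sqrB f g : sqi f -> sqi g -> (\int[m]_x ((f x - g x) ^+ 2) =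
  \int[m]_x (f x ^+ 2) - 2 * \int[m]_x (f x * g x) + \int[m]_x (g x ^+ 2))%R.
Proof.
move=> sf sg; have := Ri_sqrD sf (sqiZ (-1) sg).
under eq_Rintegral do rewrite mulN1r.
move=> ->; congr (_ + _ + _); last by apply: Ri_eq => x; ring.
rewrite -mulrN; congr (_ * _); rewrite -RiN; last exact: sqiM.
by apply: Ri_eq => x; ring.
Qed.

(** Bounded sequences of L^2 that converge almost everywhere converge weakly, on any measure space: where
    |g_n - g| <= |h| the product is dominated by h^2, and the part of h living on the complement tends to 0
    in L^2 by domination. *)
Lemma weak_cvg (h : T -> R) (g_ : nat -> T -> R) g C :
  sqi h -> (forall n, sqi (g_ n)) -> measurable_fun setT g ->
  {ae m, forall x, g_ n x @[n --> \oo] --> g x} ->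
  (forall n, (\int[m]_x (g_ n x ^+ 2))%R <= C) ->
  [/\ sqi g, (\int[m]_x (g x ^+ 2))%R <= C &
  (\int[m]_x (h x * g_ n x))%R @[n --> \oo] --> (\int[m]_x (h x * g x))%R].
Proof.
move=> sh sg_ mg cg gC.
have [g2 g2C] : intg m (fun x => g x ^+ 2) /\ (\int[m]_x (g x ^+ 2))%R <= C.
  apply: (@Ri_fatou (fun n x => g_ n x ^+ 2)).
  - by move=> n; apply: measurable_funX; exact: (sg_ n).1.
  - exact: measurable_funX.
  - by move=> n x; exact: sqr_ge0.
  - by move=> x; exact: sqr_ge0.
  - by apply: filterS cg => x cx; rewrite expr2; under eq_fun do rewrite expr2; exact: cvgM.
  - by move=> n; rewrite RiE ?lee_fin//; exact: (sg_ n).2.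
have sg : sqi g by [].
split => //.
pose b n x : R := if `|g_ n x - g x| <= `|h x| then 1 else 0.
have b01 n x : 0 <= b n x <= 1 by rewrite /b; case: ifP; rewrite lexx ler01.
have mh : measurable_fun setT h := sh.1.
have mg_ n : measurable_fun setT (g_ n) := (sg_ n).1.
have mb n : measurable_fun setT (b n).
  apply: measurable_fun_ifT => //; apply: measurable_fun_ler.
    by apply: measurableT_comp => //; exact: measurable_funB.
  exact: measurableT_comp.
have bh n x : b n x * `|g_ n x - g x| <= `|h x|.
  by rewrite /b; case: ifP => [+|_]; rewrite ?mul1r ?mul0r.
pose k n x := h x * (b n x * (g_ n x - g x)).
pose r n x := (h x * (1 - b n x)) * (g_ n x - g x).
have sbn n : sqi (fun x => h x * (1 - b n x)).
  apply: sqi_le sh _; first by apply: measurable_funM => //; exact: measurable_funB.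
  move=> x; rewrite normrM ler_piMr// ger0_norm; have /andP[] := b01 n x; lra.
have ik n : intg m (k n).
  apply: (@intg_le _ (fun x => h x ^+ 2)); [|exact: sh.2|].
    by apply: measurable_funM => //; apply: measurable_funM => //; exact: measurable_funB.
  move=> x; rewrite /k normrM normrM (@ger0_norm _ (b n x)); last by have /andP[] := b01 n x.
  rewrite -[leRHS]ger0_norm ?sqr_ge0// normrX expr2 ler_wpM2l//.
have ir n : intg m (r n) by apply: sqiM => //; exact: sqiB.
have e n : (\int[m]_x (h x * g_ n x) - \int[m]_x (h x * g x))%R =
   (\int[m]_x k n x)%R + (\int[m]_x r n x)%R.
  rewrite -RiB; [|exact: sqiM|exact: sqiM].
  by rewrite -RiD//; apply: Ri_eq => x; rewrite /k /r; ring.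
have bcv : {ae m, forall x, h x * (1 - b n x) @[n --> \oo] --> 0}.
  apply: filterS cg => x cx; have [->|h0] := eqVneq (h x) 0.
    by under eq_fun do rewrite mul0r; exact: cvg_cst.
  apply: cvg_near_cst; have hp : 0 < `|h x| by rewrite normr_gt0.
  move/cvgrPdist_le : cx => /(_ _ hp); apply: filterS => n; rewrite distrC /b => -> .
  by rewrite subrr mulr0.
have k0 : (\int[m]_x k n x)%R @[n --> \oo] --> (0 : R).
  rewrite (_ : 0 = (\int[m]_x 0)%R); last by rewrite /Rintegral integral0.
  apply: (@Ri_dct _ _ (fun x => h x ^+ 2) _ _ _ _ _).2 => //.
  - by move=> n; exact: intg_meas (ik n).
  - exact: sh.2.
  - apply: filterS cg => x cx; rewrite /k.
    have c0 : `|h x| * `|g_ n x - g x| @[n --> \oo] --> (0:R).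
      rewrite -[X in _ --> X](mulr0 `|h x|); apply: cvgM; first exact: cvg_cst.
      by rewrite -(normr0 R) -(subrr (g x)); apply: cvg_norm; apply: cvgB => //; exact: cvg_cst.
    apply: norm_cvg0; apply: (squeeze_cvgr _ (cvg_cst 0) c0).
    apply: nearW => n; rewrite normr_ge0/= normrM normrM ler_wpM2l//.
    by rewrite ler_piMl// ger0_norm; have /andP[] := b01 n x.
  - move=> n x; rewrite /k normrM normrM (@ger0_norm _ (b n x)); last by have /andP[] := b01 n x.
    by rewrite -[leRHS]ger0_norm ?sqr_ge0// normrX expr2 ler_wpM2l.
have q0 : (\int[m]_x ((h x * (1 - b n x)) ^+ 2))%R @[n --> \oo] --> (0 : R).
  rewrite (_ : 0 = (\int[m]_x 0)%R); last by rewrite /Rintegral integral0.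
  apply: (@Ri_dct _ _ (fun x => h x ^+ 2) _ _ _ _ _).2 => //.
  - by move=> n; exact: intg_meas (sbn n).2.
  - exact: sh.2.
  - apply: filterS bcv => x cx; rewrite -(mulr0 (0:R)).
    by under eq_fun do rewrite expr2; exact: cvgM.
  - move=> n x; rewrite ger0_norm ?sqr_ge0// exprMn ler_piMr ?sqr_ge0//.
    by rewrite expr_le1//; have /andP[] := b01 n x; lra.
have r0 : (\int[m]_x r n x)%R @[n --> \oo] --> (0 : R).
  have C0 : 0 <= C by apply: le_trans g2C; apply: Ri_ge0 => x; exact: sqr_ge0.
  have rb n : `|(\int[m]_x r n x)%R| <= Num.sqrt ((\int[m]_x ((h x * (1 - b n x)) ^+ 2))%R * (4 * C)).
    rewrite -sqrtr_sqr ler_wsqrtr// (le_trans (cauchy_schwarz (sbn n) (sqiB (sg_ n) sg)))//.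
    apply: ler_wpM2l; first by apply: Ri_ge0 => x; exact: sqr_ge0.
    rewrite Ri_sqrB//; have := Ri_sqrD (sg_ n) sg.
    have : 0 <= (\int[m]_x ((g_ n x + g x) ^+ 2))%R by apply: Ri_ge0 => x; exact: sqr_ge0.
    by have := gC n; lra.
  apply: norm_cvg0; apply: (squeeze_cvgr (f := fun=> 0)
    (h := fun n => Num.sqrt ((\int[m]_x ((h x * (1 - b n x)) ^+ 2))%R * (4 * C))) _ (cvg_cst 0)).
    by apply: nearW => n; rewrite normr_ge0/=; exact: rb.
  rewrite -[X in _ --> X]sqrtr0 -(mul0r (4 * C)).
  have q1 : (\int[m]_x ((h x * (1 - b n x)) ^+ 2))%R * (4 * C) @[n --> \oo] --> 0 * (4 * C).
    by apply: cvgM => //; exact: cvg_cst.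
  exact: (continuous_cvg _ (@sqrt_continuous R _) q1).
have : (\int[m]_x (h x * g_ n x) - \int[m]_x (h x * g x))%R @[n --> \oo] --> (0:R).
  by under eq_fun do rewrite e; rewrite -(addr0 (0:R)); exact: cvgD.
exact: cvg_sub0.
Qed.

(** Riesz-Fischer.  Along a subsequence the squared increments are below 8^-k, so that the sum of 4^k
    times these squares is integrable; where it is finite the increments are summable. *)
Lemma sqi_complete (g_ : nat -> T -> R) :
  (forall n, sqi (g_ n)) ->
  (forall e, 0 < e -> exists N, forall n k, (N <= n)%N -> (N <= k)%N ->
     (\int[m]_x ((g_ n x - g_ k x) ^+ 2))%R <= e) ->
  exists2 g, sqi g & forall e, 0 < e -> exists N, forall n, (N <= n)%N ->
     (\int[m]_x ((g_ n x - g x) ^+ 2))%R <= e.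
Proof.
move=> sg cg.
have mg_ n : measurable_fun setT (g_ n) := (sg n).1.
have /choice[N HN] : forall k : nat, exists N, forall n p, (N <= n)%N -> (N <= p)%N ->
     (\int[m]_x ((g_ n x - g_ p x) ^+ 2))%R <= 8^-1 ^+ k.
  by move=> k; apply: cg; rewrite exprn_gt0.
(* M is increasing and dominates N, so the squared increments along M are at most 8^-k. *)
pose M := fix M k := if k is k'.+1 then maxn (M k').+1 (N k) else N 0%N.
have MN k : (N k <= M k)%N by case: k => //= k; rewrite leq_maxr.
have MS k : (M k <= M k.+1)%N by rewrite /= (leq_trans (leqnSn _))// leq_maxl.
have kM k : (k <= M k)%N by elim: k => //= k IH; rewrite leq_max ltnS IH.
pose D k x := g_ (M k.+1) x - g_ (M k) x.
have sD k : sqi (D k) by exact: sqiB.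
have D2 k : (\int[m]_x (D k x ^+ 2))%R <= 8^-1 ^+ k.
  by apply: HN; rewrite ?MN// (leq_trans (MN k))// MS.
pose S x := (\sum_(k <oo) (4 ^+ k * D k x ^+ 2)%:E)%E.
have mDk k : measurable_fun setT (fun x => 4 ^+ k * D k x ^+ 2 : R).
  by apply: measurable_funM => //; apply: measurable_funX; exact: (sD k).1.
have poisson k x : 0 <= 4 ^+ k * D k x ^+ 2.
  by apply: mulr_ge0; [exact: exprn_ge0|exact: sqr_ge0].
have S0 x : (0 <= S x)%E by apply: nneseries_ge0 => k _ _; rewrite lee_fin.
have mS : measurable_fun setT S.
  by apply: ge0_emeasurable_sum => [k x _ _|k _]; [rewrite lee_fin|exact/measurable_EFinP].
have iS : (\int[m]_x S x < +oo)%E.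
  rewrite integral_nneseries//; last 2 first.
  - by move=> k; exact/measurable_EFinP.
  - by move=> k x _; rewrite lee_fin.
  apply: (@le_lt_trans _ _ (\sum_(k <oo) ((2^-1) ^+ k)%:E)%E).
    apply: lee_nneseries => [k _ _|k _]; first by apply: integral_ge0 => x _; rewrite lee_fin.
    rewrite RiE; last by apply: intgZ; exact: (sD k).2.
    rewrite lee_fin RiZ; last exact: (sD k).2.
    rewrite (_ : 2^-1 = 4 * 8^-1 :> R); last by field.
    by rewrite exprMn ler_wpM2l ?exprn_ge0// D2.
  have h2 : series (geometric 1 (2^-1)) @ \oo --> (1 * (1 - 2^-1)^-1 : R).
    by apply: cvg_geometric_series; rewrite ger0_norm// invf_lt1// ltr1n.
  have -> : (\sum_(k <oo) ((2^-1 : R) ^+ k)%:E)%E = (1 * (1 - 2^-1)^-1 : R)%:E.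
    apply: cvg_lim => //; under eq_fun do rewrite sumEFin.
    apply: cvg_EFin; first exact: nearW.
    apply: cvg_trans h2; apply: near_eq_cvg; apply: nearW => n /=.
    by rewrite /series/=; apply: eq_bigr => i _; rewrite mul1r.
  exact: ltry.
pose h k x := if (S x < +oo)%E then g_ (M k) x else 0.
have mA : measurable_fun setT (fun x => (S x < +oo)%E) by exact: measurable_fun_lte.
have mh k : measurable_fun setT (h k) by exact: measurable_fun_ifT.
have Sae : {ae m, forall x, (S x < +oo)%E}.
  have : m.-integrable setT S.
    apply/integrableP; split => //; apply: le_lt_trans iS.
    by under eq_integral do rewrite gee0_abs//.
  move=> /(integrable_ae measurableT); apply: filterS => x /(_ I).
  by rewrite fin_numE ltey => /andP[].
have hc x : cvgn (h^~ x).
  have [Sx|/negbTE Sx] := boolP (S x < +oo)%E; rewrite /h Sx; last first.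
    by apply/cvg_ex; exists 0; exact: cvg_cst.
  have /normed_cvg/cvg_ex[/= l diff2] : cvgn [normed series (D^~ x)].
    apply: (@series_le_cvg _ _ (geometric (fine (S x) + 1) (2^-1))).
    - by move=> k /=.
    - by move=> k /=; rewrite mulr_ge0 ?exprn_ge0// addr_ge0// fine_ge0.
    - move=> k /=.
      have : ((4 ^+ k * D k x ^+ 2)%:E <= S x)%E.
        apply: le_trans (nneseries_lim_ge k.+1 _) => [|i _ _]; last by rewrite lee_fin.
        rewrite big_nat_recr//= leeDr// sume_ge0// => i _; by rewrite lee_fin.
      have Sf : S x \is a fin_num by rewrite ge0_fin_numE.
      rewrite -(fineK Sf) lee_fin; have := fine_ge0 (S0 x); set s := fine _ => s0 hs.
      have e1 : (2 ^+ k * `|D k x|) ^+ 2 <= (s + 1) ^+ 2.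
        rewrite exprMn real_normK ?num_real// -exprM mulnC exprM.
        rewrite (_ : 2 ^+ 2 = 4 :> R); last by ring.
        by apply: le_trans hs _; nra.
      have e2 : 2 ^+ k * `|D k x| <= s + 1.
        by move: e1; rewrite ler_pXn2r// nnegrE ?addr_ge0// mulr_ge0 ?exprn_ge0.
      by rewrite exprVn ler_pdivlMr ?exprn_gt0// mulrC.
    - by apply/cvg_ex; eexists; apply: cvg_geometric_series; rewrite ger0_norm// invf_lt1// ltr1n.
  apply/cvg_ex; exists (g_ (M 0%N) x + l) => /=.
  have -> : (fun k => g_ (M k) x) = (fun k => g_ (M 0%N) x + series (D^~ x) k).
    by apply/funext => k; rewrite /series/= telescope_sumr// addrC subrK.
  by apply: cvgD => //; exact: cvg_cst.
pose g x := limn (h^~ x).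
have hg x : h n x @[n --> \oo] --> g x by exact: hc.
have mg : measurable_fun setT g by apply: (measurable_fun_cvg mh) => x _; exact: hg.
have key e N0 : 0 < e -> (forall n k, (N0 <= n)%N -> (N0 <= k)%N ->
     (\int[m]_x ((g_ n x - g_ k x) ^+ 2))%R <= e) ->
   forall n, (N0 <= n)%N -> intg m (fun x => (g_ n x - g x) ^+ 2) /\
    (\int[m]_x ((g_ n x - g x) ^+ 2))%R <= e.
  move=> e0 HN0 n N0n.
  apply: (@Ri_fatou (fun k x => (g_ n x - g_ (M (k + N0)%N) x) ^+ 2)).
  - by move=> k; apply: measurable_funX; exact: measurable_funB.
  - by apply: measurable_funX; exact: measurable_funB.
  - by move=> k x; exact: sqr_ge0.
  - by move=> x; exact: sqr_ge0.
  - apply: filterS Sae => x Sx.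
    have c : g_ (M (k + N0)%N) x @[k --> \oo] --> g x.
      have := hg x; rewrite /h Sx => h1; exact: (cvg_comp _ _ (cvg_addnr N0) h1).
    by under eq_fun do rewrite expr2; rewrite expr2; apply: cvgM; apply: cvgB => //; exact: cvg_cst.
  - move=> k; rewrite RiE ?lee_fin; last exact: (sqiB (sg _) (sg _)).2.
    by apply: HN0 => //; rewrite (leq_trans _ (kM _))// leq_addl.
exists g.
  have [N0 HN0] := cg 1 ltr01.
  have [i1 _] := key 1 N0 ltr01 HN0 N0 (leqnn _).
  have s1 : sqi (fun x => g_ N0 x - g x) by split => //; exact: measurable_funB.
  have := sqiB (sg N0) s1; by under eq_fun do rewrite opprB addrC subrK.
move=> e e0; have [N0 HN0] := cg e e0; exists N0 => n Nn.
by have [] := key e N0 e0 HN0 n Nn.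
Qed.

Lemma Lfun2P f : f \in Lfun m 2%:E <-> sqi f.
Proof.
split=> [fL|[mf f2]].
  split; last exact: Lfun2_integrable_sqr.
  by move: fL; rewrite inE => /andP[/[!inE]].
rewrite inE; apply/andP; split; rewrite inE//= /finite_norm unlock/=.
rewrite poweR_lty//; apply: le_lt_trans (intg_lty f2).
rewrite le_eqVlt; apply/orP; left; apply/eqP; apply: eq_integral => x _ /=.
by rewrite -[2]/(2%:R) powR_mulrn// real_normK// num_real.
Qed.

End Toolkit.

(** * Iterated integrals *)

Section Fub.
Context d1 d2 (T1 : measurableType d1) (T2 : measurableType d2) (R : realType).
Variables (m1 : {sigma_finite_measure set T1 -> \bar R}) (m2 : {sigma_finite_measure set T2 -> \bar R}).
Implicit Types f : T1 * T2 -> R.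

Lemma Ri_fubini1 f : intg (m1 \x m2)%E f ->
  intg m1 (fun x => \int[m2]_y f (x, y))%R /\
  (\int[(m1 \x m2)%E]_z f z = \int[m1]_x \int[m2]_y f (x, y))%R.
Proof.
move=> iF.
have i1 := integrable_fubini_F iF.
have e : {ae m1, forall x, fubini_F m2 (EFin \o f) x = (\int[m2]_y f (x, y))%R%:E}.
  have /(integrable_ae measurableT) := i1.
  by apply: filterS => x /(_ I) h; rewrite /Rintegral fineK.
have mR : measurable_fun setT (fun x => \int[m2]_y f (x, y))%R.
  by apply: measurableT_comp => //; have /integrableP[] := i1.
split.
  move/integrableP : i1 => [m_ h]; apply/integrableP; split; first exact/measurable_EFinP.
  apply: le_lt_trans h; rewrite le_eqVlt; apply/orP; left; apply/eqP.
  apply: ae_eq_integral => //.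
  - by apply: measurableT_comp => //; exact/measurable_EFinP.
  - by apply: measurableT_comp.
  - by apply: filterS e => x /= ->.
rewrite /Rintegral -integral12_prod_meas1//; congr fine.
apply: ae_eq_integral => //; [by have /integrableP[] := i1|exact/measurable_EFinP|].
by apply: filterS e => x /= -> .
Qed.

Lemma Ri_fubini2 f : intg (m1 \x m2)%E f ->
  intg m2 (fun y => \int[m1]_x f (x, y))%R /\
  (\int[(m1 \x m2)%E]_z f z = \int[m2]_y \int[m1]_x f (x, y))%R.
Proof.
move=> iF.
have iS : intg (m2 \x m1)%E (f \o (fun z => (z.2, z.1))).
  apply/integrable21ltyP.
    by apply/measurable_EFinP; apply: measurableT_comp (intg_meas iF) _; exact: measurable_fun_pair.
  have mf : measurable_fun setT (EFin \o f) by apply/measurable_EFinP; exact: intg_meas iF.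
  exact: (@integrable12ltyP _ _ _ _ _ m1 m2 (EFin \o f) mf).1.
have i1 : m2.-integrable setT (fubini_G m1 (EFin \o f)).
  by have := integrable_fubini_F iS.
have e : {ae m2, forall y, fubini_G m1 (EFin \o f) y = (\int[m1]_x f (x, y))%R%:E}.
  have /(integrable_ae measurableT) := i1.
  by apply: filterS => x /(_ I) h; rewrite /Rintegral fineK.
have mR : measurable_fun setT (fun y => \int[m1]_x f (x, y))%R.
  by apply: measurableT_comp => //; have /integrableP[] := i1.
split.
  move/integrableP : i1 => [m_ h]; apply/integrableP; split; first exact/measurable_EFinP.
  apply: le_lt_trans h; rewrite le_eqVlt; apply/orP; left; apply/eqP.
  apply: ae_eq_integral => //.
  - by apply: measurableT_comp => //; exact/measurable_EFinP.
  - by apply: measurableT_comp.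
  - by apply: filterS e => x /= ->.
rewrite /Rintegral -integral21_prod_meas1//; congr fine.
apply: ae_eq_integral => //; [by have /integrableP[] := i1|exact/measurable_EFinP|].
by apply: filterS e => x /= -> .
Qed.

Lemma Ri_swap f : intg (m1 \x m2)%E f ->
  (\int[m1]_x \int[m2]_y f (x, y) = \int[m2]_y \int[m1]_x f (x, y))%R.
Proof. by move=> iF; rewrite -(Ri_fubini1 iF).2 (Ri_fubini2 iF).2. Qed.

Lemma intg_prod1 f (g : T1 -> R) : measurable_fun setT f -> (forall x, intg m2 (fun y => f (x, y))) ->
  intg m1 g -> (forall x, (\int[m2]_y `|f (x, y)|)%R <= g x) -> intg (m1 \x m2)%E f.
Proof.
move=> mf i2 ig fg; apply/integrable12ltyP; first exact/measurable_EFinP.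
apply: (@le_lt_trans _ _ (\int[m1]_x (g x)%:E)%E).
  apply: ge0_le_integral => //.
  - by move=> x _; apply: integral_ge0.
  - apply: (@measurable_fun_fubini_tonelli_F _ _ _ _ _ m2 (fun z => `|(f z)%:E|)%E) => //.
    by apply: measurableT_comp => //; exact/measurable_EFinP.
  - by have /integrableP[] := ig.
  - move=> x _; apply: (@le_trans _ _ (\int[m2]_y (`|f (x, y)|)%:E)%E) => //.
    by rewrite RiE ?lee_fin//; exact: intg_abs.
exact: intg_lty.
Qed.

Lemma intg_prod2 f (g : T2 -> R) : measurable_fun setT f -> (forall y, intg m1 (fun x => f (x, y))) ->
  intg m2 g -> (forall y, (\int[m1]_x `|f (x, y)|)%R <= g y) -> intg (m1 \x m2)%E f.
Proof.
move=> mf i2 ig fg; apply/integrable21ltyP; first exact/measurable_EFinP.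
apply: (@le_lt_trans _ _ (\int[m2]_x (g x)%:E)%E).
  apply: ge0_le_integral => //.
  - by move=> x _; apply: integral_ge0.
  - apply: (@measurable_fun_fubini_tonelli_G _ _ _ _ _ m1 (fun z => `|(f z)%:E|)%E) => //.
    by apply: measurableT_comp => //; exact/measurable_EFinP.
  - by have /integrableP[] := ig.
  - move=> x _; apply: (@le_trans _ _ (\int[m1]_y (`|f (y, x)|)%:E)%E) => //.
    by rewrite RiE ?lee_fin//; exact: intg_abs.
exact: intg_lty.
Qed.

Lemma intg_tensor (f : T1 -> R) (g : T2 -> R) : intg m1 f -> intg m2 g ->
  intg (m1 \x m2)%E (fun z => f z.1 * g z.2).
Proof.
move=> iF ig; apply: (@intg_prod1 _ (fun x => `|f x| * (\int[m2]_y `|g y|)%R)).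
- apply: measurable_funM.
    exact: (measurableT_comp (intg_meas iF) measurable_fst).
  exact: (measurableT_comp (intg_meas ig) measurable_snd).
- by move=> x /=; apply: intgZ.
- under eq_fun do rewrite mulrC; apply: intgZ; exact: intg_abs.
- move=> x; under eq_Rintegral do rewrite normrM.
  by rewrite /= RiZ//; exact: intg_abs.
Qed.

End Fub.

(** * Affine substitutions and explicit integrals on the line *)

Section Leb.
Context {R : realType}.
Notation mu := (@lebesgue_measure R).
Implicit Types f g : R -> R.

Lemma meas_affine (a b : R) : measurable_fun setT (fun x : R => a * x + b).
Proof. by apply: measurable_funD => //; exact: measurable_funM. Qed.

Lemma mu_affine (a b : R) (A : set (measurableTypeR R)) : a != 0 -> measurable A ->
  pushforward mu ((fun x : R => a * x + b) : measurableTypeR R -> measurableTypeR R) A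
   = (`|a|^-1%:E * mu A)%E.
Proof.
move=> a0 mA; set phi := (fun x : measurableTypeR R => (a * x + b) : measurableTypeR R).
have mphi : measurable_fun setT phi by exact: meas_affine.
pose pm : {measure set (measurableTypeR R) -> \bar R} :=
  measure_function_pushforward__canonical__measure_function_Measure mu mphi.
pose m := mscale (NngNum (normr_ge0 a)) pm.
have na : 0 < `|a| by rewrite normr_gt0.
suff -> : mu A = (`|a|%:E * pushforward mu phi A)%E.
  by rewrite muleA -EFinM mulVf ?mul1e// gt_eqF.
apply: (@lebesgue_measure_unique R m) => //= _ [[p q] _ <-].
rewrite /m /mscale/= /pushforward lebesgue_measure_itv/= lte_fin.
have [ap|an|ae] := ltgtP a 0; last by rewrite ae eqxx in a0.
- have -> : phi @^-1` `]p, q] = `[(q - b) / a, (p - b) / a[%classic.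
    apply/seteqP; split => x /=; rewrite !in_itv/= /phi.
      by move=> /andP[h1 h2]; rewrite ler_ndivrMr// ltr_ndivlMr//; lra.
    by rewrite ler_ndivrMr// ltr_ndivlMr// => /andP[h1 h2]; lra.
  rewrite lebesgue_measure_itv/= lte_fin ltr_ndivrMr// divfK ?lt_eqF//.
  rewrite ltrD2r; case: ifPn => // _; last by rewrite mule0.
  by rewrite -!EFinD -EFinM ltr0_norm//; congr EFin; field.
- have -> : phi @^-1` `]p, q] = `](p - b) / a, (q - b) / a]%classic.
    apply/seteqP; split => x /=; rewrite !in_itv/= /phi.
      by move=> /andP[h1 h2]; rewrite ler_pdivlMr// ltr_pdivrMr//; lra.
    by rewrite ler_pdivlMr// ltr_pdivrMr// => /andP[h1 h2]; lra.
  rewrite lebesgue_measure_itv/= lte_fin ltr_pdivrMr// divfK ?gt_eqF//.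
  rewrite ltrD2r; case: ifPn => // _; last by rewrite mule0.
  by rewrite -!EFinD -EFinM gtr0_norm//; congr EFin; field.
Qed.

Lemma ge0_int_affine (a b : R) (f : R -> \bar R) : a != 0 -> measurable_fun setT f ->
  (forall x, 0 <= f x)%E ->
  (\int[mu]_x f (a * x + b)%R = `|a|^-1%:E * \int[mu]_x f x)%E.
Proof.
move=> a0 mf f0; set phi := (fun x : measurableTypeR R => (a * x + b) : measurableTypeR R).
have mphi : measurable_fun setT phi by exact: meas_affine.
have := @ge0_integral_pushforward _ _ _ _ _ phi mphi mu setT f measurableT mf (fun x _ => f0 x).
rewrite preimage_setT /= => <-.
have na : 0 <= `|a|^-1 by rewrite invr_ge0.
rewrite (@eq_measure_integral _ _ _ setT (mscale (NngNum na) mu)).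
  by rewrite ge0_integral_mscale.
by move=> A mA _; exact: mu_affine.
Qed.

Lemma intg_affine (a b : R) f : a != 0 -> intg mu f -> intg mu (fun x => f (a * x + b)).
Proof.
move=> a0 iF; have mf := intg_meas iF.
apply/integrableP; split.
  by apply/measurable_EFinP; apply: (measurableT_comp mf); exact: meas_affine.
have := @ge0_int_affine a b (fun x => `|(f x)%:E|)%E a0 _ _ => /= ->//.
- rewrite lte_mul_pinfty ?lee_fin ?invr_ge0//.
  by have /integrableP[] := iF.
- by apply/measurable_EFinP; exact: measurableT_comp.
Qed.

Lemma Ri_affine (a b : R) f : a != 0 -> intg mu f ->
  (\int[mu]_x f (a * x + b) = `|a|^-1 * \int[mu]_x f x)%R.
Proof.
move=> a0 iF; have mf := intg_meas iF.
have h g : intg mu g -> (forall x, 0 <= g x) ->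
    (\int[mu]_x g (a * x + b) = `|a|^-1 * \int[mu]_x g x)%R.
  move=> ig g0; have := @ge0_int_affine a b (EFin \o g) a0 _ _ => /=.
  rewrite RiE; last exact: intg_affine.
  rewrite RiE// -EFinM => H; apply: EFin_inj; apply: H => [|x]; last by rewrite lee_fin.
  by apply/measurable_EFinP; exact: intg_meas ig.
have e x : f x = (`|f x| + f x) - `|f x| by rewrite addrAC subrr add0r.
have i1 : intg mu (fun x => `|f x| + f x) by apply: intgD => //; exact: intg_abs.
have i2 := intg_abs iF.
under eq_Rintegral do rewrite e.
rewrite (_ : (\int[mu]_x f x)%R = (\int[mu]_x ((`|f x| + f x) - `|f x|))%R); last exact: Ri_eq.
rewrite !RiB//; [|exact: (intg_affine b a0 i1)|exact: (intg_affine b a0 i2)].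
rewrite mulrBr (h _ i1) ?(h _ i2)// => x.
by have := ler_norm (- f x); rewrite normrN; lra.
Qed.

Lemma intg_shift h f : intg mu f -> intg mu (fun x => f (x + h)).
Proof. by move=> /(intg_affine h (oner_neq0 R)); under eq_fun do rewrite mul1r. Qed.

Lemma Ri_shift h f : intg mu f -> (\int[mu]_x f (x + h) = \int[mu]_x f x)%R.
Proof.
move=> iF; have := Ri_affine h (oner_neq0 R) iF; rewrite normr1 invr1 mul1r => <-.
by apply: Ri_eq => x; rewrite mul1r.
Qed.

Lemma intg_opp f : intg mu f -> intg mu (fun x => f (- x)).
Proof.
have n1 : -1 != 0 :> R by rewrite oppr_eq0 oner_neq0.
by move=> /(intg_affine 0 n1); under eq_fun do rewrite addr0 mulN1r.
Qed.

Lemma Ri_opp f : intg mu f -> (\int[mu]_x f (- x) = \int[mu]_x f x)%R.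
Proof.
have n1 : -1 != 0 :> R by rewrite oppr_eq0 oner_neq0.
move=> iF; have := Ri_affine 0 n1 iF; rewrite normrN1 invr1 mul1r => <-.
by apply: Ri_eq => x; rewrite addr0 mulN1r.
Qed.

Lemma intg_subl h f : intg mu f -> intg mu (fun x => f (h - x)).
Proof. by move=> /(intg_shift h)/intg_opp; under eq_fun do rewrite addrC. Qed.

Lemma Ri_subl h f : intg mu f -> (\int[mu]_x f (h - x) = \int[mu]_x f x)%R.
Proof.
move=> iF; rewrite -(Ri_shift h iF) -(Ri_opp (intg_shift h iF)).
by apply: Ri_eq => x; rewrite addrC.
Qed.

Lemma intg_scale a f : a != 0 -> intg mu f -> intg mu (fun x => f (a * x)).
Proof. by move=> a0 /(intg_affine 0 a0); under eq_fun do rewrite addr0. Qed.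

Lemma Ri_scale a f : a != 0 -> intg mu f -> (\int[mu]_x f (a * x) = `|a|^-1 * \int[mu]_x f x)%R.
Proof. by move=> a0 iF; rewrite -(Ri_affine 0 a0 iF); apply: Ri_eq => x; rewrite addr0. Qed.

Lemma meas_inv : measurable_fun setT (fun x : R => x^-1).
Proof.
rewrite -(setUv [set 0 : R]); apply/measurable_funU => //.
  exact: measurableC.
split; first exact: measurable_fun_set1.
apply: open_continuous_measurable_fun.
  by apply/closed_openC; apply: closed_eq.
by move=> x; rewrite inE /= => /eqP x0; exact: inv_continuous.
Qed.

Lemma meas_funV d (T : measurableType d) (D : set T) (f : T -> R) :
  measurable_fun D f -> measurable_fun D (fun x => (f x)^-1).
Proof. move=> mf; exact: (measurableT_comp meas_inv mf). Qed.

Lemma meas_sqrt : measurable_fun setT (@Num.sqrt R).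
Proof. by apply: continuous_measurable_fun => x; exact: sqrt_continuous. Qed.

Lemma cauchy_int : intg mu (fun x => (1 + x ^+ 2)^-1) /\ (\int[mu]_x (1 + x ^+ 2)^-1 = pi)%R.
Proof.
have c : continuous (fun x : R => (1 + x ^+ 2)^-1) by exact: continuous_oneDsqrV.
have p (x : R) : 0 <= (1 + x ^+ 2)^-1 by rewrite invr_ge0 addr_ge0// sqr_ge0.
have e : (\int[mu]_x ((1 + x ^+ 2)^-1)%:E = pi%:E)%E.
  rewrite (ge0_symfun_integralT p c); last by move=> x /=; rewrite sqrrN.
  rewrite (_ : [set x : R | 0 <= x] = `[0, +oo[%classic); last first.
    by apply/seteqP; split => x /=; rewrite in_itv/= andbT.
  have := @integral0y_oneDsqr R; rewrite /oneDsqr => ->.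
  by rewrite -EFinM; congr EFin; field.
split; last by rewrite /Rintegral e.
by apply: intg_ge0 => //; [exact: continuous_measurable_fun|rewrite e ltry].
Qed.

Lemma cauchy_scaled_int t : 0 < t ->
  intg mu (fun x => t / (x ^+ 2 + t ^+ 2)) /\ (\int[mu]_x (t / (x ^+ 2 + t ^+ 2)) = pi)%R.
Proof.
move=> t0; have [i1 e1] := cauchy_int.
have height : t^-1 != 0 by rewrite invr_eq0 gt_eqF.
have e : (fun x => t / (x ^+ 2 + t ^+ 2)) = (fun x => t^-1 * (1 + (t^-1 * x) ^+ 2)^-1).
  apply/funext => x.
  have p1 : x ^+ 2 + t ^+ 2 != 0 by rewrite gt_eqF// ltr_wpDl ?sqr_ge0// exprn_gt0.
  have p2 : t ^+ 2 + x ^+ 2 != 0 by rewrite addrC.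
  by field; rewrite ?p1 ?p2 ?(gt_eqF t0).
have i2 := intg_scale height i1.
rewrite e; split; first exact: intgZ.
rewrite RiZ// (Ri_scale height i1) e1 ger0_norm ?invr_ge0 ?ltW// invrK mulrA mulVf ?mul1r//.
by rewrite gt_eqF.
Qed.

(** A majorant of several tails below: of order |h|^(-1/2) at 0 and |h|^(-3/2) at infinity. *)
Definition kap (h : R) : R := (Num.sqrt `|h| * (1 + `|h|))^-1.

Lemma kap_ge0 h : 0 <= kap h.
Proof. by rewrite invr_ge0 mulr_ge0 ?sqrtr_ge0// addr_ge0. Qed.

Lemma meas_kap : measurable_fun setT kap.
Proof.
apply: meas_funV; apply: measurable_funM.
  by apply: (measurableT_comp meas_sqrt).
by apply: measurable_funD.
Qed.

(** 2 atan (sqrt x) is a primitive on the positive axis. *)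
Lemma kap_half a : 0 < a -> (\int[mu]_(x in `[a, +oo[) (kap x)%:E <= pi%:E)%E.
Proof.
move=> a0; have dk (x : R) : 0 < x -> is_derive x 1 (fun y => 2 * atan (Num.sqrt y)) (kap x).
  move=> x0.
  have ds := is_derive1_sqrt x0.
  have := is_derive1_comp (is_derive1_atan (Num.sqrt x)) ds.
  move=> /(is_deriveZ 2) h; apply: is_derive_eq h _.
  rewrite /kap gtr0_norm// sqr_sqrtr ?ltW//.
  have s0 : 0 < Num.sqrt x by rewrite sqrtr_gt0.
  change (2 * ((1 + x)^-1 / (2 * Num.sqrt x)) = (Num.sqrt x * (1 + x))^-1).
  have p1 : 1 + x != 0 by rewrite gt_eqF//; lra.
  by field; rewrite p1 gt_eqF.
rewrite (ge0_continuous_FTC2y (F := fun y => 2 * atan (Num.sqrt y)) (l := pi)).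
- rewrite -EFinB lee_fin gerBl mulr_ge0//.
  by rewrite -(@atan0 R) le_atan// sqrtr_ge0.
- by move=> x _; exact: kap_ge0.
- apply: continuous_in_subspaceT => x; rewrite inE/= in_itv/= andbT => ax.
  have x0 : 0 < x by lra.
  rewrite /kap; apply: cvgV.
    by rewrite mulf_neq0// gt_eqF ?sqrtr_gt0 ?normr_gt0 ?gt_eqF//; have := normr_ge0 x; lra.
  apply: cvgM.
    apply: (@continuous_comp _ _ _ (fun y : R => `|y|) Num.sqrt); first exact: norm_continuous.
    exact: sqrt_continuous.
  by apply: cvgD; [exact: cvg_cst|exact: norm_continuous].
- rewrite -[X in _ --> X](_ : 2 * (pi / 2) = pi); last by field.
  apply: cvgMr; apply: (cvg_comp Num.sqrt atan); last exact: cvgy_atan.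
  apply/cvgryPge => A; exists (A ^+ 2); split; first exact: num_real.
  by move=> y Ay; rewrite (le_trans (ler_norm A))// -sqrtr_sqr ler_wsqrtr// ltW.
- move=> x ax; have x0 : 0 < x by lra.
  by have [] := dk x x0.
- apply: cvg_at_right_filter.
  by have [/derivable1_diffP/differentiable_continuous] := dk a a0.
- move=> x; rewrite in_itv/= andbT => ax; rewrite derive1E.
  by apply: derive_val; apply: dk; lra.
Qed.

Lemma intg_kap : intg mu kap.
Proof.
pose k (x : R) := if 0 < x then kap x else 0.
have mollifier : measurable_fun setT k.
  apply: measurable_fun_ifT => //; first exact: measurable_fun_ltr.
  exact: meas_kap.
have k0 x : 0 <= k x by rewrite /k; case: ifP => // _; exact: kap_ge0.
have ik : intg mu k.
  apply: intg_ge0 => //.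
  apply: (@le_lt_trans _ _ pi%:E); last exact: ltry.
  pose F (n : nat) : set R := `[n.+1%:R^-1, +oo[%classic.
  have e : (\int[mu]_x (k x)%:E = \int[mu]_(x in \bigcup_n F n) (kap x)%:E)%E.
    rewrite [RHS]integral_mkcond; apply: eq_integral => x _; rewrite patchE /k.
    have [x0|x0] := ltP 0 x.
      rewrite mem_set//; exists (Num.bound x^-1) => //=.
      rewrite /F/= in_itv/= andbT -[leRHS]invrK lef_pV2 ?posrE ?invr_gt0//.
      apply/ltW/(lt_le_trans (y := (Num.bound x^-1)%:R)); last by rewrite ler_nat.
      by apply: archi_boundP; rewrite invr_ge0 ltW.
    rewrite memNset// => -[n _]; rewrite /F/= in_itv/= andbT => h.
    have p : 0 < n.+1%:R^-1 :> R by rewrite invr_gt0.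
    by have := lt_le_trans p (le_trans h x0); rewrite ltxx.
  rewrite e.
  have c : (\int[mu]_(x in F i) (kap x)%:E)%E @[i --> \oo] -->
      (\int[mu]_(x in \bigcup_n F n) (kap x)%:E)%E.
    apply: ge0_nondecreasing_set_cvg_integral.
    - move=> i j ij; apply/subsetPset => x; rewrite /F/= !in_itv/= !andbT; apply: le_trans.
      by rewrite lef_pV2 ?posrE// ler_nat.
    - by move=> i; exact: measurable_itv.
    - by move=> i; apply/measurable_EFinP/measurable_funTS; exact: meas_kap.
    - by move=> i x _; rewrite lee_fin kap_ge0.
  rewrite -(cvg_lim _ c)//; apply: lime_le; first by apply/cvg_ex; eexists; exact: c.
  by apply: nearW => n; apply: kap_half; rewrite invr_gt0.
have := intgD ik (intg_opp ik); congr (intg _ _); apply/funext => x; rewrite /k/=.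
have [x0|x0|x0] := ltgtP 0 x.
- by rewrite oppr_gt0 ltNge (ltW x0)/= addr0.
- by rewrite oppr_gt0 x0 add0r /kap normrN.
- by rewrite -x0 oppr0 ltxx addr0 /kap normr0 sqrtr0 mul0r invr0.
Qed.

End Leb.

(** * Test functions and second differences *)

Section Test.
Context {R : realType}.
Notation mu := (@lebesgue_measure R).
Implicit Types f g phi : R -> R.

Definition diff2 (h : R) f (x : R) : R := 2 * f x - f (x + h) - f (x - h).

Lemma lip_bound (f f1 : R -> R) (M : R) : (forall x : R, is_derive x (1:R) f (f1 x)) ->
  (forall x, `|f1 x| <= M) -> forall a b, `|f a - f b| <= M * `|a - b|.
Proof.
move=> df fM a b; wlog ab : a b / a <= b.
  by move=> H; have [|/ltW] := leP a b; [exact: H|rewrite (distrC a) (distrC (f a)); exact: H].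
have cf : {within `[a, b], continuous f}.
  by apply: derivable_within_continuous => x _; have [] := df x.
have [c _ e] := MVT_segment ab (fun x _ => df x) cf.
rewrite distrC e normrM (distrC a) ler_wpM2r//.
Qed.

Lemma is_derive_shift (f f1 : R -> R) h x : (forall x : R, is_derive x (1:R) f (f1 x)) ->
  is_derive (x : R) (1:R) (fun y => f (y + h)) (f1 (x + h)).
Proof.
move=> df; have d1 : is_derive (x : R) (1:R) (fun y : R => y + h) 1.
  have := @is_deriveD R R R id (cst h) x 1 1 0 _ _; rewrite addr0; exact.
have := @is_derive1_comp R f (fun y : R => y + h) x _ _ (df (x + h)) d1.
by rewrite mulr1.
Qed.

Lemma d2_bound (f f1 f2 : R -> R) (M : R) : (forall x : R, is_derive x (1:R) f (f1 x)) ->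
  (forall x : R, is_derive x (1:R) f1 (f2 x)) -> (forall x, `|f2 x| <= M) ->
  forall h x, `|diff2 h f x| <= M * h ^+ 2.
Proof.
move=> d1 d2 fM h x.
have dD (s : R) : is_derive s (1:R) (fun y => f (y + h) - f y) (f1 (s + h) - f1 s).
  by apply: is_deriveB; exact: is_derive_shift.
have bD s : `|f1 (s + h) - f1 s| <= M * `|h|.
  by have := lip_bound d2 fM (s + h) s; rewrite addrAC subrr add0r.
have := lip_bound dD bD x (x - h); rewrite (_ : x - (x - h) = h); last by ring.
rewrite subrK (_ : _ - (f x - _) = - diff2 h f x); last by rewrite /diff2; ring.
by rewrite normrN -mulrA -expr2 real_normK ?num_real.
Qed.

Lemma is_derive_diff2 (f f1 : R -> R) h x : (forall x : R, is_derive x (1:R) f (f1 x)) ->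
  is_derive (x : R) (1:R) (diff2 h f) (diff2 h f1 x).
Proof.
move=> df; rewrite /diff2.
have d0 : is_derive x (1:R) (fun y => 2 * f y) (2 * f1 x) by exact: is_deriveZ.
have d1 := is_derive_shift h x df; have d2 := is_derive_shift (- h) x df.
have d3 : is_derive x (1:R) (fun y => 2 * f y - f (y + h)) (2 * f1 x - f1 (x + h)) by exact: is_deriveB.
exact: is_deriveB.
Qed.

(** Comparable to min (1, h^2): second differences of a smooth function are of order h^2 for small h and merely
    bounded for large h. *)
Definition wt (h : R) := h ^+ 2 / (1 + h ^+ 2).

Lemma wt_ge0 h : 0 <= wt h.
Proof. by rewrite divr_ge0 ?addr_ge0 ?sqr_ge0. Qed.

Lemma wt_small h : h ^+ 2 <= 1 -> h ^+ 2 <= 2 * wt h.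
Proof.
have p := sqr_ge0 h.
move=> h1; rewrite /wt mulrA ler_pdivlMr; last by lra.
by nra.
Qed.

Lemma wt_large h : 1 <= h ^+ 2 -> 1 <= 2 * wt h.
Proof. by move=> h1; rewrite /wt mulrA ler_pdivlMr; lra. Qed.

Lemma supp_int f (c r : R) : measurable_fun setT f -> 0 <= r -> 0 <= c -> (forall x, `|f x| <= c) ->
  (forall x, r < `|x| -> f x = 0) -> intg mu f /\ (\int[mu]_x `|f x| <= 2 * r * c)%R.
Proof.
move=> mf r0 c0 fc fr.
have ii : intg mu (\1_(`[-r, r]%classic) : R -> R) by exact: integrable_indic_itv.
have ic := intgZ c ii.
have le x : `|f x| <= c * \1_(`[-r, r]%classic) x.
  rewrite indicE; have [xr|xr] := leP `|x| r.
    by rewrite mem_set ?mulr1//= in_itv/= -ler_norml.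
  by rewrite fr// normr0 mulr_ge0.
have iF : intg mu f by apply: intg_le ic le.
split => //.
apply: le_trans (Ri_le (intg_abs iF) ic le) _.
rewrite RiZ// mulrC ler_wpM2r// /Rintegral integral_indic//= setIT.
rewrite lebesgue_measure_itv/= lte_fin; case: ifPn => _ /=; last by lra.
by rewrite opprK; lra.
Qed.

Lemma meas_shift f h : measurable_fun setT f -> measurable_fun setT (fun x : R => f (x + h)).
Proof. by move=> mf; apply: (measurableT_comp mf); exact: measurable_funD. Qed.

Lemma meas_diff2 f h : measurable_fun setT f -> measurable_fun setT (diff2 h f).
Proof.
move=> mf; apply: measurable_funB; last exact: meas_shift.
by apply: measurable_funB; [exact: measurable_funM|exact: meas_shift].
Qed.

Lemma intg_diff2 f h : intg mu f -> intg mu (diff2 h f).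
Proof. by move=> iF; apply: intgB; [apply: intgB; [exact: intgZ|]|]; exact: intg_shift. Qed.

Lemma diff2_L1 f h : intg mu f -> (\int[mu]_x `|diff2 h f x| <= 4 * \int[mu]_x `|f x|)%R.
Proof.
move=> iF; have ia := intg_abs iF.
have i2 := intgD (intgD (intgZ 2 ia) (intg_shift h ia)) (intg_shift (- h) ia).
apply: le_trans (_ : (\int[mu]_x (2 * `|f x| + `|f (x + h)| + `|f (x - h)|))%R <= _).
  apply: Ri_le => //; first by apply: intg_abs; exact: intg_diff2.
  move=> x; rewrite /diff2; apply: le_trans (ler_normB _ _) _; rewrite lerD2r.
  by apply: le_trans (ler_normB _ _) _; rewrite lerD2r normrM ger0_norm.
rewrite RiD//; [|by apply: intgD; [exact: intgZ|exact: (intg_shift h ia)]|exact: (intg_shift (- h) ia)].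
rewrite RiD//; [|exact: intgZ|exact: (intg_shift h ia)].
by rewrite (Ri_shift h ia) (Ri_shift (- h) ia) RiZ//; lra.
Qed.

(** For |h| <= 1 the support grows by at most 1 and the pointwise bound applies; for |h| >= 1 the
    triangle inequality is enough. *)
Lemma diff2_L1wt f (B M r : R) : measurable_fun setT f -> 0 <= r -> 0 <= B -> 0 <= M ->
  (forall x, `|f x| <= B) -> (forall x, r < `|x| -> f x = 0) ->
  (forall h x, `|diff2 h f x| <= M * h ^+ 2) ->
  forall h, (\int[mu]_x `|diff2 h f x| <= (4 * (r + 1) * M + 16 * r * B) * wt h)%R.
Proof.
move=> mf r0 B0 M0 fB fr fM h.
have [iF f1] := supp_int mf r0 B0 fB fr.
have w0 := wt_ge0 h; have h20 := sqr_ge0 h.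
have [h1|h1] := leP (h ^+ 2) 1.
  have hs : `|h| <= 1 by rewrite -(@ler_pXn2r _ 2) ?nnegrE// expr1n real_normK ?num_real.
  have [] := @supp_int (diff2 h f) (M * h ^+ 2) (r + 1).
  - exact: meas_diff2.
  - by rewrite addr_ge0.
  - by rewrite mulr_ge0.
  - exact: fM.
  - move=> x xr; rewrite /diff2 !fr ?mulr0 ?subrr ?subr0//.
    + by have := ler_normB x (x - h); rewrite opprB addrC subrK; have := ler_normD (x - h) h; rewrite subrK; lra.
    + by have := ler_normB (x + h) h; rewrite addrK; lra.
    + lra.
  move=> _ H; apply: le_trans H _.
  have := wt_small h1; have : 0 <= (r + 1) * M by rewrite mulr_ge0 ?addr_ge0.
  have : 0 <= r * B by rewrite mulr_ge0.
  set a := (r + 1) * M; set b := r * B.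
  rewrite (_ : 4 * (r + 1) * M = 4 * a); last by rewrite /a; ring.
  rewrite (_ : 16 * r * B = 16 * b); last by rewrite /b; ring.
  rewrite (_ : 2 * (r + 1) * (M * h ^+ 2) = 2 * a * h ^+ 2); last by rewrite /a; ring.
  move=> b0 a0 ws; nra.
apply: le_trans (diff2_L1 h iF) _.
have := wt_large (ltW h1).
have : 0 <= (r + 1) * M by rewrite mulr_ge0 ?addr_ge0.
have : 0 <= r * B by rewrite mulr_ge0.
set a := (r + 1) * M; set b := r * B.
rewrite (_ : 4 * (r + 1) * M = 4 * a); last by rewrite /a; ring.
rewrite (_ : 16 * r * B = 16 * b); last by rewrite /b; ring.
move: f1; rewrite (_ : 2 * r * B = 2 * b); last by rewrite /b; ring.
by move=> f1 b0 a0 ws; nra.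
Qed.

(** A function together with all its derivatives; unlike iterated derivatives, such a sequence can be
    built and transformed term by term. *)
Definition smooth_seq (F : nat -> R -> R) := forall n (x : R), is_derive x (1:R) (F n) (F n.+1 x).

Lemma test_intro (F : nat -> R -> R) (r : R) : smooth_seq F -> (forall x, r < `|x| -> F 0%N x = 0) ->
  is_test_function (F 0%N : R -> R^o).
Proof.
move=> sF Fr; split.
  suff e n : derive1n n (F 0%N : R -> R^o) = F n by move=> n x; rewrite e; have [] := sF n x.
  elim: n => // n; rewrite /derive1n /= => ->; apply/funext => x; rewrite derive1E.
  by apply: derive_val; exact: sF.
apply: (@subclosed_compact _ _ `[-r, r]%classic); first exact: closed_closure.
  exact: segment_compact.
have ci : closed (`[-r, r]%classic : set R) by exact: itv_closed.
rewrite [X in _ `<=` X](closure_id _).1//.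
apply: closureS => x /= /eqP energy_at; rewrite in_itv/= -ler_norml leNgt; apply/negP => /Fr.
exact: energy_at.
Qed.

Lemma test_elim phi : is_test_function (phi : R -> R^o) ->
  exists F, exists r : R, [/\ smooth_seq F, F 0%N = phi, 0 <= r & forall n x, r < `|x| -> F n x = 0].
Proof.
move=> [d cs]; exists (fun n => derive1n n (phi : R -> R^o)).
have [M [_ HM]] := compact_bounded cs.
have s0 : smooth_seq (fun n => derive1n n (phi : R -> R^o)).
  move=> n x; have := derivableP (d n x); rewrite -derive1E; exact.
pose r := Num.max 0 (M + 1).
have r0 : 0 <= r by rewrite le_max lexx.
exists r; split => //.
have p0 x : r < `|x| -> phi x = 0.
  move=> xr; apply/eqP; apply: contraTT xr => px; rewrite -leNgt /r le_max.
  apply/orP; right; have /(_ _)/(_ _) := HM (M + 1); apply; first by rewrite ltrDl.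
  exact: subset_closure.
elim => [|n IH] x xr; first exact: p0.
have := @derive_val _ _ _ _ _ _ _ (s0 n x) => <-.
have near0 : \forall y \near x, derive1n n (phi : R -> R^o) y = (cst 0 : R -> R) y.
  have : \forall y \near x, r < `|y|.
    have := @norm_continuous _ R x; move/cvgr_gt; apply; exact: xr.
  by apply: filterS => y; exact: IH.
by rewrite (near_eq_derive _ near0) ?derive_cst ?oner_neq0.
Qed.

Lemma smooth_meas F n : smooth_seq F -> measurable_fun setT (F n).
Proof.
move=> sF; apply: continuous_measurable_fun => x; apply: differentiable_continuous.
by apply/derivable1_diffP; have [] := sF n x.
Qed.

Lemma smooth_bound F n (r : R) : smooth_seq F -> (forall x, r < `|x| -> F n x = 0) ->
  exists2 B : R, 0 <= B & forall x, `|F n x| <= B.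
Proof.
move=> sF Fr.
have cF : {within `[-r, r], continuous (F n)}.
  by apply: derivable_within_continuous => x _; have [] := sF n x.
have := continuous_compact cF (@segment_compact _ (- r) r).
move=> /compact_bounded[M [_ HM]].
exists (Num.max 0 (M + 1)); first by rewrite le_max lexx.
move=> x; have [xr|xr] := leP `|x| r; last by rewrite Fr// normr0 le_max lexx.
rewrite le_max; apply/orP; right; apply: HM; first by rewrite ltrDl.
by exists x => //=; rewrite in_itv/= -ler_norml.
Qed.

Lemma test_diff2 phi h : is_test_function (phi : R -> R^o) -> is_test_function (diff2 h phi : R -> R^o).
Proof.
move=> /test_elim[F [r [sF F0 r0 Fr]]].
have := @test_intro (fun n => diff2 h (F n)) (r + `|h|); rewrite /= F0; apply.
  by move=> n x; apply: is_derive_diff2 => y; exact: sF.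
move=> x xr; rewrite /diff2 -F0 !Fr ?mulr0 ?subrr ?subr0//.
+ by have := ler_normD (x - h) h; rewrite subrK; lra.
+ by have := ler_normB (x + h) h; rewrite addrK; lra.
+ by have := normr_ge0 h; lra.
Qed.

(** What the exchange of the x- and h-integrations in the singular integrals needs.  Poisson kernels have
    it too, although they are not compactly supported. *)
Definition admiss phi := [/\ intg mu phi, exists B : R, forall x, `|phi x| <= B &
  exists2 C : R, 0 <= C & forall h, (\int[mu]_x `|diff2 h phi x| <= C * wt h)%R].

Lemma diff2_comm h k f x : diff2 h (diff2 k f) x = diff2 k (diff2 h f) x.
Proof.
rewrite /diff2 (addrAC x k h) (addrAC x k (-h)) (addrAC x (-k) h) (addrAC x (-k) (-h)); ring.
Qed.

(** The bound on iterated second differences is what gives cosine transforms the decay |xi|^-4, and what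
    makes the operator of order 1/2 applicable to second differences uniformly. *)
Lemma test_admiss phi : is_test_function (phi : R -> R^o) ->
  [/\ admiss phi, (exists2 C : R, 0 <= C & forall h x, `|diff2 h phi x| <= C * wt h),
   (exists L : R, forall x y, `|phi x - phi y| <= L * `|x - y|) &
   exists2 C : R, 0 <= C & forall h k, (\int[mu]_x `|diff2 h (diff2 k phi) x| <= C * (wt h * wt k))%R].
Proof.
move=> /test_elim[F [r [sF F0 r0 Fr]]].
have [B0 B00 HB0] := smooth_bound sF (Fr 0%N).
have [B1 B10 HB1] := smooth_bound sF (Fr 1%N).
have [B2 B20 HB2] := smooth_bound sF (Fr 2%N).
have [B4 B40 HB4] := smooth_bound sF (Fr 4%N).
have m0 := smooth_meas 0%N sF.
have M2 h x := d2_bound (sF 0%N) (sF 1%N) HB2 h x.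
have M4 h x := d2_bound (sF 2%N) (sF 3%N) HB4 h x.
have [i0 i0B] := supp_int m0 r0 B00 HB0 (Fr 0%N).
have L1 := diff2_L1wt m0 r0 B00 B20 HB0 (Fr 0%N) M2.
rewrite -F0; set C1 := 4 * (r + 1) * B2 + 16 * r * B0 in L1.
have C10 : 0 <= C1 by rewrite addr_ge0// !mulr_ge0// addr_ge0.
split.
- by split => //; [exists B0|exists C1].
- exists (2 * B2 + 8 * B0); first by rewrite addr_ge0// mulr_ge0.
  move=> h x; have w0 := wt_ge0 h; have [h1|h1] := leP (h ^+ 2) 1.
    by have := wt_small h1; have := M2 h x; nra.
  have : `|diff2 h (F 0%N) x| <= 4 * B0.
    rewrite /diff2; have := ler_normB (2 * F 0%N x - F 0%N (x + h)) (F 0%N (x - h)).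
    have := ler_normB (2 * F 0%N x) (F 0%N (x + h)); rewrite normrM ger0_norm//.
    by have := HB0 x; have := HB0 (x + h); have := HB0 (x - h); lra.
  by have := wt_large (ltW h1); nra.
- by exists B1 => x y; exact: (lip_bound (sF 0%N) HB1).
- pose C2 := 4 * (r + 2) * B4 + 16 * (r + 1) * B2.
  have C20 : 0 <= C2 by rewrite addr_ge0// !mulr_ge0// addr_ge0.
  exists (8 * C1 + 2 * C2); first by rewrite addr_ge0// mulr_ge0.
  move=> h k; have wh := wt_ge0 h; have cutoff_rate := wt_ge0 k.
  have whk : 0 <= wt h * wt k by rewrite mulr_ge0.
  have [k1|k1] := leP (k ^+ 2) 1.
    have ks : `|k| <= 1 by rewrite -(@ler_pXn2r _ 2) ?nnegrE// expr1n real_normK ?num_real.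
    have k20 := sqr_ge0 k.
    have := @diff2_L1wt (diff2 k (F 0%N)) (B2 * k ^+ 2) (B4 * k ^+ 2) (r + 1) _ _ _ _ _ _ _ h.
    move=> /(_ (meas_diff2 k m0)) H.
    apply: le_trans (H _ _ _ _ _ _) _.
    + by rewrite addr_ge0.
    + by rewrite mulr_ge0.
    + by rewrite mulr_ge0.
    + by move=> x; exact: M2.
    + move=> x xr; rewrite /diff2 !Fr ?mulr0 ?subrr ?subr0//.
      * by have := ler_normD (x - k) k; rewrite subrK; lra.
      * by have := ler_normB (x + k) k; rewrite addrK; lra.
      * lra.
    + move=> h' x; apply: (@d2_bound _ (diff2 k (F 1%N)) (diff2 k (F 2%N))) => y.
      * by apply: is_derive_diff2 => z; exact: sF.
      * by apply: is_derive_diff2 => z; exact: sF.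
      * exact: M4.
    + rewrite (_ : _ * wt h = (C2 * wt h) * k ^+ 2); last by rewrite /C2; ring.
      have := wt_small k1; have : 0 <= C2 * wt h by rewrite mulr_ge0.
      have : 0 <= C1 * (wt h * wt k) by rewrite mulr_ge0.
      rewrite (_ : (8 * C1 + 2 * C2) * (wt h * wt k) =
        8 * (C1 * (wt h * wt k)) + (C2 * wt h) * (2 * wt k)); last by ring.
      set a := C2 * wt h; set b := C1 * _ => b0 a0 ww; nra.
  under eq_Rintegral do rewrite diff2_comm.
  apply: le_trans (diff2_L1 k (intg_diff2 h i0)) _.
  have := L1 h; have := wt_large (ltW k1); have : 0 <= C2 * (wt h * wt k) by rewrite mulr_ge0.
  have : 0 <= C1 * wt h by rewrite mulr_ge0.
  rewrite (_ : (8 * C1 + 2 * C2) * (wt h * wt k) =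
        4 * ((C1 * wt h) * (2 * wt k)) + 2 * (C2 * (wt h * wt k))); last by ring.
  set a := C1 * wt h; set b := C2 * _ => a0 b0 ww; nra.
Qed.

End Test.

(** * Kernels of fractional order and their symbols *)

Lemma meas_Ri d1 d2 (T1 : measurableType d1) (T2 : measurableType d2) (R : realType)
  (m2 : {sigma_finite_measure set T2 -> \bar R}) (f : T1 * T2 -> R) :
  measurable_fun setT f -> measurable_fun setT (fun x => \int[m2]_y f (x, y))%R.
Proof.
move=> mf; have mE : measurable_fun setT (EFin \o f) by exact/measurable_EFinP.
apply: (measurableT_comp (f := @fine R)) => //.
rewrite (_ : (fun x => \int[m2]_y (f (x, y))%:E)%E = (fun x =>
  (\int[m2]_y ((EFin \o f)^\+ (x, y))) - (\int[m2]_y ((EFin \o f)^\- (x, y))))%E); last first.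
  by apply/funext => x; rewrite [LHS]integralE; congr (_ - _)%E; apply: eq_integral => y _;
    rewrite ?funeposE ?funenegE.
apply: emeasurable_funB.
- apply: (@measurable_fun_fubini_tonelli_F _ _ _ _ _ m2 (EFin \o f)^\+)%E => //.
  exact: measurable_funepos.
- apply: (@measurable_fun_fubini_tonelli_F _ _ _ _ _ m2 (EFin \o f)^\-)%E => //.
  exact: measurable_funeneg.
Qed.

Lemma scalerRE (R : realType) (a : R) (b : R^o) : a *: b = a * b :> R.
Proof. by []. Qed.

Section Kernels.
Context {R : realType}.
Notation mu := (@lebesgue_measure R).
Implicit Types f g phi : R -> R.

Lemma meas_cos : measurable_fun setT (@cos R).
Proof. by apply: continuous_measurable_fun => x; exact: continuous_cos. Qed.

(** Up to constants, the kernels whose symbols are |xi|^(1/2) and |xi|. *)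
Definition q32 (h : R) := (`|h| * Num.sqrt `|h|)^-1.
Definition q2 (h : R) := (h ^+ 2)^-1.

Lemma q32_ge0 h : 0 <= q32 h.
Proof. by rewrite invr_ge0 mulr_ge0// sqrtr_ge0. Qed.

Lemma q2_ge0 h : 0 <= q2 h.
Proof. by rewrite invr_ge0 sqr_ge0. Qed.

Lemma meas_q32 : measurable_fun setT q32.
Proof.
apply: meas_funV; apply: measurable_funM => //.
exact: (measurableT_comp meas_sqrt).
Qed.

Lemma meas_q2 : measurable_fun setT q2.
Proof. exact: meas_funV. Qed.

Lemma meas_wt : measurable_fun setT (@wt R).
Proof. by apply: measurable_funM => //; apply: meas_funV; exact: measurable_funD. Qed.

Lemma wt_q32 h : wt h * q32 h <= 2 * kap h.
Proof.
have [->|h0] := eqVneq h 0.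
  by rewrite /wt expr0n mul0r mul0r mulr_ge0// kap_ge0.
have a0 : 0 < `|h| by rewrite normr_gt0.
rewrite /wt /q32 /kap -[h ^+ 2]real_normK ?num_real//; set a := `|h| in a0 *.
have s0 : 0 < Num.sqrt a by rewrite sqrtr_gt0.
have -> : a ^+ 2 / (1 + a ^+ 2) / (a * Num.sqrt a) = (a / (1 + a ^+ 2)) / Num.sqrt a.
  by field; rewrite !gt_eqF//; nra.
have -> : 2 * (Num.sqrt a * (1 + a))^-1 = (2 / (1 + a)) / Num.sqrt a.
  by field; rewrite !gt_eqF//; lra.
apply: ler_wpM2r; first by rewrite invr_ge0 ltW.
by rewrite ler_pdivlMr; [rewrite mulrAC ler_pdivrMr; nra|lra].
Qed.

Lemma wt_q2 h : wt h * q2 h <= (1 + h ^+ 2)^-1.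
Proof.
have [->|h0] := eqVneq h 0.
  by rewrite /wt expr0n mul0r mul0r invr_ge0 addr_ge0.
have p : 0 < h ^+ 2 by rewrite exprn_even_gt0.
by rewrite /wt /q2 mulrAC mulfV ?gt_eqF// mul1r.
Qed.

Lemma intg_wq32 : intg mu (fun h => wt h * q32 h).
Proof.
apply: (@intg_le _ _ _ mu _ (fun h => 2 * kap h)).
- by apply: measurable_funM; [exact: meas_wt|exact: meas_q32].
- exact/intgZ/intg_kap.
- by move=> h; rewrite ger0_norm ?wt_q32// mulr_ge0 ?wt_ge0 ?q32_ge0.
Qed.

Lemma intg_wq2 : intg mu (fun h => wt h * q2 h).
Proof.
apply: (@intg_le _ _ _ mu _ (fun h => (1 + h ^+ 2)^-1)).
- by apply: measurable_funM; [exact: meas_wt|exact: meas_q2].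
- exact: cauchy_int.1.
- by move=> h; rewrite ger0_norm ?wt_q2// mulr_ge0 ?wt_ge0 ?q2_ge0.
Qed.

(** The squared chord |1 - exp (i h)|^2, which is the symbol of a second difference. *)
Definition c2 (h : R) := 2 - 2 * cos h.

Lemma c2_ge0 h : 0 <= c2 h.
Proof. by rewrite /c2; have := cos_le1 h; lra. Qed.

Lemma c2_le4 h : c2 h <= 4.
Proof. by rewrite /c2; have := cos_geN1 h; lra. Qed.

Lemma c2_sqr h : c2 h <= h ^+ 2.
Proof.
have d1 (x : R) : is_derive x (1:R) (@cos R) (- sin x) by exact: is_derive_cos.
have d2 (x : R) : is_derive x (1:R) (fun x => - sin x) (- cos x) by exact: is_deriveN.
have := @d2_bound _ cos (fun x => - sin x) (fun x => - cos x) 1 d1 d2 _ h 0.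
rewrite mul1r /diff2 cos0 add0r sub0r cosN (_ : 2 * 1 - cos h - cos h = c2 h); last by rewrite /c2; ring.
by rewrite ger0_norm ?c2_ge0//; apply => x; rewrite normrN cos_max.
Qed.

Lemma c2_wt h : c2 h <= 8 * wt h.
Proof.
have := wt_ge0 h; have [h1|h1] := leP (h ^+ 2) 1.
  by have := wt_small h1; have := c2_sqr h; lra.
by have := wt_large (ltW h1); have := c2_le4 h; lra.
Qed.

Lemma meas_c2 : measurable_fun setT c2.
Proof. by apply: measurable_funB => //; apply: measurable_funM => //; exact: meas_cos. Qed.

Lemma intg_c2q32 : intg mu (fun h => c2 h * q32 h).
Proof.
apply: (@intg_le _ _ _ mu _ (fun h => 8 * (wt h * q32 h))).
- by apply: measurable_funM; [exact: meas_c2|exact: meas_q32].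
- exact/intgZ/intg_wq32.
- move=> h; rewrite ger0_norm ?mulr_ge0 ?c2_ge0 ?q32_ge0// mulrA ler_wpM2r ?q32_ge0//.
  exact: c2_wt.
Qed.

Lemma intg_c2q2 : intg mu (fun h => c2 h * q2 h).
Proof.
apply: (@intg_le _ _ _ mu _ (fun h => 8 * (wt h * q2 h))).
- by apply: measurable_funM; [exact: meas_c2|exact: meas_q2].
- exact/intgZ/intg_wq2.
- move=> h; rewrite ger0_norm ?mulr_ge0 ?c2_ge0 ?q2_ge0// mulrA ler_wpM2r ?q2_ge0//.
  exact: c2_wt.
Qed.

Definition c_quarter : R := (\int[mu]_h (c2 h * q32 h))%R.
Definition c_half : R := (\int[mu]_h (c2 h * q2 h))%R.

(** Homogeneity: substitute h xi for h. *)
Lemma int_c2q32 xi : intg mu (fun h => c2 (h * xi) * q32 h) /\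
  (\int[mu]_h (c2 (h * xi) * q32 h) = c_quarter * Num.sqrt `|xi|)%R.
Proof.
have [->|x0] := eqVneq xi 0.
  have e h : c2 (h * 0) * q32 h = 0 by rewrite /c2 mulr0 cos0; ring.
  split; first by under eq_fun do rewrite e; exact: intg0.
  under eq_Rintegral do rewrite e.
  by rewrite normr0 sqrtr0 mulr0 /Rintegral integral0.
have a0 : 0 < `|xi| by rewrite normr_gt0.
have s0 : 0 < Num.sqrt `|xi| by rewrite sqrtr_gt0.
have e h : c2 (h * xi) * q32 h = (`|xi| * Num.sqrt `|xi|) * (c2 (xi * h) * q32 (xi * h)).
  rewrite /q32 normrM sqrtrM ?ltW// (mulrC h xi).
  have [->|h0] := eqVneq h 0; first by rewrite mulr0 /c2 cos0; ring.
  have b0 : 0 < `|h| by rewrite normr_gt0.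
  have t0 : 0 < Num.sqrt `|h| by rewrite sqrtr_gt0.
  by field; rewrite !gt_eqF.
have i1 := intg_scale x0 intg_c2q32.
split; first by under eq_fun do rewrite e; exact: intgZ.
under eq_Rintegral do rewrite e.
rewrite RiZ// (Ri_scale x0 intg_c2q32) -/c_quarter.
by field; rewrite gt_eqF.
Qed.

Lemma int_c2q2 xi : intg mu (fun h => c2 (h * xi) * q2 h) /\
  (\int[mu]_h (c2 (h * xi) * q2 h) = c_half * `|xi|)%R.
Proof.
have [->|x0] := eqVneq xi 0.
  have e h : c2 (h * 0) * q2 h = 0 by rewrite /c2 mulr0 cos0; ring.
  split; first by under eq_fun do rewrite e; exact: intg0.
  under eq_Rintegral do rewrite e.
  by rewrite normr0 mulr0 /Rintegral integral0.
have a0 : 0 < `|xi| by rewrite normr_gt0.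
have e h : c2 (h * xi) * q2 h = (xi ^+ 2) * (c2 (xi * h) * q2 (xi * h)).
  rewrite /q2 (mulrC h xi).
  have [->|h0] := eqVneq h 0; first by rewrite mulr0 /c2 cos0; ring.
  by field; rewrite h0 x0.
have i1 := intg_scale x0 intg_c2q2.
split; first by under eq_fun do rewrite e; exact: intgZ.
under eq_Rintegral do rewrite e.
rewrite RiZ// (Ri_scale x0 intg_c2q2) -/c_half -[xi ^+ 2]real_normK ?num_real//.
by field; rewrite gt_eqF.
Qed.

Lemma c2q_gt0 (q : R -> R) : (forall h, 0 <= q h) -> (exists2 c, 0 < c & forall h, 1 <= h <= 2 -> c <= q h) ->
  intg mu (fun h => c2 h * q h) -> (0 < \int[mu]_h (c2 h * q h))%R.
Proof.
move=> q0 [c c0 qc] ic.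
have d : 0 < 2 - 2 * cos (1 : R).
  have h1 : cos (1 : R) < cos 0.
    by rewrite ltr_cos ?in_itv/= ?lexx ?ler01 ?pi_ge0//=; have := pi_ge2 R; lra.
  by rewrite cos0 in h1; lra.
have ii : intg mu (\1_(`[1, 2]%classic) : R -> R) by exact: integrable_indic_itv.
have h := Ri_le (intgZ ((2 - 2 * cos 1) * c) ii) ic.
apply: lt_le_trans (h _).
  rewrite RiZ// mulr_gt0 ?mulr_gt0// /Rintegral integral_indic//= setIT.
  by rewrite lebesgue_measure_itv/= lte_fin ltr1n/= (_ : 2 - 1 = 1)//; lra.
move=> x; rewrite indicE; have [/set_mem|_] := boolP (x \in _).
  rewrite /= in_itv/= => xi; rewrite mulr1; apply: ler_pM; [exact: ltW|exact: ltW| |exact: qc].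
  rewrite /c2; have : cos x <= cos 1; last by lra.
  move: xi => /andP[x1 x2]; move: x1; rewrite le_eqVlt => /predU1P[->//|x1].
  by apply/ltW; rewrite ltr_cos ?in_itv/=; have := pi_ge2 R; lra.
by rewrite mulr0 mulr_ge0 ?c2_ge0.
Qed.

Lemma c_quarter_gt0 : 0 < c_quarter.
Proof.
apply: c2q_gt0; [exact: q32_ge0| |exact: intg_c2q32].
exists 4^-1 => // h /andP[h1 h2]; have h0 : 0 < h by lra.
rewrite /q32 gtr0_norm// lef_pV2 ?posrE ?mulr_gt0 ?sqrtr_gt0//.
have : Num.sqrt h <= h.
  by rewrite -(@ler_pXn2r _ 2) ?nnegrE ?sqrtr_ge0 ?(ltW h0)// (sqr_sqrtr (ltW h0)); nra.
have := sqrtr_ge0 h; nra.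
Qed.

Lemma c_half_gt0 : 0 < c_half.
Proof.
apply: c2q_gt0; [exact: q2_ge0| |exact: intg_c2q2].
exists 4^-1 => // h /andP[h1 h2]; have h0 : 0 < h by lra.
by rewrite /q2 lef_pV2 ?posrE ?exprn_gt0//; nra.
Qed.

(** The Poisson kernel as a Fourier integral.  Replacing cos by 1 + cos makes the integrand nonnegative, so
    that the fundamental theorem on a half line applies to an explicit primitive. *)
Lemma expcos (t x : R) : 0 < t ->
  intg mu (fun xi => expR (- (t * `|xi|)) * cos (x * xi)) /\
  (\int[mu]_xi (expR (- (t * `|xi|)) * cos (x * xi)) = 2 * (t / (x ^+ 2 + t ^+ 2)))%R.
Proof.
move=> t0.
have N0 : x ^+ 2 + t ^+ 2 != 0 by rewrite gt_eqF// ltr_wpDl ?sqr_ge0// exprn_gt0.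
pose f (y : R) xi := expR (- (t * `|xi|)) * (1 + cos (y * xi)).
have f0 y xi : 0 <= f y xi.
  by rewrite mulr_ge0 ?expR_ge0//; have := cos_geN1 (y * xi); lra.
have cf y : continuous (f y).
  move=> z; apply: cvgM.
    apply: (@continuous_comp _ _ _ (fun z : R => - (t * `|z|)) expR); last exact: continuous_expR.
    by apply: cvgN; apply: cvgMr; exact: norm_continuous.
  apply: cvgD; first exact: cvg_cst.
  apply: (@continuous_comp _ _ _ (fun z : R => y * z) cos); last exact: continuous_cos.
  by apply: cvgMr; exact: cvg_id.
pose G (y z : R) := expR (- (t * z)) * ((y * sin (y * z) - t * cos (y * z)) / (y ^+ 2 + t ^+ 2) - t^-1).
have M0 y : y ^+ 2 + t ^+ 2 != 0 by rewrite gt_eqF// ltr_wpDl ?sqr_ge0// exprn_gt0.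
have dG y z : is_derive z (1:R) (G y) (expR (- (t * z)) * (1 + cos (y * z))).
  have dt : is_derive z (1:R) (fun z : R => - (t * z)) (- t).
    apply: is_deriveN; have := @is_deriveZ R R R id t z 1 1 _.
    by rewrite /GRing.scale/= mulr1; exact.
  have dy : is_derive z (1:R) (fun z : R => y * z) y.
    by have := @is_deriveZ R R R id y z 1 1 _; rewrite /GRing.scale/= mulr1; exact.
  have de : is_derive z (1:R) (fun z => expR (- (t * z))) (expR (- (t * z)) * - t).
    exact: is_derive1_comp (is_derive_expR _) dt.
  have ds : is_derive z (1:R) (fun z => sin (y * z)) (cos (y * z) * y).
    exact: is_derive1_comp (is_derive_sin _) dy.
  have dc : is_derive z (1:R) (fun z => cos (y * z)) (- sin (y * z) * y).
    exact: is_derive1_comp (is_derive_cos _) dy.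
  rewrite /G; apply: is_derive_eq.
  by rewrite !scalerRE; field; rewrite ?M0 gt_eqF.
have lG y : G y z @[z --> +oo] --> 0.
  pose C := (`|y| + t) / (y ^+ 2 + t ^+ 2) + t^-1.
  have p : 0 < y ^+ 2 + t ^+ 2 by rewrite ltr_wpDl ?sqr_ge0// exprn_gt0.
  have GC z : `|G y z| <= C * expR (- (t * z)).
    rewrite /G normrM (ger0_norm (expR_ge0 _)) mulrC ler_wpM2r ?expR_ge0//.
    apply: le_trans (ler_normB _ _) _; apply: lerD; last by rewrite ger0_norm// invr_ge0 ltW.
    rewrite normrM (@ger0_norm _ (_^-1)) ?invr_ge0 ?(ltW p)//.
    apply: ler_wpM2r; first by rewrite invr_ge0 (ltW p).
    apply: le_trans (ler_normB _ _) _; rewrite !normrM (gtr0_norm t0).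
    by apply: lerD; rewrite ler_piMr// ?sin_max ?cos_max ?(ltW t0).
  have e0 : C * expR (- (t * z)) @[z --> +oo] --> C * 0.
    apply: cvgM; first exact: cvg_cst.
    apply: (cvg_comp (fun z => t * z) (fun x => expR (- x))); last exact: cvgr_expR.
    apply/cvgryPge => A; exists (A / t); split; first exact: num_real.
    by move=> z; rewrite ltr_pdivrMr// mulrC => /ltW.
  rewrite mulr0 in e0; apply: norm_cvg0.
  apply: (squeeze_cvgr (f := fun=> 0) (h := fun z => C * expR (- (t * z))) _ (cvg_cst 0) e0).
  by apply: nearW => z; rewrite normr_ge0/=; exact: GC.
have ef y : (\int[mu]_xi (f y xi)%:E = (2 * (t^-1 + t / (y ^+ 2 + t ^+ 2)))%:E)%E.
  rewrite (ge0_symfun_integralT (f0 y) (cf y)); last by move=> z /=; rewrite /f normrN mulrN cosN.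
  rewrite (_ : [set x : R | 0 <= x] = `[0, +oo[%classic); last first.
    by apply/seteqP; split => z /=; rewrite in_itv/= andbT.
  rewrite (ge0_continuous_FTC2y (F := G y) (l := 0)).
  - rewrite /G !mulr0 sin0 cos0 oppr0 expR0 -EFinB -EFinM; congr EFin; field.
    by rewrite M0 gt_eqF.
  - by move=> z _.
  - exact: continuous_subspaceT.
  - exact: lG.
  - by move=> z _; have [] := dG y z.
  - apply: cvg_at_right_filter.
    by have [/derivable1_diffP/differentiable_continuous] := dG y 0.
  - move=> z; rewrite in_itv/= andbT => z0; rewrite derive1E /f gtr0_norm//.
    exact: derive_val.
have if_ y : intg mu (f y).
  by apply: intg_ge0 => //; [exact: continuous_measurable_fun|rewrite ef ltry].
have eR y : (\int[mu]_xi f y xi = 2 * (t^-1 + t / (y ^+ 2 + t ^+ 2)))%R by rewrite /Rintegral ef.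
have e xi : expR (- (t * `|xi|)) * cos (x * xi) = f x xi - 2^-1 * f 0 xi.
  by rewrite /f mul0r cos0; field.
split.
  by under eq_fun do rewrite e; apply: intgB => //; exact: intgZ.
under eq_Rintegral do rewrite e.
rewrite RiB//; last exact: intgZ.
by rewrite RiZ// !eR; field; rewrite N0 ?M0 gt_eqF.
Qed.

End Kernels.

(** * The multiplier on test functions *)

Section CplxParts.
Context {R : realType}.
Local Open Scope complex_scope.

Lemma ReCM (k : R) (z : R[i]) : complex.Re (k%:C * z) = k * complex.Re z.
Proof. by case: z => a b /=; rewrite mul0r subr0. Qed.

Lemma ReM (z w : R[i]) :
  complex.Re (z * w) = complex.Re z * complex.Re w - complex.Im z * complex.Im w.
Proof. by case: z w => [a b] [c d]. Qed.

End CplxParts.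

Section Fourier.
Context {R : realType}.
Notation mu := (@lebesgue_measure R).
Implicit Types f g phi : R -> R.

(** The real part of exp (i x xi) times the Fourier transform of phi at xi. *)
Definition J phi (x xi : R) : R := (\int[mu]_y (phi y * cos ((x - y) * xi)))%R.

Lemma meas_coslin (x xi : R) : measurable_fun setT (fun y : R => cos ((x - y) * xi)).
Proof.
apply: (measurableT_comp (@meas_cos R)); apply: measurable_funM => //.
exact: measurable_funB.
Qed.

Lemma intg_J phi x xi : intg mu phi -> intg mu (fun y => phi y * cos ((x - y) * xi)).
Proof.
move=> ip; apply: (@intg_le _ _ _ mu _ (fun y => `|phi y|)).
- by apply: measurable_funM; [exact: intg_meas ip|exact: meas_coslin].
- exact: intg_abs.
- by move=> y; rewrite normrM ler_piMr ?cos_max.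
Qed.

Lemma J_le phi x xi : intg mu phi -> `|J phi x xi| <= (\int[mu]_y `|phi y|)%R.
Proof.
move=> ip; apply: Ri_abs_le; [exact: intg_J|exact: intg_abs|].
by move=> y; rewrite normrM ler_piMr ?cos_max.
Qed.

Lemma J_shift phi h x xi : intg mu phi -> J (fun y => phi (y + h)) x xi = J phi (x + h) xi.
Proof.
move=> ip; rewrite /J -(Ri_shift h (intg_J (x + h) xi ip)); apply: Ri_eq => y.
by congr (_ * cos (_ * _)); ring.
Qed.

Lemma J_diff2 phi h x xi : intg mu phi -> J (diff2 h phi) x xi = diff2 h (fun z => J phi z xi) x.
Proof.
move=> ip; rewrite {2}/diff2 -(J_shift h x xi ip) -(J_shift (- h) x xi ip).
have i1 := intg_J x xi ip; have i2 := intg_J x xi (intg_shift h ip).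
have i3 := intg_J x xi (intg_shift (- h) ip).
rewrite /J -RiZ// -RiB//; last exact: intgZ.
rewrite -RiB//; last by apply: intgB => //; exact: intgZ.
by apply: Ri_eq => y; rewrite /diff2; ring.
Qed.

Lemma J_c2 phi h x xi : intg mu phi -> diff2 h (fun z => J phi z xi) x = c2 (h * xi) * J phi x xi.
Proof.
move=> ip; rewrite /diff2; set a := J phi x xi; rewrite -addrA -opprD.
have -> : J phi (x + h) xi + J phi (x - h) xi = 2 * cos (h * xi) * a; last by rewrite /c2; ring.
rewrite /J /a -RiD; [|exact: intg_J|exact: intg_J].
rewrite -RiZ; last exact: intg_J.
apply: Ri_eq => y.
rewrite (_ : (x + h - y) * xi = (x - y) * xi + h * xi); last by ring.
rewrite (_ : (x - h - y) * xi = (x - y) * xi - h * xi); last by ring.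
by rewrite cosD cosB; ring.
Qed.

(** A second difference with step pi / xi multiplies the transform by 4, and two of them cost the square of
    [wt (pi / xi)], which is of order xi^-4. *)
Lemma J_bound phi : is_test_function (phi : R -> R^o) ->
  exists2 C : R, 0 <= C & forall x xi, `|J phi x xi| <= C * (1 + xi ^+ 2)^-1 ^+ 2.
Proof.
move=> tp; have [[ip _ _] _ _ [C C0 HC]] := test_admiss tp.
set I1 := (\int[mu]_y `|phi y|)%R.
have I10 : 0 <= I1 by apply: Ri_ge0.
exists (I1 + C * pi ^+ 4); first by rewrite addr_ge0// mulr_ge0// exprn_ge0// pi_ge0.
move=> x xi; have [->|x0] := eqVneq xi 0.
  rewrite expr0n addr0 invr1 expr1n mulr1; apply: le_trans (J_le x 0 ip) _.
  by rewrite lerDl mulr_ge0// exprn_ge0// pi_ge0.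
(* With h xi = pi both factors 2 - 2 cos (h xi) equal 4. *)
have p2 := pi_ge2 R; set h := pi / xi.
have e1 := J_diff2 h x xi (intg_diff2 h ip).
rewrite (J_c2 h x xi (intg_diff2 h ip)) (J_diff2 h x xi ip) (J_c2 h x xi ip) in e1.
have hx : h * xi = pi by rewrite /h divfK.
rewrite hx /c2 cospi in e1.
have b1 := J_le x xi (intg_diff2 h (intg_diff2 h ip)).
have := le_trans b1 (HC h h); rewrite e1.
have q0 : 0 < (1 + xi ^+ 2)^-1 by rewrite invr_gt0 ltr_wpDr ?sqr_ge0.
have w1 : wt h <= pi ^+ 2 * (1 + xi ^+ 2)^-1.
  have x2 : 0 < xi ^+ 2 by rewrite exprn_even_gt0.
  have -> : wt h = pi ^+ 2 / (xi ^+ 2 + pi ^+ 2).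
    by rewrite /wt /h; field; rewrite x0 /= !gt_eqF//; nra.
  apply: ler_wpM2l; first exact: sqr_ge0.
  by rewrite lef_pV2 ?posrE; nra.
have w0 := wt_ge0 h.
have w2 : wt h * wt h <= pi ^+ 4 * (1 + xi ^+ 2)^-1 ^+ 2.
  rewrite (_ : pi ^+ 4 * _ = (pi ^+ 2 * (1 + xi ^+ 2)^-1) * (pi ^+ 2 * (1 + xi ^+ 2)^-1)); last by ring.
  exact: ler_pM.
have w3 : C * (wt h * wt h) <= C * (pi ^+ 4 * (1 + xi ^+ 2)^-1 ^+ 2) by exact: ler_wpM2l.
have w4 : 0 <= I1 * (1 + xi ^+ 2)^-1 ^+ 2 by rewrite mulr_ge0// sqr_ge0.
rewrite (_ : (2 - 2 * -1) * ((2 - 2 * -1) * J phi x xi) = 16 * J phi x xi); last by ring.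
rewrite normrM ger0_norm// => H.
have := normr_ge0 (J phi x xi); lra.
Qed.

Lemma meas_J phi x : measurable_fun setT phi -> measurable_fun setT (J phi x).
Proof.
move=> mp; apply: (@meas_Ri _ _ _ _ _ mu (fun z : R * R => phi z.2 * cos ((x - z.2) * z.1))).
apply: measurable_funM; first exact: (measurableT_comp mp measurable_snd).
apply: (measurableT_comp (@meas_cos R)); apply: measurable_funM => //.
by apply: measurable_funB.
Qed.

Lemma intg_wJ phi x (a : R -> R) : is_test_function (phi : R -> R^o) ->
  measurable_fun setT a -> (forall xi, `|a xi| <= 1 + xi ^+ 2) ->
  intg mu (fun xi => a xi * J phi x xi).
Proof.
move=> tp ma aB; have [[ip _ _] _ _ _] := test_admiss tp.
have [C C0 HC] := J_bound tp.
apply: (@intg_le _ _ _ mu _ (fun xi => C * (1 + xi ^+ 2)^-1)).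
- by apply: measurable_funM => //; apply: meas_J; exact: intg_meas ip.
- exact/intgZ/cauchy_int.1.
- move=> xi; have q0 : 0 < (1 + xi ^+ 2)^-1 by rewrite invr_gt0 ltr_wpDr ?sqr_ge0.
  rewrite normrM; apply: le_trans (ler_pM _ _ (aB xi) (HC x xi)) _ => //.
  rewrite expr2 mulrCA; apply: ler_wpM2l => //; rewrite mulrA mulfV ?mul1r//.
  by rewrite gt_eqF// ltr_wpDr ?sqr_ge0.
Qed.

(** Abel summation: with the factor exp (- e |xi|) the integral is a Poisson mean of phi by [expcos], and
    both sides pass to the limit e -> 0. *)
Lemma inversion phi x : is_test_function (phi : R -> R^o) ->
  (\int[mu]_xi J phi x xi = 2 * pi * phi x)%R.
Proof.
move=> tp; have [[ip [B pB] _] _ [L pL] _] := test_admiss tp.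
have mp := intg_meas ip.
pose e (n : nat) : R := n.+1%:R^-1.
have e0 n : 0 < e n by rewrite invr_gt0.
have ecv : e n @[n --> \oo] --> (0 : R) by exact: cvg_harmonic.
have iJ : intg mu (J phi x).
  have := @intg_wJ phi x (cst 1) tp; under eq_fun do rewrite mul1r; apply => // xi.
  by rewrite normr1 lerDl sqr_ge0.
have B0 : 0 <= B by apply: le_trans (pB 0).
have key n : (\int[mu]_xi (expR (- (e n * `|xi|)) * J phi x xi) =
   \int[mu]_w (phi (x - e n * w) * (2 * (1 + w ^+ 2)^-1)))%R.
  pose F (z : R * R) := (expR (- (e n * `|z.1|))) * (phi z.2 * cos ((x - z.2) * z.1)).
  have mF : measurable_fun setT F.
    apply: measurable_funM.
      apply: (measurableT_comp (@measurable_expR R)).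
      apply: (measurableT_comp (@oppr_measurable R setT)).
      apply: measurable_funM => //.
      exact: (measurableT_comp (@normr_measurable R setT) measurable_fst).
    apply: measurable_funM; first exact: (measurableT_comp mp measurable_snd).
    apply: (measurableT_comp (@meas_cos R)); apply: measurable_funM => //.
    by apply: measurable_funB.
  have iE : intg mu (fun xi => expR (- (e n * `|xi|))).
    have := (expcos 0 (e0 n)).1; under eq_fun do rewrite mul0r cos0 mulr1; exact.
  have iF : intg (mu \x mu)%E F.
    apply: (@intg_le _ _ _ (mu \x mu)%E _ (fun z => expR (- (e n * `|z.1|)) * `|phi z.2|)) => //.
      exact: (intg_tensor iE (intg_abs ip)).
    move=> z; rewrite /F normrM ger0_norm ?expR_ge0// ler_wpM2l ?expR_ge0//.
    by rewrite normrM ler_piMr ?cos_max.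
  have := Ri_swap iF.
  have -> : (\int[mu]_xi \int[mu]_y F (xi, y) = \int[mu]_xi (expR (- (e n * `|xi|)) * J phi x xi))%R.
    by apply: Ri_eq => xi; rewrite /F/= RiZ//; exact: intg_J.
  move=> ->.
  pose G z := phi (x - z) * (2 * (e n / (z ^+ 2 + e n ^+ 2))).
  have iP := (cauchy_scaled_int (e0 n)).1.
  have iG : intg mu G.
    have mpx : measurable_fun setT (fun z : R => phi (x - z)).
      by apply: (measurableT_comp mp); exact: measurable_funB.
    apply: (@intg_Mb _ _ _ mu (fun z => phi (x - z)) (fun z => 2 * (e n / (z ^+ 2 + e n ^+ 2))) B) => //.
    exact: intgZ.
  transitivity (\int[mu]_y G (x - y))%R.
    apply: Ri_eq => y; rewrite /F /G/= subKr.
    under eq_Rintegral do rewrite mulrCA.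
    by rewrite RiZ; [rewrite (expcos (x - y) (e0 n)).2|exact: (expcos (x - y) (e0 n)).1].
  rewrite (Ri_subl x iG).
  have en : e n != 0 by rewrite gt_eqF.
  have := Ri_scale en iG; rewrite (gtr0_norm (e0 n)) => h.
  have -> : (\int[mu]_y G y)%R = e n * (\int[mu]_y G (e n * y))%R by rewrite h mulrA mulfV ?mul1r.
  rewrite -RiZ; last exact: intg_scale.
  apply: Ri_eq => w; rewrite /G.
  have w1 : 1 + w ^+ 2 != 0 by rewrite gt_eqF// ltr_wpDr ?sqr_ge0.
  have w2 : (e n * w) ^+ 2 + e n ^+ 2 != 0.
    by rewrite gt_eqF// ltr_wpDl ?sqr_ge0// exprn_gt0.
  rewrite mulrCA; congr (_ * _); move: w2; rewrite exprMn -[X in _ + X]mulr1 -mulrDr addrC => w2.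
  by field; rewrite en w1.
have c1 : (\int[mu]_xi (expR (- (e n * `|xi|)) * J phi x xi))%R @[n --> \oo] --> (\int[mu]_xi J phi x xi)%R.
  apply: (@Ri_dct _ _ _ mu _ _ (fun xi => `|J phi x xi|) _ _ _ _ _).2.
  - move=> n; apply: measurable_funM; last exact: intg_meas iJ.
    apply: (measurableT_comp (@measurable_expR R)).
    by apply: (measurableT_comp (@oppr_measurable R setT)); apply: measurable_funM.
  - exact: intg_meas iJ.
  - exact: intg_abs.
  - apply: aeW => xi; rewrite -[X in _ --> X]mul1r -(@expR0 R); apply: cvgM; last exact: cvg_cst.
    apply: (continuous_cvg _ (@continuous_expR R _)).
    rewrite -(@oppr0 R) -(mul0r `|xi|); apply: cvgN; apply: cvgM => //; exact: cvg_cst.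
  - move=> n xi; rewrite normrM ger0_norm ?expR_ge0// ler_piMl//.
    by rewrite -(@expR0 R) ler_expR oppr_le0 mulr_ge0// ltW.
have c2 : (\int[mu]_w (phi (x - e n * w) * (2 * (1 + w ^+ 2)^-1)))%R @[n --> \oo] -->
    (\int[mu]_w (phi x * (2 * (1 + w ^+ 2)^-1)))%R.
  have ic := intgZ 2 (cauchy_int (R := R)).1.
  apply: (@Ri_dct _ _ _ mu _ _ (fun w => B * (2 * (1 + w ^+ 2)^-1)) _ _ _ _ _).2.
  - move=> n; apply: measurable_funM; last exact: intg_meas ic.
    by apply: (measurableT_comp mp); apply: measurable_funB => //; exact: measurable_funM.
  - by apply: measurable_funM => //; exact: intg_meas ic.
  - exact: intgZ.
  - apply: aeW => w; apply: cvgM; last exact: cvg_cst.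
    apply: cvg_sub0; apply: norm_cvg0.
    have h0 : `|L| * (e n * `|w|) @[n --> \oo] --> `|L| * (0 * `|w|).
      by apply: cvgM; [exact: cvg_cst|apply: cvgM => //; exact: cvg_cst].
    rewrite mul0r mulr0 in h0.
    apply: (squeeze_cvgr (f := fun=> 0) _ (cvg_cst 0) h0); apply: nearW => n.
    rewrite normr_ge0/=; apply: le_trans (pL _ _) _.
    rewrite addrAC subrr add0r normrN normrM (gtr0_norm (e0 n)) ler_wpM2r ?ler_norm//.
    by rewrite mulr_ge0// ltW.
  - move=> n w; have p : 0 <= 2 * (1 + w ^+ 2)^-1 by rewrite mulr_ge0// invr_ge0 addr_ge0// sqr_ge0.
    by rewrite normrM (ger0_norm p); apply: ler_wpM2r.
rewrite (funext key) in c1.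
rewrite -(cvg_lim _ c1)// (cvg_lim _ c2)// RiZ; last exact/intgZ/(cauchy_int (R := R)).1.
by rewrite RiZ ?(cauchy_int (R := R)).2 1?mulrC//; exact: (cauchy_int (R := R)).1.
Qed.

Lemma diff2_J phi h x : is_test_function (phi : R -> R^o) ->
  (\int[mu]_xi (c2 (h * xi) * J phi x xi) = 2 * pi * diff2 h phi x)%R.
Proof.
move=> tp; have [[ip _ _] _ _ _] := test_admiss tp.
rewrite -(inversion x (test_diff2 h tp)); apply: Ri_eq => xi.
by rewrite J_diff2// J_c2.
Qed.

(** Integrating the squared chord against the kernel q produces the symbol a; by Fubini the same holds under
    an integral over xi. *)
Lemma swap_q (q a : R -> R) (G : R -> R) (c : R) : measurable_fun setT q -> (forall h, 0 <= q h) ->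
  (forall xi, intg mu (fun h => c2 (h * xi) * q h) /\ (\int[mu]_h (c2 (h * xi) * q h) = c * a xi)%R) ->
  intg mu G -> intg mu (fun xi => a xi * G xi) ->
  intg mu (fun h => q h * (\int[mu]_xi (c2 (h * xi) * G xi))%R) /\
  (\int[mu]_h (q h * (\int[mu]_xi (c2 (h * xi) * G xi))%R) = c * \int[mu]_xi (a xi * G xi))%R.
Proof.
move=> mq q0 Hq iG iaG; have mG := intg_meas iG.
pose F (z : R * R) := q z.2 * (c2 (z.2 * z.1) * G z.1).
have mc : measurable_fun setT (fun z : R * R => c2 (z.2 * z.1)).
  by apply: (measurableT_comp (@meas_c2 R)); exact: measurable_funM.
have mF : measurable_fun setT F.
  apply: measurable_funM; first exact: (measurableT_comp mq measurable_snd).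
  by apply: measurable_funM => //; exact: (measurableT_comp mG measurable_fst).
have e1 xi : (fun h => F (xi, h)) = (fun h => G xi * (c2 (h * xi) * q h)).
  by apply/funext => h; rewrite /F/=; ring.
have iF : intg (mu \x mu)%E F.
  apply: (@intg_prod1 _ _ _ _ _ mu mu F (fun xi => `|c * (a xi * G xi)|)) => //.
  - by move=> xi; rewrite e1; apply: intgZ; exact: (Hq xi).1.
  - exact/intg_abs/intgZ.
  - move=> xi; have ca : 0 <= c * a xi by rewrite -(Hq xi).2; apply: Ri_ge0 => h; rewrite mulr_ge0 ?c2_ge0.
    under eq_Rintegral => h _.
      rewrite /F/= mulrA normrM (@ger0_norm _ (q h * _)); last by rewrite mulr_ge0 ?c2_ge0.
      rewrite mulrC (mulrC (q h)); over.
    rewrite RiZ; last exact: (Hq xi).1.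
    rewrite (Hq xi).2 [leRHS](_ : _ = `|G xi| * (c * a xi))//.
    by rewrite mulrA normrM (ger0_norm ca) mulrC.
have [i1 _] := Ri_fubini2 iF.
have eh h : (\int[mu]_xi F (xi, h) = q h * \int[mu]_xi (c2 (h * xi) * G xi))%R.
  rewrite /F/= RiZ//; apply: (intg_Mb _ iG (C := 4)).
    by apply: (measurableT_comp (@meas_c2 R)); exact: measurable_funM.
  by move=> xi; rewrite ger0_norm ?c2_ge0 ?c2_le4.
split; first by under eq_fun do rewrite -eh.
under eq_Rintegral do rewrite -eh.
rewrite -(Ri_swap iF) -RiZ//; apply: Ri_eq => xi.
under eq_Rintegral do rewrite (congr1 (fun f => f _) (e1 _)).
rewrite RiZ; last exact: (Hq xi).1.
by rewrite (Hq xi).2; ring.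
Qed.

(** Singular integrals with symbols proportional to |xi|^(1/2) and to |xi|. *)
Definition quarter_op phi (x : R) : R := (\int[mu]_h (q32 h * diff2 h phi x))%R.
Definition half_op phi (x : R) : R := (\int[mu]_h (q2 h * diff2 h phi x))%R.

Lemma sqrt_le1D (x : R) : `|Num.sqrt `|x| | <= 1 + x ^+ 2.
Proof.
rewrite ger0_norm ?sqrtr_ge0// -[x ^+ 2]real_normK ?num_real//.
have s0 := sqrtr_ge0 `|x|; rewrite -{2}(sqr_sqrtr (normr_ge0 x)).
set s := Num.sqrt _ in s0 *; have := sqr_ge0 (s ^+ 2 - s); have := sqr_ge0 (s - 1); have := sqr_ge0 s; nra.
Qed.

Lemma norm_le1D (x : R) : `| `|x| | <= 1 + x ^+ 2.
Proof. rewrite normr_id -[x ^+ 2]real_normK ?num_real//; have := normr_ge0 x; nra. Qed.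

Lemma intg_Jt phi x : is_test_function (phi : R -> R^o) -> intg mu (J phi x).
Proof.
move=> tp; have := @intg_wJ phi x (cst 1) tp; under eq_fun do rewrite mul1r; apply => // xi.
by rewrite normr1 lerDl sqr_ge0.
Qed.

Lemma intg_sJ phi x : is_test_function (phi : R -> R^o) -> intg mu (fun xi => Num.sqrt `|xi| * J phi x xi).
Proof.
move=> tp; apply: (intg_wJ x tp); last exact: sqrt_le1D.
exact: (measurableT_comp (@meas_sqrt R)).
Qed.

Lemma intg_nJ phi x : is_test_function (phi : R -> R^o) -> intg mu (fun xi => `|xi| * J phi x xi).
Proof. by move=> tp; apply: (intg_wJ x tp); [exact: normr_measurable|exact: norm_le1D]. Qed.

Lemma pi2_neq0 : (2 * pi : R) != 0.
Proof. by rewrite mulf_neq0 ?gt_eqF ?pi_gt0. Qed.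

Lemma quarter_opE phi x : is_test_function (phi : R -> R^o) ->
  intg mu (fun h => q32 h * diff2 h phi x) /\
  quarter_op phi x = (2 * pi)^-1 * (c_quarter * \int[mu]_xi (Num.sqrt `|xi| * J phi x xi))%R.
Proof.
move=> tp.
have [i1 <-] := swap_q (@meas_q32 R) (@q32_ge0 R) (@int_c2q32 R) (intg_Jt x tp) (intg_sJ x tp).
have e h : q32 h * diff2 h phi x = (2 * pi)^-1 * (q32 h * (\int[mu]_xi (c2 (h * xi) * J phi x xi))%R).
  by rewrite diff2_J// mulrCA (mulrA (2 * pi)^-1) mulVf ?pi2_neq0// mul1r.
rewrite /quarter_op; split; first by under eq_fun do rewrite e; exact: intgZ.
by under eq_Rintegral do rewrite e; rewrite RiZ.
Qed.

Lemma half_opE phi x : is_test_function (phi : R -> R^o) ->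
  intg mu (fun h => q2 h * diff2 h phi x) /\
  half_op phi x = (2 * pi)^-1 * (c_half * \int[mu]_xi (`|xi| * J phi x xi))%R.
Proof.
move=> tp.
have [i1 <-] := swap_q (@meas_q2 R) (@q2_ge0 R) (@int_c2q2 R) (intg_Jt x tp) (intg_nJ x tp).
have e h : q2 h * diff2 h phi x = (2 * pi)^-1 * (q2 h * (\int[mu]_xi (c2 (h * xi) * J phi x xi))%R).
  by rewrite diff2_J// mulrCA (mulrA (2 * pi)^-1) mulVf ?pi2_neq0// mul1r.
rewrite /half_op; split; first by under eq_fun do rewrite e; exact: intgZ.
by under eq_Rintegral do rewrite e; rewrite RiZ.
Qed.

(** |xi|^(1/2) |xi|^(1/2) = |xi|.  The outer operator is written with the second differences of phi
    inside, because the image of phi under the inner one is not a test function. *)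
Lemma quarter_op_quarter_op phi x : is_test_function (phi : R -> R^o) ->
  intg mu (fun k => q32 k * quarter_op (diff2 k phi) x) /\
  (\int[mu]_k (q32 k * quarter_op (diff2 k phi) x) = c_quarter ^+ 2 / c_half * half_op phi x)%R.
Proof.
move=> tp; have [[ip _ _] _ _ _] := test_admiss tp.
pose G xi := Num.sqrt `|xi| * J phi x xi.
have e2 xi : Num.sqrt `|xi| * G xi = `|xi| * J phi x xi.
  by rewrite /G mulrA -expr2 sqr_sqrtr.
have iG2 : intg mu (fun xi => Num.sqrt `|xi| * G xi).
  by under eq_fun do rewrite e2; exact: intg_nJ.
have [i1 e1] := swap_q (@meas_q32 R) (@q32_ge0 R) (@int_c2q32 R) (intg_sJ x tp) iG2.
have e k : q32 k * quarter_op (diff2 k phi) x = ((2 * pi)^-1 * c_quarter) * (q32 k * (\int[mu]_xi (c2 (k * xi) * G xi))%R).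
  rewrite (quarter_opE x (test_diff2 k tp)).2.
  under eq_Rintegral do rewrite J_diff2// J_c2//.
  rewrite (_ : (\int[mu]_xi (Num.sqrt `|xi| * (c2 (k * xi) * J phi x xi)))%R =
     (\int[mu]_xi (c2 (k * xi) * G xi))%R); first by ring.
  by apply: Ri_eq => xi; rewrite /G; ring.
split; first by under eq_fun do rewrite e; exact: intgZ.
under eq_Rintegral do rewrite e.
rewrite RiZ// e1 (half_opE x tp).2.
under eq_Rintegral do rewrite e2.
move: pi2_neq0; set P := 2 * pi => P0; have K0 : c_half != 0 :> R by rewrite gt_eqF ?c_half_gt0.
by field; rewrite ?P0 ?K0.
Qed.

(** Taking real parts inside the inverse transform leaves sqrt |xi| times the cosine transform. *)
Lemma quarter_laplacian_testE phi x : is_test_function (phi : R -> R^o) ->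
  quarter_laplacian_test phi x = c_quarter^-1 * quarter_op phi x.
Proof.
move=> tp; have [[ip _ _] _ _ _] := test_admiss tp.
rewrite (quarter_opE x tp).2 mulrCA mulKf ?gt_eqF ?c_quarter_gt0//.
rewrite /quarter_laplacian_test /fourier_multiplier /inverse_fourier /cintegral.
rewrite ReCM; congr (_ * _); apply: Ri_eq => xi.
rewrite -mulrA ReCM powR12_sqrt//; congr (_ * _).
rewrite ReM /fourier /cintegral /expi /=.
have icos : intg mu (fun y => phi y * cos (y * xi)).
  by have := intg_J 0 xi ip; congr (intg _ _); apply/funext => y; rewrite sub0r mulNr cosN.
have isin : intg mu (fun y => phi y * sin (y * xi)).
  apply: (@intg_le _ _ _ mu _ (fun y => `|phi y|)).
  - apply: measurable_funM; first exact: intg_meas ip.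
    apply: (@measurableT_comp _ _ _ _ _ _ (@sin R) _ (fun y : R => y * xi)); last exact: measurable_funM.
    by apply: continuous_measurable_fun => z; exact: continuous_sin.
  - exact: intg_abs.
  - by move=> y; rewrite normrM ler_piMr ?sin_max.
rewrite (_ : (\int[mu]_y _)%R = (\int[mu]_y (phi y * cos (y * xi)))%R); last first.
  by apply: Ri_eq => y; rewrite cosN mul0r subr0.
rewrite (_ : (\int[mu]_y (_ + _))%R = (\int[mu]_y (- (phi y * sin (y * xi))))%R); last first.
  by apply: Ri_eq => y; rewrite sinN mul0r addr0 mulrN.
rewrite RiN// mulNr opprK mulrC (mulrC _ (sin _)) -!RiZ// -RiD; [|exact: intgZ|exact: intgZ].
apply: Ri_eq => y; rewrite (_ : (x - y) * xi = x * xi - y * xi); last by ring.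
by rewrite cosB; ring.
Qed.

End Fourier.

(** * Measure preserving maps of the plane *)

Section Shear.
Context {R : realType}.
Notation mu := (@lebesgue_measure R).
Notation m2 := (mu \x mu)%E.

Lemma int_unit_affine (a h : R) (f : R -> \bar R) : `|a| = 1 -> measurable_fun setT f ->
  (\int[mu]_x f (a * x + h)%R = \int[mu]_x f x)%E.
Proof.
move=> a1; have a0 : a != 0 by rewrite -normr_eq0 a1 oner_neq0.
have P (g : R -> \bar R) : measurable_fun setT g -> (forall x, 0 <= g x)%E ->
    (\int[mu]_x g (a * x + h)%R = \int[mu]_x g x)%E.
  by move=> mg g0; have := @ge0_int_affine R a h g a0 mg g0; rewrite a1 invr1 mul1e.
move=> mf; rewrite [LHS]integralE [RHS]integralE; congr (_ - _)%E.
- rewrite -(P (f^\+)%E); first by apply: eq_integral => x _; rewrite !funeposE.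
    exact: measurable_funepos.
  by move=> x; rewrite funeposE le_max lexx orbT.
- rewrite -(P (f^\-)%E); first by apply: eq_integral => x _; rewrite !funenegE.
    exact: measurable_funeneg.
  by move=> x; rewrite funenegE le_max lexx orbT.
Qed.

Lemma int_shift (f : R -> \bar R) (h : R) : measurable_fun setT f ->
  (\int[mu]_x f (x + h)%R = \int[mu]_x f x)%E.
Proof.
move=> mf; rewrite -(int_unit_affine h (normr1 R) mf).
by apply: eq_integral => x _; rewrite mul1r.
Qed.

Lemma Ri_sublm (f : R -> R) (h : R) : measurable_fun setT f ->
  (\int[mu]_x f (h - x) = \int[mu]_x f x)%R.
Proof.
move=> mf; have mE : measurable_fun setT (EFin \o f) by exact/measurable_EFinP.
rewrite /Rintegral -(int_unit_affine h (normrN1 R) mE); congr fine.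
by apply: eq_integral => x _ /=; rewrite mulN1r addrC.
Qed.

Lemma meas_sec (f : R * R -> R) x : measurable_fun setT f -> measurable_fun setT (fun y => f (x, y)).
Proof. by move=> mf; apply: (measurableT_comp mf); exact: measurable_fun_pair. Qed.

Lemma ge0_int_iter (f : R * R -> R) : measurable_fun setT f -> (forall z, 0 <= f z) ->
  (\int[m2]_z (f z)%:E = \int[mu]_x \int[mu]_y (f (x, y))%:E)%E.
Proof.
move=> mf f0; rewrite (@fubini_tonelli1 _ _ _ _ _ mu mu (EFin \o f))//.
exact/measurable_EFinP.
Qed.

Lemma ge0_int_iter2 (f : R * R -> R) : measurable_fun setT f -> (forall z, 0 <= f z) ->
  (\int[m2]_z (f z)%:E = \int[mu]_y \int[mu]_x (f (x, y))%:E)%E.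
Proof.
move=> mf f0; rewrite (@fubini_tonelli2 _ _ _ _ _ mu mu (EFin \o f))//.
exact/measurable_EFinP.
Qed.

Lemma intg_pres (T : R * R -> R * R) : measurable_fun setT T ->
  (forall f : R * R -> R, measurable_fun setT f -> (forall z, 0 <= f z) ->
    (\int[m2]_z (f (T z))%:E = \int[m2]_z (f z)%:E)%E) ->
  forall f : R * R -> R, intg m2 f -> intg m2 (f \o T) /\ (\int[m2]_z f (T z) = \int[m2]_z f z)%R.
Proof.
move=> mT HT f iF; have mf := intg_meas iF.
have mfT : measurable_fun setT (f \o T) by exact: measurableT_comp.
have P g : intg m2 g -> (forall z, 0 <= g z) ->
    intg m2 (g \o T) /\ (\int[m2]_z g (T z) = \int[m2]_z g z)%R.
  move=> ig g0; have mg := intg_meas ig; have e := HT g mg g0.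
  split; last by rewrite /Rintegral; congr fine.
  apply: intg_ge0 => [|z|]; [exact: measurableT_comp|exact: g0|].
  by move: e => /= ->; exact: intg_lty.
have ia := intg_abs iF.
have [ia' ea] := P _ ia (fun z => normr_ge0 _).
have ib : intg m2 (fun z => `|f z| + f z) by exact: intgD.
have [ib' eb] := P _ ib (fun z => ltac:(by have := ler_norm (- f z); rewrite normrN; lra)).
have e z : f z = (`|f z| + f z) - `|f z| by rewrite addrAC subrr add0r.
have iT : intg m2 (f \o T).
  have := intgB ib' ia'; congr (intg _ _); apply/funext => z /=.
  by rewrite addrAC subrr add0r.
split => //.
rewrite (_ : (\int[m2]_z f (T z))%R = (\int[m2]_z ((`|f (T z)| + f (T z)) - `|f (T z)|))%R); last exact: Ri_eq.
rewrite (_ : (\int[m2]_z f z)%R = (\int[m2]_z ((`|f z| + f z) - `|f z|))%R); last exact: Ri_eq.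
by rewrite (RiB ib' ia') (RiB ib ia) ea eb.
Qed.

Lemma meas_shear : measurable_fun setT (fun z : R * R => (z.1, z.1 + z.2)).
Proof. by apply: measurable_fun_pair => //; exact: measurable_funD. Qed.

Lemma shear_pres (f : R * R -> R) : measurable_fun setT f -> (forall z, 0 <= f z) ->
    (\int[m2]_z (f (z.1, z.1 + z.2))%:E = \int[m2]_z (f z)%:E)%E.
Proof.
move=> mf f0; rewrite (ge0_int_iter mf f0) (ge0_int_iter (measurableT_comp mf meas_shear)); last by move=> z; exact: f0.
apply: eq_integral => x _ /=.
rewrite -(@int_shift (fun y => (f (x, y))%:E) x); last by apply/measurable_EFinP; exact: meas_sec.
by apply: eq_integral => y _; rewrite addrC.
Qed.

Lemma intg_shear (f : R * R -> R) : intg m2 f ->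
  intg m2 (fun z => f (z.1, z.1 + z.2)) /\ (\int[m2]_z f (z.1, z.1 + z.2) = \int[m2]_z f z)%R.
Proof. exact: (intg_pres meas_shear shear_pres). Qed.

Lemma meas_diag (s : R) : measurable_fun setT (fun z : R * R => (z.1 + s, z.2 + s)).
Proof. by apply: measurable_fun_pair; exact: measurable_funD. Qed.

Lemma diag_pres (s : R) (f : R * R -> R) : measurable_fun setT f -> (forall z, 0 <= f z) ->
    (\int[m2]_z (f (z.1 + s, z.2 + s))%:E = \int[m2]_z (f z)%:E)%E.
Proof.
move=> mf f0; rewrite (ge0_int_iter mf f0) (ge0_int_iter (measurableT_comp mf (meas_diag s))); last by move=> z; exact: f0.
rewrite -(@int_shift (fun x => \int[mu]_y (f (x, y))%:E)%E s).
  apply: eq_integral => x _ /=.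
  by rewrite (@int_shift (fun y => (f (x + s, y))%:E) s)//; apply/measurable_EFinP; exact: meas_sec.
apply: (@measurable_fun_fubini_tonelli_F _ _ _ _ _ mu (EFin \o f)); first exact/measurable_EFinP.
by move=> z; rewrite lee_fin.
Qed.

Lemma intg_diag (s : R) (f : R * R -> R) : intg m2 f ->
  intg m2 (fun z => f (z.1 + s, z.2 + s)) /\ (\int[m2]_z f (z.1 + s, z.2 + s) = \int[m2]_z f z)%R.
Proof. exact: (intg_pres (meas_diag s) (@diag_pres s)). Qed.

Lemma swap_pres (f : R * R -> R) : measurable_fun setT f -> (forall z, 0 <= f z) ->
    (\int[m2]_z (f (z.2, z.1))%:E = \int[m2]_z (f z)%:E)%E.
Proof.
move=> mf f0; rewrite ge0_int_iter//.
  by rewrite ge0_int_iter2.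
by apply: (measurableT_comp mf); exact: measurable_fun_pair.
Qed.

Lemma intg_swap (f : R * R -> R) : intg m2 f ->
  intg m2 (fun z => f (z.2, z.1)) /\ (\int[m2]_z f (z.2, z.1) = \int[m2]_z f z)%R.
Proof.
apply: (intg_pres _ swap_pres); exact: measurable_fun_pair.
Qed.

End Shear.

(** * The Gagliardo form *)

Section Weighted.
Context {R : realType}.
Notation mu := (@lebesgue_measure R).
Notation m2 := (mu \x mu)%E.

(** The kernel q is integrable only against [wt]; the missing factor is gained by integrating in x first. *)
Lemma intg_w (q g : R -> R) (K : R * R -> R) (C : R) :
  measurable_fun setT q -> (forall h, 0 <= q h) -> intg mu (fun h => wt h * q h) ->
  measurable_fun setT g -> measurable_fun setT K ->
  (forall h, intg mu (fun x => g x * K (x, h))) ->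
  (forall h, (\int[mu]_x `|g x * K (x, h)| <= C * wt h)%R) ->
  intg m2 (fun z => q z.2 * (g z.1 * K z)).
Proof.
move=> mq q0 iq mg mK i1 b1.
apply: (@intg_prod2 _ _ _ _ _ mu mu _ (fun h => C * (wt h * q h))).
- apply: measurable_funM; first exact: (measurableT_comp mq measurable_snd).
  by apply: measurable_funM => //; exact: (measurableT_comp mg measurable_fst).
- by move=> h /=; exact: intgZ.
- exact: intgZ.
- move=> h /=; under eq_Rintegral do rewrite normrM (ger0_norm (q0 _)).
  rewrite RiZ; last exact/intg_abs.
  by rewrite mulrA mulrC; apply: ler_wpM2r.
Qed.

Lemma swap_w (q g : R -> R) (K : R * R -> R) (C : R) :
  measurable_fun setT q -> (forall h, 0 <= q h) -> intg mu (fun h => wt h * q h) ->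
  measurable_fun setT g -> measurable_fun setT K ->
  (forall x, intg mu (fun h => q h * K (x, h))) ->
  (forall h, intg mu (fun x => g x * K (x, h))) ->
  (forall h, (\int[mu]_x `|g x * K (x, h)| <= C * wt h)%R) ->
  intg mu (fun x => g x * (\int[mu]_h (q h * K (x, h)))%R) /\
  (\int[mu]_x (g x * (\int[mu]_h (q h * K (x, h)))%R) =
   \int[mu]_h (q h * (\int[mu]_x (g x * K (x, h)))%R))%R.
Proof.
move=> mq q0 iq mg mK i0 i1 b1.
have iF := intg_w mq q0 iq mg mK i1 b1.
have [j1 _] := Ri_fubini1 iF.
have e x : (\int[mu]_y (q (x, y).2 * (g (x, y).1 * K (x, y))))%R = g x * (\int[mu]_h (q h * K (x, h)))%R.
  rewrite /= -RiZ//; apply: Ri_eq => y; ring.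
split; first by have := j1; under eq_fun do rewrite e.
rewrite -(@Ri_eq _ _ _ mu _ _ e) (Ri_swap iF); apply: Ri_eq => h /=.
by rewrite RiZ.
Qed.

Lemma intg_wL1 (q : R -> R) (K : R * R -> R) (C : R) :
  measurable_fun setT q -> (forall h, 0 <= q h) -> intg mu (fun h => wt h * q h) ->
  measurable_fun setT K -> (forall h, intg mu (fun x => K (x, h))) ->
  (forall h, (\int[mu]_x `|K (x, h)| <= C * wt h)%R) ->
  intg mu (fun x => \int[mu]_h (q h * K (x, h)))%R /\
  (\int[mu]_x `|\int[mu]_h (q h * K (x, h))| <= C * \int[mu]_h (wt h * q h))%R.
Proof.
move=> mq q0 iq mK i1 b1.
have m1 : measurable_fun setT (fun _ : R => 1 : R) by [].
have iF : intg m2 (fun z => q z.2 * (1 * K z)).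
  apply: (@intg_w q (fun=> 1) K C) => //.
  - by move=> h; under eq_fun do rewrite mul1r.
  - by move=> h; under eq_Rintegral do rewrite mul1r.
have [j1 _] := Ri_fubini1 iF.
have e x : (\int[mu]_y (q (x, y).2 * (1 * K (x, y))))%R = (\int[mu]_h (q h * K (x, h)))%R.
  by apply: Ri_eq => y; rewrite mul1r.
have j2 : intg mu (fun x => \int[mu]_h (q h * K (x, h)))%R.
  by have := j1; under eq_fun do rewrite e.
split => //.
have iA := intg_abs iF; have [j3 e3] := Ri_fubini1 iA.
apply: (@le_trans _ _ (\int[mu]_x \int[mu]_y `|q (x, y).2 * (1 * K (x, y))|)%R).
  apply: Ri_ae_le => //; first exact: intg_abs.
  have := ae_integrable1 iF; apply: filterS => x ix.
  by rewrite -(e x); apply: Ri_abs.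
rewrite -e3 (Ri_fubini2 iA).2 -RiZ//.
apply: Ri_le; [exact: (Ri_fubini2 iA).1|exact: intgZ|] => h /=.
under eq_Rintegral do rewrite mul1r normrM (ger0_norm (q0 _)).
rewrite RiZ; last exact/intg_abs.
by rewrite mulrA mulrC; apply: ler_wpM2r.
Qed.

End Weighted.

Section Pairing.
Context {R : realType}.
Notation mu := (@lebesgue_measure R).
Notation m2 := (mu \x mu)%E.
Implicit Types u f phi : R -> R.

(** Up to a constant, the seminorm of order 1/2 is the L^2 norm of this difference quotient on the plane.  It is
    0 on the diagonal. *)
Definition D u (z : R * R) : R := (u z.1 - u z.2) / (z.1 - z.2).

Lemma meas_D u : measurable_fun setT u -> measurable_fun setT (D u).
Proof.
move=> mu'; apply: measurable_funM.
  apply: measurable_funB; [exact: (measurableT_comp mu' measurable_fst)|].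
  exact: (measurableT_comp mu' measurable_snd).
by apply: meas_funV; exact: measurable_funB.
Qed.

Lemma meas_diff2_kernel phi : measurable_fun setT phi -> measurable_fun setT (fun z : R * R => diff2 z.2 phi z.1).
Proof.
move=> mp; apply: measurable_funB.
  apply: measurable_funB.
    by apply: measurable_funM => //; exact: (measurableT_comp mp measurable_fst).
  by apply: (measurableT_comp mp); exact: measurable_funD.
by apply: (measurableT_comp mp); exact: measurable_funB.
Qed.

(** The shear (x, y) -> (x, x + h) followed by translations in x turns a product of first differences into
    a second difference of one factor. *)
Lemma pairD u phi (B : R) : measurable_fun setT u -> (forall x, `|u x| <= B) -> intg mu phi ->
  intg m2 (fun z => D u z * D phi z) ->
  (\int[m2]_z (D u z * D phi z) = \int[mu]_h (q2 h * (\int[mu]_x (u x * diff2 h phi x))%R))%R.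
Proof.
move=> mu' uB ip iD; have [iS <-] := intg_shear iD.
rewrite (Ri_fubini2 iS).2; apply: Ri_eq => h /=.
have mp := intg_meas ip.
have i1 k : intg mu (fun x => u x * phi (x + k)).
  apply: (@intg_Mb _ _ _ mu u (fun x => phi (x + k)) B) => //; exact: intg_shift.
have i1s k k' : intg mu (fun x => u (x + k) * phi (x + k')).
  have := intg_shift k (i1 (k' - k)); congr (intg _ _); apply/funext => x.
  by congr (_ * phi _); ring.
have mus : measurable_fun setT (fun x : R => u (x + h)) by exact: meas_shift.
have i2 : intg mu (fun x => u (x + h) * phi (x + 0)) by exact: i1s.
have e : (\int[mu]_x ((u (x + h) - u x) * (phi (x + h) - phi x)) = \int[mu]_x (u x * diff2 h phi x))%R.
  have f1 := Ri_shift h (i1 0); have f2 := Ri_shift h (i1 (- h)).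
  transitivity (\int[mu]_x (u (x + h) * phi (x + h + 0)) - \int[mu]_x (u (x + h) * phi (x + h - h))
     - \int[mu]_x (u x * phi (x + h)) + \int[mu]_x (u x * phi (x + 0)))%R.
    have a1 := intg_shift h (i1 0); have a2 := intg_shift h (i1 (- h)).
    rewrite -RiB//.
    rewrite -RiB//; last exact: intgB.
    rewrite -RiD//; last by apply: intgB => //; exact: intgB.
    by apply: Ri_eq => x; rewrite addr0 addrK addr0; ring.
  rewrite f1 f2 -RiB//.
  rewrite -RiB//; last exact: intgB.
  rewrite -RiD//; last by apply: intgB => //; exact: intgB.
  by apply: Ri_eq => x; rewrite /diff2 addr0; ring.
rewrite -e -RiZ.
  apply: Ri_eq => x; rewrite /D/= /q2 opprD addrA subrr add0r.
  have [->|h0] := eqVneq h 0; first by rewrite addr0 subrr; ring.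
  by field.
under eq_fun do rewrite mulrBr !mulrBl.
have a1 := i1s h h; have a2 := i1s h 0; have a3 := i1s 0 h; have a4 := i1s 0 0.
have := intgB (intgB a1 a3) (intgB a2 a4); congr (intg _ _); apply/funext => x; rewrite !addr0; ring.
Qed.

Lemma pairA u phi (B : R) : measurable_fun setT u -> (forall x, `|u x| <= B) -> admiss phi ->
  (forall x, intg mu (fun h => q2 h * diff2 h phi x)) ->
  intg m2 (fun z => D u z * D phi z) ->
  (\int[m2]_z (D u z * D phi z) = \int[mu]_x (u x * half_op phi x))%R.
Proof.
move=> mu' uB [ip _ [C C0 HC]] iq iD; rewrite (pairD mu' uB ip iD).
have B0 : 0 <= B by apply: le_trans (uB 0).
have i1 h : intg mu (fun x => u x * diff2 h phi x) by apply: (@intg_Mb _ _ _ mu u (diff2 h phi) B) => //; exact: intg_diff2.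
have := @swap_w _ q2 u (fun z => diff2 z.2 phi z.1) (B * C) (@meas_q2 R) (@q2_ge0 R) (@intg_wq2 R) mu'.
move=> /(_ (meas_diff2_kernel (intg_meas ip)) iq i1) H; refine (esym (proj2 (H _))) => h /=.
apply: (@le_trans _ _ (\int[mu]_x (B * `|diff2 h phi x|))%R).
  apply: Ri_le; [exact/intg_abs|exact/intgZ/intg_abs/intg_diff2|] => x.
  by rewrite normrM ler_wpM2r.
rewrite RiZ; last exact/intg_abs/intg_diff2.
by rewrite -mulrA ler_wpM2l.
Qed.

Lemma meas_quarter_op_diff2 phi : measurable_fun setT phi ->
  measurable_fun setT (fun z : R * R => quarter_op (diff2 z.2 phi) z.1).
Proof.
move=> mp.
apply: (@meas_Ri _ _ _ _ _ mu (fun w : (R * R) * R => q32 w.2 * diff2 w.2 (diff2 w.1.2 phi) w.1.1)).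
have m11 : measurable_fun setT (fun w : (R * R) * R => w.1.1) by exact: (measurableT_comp measurable_fst measurable_fst).
have m12 : measurable_fun setT (fun w : (R * R) * R => w.1.2) by exact: (measurableT_comp measurable_snd measurable_fst).
have mK (a : (R * R) * R -> R) : measurable_fun setT a ->
    measurable_fun setT (fun w : (R * R) * R => diff2 w.1.2 phi (a w)).
  move=> ma; have := measurableT_comp (meas_diff2_kernel mp) (measurable_fun_pair ma m12); exact.
apply: measurable_funM; first exact: (measurableT_comp (@meas_q32 R) measurable_snd).
apply: measurable_funB; last by apply: mK; exact: measurable_funB.
apply: measurable_funB; last by apply: mK; exact: measurable_funD.
by apply: measurable_funM => //; exact: mK.
Qed.

Lemma quarter_op_L1 phi (C : R) : is_test_function (phi : R -> R^o) ->
  (forall h, (\int[mu]_x `|diff2 h phi x| <= C * wt h)%R) ->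
  intg mu (quarter_op phi) /\ (\int[mu]_x `|quarter_op phi x| <= C * \int[mu]_h (wt h * q32 h))%R.
Proof.
move=> tp HC; have [[ip _ _] _ _ _] := test_admiss tp.
apply: (@intg_wL1 _ q32 (fun z => diff2 z.2 phi z.1) C) => //.
- exact: meas_q32.
- exact: q32_ge0.
- exact: intg_wq32.
- exact: meas_diff2_kernel (intg_meas ip).
- by move=> h /=; exact: intg_diff2.
Qed.

(** The quarter Laplacian moved twice to the test function.  It maps test functions to functions that are not
    compactly supported, so the definition of f is applied to the second differences of phi, and the resulting
    identities are integrated against the kernel of order 1/2. *)
Lemma lap_pair u f phi (B : R) : measurable_fun setT u -> (forall x, `|u x| <= B) ->
  sqi mu f -> is_quarter_laplacian u f -> is_test_function (phi : R -> R^o) ->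
  (\int[mu]_x (f x * quarter_laplacian_test phi x) = c_half^-1 * \int[mu]_x (u x * half_op phi x))%R.
Proof.
move=> mu' uB [mf f2] ul tp.
have [[ip _ [C1 C10 HC1]] [C2 C20 HC2] _ [C3 C30 HC3]] := test_admiss tp.
have mp := intg_meas ip.
have B0 : 0 <= B by apply: le_trans (uB 0).
have ifD h : intg mu (fun x => f x * diff2 h phi x).
  by have [_] := ul _ (test_diff2 h tp).
set I2 := (\int[mu]_x (f x ^+ 2))%R.
have I20 : 0 <= I2 by apply: Ri_ge0 => x; exact: sqr_ge0.
have bf h : (\int[mu]_x `|f x * diff2 h phi x| <= (C1 + C2 * I2) * wt h)%R.
  have ia := intg_abs (intg_diff2 h ip).
  have w0 := wt_ge0 h.
  apply: (@le_trans _ _ (\int[mu]_x (`|diff2 h phi x| + (C2 * wt h) * f x ^+ 2))%R).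
    apply: Ri_le; [exact/intg_abs|by apply: intgD => //; exact: intgZ|] => x.
    rewrite normrM; have := HC2 h x; have := sqr_ge0 (`|f x| - 1).
    rewrite -[f x ^+ 2]real_normK ?num_real//; have := normr_ge0 (f x); have := normr_ge0 (diff2 h phi x).
    set a := `|f x|; set b := `|diff2 h phi x|; set c := C2 * wt h => b0 a0 s bc.
    have : b * a ^+ 2 <= c * a ^+ 2 by apply: ler_wpM2r => //; exact: sqr_ge0.
    nra.
  rewrite RiD//; last exact: intgZ.
  rewrite RiZ// mulrDl; apply: lerD => //.
  by rewrite -/I2 -mulrA (mulrC (wt h)) mulrA.
have [_ e1] := @swap_w _ q32 f (fun z => diff2 z.2 phi z.1) _ (@meas_q32 R) (@q32_ge0 R) (@intg_wq32 R)
   mf (meas_diff2_kernel mp) (fun x => (quarter_opE x tp).1) ifD bf.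
have iuL h : intg mu (fun x => u x * quarter_op (diff2 h phi) x).
  apply: (@intg_Mb _ _ _ mu u (quarter_op (diff2 h phi)) B) => //.
  by apply: (@quarter_op_L1 _ (C3 * wt h) (test_diff2 h tp) _).1 => k; rewrite mulrAC -mulrA; exact: HC3.
have buL h : (\int[mu]_x `|u x * quarter_op (diff2 h phi) x| <= (B * C3 * (\int[mu]_k (wt k * q32 k))%R) * wt h)%R.
  have HH k : (\int[mu]_x `|diff2 k (diff2 h phi) x| <= (C3 * wt h) * wt k)%R.
    by rewrite mulrAC -mulrA; exact: HC3.
  have [j1 j2] := quarter_op_L1 (test_diff2 h tp) HH.
  apply: (@le_trans _ _ (\int[mu]_x (B * `|quarter_op (diff2 h phi) x|))%R).
    apply: Ri_le; [exact/intg_abs|exact/intgZ/intg_abs|] => x.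
    by rewrite normrM ler_wpM2r.
  rewrite RiZ; last exact: intg_abs.
  rewrite -!mulrA ler_wpM2l//; apply: le_trans j2 _.
  by rewrite le_eqVlt; apply/orP; left; apply/eqP; ring.
have [_ e2] := @swap_w _ q32 u (fun z => quarter_op (diff2 z.2 phi) z.1) _ (@meas_q32 R) (@q32_ge0 R) (@intg_wq32 R)
   mu' (meas_quarter_op_diff2 mp) (fun x => (quarter_op_quarter_op x tp).1) iuL buL.
have cn : c_quarter != 0 :> R by rewrite gt_eqF ?c_quarter_gt0.
have kn : c_half != 0 :> R by rewrite gt_eqF ?c_half_gt0.
have e3 h : (\int[mu]_x (f x * diff2 h phi x) = c_quarter^-1 * \int[mu]_x (u x * quarter_op (diff2 h phi) x))%R.
  have [_ _ <-] := ul _ (test_diff2 h tp).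
  rewrite -(RiZ _ (iuL h)); apply: Ri_eq => x; rewrite (quarter_laplacian_testE x (test_diff2 h tp)).
  by ring.
have iu2 : intg mu (fun x => u x * (\int[mu]_h (q32 h * quarter_op (diff2 h phi) x))%R).
  by have [] := @swap_w _ q32 u (fun z => quarter_op (diff2 z.2 phi) z.1) _ (@meas_q32 R) (@q32_ge0 R) (@intg_wq32 R)
   mu' (meas_quarter_op_diff2 mp) (fun x => (quarter_op_quarter_op x tp).1) iuL buL.
transitivity (c_quarter^-1 * (\int[mu]_x (f x * quarter_op phi x))%R).
  rewrite -RiZ.
    by apply: Ri_eq => x; rewrite (quarter_laplacian_testE x tp); ring.
  by have [] := @swap_w _ q32 f (fun z => diff2 z.2 phi z.1) _ (@meas_q32 R) (@q32_ge0 R) (@intg_wq32 R)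
   mf (meas_diff2_kernel mp) (fun x => (quarter_opE x tp).1) ifD bf.
rewrite e1 /=; under eq_Rintegral do rewrite e3 mulrCA.
have iu3 : intg mu (fun h => q32 h * (\int[mu]_x (u x * quarter_op (diff2 h phi) x))%R).
  have iF := intg_w (@meas_q32 R) (@q32_ge0 R) (@intg_wq32 R) mu' (meas_quarter_op_diff2 mp) iuL buL.
  have := (Ri_fubini2 iF).1; congr (intg _ _); apply/funext => h /=.
  by rewrite RiZ.
move: e2 => /= e2; rewrite (RiZ _ iu3) -e2.
have e4 x : u x * (\int[mu]_h (q32 h * quarter_op (diff2 h phi) x))%R = (c_quarter ^+ 2 / c_half) * (u x * half_op phi x).
  by rewrite (quarter_op_quarter_op x tp).2; ring.
rewrite (@Ri_eq _ _ _ mu _ _ e4) RiZ; first by field; rewrite cn kn.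
have ek x : u x * half_op phi x = (c_quarter ^+ 2 / c_half)^-1 * (u x * (\int[mu]_h (q32 h * quarter_op (diff2 h phi) x))%R).
  by rewrite e4; field; rewrite cn kn.
by have := intgZ (c_quarter ^+ 2 / c_half)^-1 iu2; congr (intg _ _); apply/funext => x; rewrite -ek.
Qed.

End Pairing.

(** * Bump functions and mollification *)

Section Bump.
Context {R : realType}.
Notation mu := (@lebesgue_measure R).
Implicit Types (f : R -> R) (q : {poly R}).

(** Used at the end points of the support of the bump, where all derivatives vanish quadratically. *)
Lemma is_derive_quad f (x l C : R) :
  (forall y, `|f y - f x - l * (y - x)| <= C * (y - x) ^+ 2) -> is_derive x (1:R) f l.
Proof.
move=> H.
have C0 : 0 <= C.
  by have := H (x + 1); rewrite [x + 1]addrC addrK expr1n !mulr1; apply: le_trans.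
have c : (fun h : R => h^-1 *: ((f \o shift x) (h *: (1:R)) - f x)) @ 0^' --> l.
  apply/cvgrPdist_lt => e e0; near=> h.
  have h0 : h != 0 by near: h; exact: nbhs_dnbhs_neq.
  have hs : `|h| < e / (C + 1).
    near: h; apply: dnbhs0_lt; rewrite divr_gt0// ltr_wpDl//.
  rewrite !scalerRE mulr1 /= (_ : l - _ = - (h^-1 * (f (h + x) - f x - l * (h + x - x)))); last by field.
  rewrite normrN normrM normfV ltr_pdivrMl ?normr_gt0//.
  apply: le_lt_trans (H _) _; rewrite addrK -[h ^+ 2]real_normK ?num_real// expr2 mulrCA.
  rewrite ltr_pM2l ?normr_gt0//.
  move: hs; rewrite ltr_pdivlMr ?ltr_wpDl//; apply: le_lt_trans.
  by rewrite mulrC ler_wpM2l// lerDl.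
by apply: DeriveDef; [apply/cvg_ex; exists l|exact: cvg_lim].
Unshelve. all: by end_near. Qed.

Lemma taylor2 (f f1 f2 : R -> R) (M : R) : (forall x : R, is_derive x (1:R) f (f1 x)) ->
  (forall x : R, is_derive x (1:R) f1 (f2 x)) -> (forall x, `|f2 x| <= M) ->
  forall x y, `|f y - f x - f1 x * (y - x)| <= M * (y - x) ^+ 2.
Proof.
move=> d1 d2 fM x y.
have dg (s : R) : is_derive s (1:R) (fun s => f s - f1 x * s) (f1 s - f1 x).
  have dz : is_derive s (1:R) (fun s => f1 x * s) (f1 x).
    by have := is_deriveZ (f1 x) (@is_derive_id R R s 1); rewrite scalerRE mulr1.
  exact: is_deriveB.
have K (a b c : R) : a <= c <= b -> (x = a \/ x = b) -> `|f1 c - f1 x| <= M * (b - a).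
  move=> /andP[ac cb] xab; apply: le_trans (lip_bound d2 fM c x) _.
  have M0 : 0 <= M by apply: le_trans (fM 0).
  apply: ler_wpM2l => //; rewrite ler_norml; case: xab => ->; apply/andP; split; lra.
have cg (a b : R) : {within `[a, b], continuous (fun s => f s - f1 x * s)}.
  by apply: derivable_within_continuous => s _; have [] := dg s.
rewrite (_ : _ - _ = (f y - f1 x * y) - (f x - f1 x * x)); last by ring.
have [xy|/ltW yx] := leP x y.
  have [c] := MVT_segment xy (fun s _ => dg s) (cg _ _).
  rewrite in_itv/= => cxy ->; rewrite normrM expr2 mulrA.
  have xy0 : 0 <= y - x by lra.
  by rewrite (ger0_norm xy0); apply: ler_wpM2r => //; apply: K cxy _; left.
have [c] := MVT_segment yx (fun s _ => dg s) (cg _ _).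
rewrite in_itv/= distrC => cxy ->; rewrite normrM.
have xy0 : 0 <= x - y by lra.
rewrite (_ : (y - x) ^+ 2 = (x - y) * (x - y)); last by ring.
by rewrite mulrA (ger0_norm xy0); apply: ler_wpM2r => //; apply: K cxy _; right.
Qed.

(** The shape of all derivatives of exp (-1 / (1 - x^2)): a polynomial, a power of 1 / (1 - x^2) and the
    exponential, extended by 0. *)
Definition bump_deriv q (k : nat) (x : R) : R :=
  if `|x| < 1 then q.[x] * (1 - x ^+ 2)^-1 ^+ k * expR (- (1 - x ^+ 2)^-1) else 0.

Lemma sub1_gt0 (x : R) : `|x| < 1 -> 0 < 1 - x ^+ 2.
Proof. by move=> x1; rewrite subr_gt0 -real_normK ?num_real// expr_lt1. Qed.

Lemma bump_deriv_quad q k : exists2 C : R, 0 <= C & forall x, `|x| < 1 -> `|bump_deriv q k x| <= C * (1 - x ^+ 2) ^+ 2.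
Proof.
have [M HM] := poly_itv_bound q (-1) 1.
have M0 : 0 <= M by apply: le_trans (HM 0 _); rewrite // lerN10 ler01.
exists (M * (k.+2)`!%:R); first by rewrite mulr_ge0.
move=> x x1; rewrite /bump_deriv x1; have s0 := sub1_gt0 x1; move: (1 - x ^+ 2) s0 => s s0.
rewrite 2!normrM (@ger0_norm _ (expR _)) ?expR_ge0// (@ger0_norm _ (s^-1 ^+ k)) ?exprn_ge0 ?invr_ge0 ?(ltW s0)//.
rewrite -!mulrA; apply: ler_pM => //.
- by rewrite mulr_ge0 ?exprn_ge0 ?invr_ge0 ?(ltW s0) ?expR_ge0.
- by apply: HM; rewrite -ler_norml (ltW x1).
have y0 : 0 <= s^-1 by rewrite invr_ge0 ltW.
have := expR_ge1Dxn k.+1 y0; set E := expR (s^-1) => HE.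
have f0 : 0 < (k.+2)`!%:R :> R by rewrite ltr0n fact_gt0.
have E0 : 0 < E by exact: expR_gt0.
have : s^-1 ^+ k.+2 <= E * (k.+2)`!%:R.
  by rewrite -ler_pdivrMr//; apply: le_trans HE; rewrite lerDr.
rewrite expRN -/E ler_pdivrMr// => H.
rewrite (_ : s^-1 ^+ k = s^-1 ^+ k.+2 * s ^+ 2); last by rewrite !exprS; field; rewrite gt_eqF.
rewrite (_ : (k.+2)`!%:R * s ^+ 2 * E = (E * (k.+2)`!%:R) * s ^+ 2); last by ring.
by apply: ler_wpM2r => //; exact: sqr_ge0.
Qed.

Definition bump_deriv_next q (k : nat) : {poly R} :=
  q^`() * (1 - 'X ^+ 2) ^+ 2 + 'X * q * (1 - 'X ^+ 2) *+ (2 * k) - 'X * q *+ 2.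

Lemma bump_deriv_nextE q k (x : R) : (bump_deriv_next q k).[x] =
  q^`().[x] * (1 - x ^+ 2) ^+ 2 + x * q.[x] * (1 - x ^+ 2) * (2 * k)%:R - 2 * x * q.[x].
Proof.
have h1 : (1 - 'X ^+ 2 : {poly R}).[x] = 1 - x ^+ 2 by rewrite !hornerE.
rewrite /bump_deriv_next !(hornerD (_ + _), hornerD (_ * _), hornerN, hornerMn, hornerM, horner_exp (1 - _), hornerX) h1.
by rewrite -(mulr_natr _ (2 * k)) mulr2n; ring.
Qed.

Lemma is_derive_bump_deriv q k (x : R) : is_derive x (1:R) (bump_deriv q k) (bump_deriv (bump_deriv_next q k) k.+2 x).
Proof.
have [x1|x1] := ltP `|x| 1; last first.
  have [C C0 HC] := bump_deriv_quad q k.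
  have z0 p j : bump_deriv p j x = 0 by rewrite /bump_deriv ltNge x1.
  rewrite z0; apply: (@is_derive_quad _ _ _ (C * 4)) => y.
  rewrite z0 mul0r !subr0; have [y1|y1] := ltP `|y| 1; last first.
    by rewrite /bump_deriv ltNge y1 normr0 mulr_ge0 ?sqr_ge0// mulr_ge0.
  apply: le_trans (HC y y1) _; rewrite -mulrA; apply: ler_wpM2l => //.
  have s0 := sub1_gt0 y1.
  rewrite (_ : 4 * _ = (2 * `|y - x|) ^+ 2); last by rewrite exprMn real_normK ?num_real//; ring.
  apply: lerXn2r; rewrite ?nnegrE ?mulr_ge0 ?(ltW s0)//.
  have := ler_distD 0 y x => _; have := lerB_dist x y; rewrite distrC => h1.
  apply: (@le_trans _ _ (2 * (1 - `|y|))); last by lra.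
  rewrite -[y ^+ 2]real_normK ?num_real//; have := normr_ge0 y; nra.
have s0 := sub1_gt0 x1; have sn : 1 - x ^+ 2 != 0 by rewrite gt_eqF.
pose s := fun y : R => 1 - y ^+ 2.
have ds : is_derive x (1:R) s (- (2 * x)).
  have := is_deriveB (is_derive_cst (1:R) x 1) (is_deriveX 2 (@is_derive_id R R x 1)).
  by move=> H; apply: is_derive_eq H _; rewrite !scalerRE; ring.
have dsV : is_derive x (1:R) (fun y => (s y)^-1) ((s x)^-1 ^+ 2 * (2 * x)).
  have sn' : s x != 0 by [].
  by have H := is_deriveV sn' ds; apply: is_derive_eq H _; rewrite scalerRE mulrNN exprVn.
have de : is_derive x (1:R) (fun y => expR (- (s y)^-1)) (expR (- (s x)^-1) * (- ((s x)^-1 ^+ 2 * (2 * x)))).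
  have dn : is_derive x (1:R) (fun y => - (s y)^-1) (- ((s x)^-1 ^+ 2 * (2 * x))) by exact: is_deriveN.
  exact: (@is_derive1_comp R expR _ x _ _ (is_derive_expR _) dn).
have dk : is_derive x (1:R) (fun y => (s y)^-1 ^+ k) ((k%:R * (s x)^-1 ^+ k.-1) * ((s x)^-1 ^+ 2 * (2 * x))).
  have := is_deriveX k dsV; rewrite scalerRE.
  by rewrite (_ : _ ^+ k = (fun y => (s y)^-1 ^+ k) :> (R -> R)); last by apply/funext => y; rewrite fctE.
have d1 : is_derive x (1:R) (fun y => q.[y] * (s y)^-1 ^+ k) (q.[x] * ((k%:R * (s x)^-1 ^+ k.-1) * ((s x)^-1 ^+ 2 * (2 * x))) + (s x)^-1 ^+ k * q^`().[x]).
  exact: is_deriveM.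
have d2 := is_deriveM d1 de.
have H := @near_eq_is_derive R R R _ (bump_deriv q k) x 1 _ _ d2; apply: is_derive_eq (H _) _.
  near=> y; have y1 : `|y| < 1 by near: y; have := @norm_continuous _ R x; move/cvgr_lt; apply; exact: x1.
  by rewrite /bump_deriv y1.
rewrite /bump_deriv x1 bump_deriv_nextE !scalerRE -/(s x).
set E := expR _; rewrite -/(s x) in sn; case: k {d1 d2 dk H} => [|k] /=.
  by rewrite !expr0 muln0; field.
have e3 (a : R) : a ^+ k.+3 = a ^+ k * a ^+ 3 by rewrite -exprD addn3.
by rewrite e3 (exprS _ k) natrM; set y := (s x)^-1 ^+ k; field.
Unshelve. all: by end_near. Qed.

Fixpoint bump_seq (n : nat) : {poly R} * nat :=
  if n is m.+1 then (bump_deriv_next (bump_seq m).1 (bump_seq m).2, (bump_seq m).2.+2) else (1, 0%N).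

Definition bump n (x : R) : R := bump_deriv (bump_seq n).1 (bump_seq n).2 x.

Lemma bump_smooth : smooth_seq bump.
Proof. by move=> n x; exact: is_derive_bump_deriv. Qed.

Lemma bump_supp n x : 1 <= `|x| -> bump n x = 0.
Proof. by move=> x1; rewrite /bump /bump_deriv ltNge x1. Qed.

Lemma bumpE x : bump 0 x = if `|x| < 1 then expR (- (1 - x ^+ 2)^-1) else 0.
Proof. by rewrite /bump /bump_deriv /= hornerC expr0 !mul1r. Qed.

Lemma bump_even x : bump 0 (- x) = bump 0 x.
Proof. by rewrite !bumpE normrN sqrrN. Qed.

Lemma bump_ge0 x : 0 <= bump 0 x.
Proof. by rewrite bumpE; case: ifP => // _; exact: expR_ge0. Qed.

Lemma bump_intg n : intg mu (bump n).
Proof.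
have S x : 1 < `|x| -> bump n x = 0 by move=> x1; apply: bump_supp; exact: ltW.
have [B B0 HB] := smooth_bound bump_smooth S.
by have [] := supp_int (smooth_meas n bump_smooth) ler01 B0 HB S.
Qed.

Lemma bump_int_gt0 : 0 < (\int[mu]_x bump 0 x)%R.
Proof.
pose e := expR (- (4^-1 : R)^-1).
have ii : intg mu (\1_(`[0, 2^-1]%classic) : R -> R) by exact: integrable_indic_itv.
apply: (@lt_le_trans _ _ (\int[mu]_x (e * \1_(`[0, 2^-1]%classic) x))%R).
  rewrite RiZ// mulr_gt0 ?expR_gt0// /Rintegral integral_indic//= setIT.
  by rewrite lebesgue_measure_itv/= lte_fin invr_gt0 ltr0n /= subr0.
apply: Ri_le; [exact: intgZ|exact: bump_intg|] => x.
rewrite indicE; case: (boolP (x \in _)) => [|_]; last by rewrite mulr0 bump_ge0.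
rewrite inE/= in_itv/= mulr1 => /andP[x0 x1].
rewrite bumpE (ger0_norm x0) ifT; last by lra.
rewrite ler_expR lerN2 lef_pV2 ?posrE//; last by nra.
by nra.
Qed.

End Bump.

Section Plane.
Context (R : realType).
Notation mu := (@lebesgue_measure R).
Lemma plane_sf : sigma_finite setT (mu \x mu)%E.
Proof.
have /sigma_finiteP[F [TF ndF Foo]] := sigma_finiteT mu.
exists (fun n => F n `*` F n).
 rewrite -setXTT TF predeqE => -[x y]; split.
    move=> [/= [n _ Fnx] [k _ Gky]]; exists (maxn n k) => //; split.
    - by move: x Fnx; exact/subsetPset/ndF/leq_maxl.
    - by move: y Gky; exact/subsetPset/ndF/leq_maxr.
  by move=> [n _ []/= ? ?]; split; exists n.
move=> k; have [? ?] := Foo k.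
split; first exact: measurableX.
by rewrite product_measure1E// lte_mul_pinfty// ge0_fin_numE.
Qed.
(** The product measure registered as sigma-finite, so that the plane can itself be a factor in Fubini. *)
Definition plane := (mu \x mu)%E.
HB.instance Definition _ := Measure.copy plane (mu \x mu)%E.
HB.instance Definition _ := Measure_isSigmaFinite.Build _ _ _ plane plane_sf.

Lemma ae_fst (P : R -> Prop) : {ae mu, forall x, P x} -> {ae plane, forall z, P z.1}.
Proof.
move=> [A [mA A0 PA]]; exists (A `*` setT); split; first exact: measurableX.
  apply: (eq_trans (@product_measure1E _ _ _ _ _ mu mu A setT mA measurableT)).
  by rewrite [X in (X * _)%E](_ : _ = 0%E) ?mul0e//; exact: A0.
by move=> z /= nP; split => //; apply: PA.
Qed.

Lemma ae_snd (P : R -> Prop) : {ae mu, forall x, P x} -> {ae plane, forall z, P z.2}.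
Proof.
move=> [A [mA A0 PA]]; exists (setT `*` A); split; first exact: measurableX.
  apply: (eq_trans (@product_measure1E _ _ _ _ _ mu mu setT A measurableT mA)).
  by rewrite [X in (_ * X)%E](_ : _ = 0%E) ?mule0//; exact: A0.
by move=> z /= nP; split => //; apply: PA.
Qed.

End Plane.

Section Mollifier.
Context {R : realType}.
Notation mu := (@lebesgue_measure R).
Notation m2 := (mu \x mu)%E.
Implicit Types (w u : R -> R) (n j : nat).

Let c := (\int[mu]_x (@bump R 0 x))%R.
Let c0 : 0 < c. Proof. exact: bump_int_gt0. Qed.

Definition mollifier n j (x : R) : R := c^-1 * (n.+1%:R ^+ j.+1 * bump j (n.+1%:R * x)).

Let N0 n : 0 < n.+1%:R :> R. Proof. by rewrite ltr0n. Qed.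

Lemma mollifier_smooth n : smooth_seq (mollifier n).
Proof.
move=> j x.
have d1 : is_derive x (1:R) (fun y : R => n.+1%:R * y) n.+1%:R.
  by have := is_deriveZ (n.+1%:R : R) (@is_derive_id R R x 1); rewrite scalerRE mulr1.
have d2 := @is_derive1_comp R (bump j) _ x _ _ (bump_smooth j (n.+1%:R * x)) d1.
have d3 := is_deriveZ (c^-1) (is_deriveZ (n.+1%:R ^+ j.+1) d2).
apply: is_derive_eq d3 _; rewrite !scalerRE /mollifier (exprS _ j.+1); ring.
Qed.

Lemma mollifier_supp1 n j x : 1 <= n.+1%:R * `|x| -> mollifier n j x = 0.
Proof.
by move=> H; rewrite /mollifier bump_supp ?mulr0// normrM (ger0_norm (ltW (N0 n))).
Qed.

Lemma mollifier_supp n j x : 1 < `|x| -> mollifier n j x = 0.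
Proof.
move=> x1; apply: mollifier_supp1; rewrite -[leLHS]mulr1; apply: ler_pM => //; last exact: ltW.
by rewrite ler1n.
Qed.

Lemma mollifier_ge0 n x : 0 <= mollifier n 0 x.
Proof. by rewrite /mollifier !mulr_ge0 ?bump_ge0 ?invr_ge0 ?exprn_ge0 ?(ltW c0). Qed.

Lemma mollifier_even n x : mollifier n 0 (- x) = mollifier n 0 x.
Proof. by rewrite /mollifier mulrN bump_even. Qed.

Lemma mollifier_intg n j : intg mu (mollifier n j).
Proof. by do 2 apply: intgZ; apply: intg_scale; [rewrite gt_eqF|exact: bump_intg]. Qed.

Lemma mollifier_int n : (\int[mu]_x mollifier n 0 x)%R = 1.
Proof.
have b := @bump_intg R 0; have nn : (n.+1%:R : R) != 0 by rewrite gt_eqF.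
rewrite RiZ; last by apply: intgZ; exact: intg_scale.
rewrite RiZ; last exact: intg_scale.
rewrite Ri_scale// expr1 ger0_norm ?(ltW (N0 n))// mulVKf// mulVf// gt_eqF//.
Qed.

Lemma mollifier_bound n j : exists2 B : R, 0 <= B & forall x, `|mollifier n j x| <= B.
Proof. by apply: (smooth_bound (mollifier_smooth n) (r := 1)) => x; exact: mollifier_supp. Qed.

Lemma mollifier_meas n j : measurable_fun setT (mollifier n j).
Proof. exact: intg_meas (mollifier_intg n j). Qed.

Lemma mollifier_le n x : mollifier n 0 x <= c^-1 * n.+1%:R * \1_(ball (0:R) n.+1%:R^-1) x.
Proof.
have cN : 0 <= c^-1 * n.+1%:R by rewrite mulr_ge0 ?invr_ge0 ?ltW.
rewrite indicE; have [H|H] := ltP `|x| n.+1%:R^-1.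
  rewrite mem_set; last by rewrite -ball_normE/= sub0r normrN.
  rewrite mulr1 /mollifier expr1 mulrA; rewrite -[leRHS]mulr1; apply: ler_wpM2l => //.
  rewrite bumpE; case: ifP => // ?; rewrite -[leRHS]expR0 ler_expR oppr_le0 invr_ge0.
  by apply: ltW; exact: sub1_gt0.
rewrite memNset; last by rewrite -ball_normE/= sub0r normrN; apply/negP; rewrite -leNgt.
by rewrite mulr0 mollifier_supp1// -ler_pdivrMl// mulr1.
Qed.

Definition convol (k w : R -> R) (x : R) : R := (\int[mu]_y (k (x - y) * w y))%R.

Definition mollify n w := convol (mollifier n 0) w.

Lemma convol_smooth (K : nat -> R -> R) (r : R) w : smooth_seq K ->
  (forall j x, r < `|x| -> K j x = 0) -> intg mu w -> smooth_seq (fun j => convol (K j) w).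
Proof.
move=> sK Kr iw j x.
have [M M0 HM] := smooth_bound sK (Kr j.+2).
have i1 i (y : R) : intg mu (fun z => K i (y - z) * w z).
  have [B B0 HB] := smooth_bound sK (Kr i).
  apply: (@intg_Mb _ _ _ mu (fun z => K i (y - z)) w B) => //.
  apply: (measurableT_comp (smooth_meas i sK)); exact: measurable_funB.
apply: (@is_derive_quad _ _ _ _ (M * \int[mu]_z `|w z|)%R) => y.
rewrite /convol mulrC -(RiB (i1 j y) (i1 j x)) -(RiZ (y - x) (i1 j.+1 x)).
rewrite -(RiB (intgB (i1 j y) (i1 j x)) (intgZ (y - x) (i1 j.+1 x))).
have ia := intg_abs iw.
rewrite mulrAC -(RiZ (M * (y - x) ^+ 2) ia).
apply: Ri_abs_le; [|exact: intgZ|] => [|z].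
  exact: (intgB (intgB (i1 j y) (i1 j x)) (intgZ (y - x) (i1 j.+1 x))).
rewrite (_ : _ - _ = (K j (y - z) - K j (x - z) - K j.+1 (x - z) * ((y - z) - (x - z))) * w z); last by ring.
rewrite normrM; apply: ler_wpM2r => //.
have := taylor2 (sK j) (sK j.+1) HM (x - z) (y - z).
by rewrite (_ : (y - z) - (x - z) = y - x)//; ring.
Qed.

Lemma convol_supp (k w : R -> R) (a b x : R) : (forall x, a < `|x| -> k x = 0) ->
  (forall x, b < `|x| -> w x = 0) -> a + b < `|x| -> convol k w x = 0.
Proof.
move=> ka wb xab; rewrite /convol (_ : (fun y => _) = cst 0) ?Rintegral_cst//= ?mul0r//.
apply/funext => y; have [yb|yb] := ltP b `|y|; first by rewrite wb// mulr0.
rewrite ka ?mul0r//; have := ler_normD (x - y) y; rewrite subrK; lra.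
Qed.

Lemma convol_test (K : nat -> R -> R) (a b : R) w : smooth_seq K ->
  (forall j x, a < `|x| -> K j x = 0) -> intg mu w -> (forall x, b < `|x| -> w x = 0) ->
  is_test_function (convol (K 0%N) w : R -> R^o).
Proof.
move=> sK Ka iw wb.
apply: (@test_intro _ (fun j => convol (K j) w) (a + b)); first exact: convol_smooth Ka iw.
by move=> x /=; apply: convol_supp => //; exact: Ka.
Qed.

Lemma mollify_test n (b : R) w : intg mu w -> (forall x, b < `|x| -> w x = 0) ->
  is_test_function (mollify n w : R -> R^o).
Proof. by apply: convol_test; [exact: mollifier_smooth|exact: mollifier_supp]. Qed.

Lemma meas_mollify n w : measurable_fun setT w -> measurable_fun setT (mollify n w).
Proof.
move=> mw; apply: (@meas_Ri _ _ _ _ _ mu (fun z : R * R => mollifier n 0 (z.1 - z.2) * w z.2)).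
apply: measurable_funM; last exact: (measurableT_comp mw measurable_snd).
by apply: (measurableT_comp (mollifier_meas n 0)); exact: measurable_funB.
Qed.

Lemma mollifyE n w x : measurable_fun setT w -> mollify n w x = (\int[mu]_y (mollifier n 0 y * w (x - y)))%R.
Proof.
move=> mw; rewrite /mollify /convol -(@Ri_sublm _ (fun y => mollifier n 0 y * w (x - y)) x).
  by apply: Ri_eq => y; rewrite opprB addrCA subrr addr0.
apply: measurable_funM; first exact: mollifier_meas.
by apply: (measurableT_comp mw); exact: measurable_funB.
Qed.

Lemma meas_subl w (x : R) : measurable_fun setT w -> measurable_fun setT (fun y : R => w (x - y)).
Proof. by move=> mw; apply: (measurableT_comp mw); exact: measurable_funB. Qed.

Lemma intg_mollifier n w (B x : R) : measurable_fun setT w -> (forall x, `|w x| <= B) ->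
  intg mu (fun y => mollifier n 0 y * w (x - y)).
Proof.
move=> mw wB; have := @intg_Mb _ _ _ mu (fun y => w (x - y)) (mollifier n 0) B.
move=> /(_ (meas_subl x mw) (mollifier_intg n 0) (fun y => wB _)).
by congr (intg _ _); apply/funext => y; rewrite mulrC.
Qed.

Lemma mollify_bound n w (B x : R) : measurable_fun setT w -> (forall x, `|w x| <= B) -> `|mollify n w x| <= B.
Proof.
move=> mw wB; rewrite mollifyE//.
apply: (@le_trans _ _ (\int[mu]_y (B * mollifier n 0 y))%R); last by rewrite RiZ ?mollifier_int ?mulr1//; exact: mollifier_intg.
apply: Ri_abs_le; [exact: intg_mollifier wB|by apply: intgZ; exact: mollifier_intg|] => y.
by rewrite normrM (ger0_norm (mollifier_ge0 _ _)) mulrC; apply: ler_wpM2r => //; exact: mollifier_ge0.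
Qed.

Lemma mollify_supp n w (b x : R) : (forall x, b < `|x| -> w x = 0) -> 1 + b < `|x| -> mollify n w x = 0.
Proof. by apply: convol_supp => y; exact: mollifier_supp. Qed.

Lemma itv_len (a x : R) : 0 <= a ->
  intg mu (fun z => \1_(`[-a, a]%classic) (x - z) : R) /\
  (\int[mu]_z (\1_(`[-a, a]%classic) (x - z) : R))%R = 2 * a.
Proof.
move=> a0; have ii : intg mu (\1_(`[-a, a]%classic) : R -> R) by exact: integrable_indic_itv.
split; first exact: (intg_subl x ii).
rewrite (Ri_subl x ii) /Rintegral integral_indic//= setIT.
rewrite lebesgue_measure_itv/= lte_fin; case: ifPn => [_|] /=; first by rewrite opprK; ring.
by rewrite -leNgt; lra.
Qed.

Lemma mollify_lip n w (B : R) : measurable_fun setT w -> (forall x, `|w x| <= B) ->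
  exists2 L : R, 0 <= L & forall x y, `|mollify n w x - mollify n w y| <= L * `|x - y|.
Proof.
move=> mw wB; have B0 : 0 <= B by apply: le_trans (wB 0).
have [M M0 HM] := mollifier_bound n 1.
exists (M * 4 * B); first by rewrite !mulr_ge0.
move=> x y; have i1 t : intg mu (fun z => mollifier n 0 (t - z) * w z).
  have := @intg_Mb _ _ _ mu w (fun z => mollifier n 0 (t - z)) B mw (intg_subl t (mollifier_intg n 0)) wB.
  by congr (intg _ _); apply/funext => z; rewrite mulrC.
have [i2 e2] := itv_len x (ler01 : 0 <= (1:R)); have [i3 e3] := itv_len y (ler01 : 0 <= (1:R)).
rewrite /mollify /convol -(RiB (i1 x) (i1 y)).
have -> : M * 4 * B * `|x - y| = (\int[mu]_z ((M * `|x - y| * B) * (\1_(`[-1, 1]%classic) (x - z) + \1_(`[-1, 1]%classic) (y - z))))%R.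
  by rewrite RiZ; [rewrite RiD// e2 e3; ring|exact: intgD].
apply: Ri_abs_le; [exact: (intgB (i1 x) (i1 y))|by apply: intgZ; exact: intgD|] => z.
rewrite -mulrBl normrM -mulrA [B * _]mulrC mulrA; apply: ler_pM => //.
have l01 (t : R) : (0:R) <= \1_(`[-1, 1]%classic) t by rewrite indicE.
have [x1|x1] := leP `|x - z| 1; last have [y1|y1] := leP `|y - z| 1; last first.
- by rewrite (mollifier_supp _ _ x1) (mollifier_supp _ _ y1) subrr normr0 mulr_ge0 ?mulr_ge0 ?addr_ge0.
- have := lip_bound (mollifier_smooth n 0) HM (x - z) (y - z).
  rewrite (_ : x - z - (y - z) = x - y); last by ring.
  move=> H; apply: le_trans H _; rewrite -[leLHS]mulr1; apply: ler_wpM2l; first by rewrite mulr_ge0.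
  rewrite [X in _ <= _ + X]indicE mem_set ?lerDr//= in_itv/= -ler_norml//.
- have := lip_bound (mollifier_smooth n 0) HM (x - z) (y - z).
  rewrite (_ : x - z - (y - z) = x - y); last by ring.
  move=> H; apply: le_trans H _; rewrite -[leLHS]mulr1; apply: ler_wpM2l; first by rewrite mulr_ge0.
  rewrite [X in _ <= X + _]indicE mem_set ?lerDl//= in_itv/= -ler_norml//.
Qed.

Lemma mollify_sym n u w (B : R) : measurable_fun setT u -> (forall x, `|u x| <= B) -> intg mu w ->
  (\int[mu]_x (u x * mollify n w x) = \int[mu]_x (mollify n u x * w x))%R.
Proof.
move=> mu' uB iw; have B0 : 0 <= B by apply: le_trans (uB 0).
have mw := intg_meas iw; have [M M0 HM] := mollifier_bound n 0.
have mF : measurable_fun setT (fun z : R * R => u z.1 * (mollifier n 0 (z.1 - z.2) * w z.2)).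
  apply: measurable_funM; first exact: (measurableT_comp mu' measurable_fst).
  apply: measurable_funM; last exact: (measurableT_comp mw measurable_snd).
  by apply: (measurableT_comp (mollifier_meas n 0)); exact: measurable_funB.
have i1 y : intg mu (fun x => u x * (mollifier n 0 (x - y) * w y)).
  apply: (@intg_Mb _ _ _ mu u (fun x => mollifier n 0 (x - y) * w y) B) => //.
  under eq_fun do rewrite mulrC; apply: intgZ; exact: intg_shift (mollifier_intg n 0).
have iF : intg m2 (fun z : R * R => u z.1 * (mollifier n 0 (z.1 - z.2) * w z.2)).
  apply: (@intg_prod2 _ _ _ _ _ mu mu _ (fun y => B * `|w y|) mF i1).
    by apply: intgZ; exact: intg_abs.
  move=> y /=; have ik := intg_shift (- y) (mollifier_intg n 0).
  apply: (@le_trans _ _ (\int[mu]_x ((B * `|w y|) * mollifier n 0 (x - y)))%R).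
    apply: Ri_le; [exact/intg_abs|exact: intgZ|] => x.
    rewrite normrM [X in _ * X]normrM (ger0_norm (mollifier_ge0 _ _)) -mulrA [`|w y| * _]mulrC; apply: ler_wpM2r => //.
    by rewrite mulr_ge0 ?mollifier_ge0.
  by rewrite (RiZ _ ik) (Ri_shift (- y) (mollifier_intg n 0)) mollifier_int mulr1.
transitivity (\int[mu]_x \int[mu]_y (u x * (mollifier n 0 (x - y) * w y)))%R.
  apply: Ri_eq => x; rewrite RiZ//.
  have [M' _ HM'] := mollifier_bound n 0.
  by apply: (@intg_Mb _ _ _ mu (fun y => mollifier n 0 (x - y)) w M') => //; exact: meas_subl (mollifier_meas n 0).
rewrite (Ri_swap iF); apply: Ri_eq => y /=.
rewrite /mollify /convol mulrC -RiZ; last first.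
  have := @intg_Mb _ _ _ mu u (fun z => mollifier n 0 (y - z)) B mu' (intg_subl y (mollifier_intg n 0)) uB.
  by congr (intg _ _); apply/funext => z; rewrite mulrC.
by apply: Ri_eq => x; rewrite -(mollifier_even n (x - y)) opprB; ring.
Qed.

Lemma mollify_diff2 n h w x : intg mu w -> diff2 h (mollify n w) x = mollify n (diff2 h w) x.
Proof.
move=> iw; have mw := intg_meas iw; have [M M0 HM] := mollifier_bound n 0.
have i1 t : intg mu (fun y => mollifier n 0 y * w (t - y)).
  by apply: (@intg_Mb _ _ _ mu (mollifier n 0) (fun y => w (t - y)) M) => //; [exact: mollifier_meas|exact: intg_subl].
rewrite [RHS]mollifyE; last exact: meas_diff2.
rewrite [LHS]/diff2 !mollifyE// -(RiZ 2 (i1 x)) -(RiB (intgZ 2 (i1 x)) (i1 (x + h))).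
rewrite -(RiB (intgB (intgZ 2 (i1 x)) (i1 (x + h))) (i1 (x - h))).
apply: Ri_eq => y; rewrite /diff2 (addrAC x h) (addrAC x (- h)); ring.
Qed.

Lemma mollify_D n w (B : R) z : measurable_fun setT w -> (forall x, `|w x| <= B) ->
  D (mollify n w) z = (\int[mu]_y (mollifier n 0 y * D w (z.1 - y, z.2 - y)))%R.
Proof.
move=> mw wB; rewrite /D !mollifyE// -RiB; last 2 first.
- exact: intg_mollifier wB.
- exact: intg_mollifier wB.
rewrite mulrC -RiZ; last by apply: intgB; exact: intg_mollifier wB.
by apply: Ri_eq => y /=; rewrite opprB addrA subrK; ring.
Qed.

Lemma cs_weight (k a : R -> R) (B : R) : (forall x, 0 <= k x) -> intg mu k ->
  measurable_fun setT a -> (forall x, `|a x| <= B) ->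
  ((\int[mu]_y (k y * a y)) ^+ 2 <= (\int[mu]_y k y) * (\int[mu]_y (k y * a y ^+ 2)))%R.
Proof.
move=> k0 ik ma aB; have B0 : 0 <= B by apply: le_trans (aB 0).
have sq y : Num.sqrt (k y) ^+ 2 = k y by rewrite sqr_sqrtr.
have mS : measurable_fun setT (fun y => Num.sqrt (k y)).
  exact: (measurableT_comp (@meas_sqrt R) (intg_meas ik)).
have s1 : sqi mu (fun y => Num.sqrt (k y)).
  by split => //; under eq_fun do rewrite sq.
have e2 y : (Num.sqrt (k y) * a y) ^+ 2 = k y * a y ^+ 2 by rewrite exprMn sq.
have s2 : sqi mu (fun y => Num.sqrt (k y) * a y).
  split; first exact: measurable_funM.
  under eq_fun do rewrite e2 mulrC.
  apply: (@intg_Mb _ _ _ mu (fun y => a y ^+ 2) k (B ^+ 2)) => //; first exact: measurable_funX.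
  by move=> x; rewrite normrX; apply: lerXn2r; rewrite ?nnegrE.
have := cauchy_schwarz s1 s2.
rewrite (@Ri_eq _ _ _ mu _ k sq) (@Ri_eq _ _ _ mu _ _ e2).
apply: le_trans; rewrite le_eqVlt; apply/orP; left; apply/eqP; congr (_ ^+ 2).
by apply: Ri_eq => y; rewrite mulrA -expr2 sq.
Qed.

Lemma jensen_mollifier n (a : R -> R) (B : R) : measurable_fun setT a -> (forall x, `|a x| <= B) ->
  ((\int[mu]_y (mollifier n 0 y * a y)) ^+ 2 <= \int[mu]_y (mollifier n 0 y * a y ^+ 2))%R.
Proof.
by move=> ma aB; have := cs_weight (mollifier_ge0 n) (mollifier_intg n 0) ma aB; rewrite mollifier_int mul1r.
Qed.

(** The difference quotient of a mollification is an average of diagonal translates of the difference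
    quotient, so Jensen applies. *)
Lemma mollify_gag n w (B : R) : measurable_fun setT w -> (forall x, `|w x| <= B) -> sqi m2 (D w) ->
  sqi m2 (D (mollify n w)) /\ (\int[m2]_z (D (mollify n w) z ^+ 2) <= \int[m2]_z (D w z ^+ 2))%R.
Proof.
move=> mw wB [mD iD]; have B0 : 0 <= B by apply: le_trans (wB 0).
pose G (p : (R * R) * R) : R := mollifier n 0 p.2 * D w (p.1.1 - p.2, p.1.2 - p.2) ^+ 2.
have m11 : measurable_fun setT (fun p : (R * R) * R => p.1.1) by exact: (measurableT_comp measurable_fst measurable_fst).
have m12 : measurable_fun setT (fun p : (R * R) * R => p.1.2) by exact: (measurableT_comp measurable_snd measurable_fst).
have mT : measurable_fun setT (fun p : (R * R) * R => (p.1.1 - p.2, p.1.2 - p.2)).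
  by apply: measurable_fun_pair; exact: measurable_funB.
have mG : measurable_fun setT G.
  apply: measurable_funM; first exact: (measurableT_comp (mollifier_meas n 0) measurable_snd).
  by apply: measurable_funX; exact: (measurableT_comp mD mT).
have iS (y : R) := intg_diag (- y) iD.
have iG : intg (@plane R \x mu)%E G.
  refine (@intg_prod2 _ _ _ _ _ (@plane R) mu G (fun y => (\int[m2]_z (D w z ^+ 2))%R * mollifier n 0 y) mG _ _ _).
  - move=> y; have H := @intgZ _ _ _ m2 (mollifier n 0 y) _ (iS y).1; exact H.
  - by apply: intgZ; exact: mollifier_intg.
  - move=> y; rewrite (_ : (\int[@plane R]_x `|G (x, y)|)%R = (\int[m2]_z (mollifier n 0 y * D w (z.1 - y, z.2 - y) ^+ 2))%R).
      by rewrite (RiZ _ (iS y).1) (iS y).2 mulrC.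
    by apply: Ri_eq => z; rewrite ger0_norm// mulr_ge0 ?mollifier_ge0 ?sqr_ge0.
have [j1 e1] := Ri_fubini1 iG; have [_ e2] := Ri_fubini2 iG.
have le z : D (mollify n w) z ^+ 2 <= (\int[mu]_y G (z, y))%R.
  rewrite (mollify_D n z mw wB).
  apply: (@jensen_mollifier n (fun y => D w (z.1 - y, z.2 - y)) (2 * B * `|z.1 - z.2|^-1)).
    apply: (measurableT_comp mD); apply: measurable_fun_pair; exact: measurable_funB.
  move=> y; rewrite /D /= opprB addrA subrK normrM normfV.
  apply: ler_wpM2r; first by rewrite invr_ge0.
  by apply: le_trans (ler_normB _ _) _; rewrite mulr2n mulrDl mul1r; apply: lerD.
have mM : measurable_fun setT (D (mollify n w)) by apply: meas_D; exact: meas_mollify.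
have iM : intg m2 (fun z => D (mollify n w) z ^+ 2).
  apply: (intg_le _ j1); first exact: measurable_funX.
  by move=> z; rewrite ger0_norm ?sqr_ge0.
split => //; apply: le_trans (Ri_le iM j1 le) _.
rewrite -e1 e2 /G /= (_ : (fun y => _) = (fun y => (\int[m2]_z (D w z ^+ 2))%R * mollifier n 0 y)).
  by rewrite RiZ ?mollifier_int ?mulr1//; exact: mollifier_intg.
by apply/funext => y; rewrite RiZ; [rewrite (iS y).2 mulrC|exact: (iS y).1].
Qed.

Lemma bnd_locally w (B : R) : measurable_fun setT w -> (forall x, `|w x| <= B) -> locally_integrable setT w.
Proof.
move=> mw wB; split => //; first exact: openT.
move=> K _ cK; have mK : measurable K by exact: compact_measurable.
have B0 : 0 <= B by apply: le_trans (wB 0).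
apply: (@le_lt_trans _ _ (\int[mu]_(x in K) (cst B%:E x))%E).
  apply: ge0_le_integral => //.
  - by apply/measurable_EFinP; apply: measurable_funTS; exact: measurableT_comp.
  - by move=> x _ /=; rewrite lee_fin.
  by rewrite integral_cst//= lte_mul_pinfty//; exact: compact_finite_measure.
Qed.

(** The kernels are at most a multiple of the normalised indicators of shrinking balls, so this is Lebesgue
    differentiation. *)
Lemma mollify_cvg w (B : R) : measurable_fun setT w -> (forall x, `|w x| <= B) ->
  {ae mu, forall x, mollify n w x @[n --> \oo] --> w x}.
Proof.
move=> mw wB; have B0 : 0 <= B by apply: le_trans (wB 0).
have LD := lebesgue_differentiation (bnd_locally mw wB).
apply: (@filterS _ _ (ae_filter_ringOfSetsType mu) _ _ _ LD) => x; rewrite /lebesgue_pt => /cvge_at_rightP/(_ (fun n => n.+1%:R^-1)).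
move=> /(_ _)/fine_cvgP[|_ H]; first by split; [move=> n; rewrite invr_gt0|exact: cvg_harmonic].
apply: cvg_sub0; apply: norm_cvg0.
apply: (@squeeze_cvgr _ _ _ _ (fun=> 0) (fun n => 2 * c^-1 * fine (davg w x n.+1%:R^-1))) => //; last first.
- by have := cvgM (cvg_cst (2 * c^-1 : R)) H; rewrite mulr0; apply.
- exact: cvg_cst.
apply: nearW => n; rewrite normr_ge0/=.
have mb : measurable (ball x n.+1%:R^-1 : set R) by exact: measurable_ball.
have r0 : 0 <= n.+1%:R^-1 :> R by rewrite invr_ge0 ltW.
have i1 : intg mu (fun y => mollifier n 0 (x - y) * w y).
  have := @intg_Mb _ _ _ mu w (fun z => mollifier n 0 (x - z)) B mw (intg_subl x (mollifier_intg n 0)) wB.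
  by congr (intg _ _); apply/funext => z; rewrite mulrC.
have ik := intg_subl x (mollifier_intg n 0).
have -> : mollify n w x - w x = (\int[mu]_y (mollifier n 0 (x - y) * w y - w x * mollifier n 0 (x - y)))%R.
  by rewrite (RiB i1 (intgZ (w x) ik)) (RiZ _ ik) (Ri_subl x (mollifier_intg n 0)) mollifier_int mulr1.
pose bI (y : R) := c^-1 * n.+1%:R * (\1_(ball x n.+1%:R^-1 : set R) y * `|w y - w x|).
have iI : intg mu (fun y => \1_(ball x n.+1%:R^-1 : set R) y * `|w y - w x|).
  have iB : intg mu (\1_(ball x n.+1%:R^-1 : set R)).
    by rewrite ball_itv; exact: integrable_indic_itv.
  have := @intg_Mb _ _ _ mu (fun y => `|w y - w x|) _ (2 * B) _ iB.
  rewrite (_ : (fun x0 => _ * _) = (fun y => \1_(ball x n.+1%:R^-1 : set R) y * `|w y - w x|)).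
    apply; first by apply: measurableT_comp => //; exact: measurable_funB.
    move=> y; rewrite normr_id; apply: le_trans (ler_normB _ _) _.
    by rewrite mulr2n mulrDl mul1r; apply: lerD.
  by apply/funext => y; rewrite mulrC.
have ifI : intg mu bI by exact: intgZ.
apply: (@le_trans _ _ (\int[mu]_y bI y)%R).
  apply: Ri_abs_le => //; first exact: (intgB i1 (intgZ (w x) ik)).
  move=> y; rewrite [w x * _]mulrC -mulrBr normrM (ger0_norm (mollifier_ge0 _ _)) /bI mulrA.
  apply: ler_wpM2r => //; apply: le_trans (mollifier_le n (x - y)) _.
  apply: ler_wpM2l; first by rewrite mulr_ge0 ?invr_ge0 ?ltW.
  have -> // : \1_(ball (0:R) n.+1%:R^-1) (x - y) = \1_(ball x n.+1%:R^-1 : set R) y :> R.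
  by rewrite !indicE; congr (_%:R); congr nat_of_bool; apply/idP/idP; rewrite !inE -!ball_normE/= sub0r normrN.
rewrite RiZ// /davg /iavg lebesgue_measure_ball//.
have e1 : (\int[mu]_(y in ball x n.+1%:R^-1) `|((center (w x) \o w) y)%:E| =
   (\int[mu]_y (\1_(ball x n.+1%:R^-1 : set R) y * `|w y - w x|))%R%:E)%E.
  rewrite [LHS]integral_mkcond -(RiE iI); apply: eq_integral => y _ /=.
  rewrite patchE indicE; case: ifPn => _ /=; first by rewrite mul1r.
  by rewrite mul0r.
have nz : n.+1%:R^-1 *+ 2 != 0 :> R by rewrite mulrn_eq0/= invr_eq0 gt_eqF.
rewrite e1 inver (negPf nz) -EFinM /= le_eqVlt; apply/orP; left; apply/eqP.
rewrite -(mulr_natr (n.+1%:R^-1) 2) invfM invrK.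
have cn : c != 0 by rewrite gt_eqF.
by field.
Qed.

End Mollifier.

(** * Energy and quarter Laplacian *)

Section Gagliardo.
Context {R : realType}.
Notation mu := (@lebesgue_measure R).
Notation m2 := (mu \x mu)%E.
Implicit Types (u w f g phi : R -> R).

Lemma intg_unshear (F : R * R -> R) : measurable_fun setT F ->
  intg m2 (fun z => F (z.1, z.1 + z.2)) -> intg m2 F.
Proof.
move=> mF iS; apply: (@intg_le _ _ _ m2 F (fun z => `|F z|)) => //.
apply: intg_ge0 => //; first exact: measurableT_comp.
rewrite -(@shear_pres R (fun z => `|F z|))//; last exact: measurableT_comp.
by have := intg_lty (intg_abs iS).
Qed.

Lemma lip_meas w (L : R) : (forall x y, `|w x - w y| <= L * `|x - y|) -> measurable_fun setT w.
Proof.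
move=> Lw; apply: continuous_measurable_fun => x; apply/cvgrPdist_lt => e e0.
have L0 : 0 <= L.
  by have := Lw 1 0; rewrite subr0 normr1 mulr1; apply: le_trans.
near=> y; apply: le_lt_trans (Lw x y) _.
have : `|x - y| < e / (L + 1).
  near: y; have /cvgrPdist_lt := @cvg_id _ (nbhs x); apply; rewrite divr_gt0// ltr_wpDl//.
rewrite ltr_pdivlMr ?ltr_wpDl//; apply: le_lt_trans.
by rewrite mulrC; apply: ler_wpM2l => //; rewrite lerDl.
Unshelve. all: by end_near. Qed.

(** Lipschitz bounds serve for |h| <= s and sup bounds for |h| > s.  The constant is invariant under the
    rescaling x -> s x, which is what makes it uniform in s for dilated functions. *)
Lemma gag_lip u w (B L B' L' s : R) : 0 < s ->
  (forall x, `|u x| <= B) -> (forall x y, `|u x - u y| <= L * `|x - y|) ->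
  (forall x, `|w x| <= B') -> (forall x y, `|w x - w y| <= L' * `|x - y|) ->
  (forall x, s < `|x| -> w x = 0) ->
  intg m2 (fun z => D u z * D w z) /\
  (\int[m2]_z `|D u z * D w z| <= 8 * (s ^+ 2 * (L * L') + 2 * (B * B')) * pi)%R.
Proof.
move=> s0 uB uL wB wL ws.
have mu' := lip_meas uL; have mw := lip_meas wL.
have B0 : 0 <= B by apply: le_trans (uB 0).
have B'0 : 0 <= B' by apply: le_trans (wB 0).
have L0 : 0 <= L by have := uL 1 0; rewrite subr0 normr1 mulr1; apply: le_trans.
have L'0 : 0 <= L' by have := wL 1 0; rewrite subr0 normr1 mulr1; apply: le_trans.
have s0' := ltW s0.
have mF : measurable_fun setT (fun z => D u z * D w z) by apply: measurable_funM; exact: meas_D.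
have mFS : measurable_fun setT (fun z : R * R => D u (z.1, z.1 + z.2) * D w (z.1, z.1 + z.2)).
  exact: (measurableT_comp mF (@meas_shear R)).
pose K := 8 * (s ^+ 2 * (L * L') + 2 * (B * B')).
have K0 : 0 <= K by rewrite mulr_ge0// addr_ge0// !mulr_ge0// sqr_ge0.
have [ip ep] := cauchy_scaled_int s0.
pose g (h : R) := K * (s / (h ^+ 2 + s ^+ 2)).
have ig : intg mu g by exact: intgZ.
have iw : intg mu w by have [] := supp_int mw s0' B'0 wB ws.
have e (x h : R) : D u (x, x + h) * D w (x, x + h) = q2 h * ((u x - u (x + h)) * (w x - w (x + h))).
  rewrite /D/= /q2 opprD addrA subrr add0r.
  have [->|h0] := eqVneq h 0; first by rewrite addr0 !subrr; ring.
  by field.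
have mus h : measurable_fun setT (fun x : R => u x - u (x + h)) by apply: measurable_funB => //; exact: meas_shift.
have i1 h : intg mu (fun x => (u x - u (x + h)) * (w x - w (x + h))).
  apply: (@intg_Mb _ _ _ mu _ _ (2 * B) (mus h) (intgB iw (intg_shift h iw))) => x.
  apply: le_trans (ler_normB _ _) _.
  by rewrite mulr2n mulrDl mul1r; apply: lerD.
have b1 h : (\int[mu]_x `|(u x - u (x + h)) * (w x - w (x + h))| <= h ^+ 2 * g h)%R.
  have h2 := sqr_ge0 h; have den : 0 < h ^+ 2 + s ^+ 2 by rewrite ltr_wpDl// exprn_gt0.
  rewrite (_ : h ^+ 2 * g h = K * s * (h ^+ 2 / (h ^+ 2 + s ^+ 2))); last by rewrite /g; ring.
  have [hs|hs] := leP `|h| s.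
    have [] := @supp_int _ (fun x => (u x - u (x + h)) * (w x - w (x + h))) (L * L' * h ^+ 2) (2 * s).
    - exact: intg_meas (i1 h).
    - by rewrite mulr_ge0.
    - by rewrite mulr_ge0// mulr_ge0.
    - move=> x; rewrite normrM.
      have := uL x (x + h); have := wL x (x + h); rewrite opprD addrA subrr add0r normrN => a b.
      apply: le_trans (ler_pM _ _ b a) _ => //.
      by rewrite -[h ^+ 2]real_normK ?num_real// le_eqVlt; apply/orP; left; apply/eqP; ring.
    - move=> x xs; rewrite !ws ?subrr ?mulr0//; last by lra.
      by have := ler_normB (x + h) h; rewrite addrK; lra.
    move=> _ H; apply: le_trans H _.
    have w2 : 1 <= 2 * (s ^+ 2 / (h ^+ 2 + s ^+ 2)).
      rewrite mulrA ler_pdivlMr// mul1r.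
      have : h ^+ 2 <= s ^+ 2 by rewrite -[h ^+ 2]real_normK ?num_real//; apply: lerXn2r; rewrite ?nnegrE.
      by lra.
    have a0 : 0 <= 4 * s * (L * L' * h ^+ 2) by rewrite mulr_ge0 ?(mulr_ge0 _ h2) ?mulr_ge0.
    apply: (@le_trans _ _ (4 * s * (L * L' * h ^+ 2) * (2 * (s ^+ 2 / (h ^+ 2 + s ^+ 2))))).
      by rewrite (_ : 2 * (2 * s) = 4 * s) ?ler_peMr//; ring.
    rewrite (_ : 4 * s * _ * _ = 8 * (s ^+ 2 * (L * L')) * s * (h ^+ 2 / (h ^+ 2 + s ^+ 2))); last by ring.
    apply: ler_wpM2r; first by rewrite divr_ge0// ltW.
    apply: ler_wpM2r => //; rewrite /K; apply: ler_wpM2l => //.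
    by rewrite lerDl !mulr_ge0.
  have w1 : 1 <= 2 * (h ^+ 2 / (h ^+ 2 + s ^+ 2)).
    rewrite mulrA ler_pdivlMr// mul1r.
    have : s ^+ 2 <= h ^+ 2 by rewrite -[h ^+ 2]real_normK ?num_real//; apply: lerXn2r; rewrite ?nnegrE// ltW.
    by lra.
  have ia := intg_abs iw; have [_ wi] := supp_int mw s0' B'0 wB ws.
  apply: (@le_trans _ _ (\int[mu]_x (2 * B * (`|w x| + `|w (x + h)|)))%R).
    apply: Ri_le; [exact/intg_abs|by apply: intgZ; apply: intgD => //; exact: (intg_shift h ia)|] => x.
    rewrite normrM; apply: ler_pM => //; last exact: ler_normB.
    by apply: le_trans (ler_normB _ _) _; rewrite mulr2n mulrDl mul1r; apply: lerD.
  rewrite RiZ; last by apply: intgD => //; exact: (intg_shift h ia).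
  rewrite RiD//; last exact: (intg_shift h ia).
  rewrite (Ri_shift h ia).
  apply: (@le_trans _ _ (8 * s * (B * B') * 1)).
    rewrite mulr1; have : B * (\int[mu]_x `|w x|)%R <= B * (2 * s * B') by apply: ler_wpM2l.
    by lra.
  apply: (@le_trans _ _ (8 * s * (B * B') * (2 * (h ^+ 2 / (h ^+ 2 + s ^+ 2))))).
    by apply: ler_wpM2l => //; rewrite !mulr_ge0.
  rewrite (_ : 8 * s * _ * _ = 8 * (2 * (B * B')) * s * (h ^+ 2 / (h ^+ 2 + s ^+ 2))); last by ring.
  apply: ler_wpM2r; first by rewrite divr_ge0// ltW.
  apply: ler_wpM2r => //; rewrite /K; apply: ler_wpM2l => //.
  by rewrite lerDr !mulr_ge0// sqr_ge0.
have b2 h : (\int[mu]_x `|D u (x, x + h) * D w (x, x + h)| <= g h)%R.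
  under eq_Rintegral do rewrite e normrM (ger0_norm (q2_ge0 h)).
  rewrite RiZ; last exact: intg_abs.
  apply: le_trans (ler_wpM2l (q2_ge0 h) (b1 h)) _.
  have [->|h0] := eqVneq h 0.
    rewrite expr0n /= mul0r mulr0 /g mulr_ge0// divr_ge0// addr_ge0 ?sqr_ge0//.
  by rewrite /q2 mulrA mulVf ?mul1r// sqrf_eq0.
have iS : intg m2 (fun z => D u (z.1, z.1 + z.2) * D w (z.1, z.1 + z.2)).
  apply: (@intg_prod2 _ _ _ _ _ mu mu _ g mFS _ ig) => h /=; last exact: b2.
  under eq_fun do rewrite e; exact: intgZ.
have iF := intg_unshear mF iS.
split => //.
have [iA <-] := intg_shear (intg_abs iF).
rewrite (Ri_fubini2 iA).2 -/K -ep -RiZ//.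
by apply: Ri_le; [exact: (Ri_fubini2 iA).1|exact: ig|exact: b2].
Qed.

Lemma gag_fin w (B L s : R) : 0 < s ->
  (forall x, `|w x| <= B) -> (forall x y, `|w x - w y| <= L * `|x - y|) ->
  (forall x, s < `|x| -> w x = 0) ->
  sqi m2 (D w) /\ (\int[m2]_z (D w z ^+ 2) <= 8 * (s ^+ 2 * (L * L) + 2 * (B * B)) * pi)%R.
Proof.
move=> s0 wB wL ws; have [iF H] := gag_lip s0 wB wL wB wL ws.
split; first by split; [exact: meas_D (lip_meas wL)|exact: iF].
apply: le_trans H; rewrite le_eqVlt; apply/orP; left; apply/eqP.
by apply: Ri_eq => z; rewrite -expr2 ger0_norm ?sqr_ge0.
Qed.

Lemma test_gag phi : is_test_function (phi : R -> R^o) -> sqi m2 (D phi).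
Proof.
move=> tp; have [[_ [B HB] _] _ [L HL] _] := test_admiss tp.
have [F [r [sF F0 r0 Fr]]] := test_elim tp.
have r1 : 0 < r + 1 by lra.
have S x : r + 1 < `|x| -> phi x = 0 by move=> xr; rewrite -F0 Fr//; lra.
by have [] := gag_fin r1 HB HL S.
Qed.

Notation Lam := (@quarter_laplacian_test R).

Lemma LamE phi : is_test_function (phi : R -> R^o) -> Lam phi = fun x => c_quarter^-1 * quarter_op phi x.
Proof. by move=> tp; apply/funext => x; exact: quarter_laplacian_testE. Qed.

Lemma Lam_facts phi : is_test_function (phi : R -> R^o) ->
  [/\ intg mu (Lam phi), exists B : R, forall x, `|Lam phi x| <= B & sqi mu (Lam phi)].
Proof.
move=> tp; have [[ip [B HB] [C C0 HC]] [C2 C20 HC2] _ _] := test_admiss tp.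
have [iL _] := quarter_op_L1 tp HC; rewrite LamE//.
have iK : intg mu (fun x => c_quarter^-1 * quarter_op phi x) by exact: intgZ.
pose I := (\int[mu]_h (wt h * q32 h : R))%R.
have bL x : `|quarter_op phi x| <= C2 * I.
  rewrite /I -RiZ; last exact: intg_wq32.
  apply: Ri_abs_le; [exact: (quarter_opE x tp).1|by apply: intgZ; exact: intg_wq32|] => h.
  rewrite normrM (ger0_norm (q32_ge0 h)) mulrC mulrA; apply: ler_wpM2r; first exact: q32_ge0.
  exact: HC2.
have bK x : `|c_quarter^-1 * quarter_op phi x| <= `|c_quarter^-1| * (C2 * I).
  by rewrite normrM; apply: ler_wpM2l.
split => //; first by exists (`|c_quarter^-1| * (C2 * I)).
split; first exact: intg_meas iK.
under eq_fun do rewrite expr2.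
exact: (@intg_Mb _ _ _ mu _ _ _ (intg_meas iK) iK bK).
Qed.

Lemma test_sqi phi : is_test_function (phi : R -> R^o) -> sqi mu phi.
Proof.
move=> tp; have [[ip [B HB] _] _ _ _] := test_admiss tp; split; first exact: intg_meas ip.
under eq_fun do rewrite expr2.
exact: (@intg_Mb _ _ _ mu _ _ _ (intg_meas ip) ip HB).
Qed.

Lemma diff2_sym u phi h : intg mu (fun x => u x * phi x) -> intg mu (fun x => u x * phi (x + h)) ->
  intg mu (fun x => u x * phi (x - h)) ->
  (\int[mu]_x (u x * diff2 h phi x) = \int[mu]_x (diff2 h u x * phi x))%R.
Proof.
move=> i0 ip im.
have jp : intg mu (fun x => u (x - h) * phi x).
  by have := intg_shift (- h) ip; congr (intg _ _); apply/funext => x; rewrite subrK.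
have jm : intg mu (fun x => u (x + h) * phi x).
  by have := intg_shift h im; congr (intg _ _); apply/funext => x; rewrite addrK.
transitivity (2 * \int[mu]_x (u x * phi x) - \int[mu]_x (u x * phi (x + h)) - \int[mu]_x (u x * phi (x - h)))%R.
  rewrite -(RiZ 2 i0) -(RiB (intgZ 2 i0) ip) -(RiB (intgB (intgZ 2 i0) ip) im).
  by apply: Ri_eq => x; rewrite /diff2; ring.
rewrite -(Ri_shift (- h) ip) -(Ri_shift h im).
have -> : (\int[mu]_x (u (x - h) * phi (x - h + h)) = \int[mu]_x (u (x - h) * phi x))%R.
  by apply: Ri_eq => x; rewrite subrK.
have -> : (\int[mu]_x (u (x + h) * phi (x + h - h)) = \int[mu]_x (u (x + h) * phi x))%R.
  by apply: Ri_eq => x; rewrite addrK.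
rewrite addrAC -(RiZ 2 i0) -(RiB (intgZ 2 i0) jm) -(RiB (intgB (intgZ 2 i0) jm) jp).
by apply: Ri_eq => x; rewrite /diff2; ring.
Qed.

Lemma Lam_sym psi : is_test_function (psi : R -> R^o) -> is_quarter_laplacian psi (Lam psi).
Proof.
move=> ts phi tp.
have [ip [B HB] _] := Lam_facts tp; have [iS [B' HB'] _] := Lam_facts ts.
have [[jp [b hb] [C C0 HC]] _ _ _] := test_admiss tp; have [[jS [b' hb'] [C' C'0 HC']] _ _ _] := test_admiss ts.
have mp := intg_meas jp; have ms := intg_meas jS.
have i1 f g (c : R) : intg mu f -> measurable_fun setT g -> (forall x, `|g x| <= c) -> intg mu (fun x => f x * g x).
  move=> iF mg gc; have := @intg_Mb _ _ _ mu _ _ _ mg iF gc; congr (intg _ _); apply/funext => x; exact: mulrC.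
split.
- exact: (@intg_Mb _ _ _ mu _ _ _ ms ip hb').
- exact: (@intg_Mb _ _ _ mu _ _ _ (intg_meas iS) jp HB').
have sw f g : is_test_function (f : R -> R^o) -> is_test_function (g : R -> R^o) ->
    (\int[mu]_x (f x * quarter_op g x) = \int[mu]_h (q32 h * (\int[mu]_x (f x * diff2 h g x))%R))%R.
  move=> tf tg; have [[jf [bf hf] _] _ _ _] := test_admiss tf.
  have [[jg _ [Cg Cg0 Hg]] _ _ _] := test_admiss tg.
  have mf := intg_meas jf.
  have bf0 : 0 <= bf by apply: le_trans (hf 0).
  refine (@swap_w _ q32 f (fun z => diff2 z.2 g z.1) (bf * Cg) (@meas_q32 R) (@q32_ge0 R) (@intg_wq32 R) mf
    (meas_diff2_kernel (intg_meas jg)) (fun x => (quarter_opE x tg).1) _ _).2.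
    by move=> h; apply: (@intg_Mb _ _ _ mu f (diff2 h g) bf mf _ hf); exact: intg_diff2.
  move=> h /=; have iD := intg_diff2 h jg.
  apply: (@le_trans _ _ (\int[mu]_x (bf * `|diff2 h g x|))%R).
    apply: Ri_le; [by apply: intg_abs; exact: (@intg_Mb _ _ _ mu f (diff2 h g) bf mf _ hf)|by apply: intgZ; exact: intg_abs|] => x.
    by rewrite normrM; apply: ler_wpM2r.
  rewrite RiZ; last exact: intg_abs.
  by rewrite -mulrA; apply: ler_wpM2l.
have k1 : (\int[mu]_x (psi x * Lam phi x) = c_quarter^-1 * \int[mu]_x (psi x * quarter_op phi x))%R.
  rewrite -RiZ; first by apply: Ri_eq => x; rewrite (LamE tp); ring.
  by apply: (@intg_Mb _ _ _ mu _ _ _ ms _ hb'); exact: (quarter_op_L1 tp HC).1.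
have k2 : (\int[mu]_x (Lam psi x * phi x) = c_quarter^-1 * \int[mu]_x (phi x * quarter_op psi x))%R.
  rewrite -RiZ; first by apply: Ri_eq => x; rewrite (LamE ts); ring.
  by apply: (@intg_Mb _ _ _ mu _ _ _ mp _ hb); exact: (quarter_op_L1 ts HC').1.
rewrite k1 k2 (sw _ _ ts tp) (sw _ _ tp ts); congr (_ * _); apply: Ri_eq => h; congr (_ * _).
rewrite diff2_sym; first by apply: Ri_eq => x; rewrite mulrC.
- exact: (@intg_Mb _ _ _ mu _ _ _ ms jp hb').
- exact: (@intg_Mb _ _ _ mu _ _ _ ms (intg_shift h jp) hb').
- exact: (@intg_Mb _ _ _ mu _ _ _ ms (intg_shift (- h) jp) hb').
Qed.

Lemma lap_D u f phi (B : R) : measurable_fun setT u -> (forall x, `|u x| <= B) ->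
  sqi mu f -> is_quarter_laplacian u f -> sqi m2 (D u) -> is_test_function (phi : R -> R^o) ->
  (\int[mu]_x (f x * Lam phi x) = c_half^-1 * \int[m2]_z (D u z * D phi z))%R.
Proof.
move=> mu' uB sf ul sD tp; rewrite (lap_pair mu' uB sf ul tp); congr (_ * _).
have [ad _ _ _] := test_admiss tp.
rewrite (pairA mu' uB ad)//; last by apply: sqiM => //; exact: test_gag.
by move=> x; exact: (half_opE x tp).1.
Qed.

(** The energy of a test function, computed in both ways: the quarter Laplacian is symmetric, so
    [lap_D] applies to the test function itself. *)
Lemma Lam_norm phi : is_test_function (phi : R -> R^o) ->
  (\int[mu]_x (Lam phi x ^+ 2) = c_half^-1 * \int[m2]_z (D phi z ^+ 2))%R.
Proof.
move=> tp; have [[ip [B HB] _] _ _ _] := test_admiss tp.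
have [_ _ sL] := Lam_facts tp.
by have := lap_D (intg_meas ip) HB sL (Lam_sym tp) (test_gag tp) tp.
Qed.

End Gagliardo.

Section Tent.
Context {R : realType}.
Notation mu := (@lebesgue_measure R).
Notation m2 := (mu \x mu)%E.

(** Cutoffs at scale n.  Their energy does not tend to 0, but it is bounded because the seminorm is scale
    invariant, and boundedness suffices for weak convergence. *)
Definition tent (n : nat) (x : R) : R := Num.max 0 (1 - `|x| / n.+1%:R).

Lemma tent_ge0 n x : 0 <= tent n x.
Proof. by rewrite /tent le_max lexx. Qed.

Lemma tent_le1 n x : tent n x <= 1.
Proof. by rewrite /tent ge_max ler01/= lerBlDr lerDl divr_ge0. Qed.

Lemma tent_bound n x : `|tent n x| <= 1.
Proof. by rewrite ger0_norm ?tent_ge0// tent_le1. Qed.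

Lemma tent_lip n x y : `|tent n x - tent n y| <= n.+1%:R^-1 * `|x - y|.
Proof.
have H a b : `|Num.max 0 a - Num.max 0 b| <= `|a - b| :> R.
  rewrite /Num.max; case: (ltP 0 a) => ?; case: (ltP 0 b) => ?; rewrite ?subrr ?normr0 ?normr_ge0//;
  rewrite ?subr0 ?sub0r ?normrN ler_norml; have := ler_norm (a - b); have := ler_norm (- (a - b)); rewrite normrN => ? ?; apply/andP; split; lra.
apply: le_trans (H _ _) _.
rewrite (_ : _ - _ = n.+1%:R^-1 * (`|y| - `|x|)); last by ring.
rewrite normrM ger0_norm ?invr_ge0//; apply: ler_wpM2l; first by rewrite invr_ge0.
by rewrite distrC; apply: le_trans (ler_dist_dist _ _) _; rewrite distrC.
Qed.

Lemma tent_supp n x : n.+1%:R < `|x| -> tent n x = 0.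
Proof.
move=> nx; rewrite /tent max_l// subr_le0 ler_pdivlMr ?ltr0n// mul1r; exact: ltW.
Qed.

Lemma meas_tent n : measurable_fun setT (tent n).
Proof. exact: (lip_meas (tent_lip n)). Qed.

Lemma tent_cvg x : tent n x @[n --> \oo] --> (1:R).
Proof.
have h : (fun n => `|x| * n.+1%:R^-1) @ \oo --> (0:R).
  by have := cvgM (cvg_cst `|x|) (@cvg_harmonic R); rewrite mulr0; apply.
apply: cvg_sub0; apply: norm_cvg0.
apply: (@squeeze_cvgr _ _ _ _ (fun=> 0) (fun n => `|x| * n.+1%:R^-1)) => //; last exact: cvg_cst.
apply: nearW => n; rewrite normr_ge0/= distrC ger0_norm; last by rewrite subr_ge0 tent_le1.
have : 1 - `|x| / n.+1%:R <= tent n x by rewrite /tent le_max lexx orbT.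
by rewrite lerBlDr => H; rewrite lerBlDr addrC.
Qed.

Lemma tent_gag n : sqi m2 (D (tent n)) /\ (\int[m2]_z (D (tent n) z ^+ 2) <= 24 * pi)%R.
Proof.
have N0 : 0 < n.+1%:R :> R by rewrite ltr0n.
have [s1 s2] := gag_fin N0 (tent_bound n) (tent_lip n) (@tent_supp n).
split => //; apply: le_trans s2 _; rewrite mulr1.
rewrite (_ : n.+1%:R ^+ 2 * _ = 1); last by field; rewrite gt_eqF.
by rewrite le_eqVlt; apply/orP; left; apply/eqP; ring.
Qed.

End Tent.

Section Energy.
Context {R : realType}.
Notation mu := (@lebesgue_measure R).
Notation m2 := (mu \x mu)%E.
Notation Lam := (@quarter_laplacian_test R).
Implicit Types (u w f g phi : R -> R).

Lemma lipM u w (B B' L L' : R) : (forall x, `|u x| <= B) -> (forall x, `|w x| <= B') ->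
  (forall x y, `|u x - u y| <= L * `|x - y|) -> (forall x y, `|w x - w y| <= L' * `|x - y|) ->
  forall x y, `|u x * w x - u y * w y| <= (B * L' + B' * L) * `|x - y|.
Proof.
move=> uB wB uL wL x y.
rewrite (_ : _ - _ = u x * (w x - w y) + w y * (u x - u y)); last by ring.
apply: le_trans (ler_normD _ _) _; rewrite mulrDl !normrM -!mulrA; apply: lerD.
  by apply: ler_pM.
by apply: ler_pM.
Qed.

Lemma sqrB_le2 (a b c : R) : (a - b) ^+ 2 <= 2 * ((a - c) ^+ 2 + (b - c) ^+ 2).
Proof.
rewrite -subr_ge0 (_ : _ - _ = ((a - c) + (b - c)) ^+ 2); last by ring.
exact: sqr_ge0.
Qed.

Lemma quarter_split (A B X e k : R) : 0 < k -> A <= e * k / 4 -> B <= e * k / 4 ->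
  X <= 2 * (A + B) -> k^-1 * X <= e.
Proof. by move=> k0 a b x; rewrite ler_pdivrMl//; lra. Qed.

Lemma quad_le (c K I Y : R) : 0 <= c -> 0 <= K -> Y - c <= I -> I ^+ 2 <= 2 * K * (Y + c) ->
  Y <= 3 * c + 2 * K.
Proof.
move=> c0 K0 lo CS; have [//|Yc] := leP Y (3 * c + 2 * K); exfalso.
have h0 : 0 <= Y - c by lra.
have h4 : (Y - c) ^+ 2 <= I ^+ 2 by apply: lerXn2r; rewrite ?nnegrE//; apply: le_trans lo.
have p1 : 0 <= (Y - (3 * c + 2 * K)) * (Y - c) by apply: mulr_ge0; lra.
have p2 : 0 <= (Y - (3 * c + 2 * K)) * c by apply: mulr_ge0; lra.
have p3 : 0 < (Y - (3 * c + 2 * K)) ^+ 2 by apply: exprn_gt0; lra.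
have p4 : 0 <= c * K by apply: mulr_ge0.
have p5 : 0 <= K * (Y - (3 * c + 2 * K)) by apply: mulr_ge0; lra.
have p6 : 0 <= c ^+ 2 by exact: sqr_ge0.
nra.
Qed.

Lemma pair_half_op u phi (B : R) : measurable_fun setT u -> (forall x, `|u x| <= B) -> admiss phi ->
  (forall x, intg mu (fun h => q2 h * diff2 h phi x)) ->
  (\int[mu]_x (u x * half_op phi x) = \int[mu]_h (q2 h * (\int[mu]_x (u x * diff2 h phi x))%R))%R.
Proof.
move=> mu' uB [ip _ [C C0 HC]] iq.
have B0 : 0 <= B by apply: le_trans (uB 0).
have i1 h : intg mu (fun x => u x * diff2 h phi x).
  by apply: (@intg_Mb _ _ _ mu u (diff2 h phi) B) => //; exact: intg_diff2.
have H := @swap_w _ q2 u (fun z => diff2 z.2 phi z.1) (B * C) (@meas_q2 R) (@q2_ge0 R) (@intg_wq2 R) mu'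
  (meas_diff2_kernel (intg_meas ip)) iq i1.
refine (proj2 (H _)) => h /=.
apply: (@le_trans _ _ (\int[mu]_x (B * `|diff2 h phi x|))%R).
  apply: Ri_le; [exact/intg_abs|exact/intgZ/intg_abs/intg_diff2|] => x.
  by rewrite normrM ler_wpM2r.
rewrite RiZ; last exact/intg_abs/intg_diff2.
by rewrite -mulrA ler_wpM2l.
Qed.

(** Moving the mollification from the test function to u makes the left factor Lipschitz. *)
Lemma pair_half_op_mollify u w n (B B' L s : R) : measurable_fun setT u -> (forall x, `|u x| <= B) -> 0 < s ->
  (forall x, `|w x| <= B') -> (forall x y, `|w x - w y| <= L * `|x - y|) ->
  (forall x, s < `|x| -> w x = 0) ->
  (\int[mu]_x (u x * half_op (mollify n w) x) = \int[m2]_z (D (mollify n u) z * D w z))%R.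
Proof.
move=> mu' uB s0 wB wL ws; have mw := lip_meas wL.
have B'0 : 0 <= B' by apply: le_trans (wB 0).
have iw : intg mu w by have [] := supp_int mw (ltW s0) B'0 wB ws.
have tp := mollify_test n iw ws; have [ad _ _ _] := test_admiss tp.
have [K K0 HK] := mollify_lip n mu' uB.
have MB x : `|mollify n u x| <= B by exact: mollify_bound.
have [iD _] := gag_lip s0 MB HK wB wL ws.
rewrite (pair_half_op mu' uB ad); last by move=> x; exact: (half_opE x tp).1.
rewrite (pairD (meas_mollify n mu') MB iw iD); apply: Ri_eq => h; congr (_ * _).
rewrite -(@mollify_sym R n u (diff2 h w) B mu' uB (intg_diff2 h iw)).
by apply: Ri_eq => x; rewrite mollify_diff2.
Qed.

(** Let u_n be the mollification of u, chi a tent and V = chi u_n.  Testing with the mollification of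
    chi^2 u_n, the form is at least ||D V||^2 - C, while by Cauchy-Schwarz and [Lam_norm] it is at most
    ||f|| (C + C ||D V||^2)^(1/2).  This bounds ||D V|| uniformly in n ([quad_le]), and Fatou concludes. *)
Lemma lap_finite u f (B : R) : measurable_fun setT u -> (forall x, `|u x| <= B) ->
  sqi mu f -> is_quarter_laplacian u f -> sqi m2 (D u).
Proof.
move=> mu' uB sf ul; have B0 : 0 <= B by apply: le_trans (uB 0).
pose U n := mollify n u; pose V n x := tent n x * U n x; pose w n x := tent n x * V n x.
have UB n x : `|U n x| <= B by exact: mollify_bound.
have VB n x : `|V n x| <= B.
  by rewrite normrM -[leRHS]mul1r; apply: ler_pM => //; exact: tent_bound.
have wB n x : `|w n x| <= B.
  by rewrite normrM -[leRHS]mul1r; apply: ler_pM => //; exact: tent_bound.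
have Vs n x : n.+1%:R < `|x| -> V n x = 0 by move=> h; rewrite /V tent_supp// mul0r.
have ws n x : n.+1%:R < `|x| -> w n x = 0 by move=> h; rewrite /w tent_supp// mul0r.
have N0 n : 0 < n.+1%:R :> R by rewrite ltr0n.
pose c := 24 * pi * B ^+ 2 : R; pose K := c_half * (\int[mu]_x (f x ^+ 2))%R : R.
have K0 : 0 <= K by rewrite mulr_ge0 ?(ltW (c_half_gt0)) ?Ri_ge0// => x; exact: sqr_ge0.
have c0 : 0 <= c by rewrite !mulr_ge0 ?pi_ge0 ?sqr_ge0.
have main n : sqi m2 (D (V n)) /\ (\int[m2]_z (D (V n) z ^+ 2) <= 3 * c + 2 * K)%R.
  have [L L0 UL] := mollify_lip n mu' uB.
  have VL := lipM (tent_bound n) (UB n) (tent_lip n) UL.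
  have wL := lipM (tent_bound n) (VB n) (tent_lip n) VL.
  have [sV _] := gag_fin (N0 n) (VB n) VL (Vs n).
  have [sw _] := gag_fin (N0 n) (wB n) wL (ws n).
  have [sT gT] := @tent_gag R n.
  have mw := lip_meas wL.
  have iw : intg mu (w n) by have [] := supp_int mw (ltW (N0 n)) B0 (wB n) (ws n).
  split => //; set Y := (\int[m2]_z _)%R.
  have Y0 : 0 <= Y by apply: Ri_ge0 => z; exact: sqr_ge0.
  have tp := mollify_test n iw (ws n).
  have e1 := lap_pair mu' uB sf ul tp.
  rewrite (pair_half_op_mollify n mu' uB (N0 n) (wB n) wL (ws n)) in e1.
  have [iUw _] := gag_lip (N0 n) (UB n) UL (wB n) wL (ws n).
  (* (a - b) (s^2 a - t^2 b) = (s a - t b)^2 - a b (s - t)^2 *)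
  have lo : Y - c <= (\int[m2]_z (D (U n) z * D (w n) z))%R.
    apply: (@le_trans _ _ (\int[m2]_z (D (V n) z ^+ 2 - B ^+ 2 * D (tent n) z ^+ 2))%R).
      rewrite (RiB sV.2 (intgZ _ sT.2)) (RiZ _ sT.2); apply: lerB => //.
      by rewrite /c mulrC; apply: ler_wpM2r => //; exact: sqr_ge0.
    apply: Ri_le => //; first exact: (intgB sV.2 (intgZ _ sT.2)).
    move=> z; rewrite /D /w /V.
    set a := U n z.1; set b := U n z.2; set s := tent n z.1; set t := tent n z.2; set d := (z.1 - z.2)^-1.
    rewrite (_ : (a - b) * d * _ = ((s * a - t * b) * d) ^+ 2 - a * b * ((s - t) * d) ^+ 2); last by ring.
    rewrite lerD2l lerN2; apply: ler_wpM2r; first exact: sqr_ge0.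
    apply: le_trans (ler_norm _) _; rewrite normrM expr2; exact: ler_pM (UB _ _) (UB _ _).
  have growth : (\int[m2]_z (D (w n) z ^+ 2) <= 2 * (Y + c))%R.
    apply: (@le_trans _ _ (\int[m2]_z (2 * (D (V n) z ^+ 2 + B ^+ 2 * D (tent n) z ^+ 2)))%R).
      apply: Ri_le; [exact: sw.2|exact: (intgZ 2 (intgD sV.2 (intgZ _ sT.2)))|] => z.
      rewrite /D /w; set a := V n z.1; set b := V n z.2; set s := tent n z.1; set t := tent n z.2; set d := (z.1 - z.2)^-1.
      have s1 : s ^+ 2 <= 1 by rewrite expr_le1 ?tent_ge0 ?tent_le1.
      have b1 : b ^+ 2 <= B ^+ 2 by rewrite -[b ^+ 2]real_normK ?num_real//; apply: lerXn2r; rewrite ?nnegrE//; exact: VB.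
      rewrite (_ : (s * a - t * b) * d = s * ((a - b) * d) + b * ((s - t) * d)); last by ring.
      have h1 : s ^+ 2 * ((a - b) * d) ^+ 2 <= ((a - b) * d) ^+ 2 by rewrite ler_piMl ?sqr_ge0.
      have h2 : b ^+ 2 * ((s - t) * d) ^+ 2 <= B ^+ 2 * ((s - t) * d) ^+ 2 by apply: ler_wpM2r => //; exact: sqr_ge0.
      have := sqr_ge0 (s * ((a - b) * d) - b * ((s - t) * d)).
      by rewrite -!exprMn in h1 h2 *; nra.
    rewrite (RiZ _ (intgD sV.2 (intgZ _ sT.2))) (RiD sV.2 (intgZ _ sT.2)) (RiZ _ sT.2).
    apply: ler_wpM2l => //; rewrite lerD2l /c mulrC; apply: ler_wpM2r => //; exact: sqr_ge0.
  have [_ _ sL] := Lam_facts tp.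
  have CS := cauchy_schwarz sf sL.
  rewrite (Lam_norm tp) e1 in CS.
  have [_ gm] := mollify_gag n mw (wB n) sw.
  have k0 := @c_half_gt0 R; have ki : 0 <= c_half^-1 :> R by rewrite invr_ge0 ltW.
  set I := (\int[m2]_z (D (U n) z * D (w n) z))%R in lo CS.
  have CS2 : I ^+ 2 <= 2 * K * (Y + c).
    have h0 : 0 <= (\int[mu]_x (f x ^+ 2))%R by apply: Ri_ge0 => x; exact: sqr_ge0.
    have h3 : (\int[mu]_x (f x ^+ 2))%R * (c_half^-1 * (\int[m2]_z (D (mollify n (w n)) z ^+ 2))%R) <=
       (\int[mu]_x (f x ^+ 2))%R * (c_half^-1 * (2 * (Y + c))).
      by apply: ler_wpM2l => //; apply: ler_wpM2l => //; exact: le_trans gm growth.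
    have := ler_wpM2l (sqr_ge0 c_half) (le_trans CS h3).
    rewrite exprMn exprVn mulVKf ?sqrf_eq0 ?gt_eqF// => H; apply: le_trans H _.
    rewrite /K le_eqVlt; apply/orP; left; apply/eqP; field; rewrite gt_eqF//.
  exact: quad_le c0 K0 lo CS2.
have mD := meas_D mu'.
have aec : {ae (@plane R), forall z, D (V n) z @[n --> \oo] --> D u z}.
  have c1 := mollify_cvg mu' uB.
  have P1 : {ae mu, forall x, V n x @[n --> \oo] --> u x}.
    apply: (@filterS _ _ (ae_filter_ringOfSetsType mu) _ _ _ c1) => x cx.
    by have := cvgM (@tent_cvg R x) cx; rewrite mul1r; apply.
  apply: (@filterS2 _ _ (ae_filter_ringOfSetsType (@plane R)) _ _ _ _ (ae_fst P1) (ae_snd P1)) => z a b.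
  by apply: cvgM; [exact: cvgB|exact: cvg_cst].
split => //.
have [] := @Ri_fatou _ _ _ m2 (fun n z => D (V n) z ^+ 2) (fun z => D u z ^+ 2) (3 * c + 2 * K) => //.
- by move=> n; apply: measurable_funX; exact: (main n).1.1.
- exact: measurable_funX.
- by move=> n z; exact: sqr_ge0.
- by move=> z; exact: sqr_ge0.
- apply: (@filterS _ _ (ae_filter_ringOfSetsType (@plane R)) _ _ _ aec) => z cz.
  by rewrite expr2; under eq_fun do rewrite expr2; exact: cvgM.
- by move=> n; rewrite (RiE (main n).1.2) lee_fin; exact: (main n).2.
Qed.

Lemma test_B phi psi : is_test_function (phi : R -> R^o) -> is_test_function (psi : R -> R^o) ->
  is_test_function ((fun x => phi x - psi x) : R -> R^o).
Proof.
move=> /test_elim[F [r [sF <- r0 Fr]]] /test_elim[G [r' [sG <- r'0 Gr]]].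
apply: (@test_intro _ (fun n x => F n x - G n x) (r + r')).
  by move=> n x; apply: is_deriveB; [exact: sF|exact: sG].
by move=> x h; rewrite Fr ?Gr ?subrr//; lra.
Qed.

Lemma Lam_B phi psi x : is_test_function (phi : R -> R^o) -> is_test_function (psi : R -> R^o) ->
  Lam (fun x => phi x - psi x) x = Lam phi x - Lam psi x.
Proof.
move=> tp ts; rewrite !LamE//; last exact: test_B.
rewrite -mulrBr /quarter_op -(RiB (quarter_opE x tp).1 (quarter_opE x ts).1); congr (_ * _).
by apply: Ri_eq => h; rewrite /diff2; ring.
Qed.

Lemma D_B u w z : D (fun x => u x - w x) z = D u z - D w z.
Proof. by rewrite /D; ring. Qed.

Lemma cvgE (a : nat -> R) l : (a n @[n --> \oo] --> l) <->
  (forall e, 0 < e -> exists N, forall n, (N <= n)%N -> `|a n - l| <= e).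
Proof.
split.
  move=> /cvgrPdist_le H e e0; have [N _ HN] := H e e0.
  by exists N => n Nn; rewrite distrC; exact: HN.
move=> H; apply/cvgrPdist_le => e e0; have [N HN] := H e e0.
by exists N => // n Nn; rewrite distrC; exact: HN.
Qed.

Lemma cvg0_le (a : nat -> R) : a n @[n --> \oo] --> 0 ->
  forall e, 0 < e -> exists N, forall n, (N <= n)%N -> a n <= e.
Proof.
move=> /cvgE H e e0; have [N HN] := H e e0; exists N => n Nn.
by apply: le_trans (HN n Nn); rewrite subr0 ler_norm.
Qed.

(** Mollification does not increase the energy, so the weak convergence of the difference quotients is
    strong. *)
Lemma mollify_gag_cvg w (B : R) : measurable_fun setT w -> (forall x, `|w x| <= B) -> sqi m2 (D w) ->
  (forall h : R * R -> R, sqi m2 h -> (\int[m2]_z (h z * D (mollify n w) z))%R @[n --> \oo] --> (\int[m2]_z (h z * D w z))%R)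
  /\ (\int[m2]_z ((D (mollify n w) z - D w z) ^+ 2))%R @[n --> \oo] --> (0:R).
Proof.
move=> mw wB sD; have c1 := mollify_cvg mw wB.
have aec : {ae (@plane R), forall z, D (mollify n w) z @[n --> \oo] --> D w z}.
  apply: (@filterS2 _ _ (ae_filter_ringOfSetsType (@plane R)) _ _ _ _ (ae_fst c1) (ae_snd c1)) => z a b.
  by apply: cvgM; [exact: cvgB|exact: cvg_cst].
have sM n := (mollify_gag n mw wB sD).1; have gM n := (mollify_gag n mw wB sD).2.
have W h : sqi m2 h -> (\int[m2]_z (h z * D (mollify n w) z))%R @[n --> \oo] --> (\int[m2]_z (h z * D w z))%R.
  by move=> sh; have [] := weak_cvg sh sM sD.1 aec gM.
split => //; have c2 := W _ sD.
have c3 : (2 * ((\int[m2]_z (D w z * D w z)) - (\int[m2]_z (D w z * D (mollify n w) z))))%R @[n --> \oo] --> (0:R).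
  rewrite -(mulr0 2) -[X in 2 * X](subrr (\int[m2]_z (D w z * D w z))%R).
  by apply: cvgM; [exact: cvg_cst|apply: cvgB => //; exact: cvg_cst].
apply: (squeeze_cvgr _ (cvg_cst 0) c3); apply: nearW => n.
rewrite Ri_ge0 ?sqr_ge0//=; last by move=> z; exact: sqr_ge0.
rewrite (Ri_sqrB (sM n) sD).
have e : (\int[m2]_z (D (mollify n w) z * D w z) = \int[m2]_z (D w z * D (mollify n w) z))%R by apply: Ri_eq => z; exact: mulrC.
have e2 : (\int[m2]_z (D w z ^+ 2) = \int[m2]_z (D w z * D w z))%R by [].
by rewrite e; have := gM n; rewrite e2; lra.
Qed.

(** The quarter Laplacians of the mollifications of w form a Cauchy sequence, since on test functions the
    L^2 norm of the quarter Laplacian is the Gagliardo norm.  The pairing formula survives in the limit by weak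
    convergence. *)
Lemma lap_exists w (B b : R) : measurable_fun setT w -> (forall x, `|w x| <= B) ->
  (forall x, b < `|x| -> w x = 0) -> sqi m2 (D w) ->
  exists g, [/\ sqi mu g, is_quarter_laplacian w g &
    forall u f (B' : R), measurable_fun setT u -> (forall x, `|u x| <= B') ->
      sqi mu f -> is_quarter_laplacian u f -> sqi m2 (D u) ->
      (\int[mu]_x (f x * g x) = c_half^-1 * \int[m2]_z (D u z * D w z))%R].
Proof.
move=> mw wB wb sD; have B0 : 0 <= B by apply: le_trans (wB 0).
have iw : intg mu w.
  have [] := @supp_int _ w B (Num.max 0 b) mw _ B0 wB _ => //; first by rewrite le_max lexx.
  by move=> x; rewrite gt_max => /andP[_]; exact: wb.
have tp n := mollify_test n iw wb.
have [W c0] := mollify_gag_cvg mw wB sD.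
have sM n := (mollify_gag n mw wB sD).1.
have k0 := @c_half_gt0 R; have ki : 0 < c_half^-1 :> R by rewrite invr_gt0.
have [g sg Hg] : exists2 g, sqi mu g & forall e, 0 < e -> exists N, forall n, (N <= n)%N ->
    (\int[mu]_x ((Lam (mollify n w) x - g x) ^+ 2))%R <= e.
  apply: sqi_complete; first by move=> n; have [] := Lam_facts (tp n).
  move=> e e0; have e1 : 0 < e * c_half / 4 by rewrite !mulr_gt0.
  have [N HN] := cvg0_le c0 e1; exists N => n k Nn Nk.
  have -> : (\int[mu]_x ((Lam (mollify n w) x - Lam (mollify k w) x) ^+ 2) = c_half^-1 * \int[m2]_z (D (mollify n w) z - D (mollify k w) z) ^+ 2)%R.
    rewrite (@Ri_eq _ _ _ mu _ (fun x => Lam (fun x => mollify n w x - mollify k w x) x ^+ 2)); last first.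
      by move=> x; rewrite (Lam_B _ (tp n) (tp k)).
    rewrite (Lam_norm (test_B (tp n) (tp k))); congr (_ * _).
    by apply: Ri_eq => z; rewrite D_B.
  have s1 := sqiB (sM n) sD; have s2 := sqiB (sM k) sD.
  have a1 := HN n Nn; have a2 := HN k Nk.
  have : (\int[m2]_z (D (mollify n w) z - D (mollify k w) z) ^+ 2 <= \int[m2]_z (2 * ((D (mollify n w) z - D w z) ^+ 2 + (D (mollify k w) z - D w z) ^+ 2)))%R.
    apply: Ri_le; [exact: (sqiB (sM n) (sM k)).2|exact: (intgZ 2 (intgD s1.2 s2.2))|] => z.
    exact: sqrB_le2.
  rewrite (RiZ _ (intgD s1.2 s2.2)) (RiD s1.2 s2.2) => H.
  exact: quarter_split k0 a1 a2 H.
have CSc f : sqi mu f -> (\int[mu]_x (f x * Lam (mollify n w) x))%R @[n --> \oo] --> (\int[mu]_x (f x * g x))%R.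
  move=> sf; apply/cvgE => e e0; pose F := (\int[mu]_x (f x ^+ 2))%R.
  have F0 : 0 <= F by apply: Ri_ge0 => x; exact: sqr_ge0.
  have e1 : 0 < e ^+ 2 / (F + 1) by rewrite divr_gt0 ?exprn_gt0// ltr_wpDl.
  have [N HN] := Hg _ e1; exists N => n Nn.
  have [_ _ sL] := Lam_facts (tp n).
  rewrite -(RiB (sqiM sf sL) (sqiM sf sg)).
  rewrite -(@ler_pXn2r _ 2) ?nnegrE ?(ltW e0)// real_normK ?num_real//.
  have := cauchy_schwarz sf (sqiB sL sg); rewrite -/F => CS.
  rewrite (@Ri_eq _ _ _ mu _ (fun x => f x * (Lam (mollify n w) x - g x))); last by move=> x; ring.
  apply: le_trans CS _; apply: (@le_trans _ _ (F * (e ^+ 2 / (F + 1)))).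
    by apply: ler_wpM2l => //; exact: HN.
  by rewrite mulrA ler_pdivrMr ?ltr_wpDl//; have := sqr_ge0 e; nra.
exists g; split => //.
- move=> phi tphi; have [iL [Bp HBp] sL] := Lam_facts tphi; have sp := test_sqi tphi.
  have i1 : intg mu (w \* Lam phi) by exact: (@intg_Mb _ _ _ mu w (Lam phi) B mw iL wB).
  have i2 : intg mu (g \* phi) by exact: sqiM.
  split => //.
  have a1 := CSc _ sp.
  have a2 : (\int[mu]_x (mollify n w x * Lam phi x))%R @[n --> \oo] --> (\int[mu]_x (w x * Lam phi x))%R.
    have [] := @Ri_dct _ _ _ mu (fun n x => mollify n w x * Lam phi x) (fun x => w x * Lam phi x) (fun x => B * `|Lam phi x|) => //.
    + by move=> n; apply: measurable_funM; [exact: meas_mollify|exact: intg_meas iL].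
    + exact: intg_meas i1.
    + by apply: intgZ; exact: intg_abs.
    + apply: (@filterS _ _ (ae_filter_ringOfSetsType mu) _ _ _ (mollify_cvg mw wB)) => x cx.
      by apply: cvgM => //; exact: cvg_cst.
    + by move=> n x; rewrite normrM; apply: ler_wpM2r => //; exact: mollify_bound.
  have e n : (\int[mu]_x (mollify n w x * Lam phi x) = \int[mu]_x (phi x * Lam (mollify n w) x))%R.
    have [_ _ e1] := Lam_sym (tp n) tphi; apply: (etrans e1).
    by apply: Ri_eq => x; rewrite [LHS]mulrC.
  rewrite (funext e) in a2.
  apply: (etrans (cvg_unique _ a2 a1)) => //.
  by apply: Ri_eq => x; rewrite [LHS]mulrC.
- move=> u f B' mu' uB sf ul su.
  have a1 := CSc _ sf.
  rewrite (funext (fun n => lap_D mu' uB sf ul su (tp n))) in a1.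
  have a2 := cvgM (cvg_cst (c_half^-1 : R)) (W _ su).
  exact: (cvg_unique _ a1 (a2 _ _)).
Qed.

(** The difference h is tested with mollifications of h / (1 + |h|) cut off by tents. *)
Lemma lap_unique u f f' : sqi mu f -> sqi mu f' -> is_quarter_laplacian u f -> is_quarter_laplacian u f' ->
  {ae mu, forall x, f x = f' x}.
Proof.
move=> sf sf' ul ul'; pose h x := f x - f' x.
have sh : sqi mu h by exact: sqiB.
have ht phi : is_test_function (phi : R -> R^o) -> (\int[mu]_x (h x * phi x))%R = 0.
  move=> tp; have [_ i1 e1] := ul _ tp; have [_ i2 e2] := ul' _ tp.
  have := RiB i1 i2; rewrite -e1 -e2 subrr => <-; apply: Ri_eq => x; rewrite /h/=; ring.
pose q x := h x / (1 + `|h x|).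
have q1 x : 0 < 1 + `|h x| by rewrite ltr_pwDl.
have qb x : `|q x| <= 1.
  by rewrite normrM normfV (ger0_norm (ltW (q1 x))) ler_pdivrMr// mul1r lerDr.
have mq : measurable_fun setT q.
  apply: measurable_funM; first exact: sh.1.
  by apply: meas_funV; apply: measurable_funD => //; apply: measurableT_comp => //; exact: sh.1.
have hq x : 0 <= h x * q x <= h x ^+ 2.
  rewrite /q mulrA -expr2 divr_ge0 ?sqr_ge0 ?(ltW (q1 x))//= ler_pdivrMr//.
  by rewrite ler_peMr ?sqr_ge0// lerDl.
have mhq : measurable_fun setT (fun x => h x * q x) by apply: measurable_funM => //; exact: sh.1.
have z n : (\int[mu]_x (h x * (tent n x * q x)))%R = 0.
  pose w x := tent n x * q x.
  have wB x : `|w x| <= 1 by rewrite normrM -[leRHS]mul1r; apply: ler_pM => //; exact: tent_bound.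
  have mw : measurable_fun setT w by apply: measurable_funM => //; exact: meas_tent.
  have ws x : n.+1%:R < `|x| -> w x = 0 by move=> H; rewrite /w tent_supp// mul0r.
  have iw : intg mu w by have [] := supp_int mw (ler0n _ n.+1) ler01 wB ws.
  have sI : sqi mu (\1_(`[- (n.+2%:R), n.+2%:R]%classic) : R -> R).
    have ii : intg mu (\1_(`[- (n.+2%:R), n.+2%:R]%classic) : R -> R) by exact: integrable_indic_itv.
    split; first exact: intg_meas ii.
    rewrite (_ : (fun x => _ ^+ 2) = (\1_(`[- (n.+2%:R), n.+2%:R]%classic) : R -> R))//.
    by apply/funext => x; rewrite indicE; case: (_ \in _); rewrite ?expr1n ?expr0n.
  have sha : sqi mu (fun x => `|h x|).
    split; first by apply: measurableT_comp => //; exact: sh.1.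
    rewrite (_ : (fun x => _ ^+ 2) = (fun x => h x ^+ 2)); first exact: sh.2.
    by apply/funext => x; rewrite real_normK ?num_real.
  have [] := @Ri_dct _ _ _ mu (fun k x => h x * mollify k w x) (fun x => h x * w x)
     (fun x => `|h x| * \1_(`[- (n.+2%:R), n.+2%:R]%classic) x).
  - by move=> k; apply: measurable_funM; [exact: sh.1|exact: meas_mollify].
  - by apply: measurable_funM; [exact: sh.1|].
  - exact: sqiM.
  - apply: (@filterS _ _ (ae_filter_ringOfSetsType mu) _ _ _ (mollify_cvg mw wB)) => x cx.
    by apply: cvgM => //; exact: cvg_cst.
  - move=> k x; rewrite normrM; apply: ler_wpM2l => //.
    rewrite indicE; have [xn|xn] := leP `|x| n.+2%:R.
      by rewrite mem_set; [exact: mollify_bound|rewrite /= in_itv/= -ler_norml].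
    rewrite (@mollify_supp _ k w n.+1%:R x ws) ?nat1r// normr0.
    by case: (_ \in _).
  move=> _ H; rewrite (funext (fun k => ht _ (mollify_test k iw ws))) in H.
  exact: cvg_unique H (cvg_cst 0).
have ihq : intg mu (fun x => h x * q x).
  apply: (@intg_le _ _ _ mu _ (fun x => h x ^+ 2)) => //; first exact: sh.2.
  by move=> x; have /andP[a b] := hq x; rewrite ger0_norm.
have z0 : (\int[mu]_x (h x * q x))%R = 0.
  have [] := @Ri_dct _ _ _ mu (fun n x => h x * (tent n x * q x)) (fun x => h x * q x) (fun x => h x * q x) => //.
  - move=> n; apply: measurable_funM; first exact: sh.1.
    by apply: measurable_funM => //; exact: meas_tent.
  - apply: nearW => x; apply: cvgM; first exact: cvg_cst.
    by have := cvgM (@tent_cvg R x) (cvg_cst (q x)); rewrite mul1r; apply.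
  - move=> n x; have /andP[a _] := hq x; rewrite mulrCA normrM (ger0_norm a).
    by rewrite ler_piMl// tent_bound.
  move=> _ H; rewrite (funext z) in H.
  exact: cvg_unique H (cvg_cst 0).
have mE : measurable_fun setT (fun x => (h x * q x)%:E) by exact/measurable_EFinP.
have /(ae_eq_integral_abs mu measurableT mE) : (\int[mu]_(x in setT) `|(h x * q x)%:E| = 0)%E.
  rewrite -[RHS]/(0%R%:E) -z0 -(RiE ihq); apply: eq_integral => x _ /=.
  by have /andP[a _] := hq x; rewrite ger0_norm.
apply: (@filterS _ _ (ae_filter_ringOfSetsType mu)) => x /(_ I) [] /eqP.
rewrite /q mulf_eq0 mulf_eq0 invr_eq0 (gt_eqF (q1 x)) orbF orbb subr_eq0 => /eqP; exact.
Qed.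

End Energy.

(** * The first variation *)

Section UniformFamilies.
Context {R : realType} (S : R -> R -> R) (t0 : R).
Hypothesis S0 : forall x y, 0 <= S x y.
Hypothesis t00 : 0 <= t0.
Implicit Types F G : R -> R -> R.

(** The families built from U, phi and t by sums, products, inverses and square roots stay in this class, so
    that bounding the energy of the projected variation reduces to reading its formula.  In the application S x y
    is a sum of increments |U_j x - U_j y| and |phi x - phi y|. *)
Definition ulip F := exists2 C : R, 0 <= C & forall t, `|t| <= t0 ->
  [/\ measurable_fun setT (F t), forall x, `|F t x| <= C & forall x y, `|F t x - F t y| <= C * S x y].

Lemma ulip_cst (c : R) : ulip (fun _ _ => c).
Proof. by exists `|c| => // t _; split => // x y; rewrite subrr normr0 mulr_ge0. Qed.

Lemma ulip_par : ulip (fun t _ => t).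
Proof. by exists t0 => // t tt; split => // x y; rewrite subrr normr0 mulr_ge0. Qed.

Lemma ulip_fun (u : R -> R) (B : R) : measurable_fun setT u -> (forall x, `|u x| <= B) ->
  (forall x y, `|u x - u y| <= S x y) -> ulip (fun _ => u).
Proof.
move=> mu uB uS; have B0 : 0 <= B by apply: le_trans (uB 0).
exists (B + 1); first by rewrite addr_ge0.
move=> t _; split => // [x|x y]; first by apply: le_trans (uB x) _; rewrite lerDl.
by apply: le_trans (uS x y) _; rewrite mulrDl mul1r lerDr mulr_ge0.
Qed.

Lemma ulipD F G : ulip F -> ulip G -> ulip (fun t x => F t x + G t x).
Proof.
move=> [C C0 HC] [C' C'0 HC']; exists (C + C'); first exact: addr_ge0.
move=> t tt; have [a b c] := HC t tt; have [a' b' c'] := HC' t tt; split.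
- exact: measurable_funD.
- by move=> x; apply: le_trans (ler_normD _ _) _; exact: lerD.
- move=> x y; rewrite opprD addrACA mulrDl; apply: le_trans (ler_normD _ _) _; exact: lerD.
Qed.

Lemma ulipM F G : ulip F -> ulip G -> ulip (fun t x => F t x * G t x).
Proof.
move=> [C C0 HC] [C' C'0 HC']; exists (2 * (C * C') ); first by rewrite !mulr_ge0.
move=> t tt; have [a b c] := HC t tt; have [a' b' c'] := HC' t tt; split.
- exact: measurable_funM.
- move=> x; rewrite normrM; apply: (@le_trans _ _ (C * C')); first exact: ler_pM.
  by rewrite mulr2n mulrDl mul1r lerDl mulr_ge0.
- move=> x y.
  rewrite (_ : _ - _ = F t x * (G t x - G t y) + (F t x - F t y) * G t y); last by ring.
  apply: le_trans (ler_normD _ _) _; rewrite !normrM.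
  rewrite (_ : 2 * (C * C') * S x y = C * (C' * S x y) + (C * S x y) * C'); last by ring.
  by apply: lerD; apply: ler_pM.
Qed.

Lemma ulipV F (d : R) : ulip F -> 0 < d -> (forall t x, `|t| <= t0 -> d <= F t x) ->
  ulip (fun t x => (F t x)^-1).
Proof.
move=> [C C0 HC] d0 Fd; exists (d^-1 + C * d^-1 ^+ 2).
  by rewrite addr_ge0 ?invr_ge0 ?(ltW d0)// mulr_ge0// sqr_ge0.
move=> t tt; have [a b c] := HC t tt.
have F0 x : 0 < F t x by apply: lt_le_trans (Fd t x tt).
have bV x : (F t x)^-1 <= d^-1 by rewrite lef_pV2 ?posrE//; exact: Fd.
have C2 : 0 <= C * d^-1 ^+ 2 by rewrite mulr_ge0 ?sqr_ge0.
split; first exact: meas_funV.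
- move=> x; rewrite ger0_norm ?invr_ge0 ?(ltW (F0 x))//; apply: le_trans (bV x) _.
  by rewrite lerDl.
- move=> x y; rewrite (_ : _ - _ = (F t x)^-1 * (F t y)^-1 * (F t y - F t x)); last first.
    by field; rewrite !gt_eqF.
  have h : `|F t y - F t x| <= C * S x y by rewrite distrC.
  have d1 : 0 <= d^-1 by rewrite invr_ge0 ltW.
  have f1 z : 0 <= (F t z)^-1 by rewrite invr_ge0 ltW.
  rewrite 2!normrM !(ger0_norm (f1 _)).
  apply: le_trans (ler_pM _ _ (ler_pM (f1 x) (f1 y) (bV x) (bV y)) h) _ => //.
    by rewrite mulr_ge0.
  rewrite (_ : d^-1 * d^-1 * (C * S x y) = C * d^-1 ^+ 2 * S x y); last by ring.
  by apply: ler_wpM2r => //; rewrite lerDr.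
Qed.

Lemma ulip_sqrt F (d : R) : ulip F -> 0 < d -> (forall t x, `|t| <= t0 -> d ^+ 2 <= F t x) ->
  ulip (fun t x => Num.sqrt (F t x)).
Proof.
move=> [C C0 HC] d0 Fd; exists (1 + C + C * d^-1).
  by rewrite !addr_ge0// mulr_ge0// invr_ge0 ltW.
have Cd : 0 <= C * d^-1 by rewrite mulr_ge0// invr_ge0 ltW.
move=> t tt; have [a b c] := HC t tt.
have F0 x : 0 <= F t x by apply: le_trans (Fd t x tt); exact: sqr_ge0.
have sd x : d <= Num.sqrt (F t x).
  by rewrite -(ger0_norm (ltW d0)) -sqrtr_sqr ler_wsqrtr// Fd.
split; first exact: (measurableT_comp (@meas_sqrt R) a).
- move=> x; rewrite ger0_norm ?sqrtr_ge0//.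
  have h1 : Num.sqrt (F t x) ^+ 2 <= C by rewrite sqr_sqrtr// (le_trans (ler_norm _)).
  have := sqr_ge0 (Num.sqrt (F t x) - 1); have := sqrtr_ge0 (F t x); nra.
- move=> x y; set p := Num.sqrt (F t x); set q := Num.sqrt (F t y).
  have pd := sd x; have qd := sd y; rewrite -/p -/q in pd qd.
  have pq : 0 < p + q by lra.
  have e : p - q = (F t x - F t y) / (p + q).
    rewrite -[F t x]sqr_sqrtr// -[F t y]sqr_sqrtr// -/p -/q; field; rewrite gt_eqF//.
  rewrite e normrM normfV (gtr0_norm pq) ler_pdivrMr//.
  apply: le_trans (c x y) _.
  have : 0 <= S x y by []. have : 1 <= d^-1 * (p + q) by rewrite ler_pdivlMl// mulr1; lra.
  move: (S x y) => s dpq s0; rewrite mulrAC (mulrC _ s) [X in _ <= X]mulrC.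
  rewrite (mulrC C); apply: ler_wpM2l => //; apply: (@le_trans _ _ (C * (d^-1 * (p + q)))).
    by rewrite ler_peMr.
  by rewrite mulrA; apply: ler_wpM2r; [exact: ltW|rewrite [C * _]mulrC lerDr addr_ge0].
Qed.

End UniformFamilies.

Section QL.
Context {R : realType}.
Notation mu := (@lebesgue_measure R).
Notation Lam := (@quarter_laplacian_test R).
Implicit Types (u w f g phi : R -> R).

Lemma ql_ae u u' f : measurable_fun setT u' -> {ae mu, forall x, u x = u' x} ->
  is_quarter_laplacian u f -> is_quarter_laplacian u' f.
Proof.
move=> mu' uu ul phi tp; have [i1 i2 e] := ul _ tp.
have mL : measurable_fun setT (Lam phi) by have [/intg_meas] := Lam_facts tp.
have ae : {ae mu, forall x, u x * Lam phi x = u' x * Lam phi x}.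
  by apply: (@filterS _ _ (ae_filter_ringOfSetsType mu) _ _ _ uu) => x ->.
have m1 := intg_meas i1; have m2 : measurable_fun setT (fun x => u' x * Lam phi x) by exact: measurable_funM.
split => //; first exact: (ae_intg _ ae i1).
by rewrite -e; apply/esym; apply: ae_Ri.
Qed.

Lemma ql_lin u w f g (t : R) : is_quarter_laplacian u f -> is_quarter_laplacian w g ->
  is_quarter_laplacian (fun x => u x + t * w x) (fun x => f x + t * g x).
Proof.
move=> ul wl phi tp; have [i1 i2 e] := ul _ tp; have [j1 j2 e'] := wl _ tp.
have k1 : forall x, u x * Lam phi x + t * (w x * Lam phi x) = (u x + t * w x) * Lam phi x by move=> x; ring.
have k2 : forall x, f x * phi x + t * (g x * phi x) = (f x + t * g x) * phi x by move=> x; ring.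
have p1 := intgD i1 (intgZ t j1); have p2 := intgD i2 (intgZ t j2).
split.
- by move: p1; congr (intg _ _); apply/funext => x; exact: k1.
- by move: p2; congr (intg _ _); apply/funext => x; exact: k2.
rewrite -(@Ri_eq _ _ _ mu _ _ k1) -(@Ri_eq _ _ _ mu _ _ k2).
have := RiD i1 (intgZ t j1); have := RiD i2 (intgZ t j2) => /= -> ->.
by rewrite (RiZ t j1) (RiZ t j2); congr (_ + _ * _).
Qed.

(** The representative chosen by [quarter_laplacian] is irrelevant by [lap_unique]. *)
Lemma ql_choice u f : sqi mu f -> is_quarter_laplacian u f ->
  sqi mu (quarter_laplacian u) /\ (\int[mu]_x (quarter_laplacian u x ^+ 2) = \int[mu]_x (f x ^+ 2))%R.
Proof.
move=> sf ul; have H : L2_quarter_laplacians u f by split => //; exact/Lfun2P.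
have [/Lfun2P sq ul'] := xgetPex (cst 0) (ex_intro _ f H); rewrite -/(quarter_laplacian u) in sq ul'.
split => //; have ae := lap_unique sq sf ul' ul.
apply: ae_Ri; [exact: intg_meas sq.2|exact: intg_meas sf.2|].
by apply: (@filterS _ _ (ae_filter_ringOfSetsType mu) _ _ _ ae) => x ->.
Qed.

Lemma energyE (m : nat) (v : R -> 'rV[R]_m) (f : 'I_m -> R -> R) :
  (forall i, sqi mu (f i)) -> (forall i, is_quarter_laplacian (component v i) (f i)) ->
  energy v = \sum_i (\int[mu]_x (f i x ^+ 2))%R.
Proof.
move=> sf ul; rewrite /energy.
rewrite (@Ri_eq _ _ _ mu _ (fun x => \sum_i quarter_laplacian (component v i) x ^+ 2)); last first.
  move=> x; rewrite /enorm sqr_sqrtr; last by apply: sumr_ge0 => i _; exact: sqr_ge0.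
  by apply: eq_bigr => i _; rewrite mxE.
rewrite Ri_sum; last by move=> i; exact: (ql_choice (sf i) (ul i)).1.2.
by apply: eq_bigr => i _; exact: (ql_choice (sf i) (ul i)).2.
Qed.

End QL.

Section EulerLagrange.
Context {R : realType} {m : nat}.
Notation mu := (@lebesgue_measure R).
Notation m2 := (mu \x mu)%E.
Implicit Types (U : 'I_m -> R -> R) (phi : R -> R).

(** The constraint holds at every point; fields of the class of u are changed on a null set for this. *)
Definition unit_field U := (forall i, measurable_fun setT (U i)) /\ forall x, \sum_i U i x ^+ 2 = 1.

Definition energy_density U (z : R * R) : R := \sum_i D (U i) z ^+ 2.

Lemma unit_le1 U i x : unit_field U -> `|U i x| <= 1.
Proof.
move=> [_ HU]; rewrite -(@expr_le1 _ 2)// real_normK ?num_real// -(HU x).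
by rewrite (bigD1 i)//= lerDl; apply: sumr_ge0 => j _; exact: sqr_ge0.
Qed.

Section Variation.
Variables (U : 'I_m -> R -> R) (k : 'I_m) (phi : R -> R).
Hypotheses (hU : unit_field U).
Variables (B b : R).
Hypotheses (mphi : measurable_fun setT phi) (phiB : forall x, `|phi x| <= B) (phib : forall x, b < `|x| -> phi x = 0).

Let dlt (i : 'I_m) : R := (i == k)%:R.
Definition var_norm2 (t x : R) : R := 1 + t * (2 * (U k x * phi x) + t * (phi x * phi x)).
Definition var_norm t x := Num.sqrt (var_norm2 t x).
(** If r = |U + t phi e_k|, the projection of the variation is (U + t phi e_k) / r = U + t psi.  The quotient
    (r - 1) / t is written as ((r^2 - 1) / t) / (1 + r), which makes sense at t = 0. *)
Definition psi i t x : R := (phi x * dlt i + (-1) * (U i x * (2 * (U k x * phi x) + t * (phi x * phi x)) * (1 + var_norm t x)^-1)) * (var_norm t x)^-1.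

Lemma var_norm2E t x : \sum_i (U i x + t * (phi x * dlt i)) ^+ 2 = var_norm2 t x.
Proof.
rewrite (eq_bigr (fun i => U i x ^+ 2 + (2 * t * phi x * U i x + t ^+ 2 * phi x ^+ 2) * dlt i)).
  rewrite big_split/= hU.2 (bigD1 k)//= /dlt eqxx mulr1 big1 ?addr0; last first.
    by move=> i /negPf ->; rewrite mulr0.
  by rewrite /var_norm2; ring.
by move=> i _; rewrite /dlt; case: (i == k) => /=; ring.
Qed.

Let B0 : 0 <= B. Proof. by apply: le_trans (phiB 0). Qed.
Definition var_time : R := (2 * (2 * B + B * B + 1))^-1.

Lemma var_time_gt0 : 0 < var_time.
Proof. by rewrite invr_gt0 mulr_gt0// ltr_wpDl// addr_ge0 ?mulr_ge0. Qed.

Lemma var_time_le1 : var_time <= 1.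
Proof.
have h : 0 <= B * B by rewrite mulr_ge0.
rewrite invf_le1; last by rewrite mulr_gt0// ltr_wpDl// addr_ge0 ?mulr_ge0.
by have := B0; lra.
Qed.

Lemma var_norm2_ge t x : `|t| <= var_time -> 2^-1 ^+ 2 <= var_norm2 t x.
Proof.
move=> tt; have t1 := le_trans tt var_time_le1.
have h : `|t * (2 * (U k x * phi x) + t * (phi x * phi x))| <= 2^-1.
  rewrite normrM; apply: (@le_trans _ _ (var_time * (2 * B + B * B + 1))).
    apply: ler_pM => //; apply: le_trans (ler_normD _ _) _.
    apply: ler_wpDr => //; apply: lerD.
      rewrite normrM ger0_norm//; apply: ler_wpM2l => //; rewrite normrM -[leRHS]mul1r.
      by apply: ler_pM => //; exact: unit_le1.
    by rewrite normrM -[leRHS]mul1r; apply: ler_pM => //; rewrite normrM; apply: ler_pM.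
  rewrite /var_time invfM -mulrA mulVf ?mulr1//.
  by rewrite gt_eqF// ltr_wpDl// addr_ge0 ?mulr_ge0.
by move: h; rewrite ler_norml /var_norm2 => /andP[h _]; lra.
Qed.

Lemma var_norm_ge t x : `|t| <= var_time -> 2^-1 <= var_norm t x.
Proof.
move=> tt; rewrite /var_norm; have h2 : 0 <= 2^-1 :> R by [].
by rewrite -(ger0_norm h2) -sqrtr_sqr ler_wsqrtr// var_norm2_ge.
Qed.

Lemma psiE i t x : `|t| <= var_time -> (var_norm t x)^-1 * (U i x + t * (phi x * dlt i)) = U i x + t * psi i t x.
Proof.
move=> tt; have r0 := var_norm_ge x tt; have r1 : 0 < var_norm t x by apply: lt_le_trans r0.
have e : var_norm t x ^+ 2 = 1 + t * (2 * (U k x * phi x) + t * (phi x * phi x)).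
  by rewrite /var_norm sqr_sqrtr// (le_trans _ (var_norm2_ge x tt))// sqr_ge0.
rewrite /psi; set q := 2 * (U k x * phi x) + t * (phi x * phi x) in e *.
have tq : t * q = var_norm t x ^+ 2 - 1 by rewrite e; ring.
have n0 : var_norm t x != 0 by rewrite gt_eqF.
have n1 : 1 + var_norm t x != 0 by rewrite gt_eqF// ltr_wpDl.
apply: (mulfI n0); rewrite mulVKf// mulrDr.
rewrite (_ : var_norm t x * (t * _) = t * (phi x * dlt i) - U i x * (t * q) * (1 + var_norm t x)^-1); last by field; rewrite n0 n1.
by rewrite tq; field.
Qed.

Let SS x y : R := \sum_j `|U j x - U j y| + `|phi x - phi y|.
Let SS0 x y : 0 <= SS x y. Proof. by rewrite addr_ge0// sumr_ge0. Qed.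

Lemma psi_ulip i : ulip SS var_time (psi i).
Proof.
have t0 := ltW var_time_gt0.
have uU j : ulip SS var_time (fun _ => U j).
  apply: (@ulip_fun _ SS var_time SS0 (U j) 1) => //; first exact: hU.1.
    by move=> x; exact: unit_le1.
  by move=> x y; rewrite /SS (bigD1 j)//= -addrA lerDl addr_ge0// sumr_ge0.
have up : ulip SS var_time (fun _ => phi).
  by apply: (@ulip_fun _ SS var_time SS0 phi B) => // x y; rewrite /SS lerDr sumr_ge0.
have c c0 := @ulip_cst _ SS var_time SS0 c0.
have ut := @ulip_par _ SS var_time SS0 t0.
have uq : ulip SS var_time (fun t x => 2 * (U k x * phi x) + t * (phi x * phi x)).
  apply: ulipD => //; first by apply: ulipM => //; exact: ulipM.
  by apply: ulipM => //; exact: ulipM.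
have ur : ulip SS var_time var_norm.
  apply: (@ulip_sqrt _ SS var_time SS0 _ (2^-1)) => //; last exact: var_norm2_ge.
  by apply: ulipD => //; exact: ulipM.
apply: ulipM => //; last first.
  by apply: (@ulipV _ SS var_time SS0 _ (2^-1)) => // t x; exact: var_norm_ge.
apply: ulipD => //; first exact: ulipM.
apply: ulipM => //; apply: ulipM => //; first exact: ulipM.
apply: (@ulipV _ SS var_time SS0 _ 1) => //; first exact: ulipD.
by move=> t x tt; rewrite lerDl sqrtr_ge0.
Qed.

Lemma psi_supp i t x : b < `|x| -> psi i t x = 0.
Proof. by move=> /phib h; rewrite /psi h; ring. Qed.

Lemma psi0E i x : psi i 0 x = phi x * dlt i - U i x * (U k x * phi x).
Proof. by rewrite /psi /var_norm /var_norm2 !mul0r !addr0 sqrtr1; field. Qed.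

Lemma psi_cvg i (t_ : nat -> R) x : t_ n @[n --> \oo] --> 0 -> psi i (t_ n) x @[n --> \oo] --> psi i 0 x.
Proof.
move=> ct; have cc (a : R) : (fun _ : nat => a) n @[n --> \oo] --> a by exact: cvg_cst.
have cq : (2 * (U k x * phi x) + t_ n * (phi x * phi x)) @[n --> \oo] --> (2 * (U k x * phi x) + 0 * (phi x * phi x)).
  by apply: cvgD => //; apply: cvgM.
have cr : var_norm (t_ n) x @[n --> \oo] --> var_norm 0 x.
  apply: (@continuous_cvg _ _ _ _ _ _ (@Num.sqrt R)); first exact: sqrt_continuous.
  by apply: cvgD => //; apply: cvgM.
have r1 : var_norm 0 x = 1 by rewrite /var_norm /var_norm2 !mul0r !addr0 sqrtr1.
apply: cvgM; last by apply: cvgV => //; rewrite r1 oner_neq0.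
apply: cvgD => //; apply: cvgM => //; apply: cvgM; first exact: cvgM.
by apply: cvgV; [rewrite r1 -(natrD _ 1 1) pnatr_eq0|exact: cvgD].
Qed.

Lemma psi_gag i : (forall j, sqi m2 (D (U j))) -> sqi m2 (D phi) ->
  exists2 C : R, 0 <= C & forall t, `|t| <= var_time ->
    [/\ measurable_fun setT (psi i t), exists B' : R, forall x, `|psi i t x| <= B',
      sqi m2 (D (psi i t)) & (\int[m2]_z (D (psi i t) z ^+ 2) <= C)%R].
Proof.
move=> sU sp; have [C C0 HC] := psi_ulip i.
pose SD (z : R * R) := C * (\sum_j `|D (U j) z| + `|D phi z|).
have sabs (w : R * R -> R) : sqi m2 w -> sqi m2 (fun z => `|w z|).
  move=> [mw iw]; split; first exact: measurableT_comp.
  rewrite (_ : (fun z => _ ^+ 2) = (fun z => w z ^+ 2))//.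
  by apply/funext => z; rewrite real_normK ?num_real.
have sSD : sqi m2 SD.
  apply: sqiZ; apply: sqiD; last exact: sabs.
  elim: (index_enum _) => [|j s IH].
    under eq_fun do rewrite big_nil; split => //; under eq_fun do rewrite expr0n; exact: intg0.
  by under eq_fun do rewrite big_cons; apply: sqiD => //; exact: sabs.
exists (\int[m2]_z (SD z ^+ 2))%R; first by apply: Ri_ge0 => z; exact: sqr_ge0.
move=> t tt; have [mp bp lp] := HC t tt.
have le z : `|D (psi i t) z| <= `|SD z|.
  rewrite (ger0_norm (_ : 0 <= SD z)); last by rewrite mulr_ge0// addr_ge0// sumr_ge0.
  rewrite /D normrM; apply: le_trans (ler_wpM2r (normr_ge0 _) (lp _ _)) _.
  rewrite /SD /SS -mulrA; apply: ler_wpM2l => //.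
  rewrite mulrDl mulr_suml le_eqVlt; apply/orP; left; apply/eqP.
  by congr (_ + _); [apply: eq_bigr => j _|]; rewrite /D normrM.
have sD := @sqi_le _ _ _ m2 _ _ (meas_D mp) sSD le.
split => //; first by exists C.
apply: Ri_le; [exact: sD.2|exact: sSD.2|] => z.
by rewrite -[leLHS]real_normK ?num_real// -[leRHS]real_normK ?num_real//; apply: lerXn2r; rewrite ?nnegrE.
Qed.

End Variation.

Lemma meas_energy_density U : (forall i, measurable_fun setT (U i)) -> measurable_fun setT (energy_density U).
Proof. by move=> mU; apply: measurable_sum => i; apply: measurable_funX; exact: meas_D. Qed.

Lemma intg_energy_density U : (forall i, sqi m2 (D (U i))) -> intg m2 (energy_density U).
Proof. by move=> sU; apply: intg_sum => i; exact: (sU i).2. Qed.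

Lemma energy_density_ge0 U z : 0 <= energy_density U z.
Proof. by apply: sumr_ge0 => i _; exact: sqr_ge0. Qed.

Lemma energy_density_swap U z : energy_density U (z.2, z.1) = energy_density U z.
Proof.
apply: eq_bigr => i _; rewrite /D /= (_ : _ / _ = (U i z.1 - U i z.2) / (z.1 - z.2))//.
by rewrite -[U i z.2 - _]opprB -[z.2 - z.1]opprB invrN mulrNN.
Qed.

(** On the sphere the increment of U is orthogonal to the sum of the two values. *)
Lemma sphere_polar U q z : unit_field U ->
  \sum_i D (U i) z * D (fun x => U i x * q x) z = 2^-1 * (energy_density U z * q z.1 + energy_density U z * q z.2).
Proof.
move=> [_ HU]; rewrite -mulrDr /energy_density mulr_suml mulr_sumr.
set d := (z.1 - z.2)^-1.
pose a i := U i z.1; pose b i := U i z.2.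
have e1 : \sum_i a i ^+ 2 = 1 by exact: HU.
have e2 : \sum_i b i ^+ 2 = 1 by exact: HU.
rewrite (eq_bigr (fun i => d ^+ 2 * (q z.1 - q z.2) / 2 * (a i ^+ 2 - b i ^+ 2) +
    2^-1 * (D (U i) z ^+ 2 * (q z.1 + q z.2)))).
  by rewrite big_split/= -mulr_sumr sumrB e1 e2 subrr mulr0 add0r.
by move=> i _; rewrite /D -/d -/(a i) -/(b i); field.
Qed.

Lemma cvg_sumR (I : Type) (s : seq I) (f : I -> nat -> R) (l : I -> R) :
  (forall i, f i n @[n --> \oo] --> l i) ->
  (\sum_(i <- s) f i n) @[n --> \oo] --> \sum_(i <- s) l i.
Proof.
move=> H; elim: s => [|i s IH].
  by rewrite big_nil; under eq_fun do rewrite big_nil; exact: cvg_cst.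
by rewrite big_cons; under eq_fun do rewrite big_cons; exact: cvgD.
Qed.

(** E t = E 0 + (2 t <DU, D psi_t> + t^2 ||D psi_t||^2) / c_half, so <DU, D psi_t> tends to 0; it also tends to
    <DU, D psi_0> by weak convergence.  As psi_0 = phi (e_k - U_k U), [sphere_polar] with q = U_k phi turns the
    vanishing of the latter into the equation.  E is known only on the projected variations, for which it is a sum of
    squared norms. *)
Lemma euler_lagrange U (f : 'I_m -> R -> R) (k : 'I_m) phi (E : R -> R) :
  unit_field U -> (forall i, sqi mu (f i)) -> (forall i, is_quarter_laplacian (U i) (f i)) ->
  is_test_function (phi : R -> R^o) ->
  (forall t (F : 'I_m -> R -> R), (forall x, 2^-1 ^+ 2 <= var_norm2 U k phi t x) ->
     (forall x i, (var_norm U k phi t x)^-1 * (U i x + t * (phi x * (i == k)%:R)) = U i x + t * psi U k phi i t x) ->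
     (forall i, measurable_fun setT (fun x => U i x + t * psi U k phi i t x)) ->
     (forall i, sqi mu (F i)) ->
     (forall i, is_quarter_laplacian (fun x => U i x + t * psi U k phi i t x) (F i)) ->
     E t = \sum_i (\int[mu]_x (F i x ^+ 2))%R) ->
  is_derive (0:R) (1:R) (E : R -> R^o) 0 ->
  (\int[m2]_z (D (U k) z * D phi z) = \int[m2]_z (energy_density U z * (U k z.1 * phi z.1)))%R.
Proof.
move=> hU sf ul tp HE dE.
have U1 i x := unit_le1 i x hU; have mU := hU.1.
have sU i : sqi m2 (D (U i)) by exact: lap_finite (mU i) (U1 i) (sf i) (ul i).
have [[ip [B HB] _] _ _ _] := test_admiss tp.
have mp := intg_meas ip.
have [b Hb] : exists b : R, forall x, b < `|x| -> phi x = 0.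
  by have [F [r [_ <- _ Fr]]] := test_elim tp; exists r => x; exact: Fr.
have sp := test_gag tp.
pose t0 := var_time B; have t00 : 0 < t0 by exact: (var_time_gt0 HB).
pose I i t := (\int[m2]_z (D (U i) z * D (psi U k phi i t) z))%R.
pose G i t := (\int[m2]_z (D (psi U k phi i t) z ^+ 2))%R.
have PG i := psi_gag k hU mp HB i sU sp.
have step t : `|t| <= t0 -> E t = \sum_i ((\int[mu]_x (f i x ^+ 2))%R + (2 * t * (c_half^-1 * I i t) + t ^+ 2 * (c_half^-1 * G i t))).
  move=> tt.
  have ex i : exists g, [/\ sqi mu g, is_quarter_laplacian (psi U k phi i t) g,
      (\int[mu]_x (f i x * g x))%R = c_half^-1 * I i t & (\int[mu]_x (g x ^+ 2))%R = c_half^-1 * G i t].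
    have [C _ /(_ t tt)[m1 [B' HB'] sD _]] := PG i.
    have ps x : b < `|x| -> psi U k phi i t x = 0 by exact: psi_supp.
    have [g [sg gl Hg]] := lap_exists m1 HB' ps sD.
    exists g; split => //; first exact: (Hg (U i) (f i) 1 (mU i) (U1 i) (sf i) (ul i) (sU i)).
    exact: (Hg _ g B' m1 HB' sg gl sD).
  have [g Hg] := choice ex.
  have sF i : sqi mu (fun x => f i x + t * g i x).
    by apply: sqiD => //; apply: sqiZ; have [] := Hg i.
  rewrite (HE t (fun i x => f i x + t * g i x)) //.
  - apply: eq_bigr => i _; have [sg gl e1 e2] := Hg i.
    rewrite (Ri_sqrD (sf i) (sqiZ t sg)) -addrA; congr (_ + (_ + _)).
      rewrite -e1 -mulrA; congr (_ * _); rewrite -(RiZ t (sqiM (sf i) sg)).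
      by apply: Ri_eq => x; ring.
    rewrite -e2 -(RiZ (t ^+ 2) sg.2).
    by apply: Ri_eq => x; ring.
  - by move=> x; exact: (var_norm2_ge k hU HB x tt).
  - by move=> x i; exact: (psiE k hU HB i x tt).
  - move=> i; have [C _ /(_ t tt)[m1 _ _ _]] := PG i.
    by apply: measurable_funD => //; exact: measurable_funM.
  - by move=> i; apply: ql_lin => //; have [] := Hg i.
pose t_ n : R := t0 * n.+1%:R^-1.
have tp0 n : 0 < t_ n by apply: divr_gt0; rewrite // ltr0n.
have tn0 n : t_ n != 0 by rewrite gt_eqF.
have tt n : `|t_ n| <= t0.
  by rewrite (ger0_norm (ltW (tp0 n))) ler_piMr ?(ltW t00)// invf_le1 ?ltr0n// ler1n.
have ct : t_ n @[n --> \oo] --> (0:R).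
  by have := cvgM (cvg_cst t0) (@cvg_harmonic R); rewrite mulr0; apply.
have E0 : E 0 = \sum_i (\int[mu]_x (f i x ^+ 2))%R.
  rewrite step ?normr0 ?(ltW t00)//; apply: eq_bigr => i _; ring.
have dq n : (t_ n)^-1 * (E (t_ n) - E 0) = 2 * c_half^-1 * (\sum_i I i (t_ n)) + t_ n * (c_half^-1 * \sum_i G i (t_ n)).
  rewrite step// E0 big_split/= addrAC subrr add0r !mulr_sumr -[RHS]big_split/=.
  apply: eq_bigr => i _; have sn := tn0 n; have kn : c_half != 0 :> R by rewrite gt_eqF ?c_half_gt0.
  by move: (t_ n) sn => s sn; field; rewrite kn.
have c1 : (t_ n)^-1 * (E (t_ n) - E 0) @[n --> \oo] --> (0:R).
  have [dv ev] := dE.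
  have := dv => /cvg_ex[l cl]; have el : l = 0 by rewrite -ev; apply/esym; exact: cvg_lim.
  rewrite el in cl.
  have /cvgr_dnbhsP/(_ t_ (conj tn0 ct)) := cl.
  by apply: cvg_trans; apply: near_eq_cvg; apply: nearW => n; rewrite /= scalerRE addr0 scalerRE mulr1.
have c2 i : I i (t_ n) @[n --> \oo] --> I i 0.
  have [C _ HC] := PG i.
  have cP : {ae (@plane R), forall z, D (psi U k phi i (t_ n)) z @[n --> \oo] --> D (psi U k phi i 0) z}.
    apply: nearW => z; apply: cvgM; last exact: cvg_cst.
    by apply: cvgB; exact: psi_cvg.
  have [] := @weak_cvg _ _ _ m2 (D (U i)) (fun n => D (psi U k phi i (t_ n))) (D (psi U k phi i 0)) C (sU i) _ _ cP _ => //.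
  - by move=> n; have [] := HC _ (tt n).
  - by have [] := HC 0; [rewrite normr0 ltW|move=> m1 _ _ _; exact: meas_D].
  - by move=> n; have [] := HC _ (tt n).
have c3 : (\sum_i I i (t_ n)) @[n --> \oo] --> \sum_i I i 0.
  by apply: (cvg_sumR (f := fun i n => I i (t_ n))) => i; exact: c2.
have [CG HCG] : exists CG : R, forall n, `|c_half^-1 * \sum_i G i (t_ n)| <= CG.
  have exC i : exists C : R, forall n, G i (t_ n) <= C.
    by have [C _ HC] := PG i; exists C => n; have [] := HC _ (tt n).
  have [Cf HCf] := choice exC.
  exists (`|c_half^-1| * \sum_i Cf i) => n; rewrite normrM; apply: ler_wpM2l => //.
  rewrite ger0_norm; last by apply: sumr_ge0 => i _; apply: Ri_ge0 => z; exact: sqr_ge0.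
  by apply: ler_sum => i _; exact: HCf.
have c4 : t_ n * (c_half^-1 * \sum_i G i (t_ n)) @[n --> \oo] --> (0:R).
  have c5 : (t_ n * CG) @[n --> \oo] --> (0:R) by have := cvgM ct (cvg_cst CG); rewrite mul0r; apply.
  apply: norm_cvg0; apply: (squeeze_cvgr _ (cvg_cst 0) c5); apply: nearW => n.
  by rewrite normr_ge0 normrM /= (ger0_norm (ltW (tp0 n))); apply: ler_wpM2l => //; exact: ltW.
rewrite (funext dq) in c1.
have c6 : 2 * c_half^-1 * (\sum_i I i (t_ n)) + t_ n * (c_half^-1 * \sum_i G i (t_ n)) @[n --> \oo] --> 2 * c_half^-1 * (\sum_i I i 0) + 0.
  by apply: cvgD => //; apply: cvgM => //; exact: cvg_cst.
have S1 : 2 * c_half^-1 * (\sum_i I i 0) + 0 = 0 by exact: (cvg_unique _ c6 c1).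
have kn : 2 * c_half^-1 != 0 :> R by rewrite gt_eqF// mulr_gt0// invr_gt0 c_half_gt0.
have S0 : \sum_i I i 0 = 0 by move/eqP: S1; rewrite addr0 mulf_eq0 (negPf kn) => /eqP.
have sp0 i : sqi m2 (D (psi U k phi i 0)).
  by have [C _ /(_ 0)[]] := PG i; rewrite ?normr0 ?(ltW t00).
have iN := intg_energy_density sU.
pose q x := U k x * phi x.
have mq : measurable_fun setT q by exact: measurable_funM.
have qB x : `|q x| <= B.
  by rewrite normrM -[leRHS]mul1r; apply: ler_pM.
have iq1 : intg m2 (fun z => energy_density U z * q z.1).
  have mq1 : measurable_fun setT (fun z : R * R => q z.1) by exact: (measurableT_comp mq measurable_fst).
  have := @intg_Mb _ _ _ m2 (fun z => q z.1) (energy_density U) B mq1 iN (fun z => qB _).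
  by congr (intg _ _); apply/funext => z; rewrite mulrC.
have [iq2 eq2] := intg_swap iq1.
have iDD := sqiM (sU k) sp.
have pt z : \sum_i D (U i) z * D (psi U k phi i 0) z = D (U k) z * D phi z - 2^-1 * (energy_density U z * q z.1 + energy_density U (z.2, z.1) * q z.2).
  rewrite energy_density_swap -(sphere_polar q z hU).
  rewrite (eq_bigr (fun i => D (U i) z * D phi z * (i == k)%:R - D (U i) z * D (fun x => U i x * q x) z)).
    rewrite sumrB (bigD1 k)//= eqxx mulr1 big1 ?addr0// => i /negPf ->; by rewrite mulr0.
  by move=> i _; rewrite /D !psi0E /q; ring.
rewrite /I -(@Ri_sum _ _ _ m2) in S0; last by move=> i; exact: sqiM.
rewrite (@Ri_eq _ _ _ m2 _ _ pt) in S0.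
have iq3 := intgZ 2^-1 (intgD iq1 iq2).
rewrite (RiB iDD iq3) (RiZ _ (intgD iq1 iq2)) (RiD iq1 iq2) eq2 in S0.
have hd (a : R) : 2^-1 * (a + a) = a by field.
move/eqP: S0; rewrite subr_eq0 => /eqP e; apply: (etrans e); exact: hd.
Qed.

End EulerLagrange.

(** * The equation for bounded tests of finite energy *)

Section WeakForm.
Context {R : realType} {m : nat}.
Notation mu := (@lebesgue_measure R).
Notation m2 := (mu \x mu)%E.
Implicit Types (U : 'I_m -> R -> R) (phi w : R -> R).

Lemma sqr_bound (a B : R) : `|a| <= B -> a ^+ 2 <= B ^+ 2.
Proof.
move=> aB; rewrite -[a ^+ 2]real_normK ?num_real//.
by apply: lerXn2r => //; rewrite ?nnegrE// (le_trans _ aB).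
Qed.

Lemma gagM w phi (A B : R) : measurable_fun setT w -> measurable_fun setT phi ->
  (forall x, `|w x| <= A) -> (forall x, `|phi x| <= B) ->
  sqi m2 (D w) -> sqi m2 (D phi) -> sqi m2 (D (fun x => w x * phi x)) /\
  (\int[m2]_z (D (fun x => w x * phi x) z ^+ 2) <=
   2 * (A ^+ 2 * (\int[m2]_z (D phi z ^+ 2))%R + B ^+ 2 * (\int[m2]_z (D w z ^+ 2))%R))%R.
Proof.
move=> mw mp wA pB sw sp.
have mD : measurable_fun setT (D (fun x => w x * phi x)) by apply: meas_D; exact: measurable_funM.
have iB := intgZ 2 (intgD (intgZ (A ^+ 2) sp.2) (intgZ (B ^+ 2) sw.2)).
have le z : D (fun x => w x * phi x) z ^+ 2 <= 2 * (A ^+ 2 * D phi z ^+ 2 + B ^+ 2 * D w z ^+ 2).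
  have e : D (fun x => w x * phi x) z = w z.1 * D phi z + phi z.2 * D w z by rewrite /D; ring.
  have h1 := sqr_bound (wA z.1); have h2 := sqr_bound (pB z.2).
  rewrite e; apply: (@le_trans _ _ (2 * (w z.1 ^+ 2 * D phi z ^+ 2 + phi z.2 ^+ 2 * D w z ^+ 2))).
    have := sqr_ge0 (w z.1 * D phi z - phi z.2 * D w z).
    move: (w z.1) (D phi z) (phi z.2) (D w z) => a b c d; rewrite -!exprMn; nra.
  apply: ler_wpM2l => //; apply: lerD; apply: ler_wpM2r => //; exact: sqr_ge0.
have iM : intg m2 (fun z => D (fun x => w x * phi x) z ^+ 2).
  apply: (@intg_le _ _ _ m2 _ _ _ iB); first exact: measurable_funX.
  by move=> z; rewrite ger0_norm ?sqr_ge0.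
split => //; apply: le_trans (Ri_le iM iB le) _.
rewrite (RiZ 2 (intgD (intgZ (A ^+ 2) sp.2) (intgZ (B ^+ 2) sw.2))).
by rewrite (RiD (intgZ (A ^+ 2) sp.2) (intgZ (B ^+ 2) sw.2)) (RiZ _ sp.2) (RiZ _ sw.2).
Qed.

(** Up to normalisation, (- Laplacian)^(1/2) U = |dU|^2 U in weak form.  The tests need not be smooth or
    compactly supported: Poisson kernels and cutoffs with quadratic tails will be used. *)
Definition harmonic U := forall (k : 'I_m) phi (B : R), measurable_fun setT phi ->
  (forall x, `|phi x| <= B) -> sqi m2 (D phi) ->
  (\int[m2]_z (D (U k) z * D phi z) = \int[m2]_z (energy_density U z * (U k z.1 * phi z.1)))%R.

Lemma intg_energy_density1 U phi (B : R) : (forall i, sqi m2 (D (U i))) -> measurable_fun setT phi ->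
  (forall x, `|phi x| <= B) -> intg m2 (fun z => energy_density U z * phi z.1).
Proof.
move=> sU mp pB; have mq : measurable_fun setT (fun z : R * R => phi z.1) by exact: (measurableT_comp mp measurable_fst).
have := @intg_Mb _ _ _ m2 (fun z => phi z.1) (energy_density U) B mq (intg_energy_density sU) (fun z => pB _).
by congr (intg _ _); apply/funext => z; rewrite mulrC.
Qed.

Lemma energy_density1_dct U (p_ : nat -> R -> R) (p : R -> R) (B : R) : (forall i, sqi m2 (D (U i))) ->
  (forall n, measurable_fun setT (p_ n)) -> measurable_fun setT p ->
  (forall n x, `|p_ n x| <= B) -> {ae mu, forall x, p_ n x @[n --> \oo] --> p x} ->
  (\int[m2]_z (energy_density U z * p_ n z.1))%R @[n --> \oo] --> (\int[m2]_z (energy_density U z * p z.1))%R.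
Proof.
move=> sU mp_ mp pB cp; have iN := intg_energy_density sU; have mN := intg_meas iN.
have m1 q : measurable_fun setT q -> measurable_fun setT (fun z : R * R => energy_density U z * q z.1).
  by move=> mq; apply: measurable_funM; [exact: mN|exact: (measurableT_comp mq measurable_fst)].
have [] := @Ri_dct _ _ _ m2 (fun n z => energy_density U z * p_ n z.1) (fun z => energy_density U z * p z.1) (fun z => B * energy_density U z) => //.
- by move=> n; exact: m1.
- exact: m1.
- exact: intgZ.
- apply: (@filterS _ _ (ae_filter_ringOfSetsType (@plane R)) _ _ _ (ae_fst cp)) => z cz.
  by apply: cvgM => //; exact: cvg_cst.
- move=> n z; rewrite normrM (ger0_norm (energy_density_ge0 _ _)) mulrC; apply: ler_wpM2r => //; exact: energy_density_ge0.
Qed.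

(** Mollification reaches bounded tests of compact support, and tents reach the others; in both steps
    difference quotients converge weakly. *)
Lemma harmonic_ext U : unit_field U -> (forall i, sqi m2 (D (U i))) ->
  (forall (k : 'I_m) phi, is_test_function (phi : R -> R^o) ->
  (\int[m2]_z (D (U k) z * D phi z) = \int[m2]_z (energy_density U z * (U k z.1 * phi z.1)))%R) ->
  harmonic U.
Proof.
move=> hU sU HT k.
have mUk := hU.1 k; have U1 x := unit_le1 k x hU.
have cs phi (B b : R) : measurable_fun setT phi -> (forall x, `|phi x| <= B) -> (forall x, b < `|x| -> phi x = 0) ->
    sqi m2 (D phi) ->
    (\int[m2]_z (D (U k) z * D phi z) = \int[m2]_z (energy_density U z * (U k z.1 * phi z.1)))%R.
  move=> mp pB pb sp; have B0 : 0 <= B by apply: le_trans (pB 0).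
  have ip : intg mu phi.
    have [] := @supp_int _ phi B (Num.max 0 b) mp _ B0 pB _ => //; first by rewrite le_max lexx.
    by move=> x; rewrite gt_max => /andP[_]; exact: pb.
  have c1 := (mollify_gag_cvg mp pB sp).1 _ (sU k).
  rewrite (funext (fun n => HT k _ (mollify_test n ip pb))) in c1.
  apply: (cvg_unique _ c1) => //.
  apply: (@energy_density1_dct U (fun n x => U k x * mollify n phi x) (fun x => U k x * phi x) B sU).
  - by move=> n; apply: measurable_funM => //; exact: meas_mollify.
  - exact: measurable_funM.
  - by move=> n x; rewrite normrM -[leRHS]mul1r; apply: ler_pM => //; exact: mollify_bound.
  - apply: (@filterS _ _ (ae_filter_ringOfSetsType mu) _ _ _ (mollify_cvg mp pB)) => x cx.
    by apply: cvgM => //; exact: cvg_cst.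
move=> phi B mp pB sp; have B0 : 0 <= B by apply: le_trans (pB 0).
pose w n x := tent n x * phi x.
have wB n x : `|w n x| <= B.
  by rewrite normrM -[leRHS]mul1r; apply: ler_pM => //; exact: tent_bound.
have mw n : measurable_fun setT (w n) by apply: measurable_funM => //; exact: meas_tent.
have ws n x : n.+1%:R < `|x| -> w n x = 0 by move=> h; rewrite /w tent_supp// mul0r.
pose C := 2 * ((\int[m2]_z (D phi z ^+ 2))%R + B ^+ 2 * (24 * pi)) : R.
have sw n : sqi m2 (D (w n)) /\ (\int[m2]_z (D (w n) z ^+ 2) <= C)%R.
  have [sT gT] := @tent_gag R n.
  have [s1 g1] := gagM (@meas_tent R n) mp (@tent_bound R n) pB sT sp.
  split => //; apply: le_trans g1 _; rewrite /C expr1n mul1r; apply: ler_wpM2l => //.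
  rewrite lerD2l; apply: ler_wpM2l => //; exact: sqr_ge0.
have cw x : w n x @[n --> \oo] --> phi x.
  by have := cvgM (@tent_cvg R x) (cvg_cst (phi x)); rewrite mul1r; apply.
have [_ _ c1] := @weak_cvg _ _ _ m2 (D (U k)) (fun n => D (w n)) (D phi) C (sU k)
   (fun n => (sw n).1) sp.1 (aeW (@plane R) (fun z => cvgM (cvgB (cw z.1) (cw z.2)) (cvg_cst (z.1 - z.2)^-1))) (fun n => (sw n).2).
rewrite (funext (fun n => cs _ _ _ (mw n) (wB n) (@ws n) (sw n).1)) in c1.
apply: (cvg_unique _ c1) => //.
apply: (@energy_density1_dct U (fun n x => U k x * w n x) (fun x => U k x * phi x) B sU).
- by move=> n; apply: measurable_funM.
- exact: measurable_funM.
- by move=> n x; rewrite normrM -[leRHS]mul1r; apply: ler_pM.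
- by apply: aeW => x; apply: cvgM => //; exact: cvg_cst.
Qed.

Lemma test_vec (phi : R -> R) (e : 'rV[R]_m) : is_test_function (phi : R -> R^o) -> e != 0 ->
  is_test_function (fun x => phi x *: e).
Proof.
move=> tp e0; have [F [r [sF F0 _ _]]] := test_elim tp.
have dv n (x : R) : is_derive x (1:R) (fun y => F n y *: e) (F n.+1 x *: e).
  have [d1 d2] := sF n x.
  have c : (fun h : R => h^-1 *: (((fun y => F n y *: e) \o shift x) (h *: (1:R)) - F n x *: e)) @ 0^' --> F n.+1 x *: e.
    rewrite -d2; have H := cvgZ d1 (cvg_cst e); apply: cvg_trans (H _ _).
    by apply: near_eq_cvg; apply: nearW => h /=; rewrite -scalerBl scalerA.
  by apply: DeriveDef; [apply/cvg_ex; eexists; exact: c|exact: cvg_lim].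
split.
  suff E n : derive1n n (fun x => phi x *: e) = (fun x => F n x *: e).
    by move=> n x; rewrite E; have [] := dv n x.
  elim: n => [|n IH]; first by rewrite /= F0.
  by rewrite /derive1n /= in IH *; rewrite IH; apply/funext => x; rewrite derive1E; apply: derive_val; exact: dv.
have [_] := tp; congr (compact (closure _)); apply/seteqP; split => x /=; rewrite scaler_eq0 (negPf e0) orbF//.
Qed.

Lemma weak_harmonic_field (u : R -> 'rV[R]_m) : (1 <= m)%N -> weak_half_harmonic u ->
  exists U, [/\ unit_field U, forall i, sqi m2 (D (U i)), harmonic U &
    {ae mu, forall x, forall i, u x ord0 i = U i x}].
Proof.
move=> m1 [[hH us] hv].
have i0 : 'I_m := Ordinal m1.
have mu1 i : measurable_fun setT (component u i) := (hH i).1.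
pose A : set R := [set x | \sum_i component u i x ^+ 2 = 1].
have mA : measurable A.
  have ms : measurable_fun setT (fun x => \sum_i component u i x ^+ 2).
    by apply: measurable_sum => i; exact: measurable_funX.
  by have := ms measurableT [set (1:R)] (measurable_set1 _); rewrite setTI.
(* On the null set where |u| is not 1 the field takes the value of a fixed basis vector. *)
pose U i x : R := \1_A x * component u i x + (1 - \1_A x) * (i == i0)%:R.
have uU : {ae mu, forall x, forall i, u x ord0 i = U i x}.
  apply: (@filterS _ _ (ae_filter_ringOfSetsType mu) _ _ _ us) => x sx i.
  rewrite /U indicE mem_set ?mul1r ?subrr ?mul0r ?addr0//.
  have s0 : 0 <= \sum_i component u i x ^+ 2 by apply: sumr_ge0 => j _; exact: sqr_ge0.
  by rewrite /A/= -[LHS]sqr_sqrtr//; move: sx; rewrite /sphere/= /enorm => ->; rewrite expr1n.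
have mU i : measurable_fun setT (U i).
  have mI : measurable_fun setT (\1_A : R -> R) by exact: measurable_indic.
  by apply: measurable_funD; apply: measurable_funM => //; exact: measurable_funB.
have hU : unit_field U.
  split => // x; rewrite /U indicE; case: (boolP (x \in A)) => [|_].
    rewrite inE /A/= => xA; apply: etrans xA; apply: eq_bigr => i _; by rewrite mul1r subrr mul0r addr0.
  rewrite (bigD1 i0)//= eqxx big1; first by rewrite subr0 !mul1r mul0r add0r expr1n addr0.
  by move=> i /negPf ->; rewrite mul0r mulr0 addr0 expr0n.
have aeU i : {ae mu, forall x, component u i x = U i x}.
  by apply: (@filterS _ _ (ae_filter_ringOfSetsType mu) _ _ _ uU) => x /(_ i).
have exf i : exists f, sqi mu f /\ is_quarter_laplacian (U i) f.
  have [_ [f [/Lfun2P sf ul]]] := hH i; exists f; split => //; exact: (ql_ae (mU i) (aeU i)).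
have [f Hf] := choice exf.
have sU i : sqi m2 (D (U i)).
  by apply: (lap_finite (mU i) _ (Hf i).1 (Hf i).2) => x; exact: unit_le1.
exists U; split => //; apply: harmonic_ext => // k phi tp.
pose e : 'rV[R]_m := delta_mx ord0 k.
have e0 : e != 0.
  by apply/eqP => /matrixP/(_ ord0 k)/eqP; rewrite !mxE !eqxx oner_eq0.
have dE := hv _ (test_vec tp e0).
have mp : measurable_fun setT phi by have [_ _] := test_admiss tp; have [[/intg_meas]] := test_admiss tp.
apply: (euler_lagrange hU (fun i => (Hf i).1) (fun i => (Hf i).2) tp _ dE).
move=> t F rge pE mF sF uF; apply: energyE => // i.
have mr : measurable_fun setT (fun x => enorm (u x + t *: (phi x *: e))).
  apply: (measurableT_comp (@meas_sqrt R)); apply: measurable_sum => j; apply: measurable_funX.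
  rewrite (_ : (fun x => _) = (fun x => component u j x + t * (phi x * e ord0 j))).
    by apply: measurable_funD => //; apply: measurable_funM => //; exact: measurable_funM.
  by apply/funext => x; rewrite !mxE.
apply: (ql_ae _ _ (uF i)).
  rewrite (_ : component _ i = (fun x => (enorm (u x + t *: (phi x *: e)))^-1 * (component u i x + t * (phi x * e ord0 i)))).
    apply: measurable_funM; first exact: meas_funV.
    by apply: measurable_funD => //; apply: measurable_funM => //; exact: measurable_funM.
  by apply/funext => x; rewrite /component /sphere_proj !mxE.
apply: (@filterS _ _ (ae_filter_ringOfSetsType mu) _ _ _ uU) => x ux.
rewrite -pE /component /sphere_proj !mxE eqxx ux; congr (_^-1 * _).
rewrite /var_norm /enorm; congr Num.sqrt; rewrite -(var_norm2E k phi hU); apply: eq_bigr => j _.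
by rewrite !mxE eqxx ux.
Qed.

End WeakForm.

(** * The source term is bounded by the rate of energy *)

Section PoissonKernel.
Context {R : realType}.
Notation mu := (@lebesgue_measure R).
Notation m2 := (mu \x mu)%E.

Definition poisson (t x : R) : R := t / (x ^+ 2 + t ^+ 2).
(** [cutoff] at scale t has t-derivative twice [cutoff_rate]. *)
Definition cutoff_rate (t x : R) : R := t * x ^+ 2 / (x ^+ 2 + t ^+ 2) ^+ 2.
Definition cutoff (t x : R) : R := t ^+ 2 / (x ^+ 2 + t ^+ 2).

Lemma den_gt0 (t x : R) : 0 < t -> 0 < x ^+ 2 + t ^+ 2.
Proof. by move=> t0; rewrite ltr_wpDl ?sqr_ge0// exprn_gt0. Qed.

Lemma poisson_ge0 t x : 0 < t -> 0 <= poisson t x.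
Proof. by move=> t0; rewrite divr_ge0 ?(ltW t0) ?(ltW (den_gt0 x t0)). Qed.

Lemma cutoff_rate_ge0 t x : 0 < t -> 0 <= cutoff_rate t x.
Proof. by move=> t0; rewrite divr_ge0 ?sqr_ge0// mulr_ge0 ?sqr_ge0 ?(ltW t0). Qed.

Lemma cutoff_ge0 t x : 0 < t -> 0 <= cutoff t x.
Proof. by move=> t0; rewrite divr_ge0 ?sqr_ge0// ltW// den_gt0. Qed.

Lemma cutoff_le1 t x : 0 < t -> cutoff t x <= 1.
Proof. by move=> t0; rewrite ler_pdivrMr ?den_gt0// mul1r lerDr sqr_ge0. Qed.

Lemma cutoffE t x : cutoff t x = t * poisson t x.
Proof. by rewrite /cutoff /poisson; ring. Qed.

Lemma cutoff_rate_cutoff t x : 0 < t -> t * cutoff_rate t x <= cutoff t x.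
Proof.
move=> t0; have d0 := den_gt0 x t0; rewrite /cutoff_rate /cutoff.
rewrite (_ : t * _ = t ^+ 2 / (x ^+ 2 + t ^+ 2) * (x ^+ 2 / (x ^+ 2 + t ^+ 2))); last by field; rewrite gt_eqF.
rewrite ler_piMr ?cutoff_ge0// ler_pdivrMr// mul1r lerDl sqr_ge0//.
Qed.

Lemma poisson_le t x : 0 < t -> poisson t x <= t^-1.
Proof.
move=> t0; have := cutoff_le1 x t0; rewrite cutoffE -ler_pdivlMl// mulr1; exact.
Qed.

Lemma meas_den t : measurable_fun setT (fun x : R => (x ^+ 2 + t ^+ 2)^-1).
Proof. by apply: meas_funV; apply: measurable_funD => //; exact: measurable_funX. Qed.

Lemma meas_poisson t : measurable_fun setT (poisson t).
Proof. by apply: measurable_funM => //; exact: meas_den. Qed.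

Lemma meas_cutoff t : measurable_fun setT (cutoff t).
Proof. by apply: measurable_funM => //; exact: meas_den. Qed.

Lemma meas_cutoff_rate t : measurable_fun setT (cutoff_rate t).
Proof.
apply: measurable_funM; first by apply: measurable_funM => //; exact: measurable_funX.
apply: meas_funV; apply: measurable_funX; apply: measurable_funD => //; exact: measurable_funX.
Qed.

Lemma poisson_mass t : 0 < t -> intg mu (poisson t) /\ (\int[mu]_x poisson t x)%R = pi.
Proof. exact: cauchy_scaled_int. Qed.

Lemma twice_le (a b c : R) : 0 <= b -> 0 <= c -> a ^+ 2 <= b * c -> 2 * a <= b + c.
Proof.
move=> b0 c0 abc; have [//|h] := leP (2 * a) (b + c); exfalso.
have : (b + c) ^+ 2 < (2 * a) ^+ 2 by rewrite ltr_pXn2r ?nnegrE ?addr_ge0//; lra.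
have := sqr_ge0 (b - c); nra.
Qed.

(** If |x + y| <= 2 |x - y| the singular quotient is bounded.  Otherwise |x| and |y| are comparable, and
    Young's inequality puts (x + y)^2 into the cutoff rate at x. *)
Lemma kernel_young (x y t n q S A d : R) : 0 < t -> 0 < d -> x != y -> 0 <= n -> 0 <= q ->
  A ^+ 2 <= n * q -> n <= 2 * S -> q <= 2 * S ->
  `|(x + y) * A / (x - y)| * (t / ((x ^+ 2 + t ^+ 2) * (y ^+ 2 + t ^+ 2))) <=
  d * (n / (x - y) ^+ 2 * (cutoff_rate t x + cutoff_rate t y)) +
  (4 + 72 / d) * (S * (t / ((x ^+ 2 + t ^+ 2) * (y ^+ 2 + t ^+ 2)))).
Proof.
move=> t0 d0 xy n0 q0 Anq nS qS.
have X0 := den_gt0 x t0; have Y0 := den_gt0 y t0.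
have S0 : 0 <= S by lra.
set k := t / _; have k0 : 0 <= k by rewrite divr_ge0 ?(ltW t0)// mulr_ge0 ?(ltW X0) ?(ltW Y0).
have d1 : 0 <= 72 / d by rewrite divr_ge0// ltW.
have b0 : x - y != 0 by rewrite subr_eq0.
have b2 : 0 < (x - y) ^+ 2 by rewrite exprn_even_gt0.
have N0 : 0 <= n / (x - y) ^+ 2 by rewrite divr_ge0 ?sqr_ge0.
have aA : `|A| ^+ 2 <= n * q by rewrite real_normK ?num_real.
have W0 : 0 <= d * (n / (x - y) ^+ 2 * (cutoff_rate t x + cutoff_rate t y)).
  by rewrite mulr_ge0 ?(ltW d0)// mulr_ge0// addr_ge0 ?cutoff_rate_ge0.
have [h|h] := leP ((x + y) ^+ 2) (4 * (x - y) ^+ 2).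
  apply: ler_wpDl => //; rewrite [leRHS]mulrA; apply: ler_wpM2r => //.
  have r2 : `|(x + y) / (x - y)| <= 2.
    rewrite -(@ler_pXn2r _ 2) ?nnegrE// real_normK ?num_real// expr_div_n ler_pdivrMr//.
    by apply: le_trans h _; rewrite ler_pM2r//; lra.
  rewrite (_ : (x + y) * A / (x - y) = (x + y) / (x - y) * A); last by ring.
  rewrite normrM; apply: (@le_trans _ _ (2 * `|A|)); first exact: ler_wpM2r.
  have := twice_le n0 q0 aA; have : 0 <= 72 / d * S by rewrite mulr_ge0.
  lra.
have [h1 h2] : (x + y) ^+ 2 <= 16 * x ^+ 2 /\ x ^+ 2 <= 9 * y ^+ 2.
  have hp : 0 <= (x + y - 2 * (x - y)) * (x + y + 2 * (x - y)).
    rewrite (_ : _ * _ = (x + y) ^+ 2 - 4 * (x - y) ^+ 2); last by ring.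
    by rewrite subr_ge0 ltW.
  have := sqr_ge0 (x - y); have := sqr_ge0 (x + y); have := sqr_ge0 x; have := sqr_ge0 y.
  by split; nra.
have h3 : (x + y) ^+ 2 * k <= 144 * cutoff_rate t x.
  have h4 : x ^+ 2 + t ^+ 2 <= 9 * (y ^+ 2 + t ^+ 2) by have := sqr_ge0 t; lra.
  have h5 : (x + y) ^+ 2 * (x ^+ 2 + t ^+ 2) <= 16 * x ^+ 2 * (9 * (y ^+ 2 + t ^+ 2)).
    by apply: ler_pM => //; rewrite ?sqr_ge0 ?(ltW X0).
  rewrite -subr_ge0 (_ : _ - _ = (144 * x ^+ 2 * (y ^+ 2 + t ^+ 2) - (x + y) ^+ 2 * (x ^+ 2 + t ^+ 2)) *
     (t / ((x ^+ 2 + t ^+ 2) ^+ 2 * (y ^+ 2 + t ^+ 2)))); last first.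
    by rewrite /k /cutoff_rate; field; rewrite !gt_eqF.
  apply: mulr_ge0; last by rewrite divr_ge0 ?(ltW t0)// mulr_ge0 ?sqr_ge0 ?(ltW Y0).
  by rewrite subr_ge0; apply: le_trans h5 _; rewrite le_eqVlt; apply/orP; left; apply/eqP; ring.
set r := (x + y) / (x - y).
have e2 : r ^+ 2 = (x + y) ^+ 2 / (x - y) ^+ 2 by rewrite /r expr_div_n.
have key : 2 * (`|r| * `|A|) <= d / 72 * (n * r ^+ 2) + 72 / d * q.
  have d72 : 0 <= d / 72 by apply: divr_ge0 => //; exact: ltW.
  apply: twice_le; first exact: (mulr_ge0 d72 (mulr_ge0 n0 (sqr_ge0 r))).
    exact: mulr_ge0.
  rewrite exprMn real_normK ?num_real//.
  rewrite (_ : d / 72 * (n * r ^+ 2) * (72 / d * q) = r ^+ 2 * (n * q)); last by field; rewrite gt_eqF.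
  by apply: ler_wpM2l => //; exact: sqr_ge0.
rewrite (_ : (x + y) * A / (x - y) = r * A); last by rewrite /r; ring.
rewrite normrM.
have key2 : `|r| * `|A| * k <= (d / 144 * (n * r ^+ 2) + 72 / d * S) * k.
  apply: ler_wpM2r => //; have : 72 / d * q <= 72 / d * (2 * S) by apply: ler_wpM2l.
  have e3 : d / 72 * (n * r ^+ 2) = 2 * (d / 144 * (n * r ^+ 2)) by field.
  rewrite e3 in key; lra.
apply: le_trans key2 _; rewrite mulrDl; apply: lerD.
  rewrite e2 (_ : d / 144 * _ * k = d * (n / (x - y) ^+ 2 * (((x + y) ^+ 2 * k) / 144))); last by field.
  apply: ler_wpM2l; first exact: ltW.
  apply: ler_wpM2l => //; rewrite ler_pdivrMr//; apply: le_trans h3 _.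
  by have := cutoff_rate_ge0 y t0; lra.
rewrite -[leLHS]mulrA; apply: ler_wpM2r; first by rewrite mulr_ge0.
by rewrite lerDr.
Qed.

End PoissonKernel.

Section RegularFunctions.
Context {R : realType}.
Notation mu := (@lebesgue_measure R).
Notation m2 := (mu \x mu)%E.
Implicit Types w v : R -> R.

(** The functions with which the equation may be tested; they form an algebra. *)
Definition reg w := [/\ measurable_fun setT w, exists B : R, forall x, `|w x| <= B & sqi m2 (D w)].

Lemma reg_cst (c : R) : reg (fun=> c).
Proof.
split => //; first by exists `|c|.
have e : D (fun=> c) = (fun _ => 0) :> (R * R -> R) by apply/funext => z; rewrite /D subrr mul0r.
by rewrite e; split => //; under eq_fun do rewrite expr0n; exact: intg0.
Qed.

Lemma regD w v : reg w -> reg v -> reg (fun x => w x + v x).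
Proof.
move=> [mw [B HB] sw] [mv [B' HB'] sv]; split; first exact: measurable_funD.
  by exists (B + B') => x; apply: le_trans (ler_normD _ _) _; exact: lerD.
have e : D (fun x => w x + v x) = (fun z => D w z + D v z) by apply/funext => z; rewrite /D; ring.
by rewrite e; exact: sqiD.
Qed.

Lemma regM w v : reg w -> reg v -> reg (fun x => w x * v x).
Proof.
move=> [mw [B HB] sw] [mv [B' HB'] sv]; split; first exact: measurable_funM.
  by exists (B * B') => x; rewrite normrM; exact: ler_pM.
exact: (gagM mw mv HB HB' sw sv).1.
Qed.

Lemma regZ (c : R) w : reg w -> reg (fun x => c * w x).
Proof. by move=> rw; apply: regM => //; exact: reg_cst. Qed.

Lemma regB w v : reg w -> reg v -> reg (fun x => w x - v x).
Proof.
move=> rw rv; have := regD rw (regZ (-1) rv); congr reg; apply/funext => x; rewrite mulN1r//.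
Qed.

Lemma reg_sum (I : Type) (s : seq I) (w : I -> R -> R) : (forall i, reg (w i)) ->
  reg (fun x => \sum_(i <- s) w i x).
Proof.
move=> H; elim: s => [|i s IH].
  by under eq_fun do rewrite big_nil; exact: reg_cst.
by under eq_fun do rewrite big_cons; exact: regD.
Qed.

Lemma D_poisson t (z : R * R) : 0 < t -> z.1 != z.2 ->
  D (poisson t) z = - (t * (z.1 + z.2) / ((z.1 ^+ 2 + t ^+ 2) * (z.2 ^+ 2 + t ^+ 2))).
Proof.
move=> t0; rewrite -subr_eq0 => h; have X0 := den_gt0 z.1 t0; have Y0 := den_gt0 z.2 t0.
by rewrite /D /poisson; field; rewrite h !gt_eqF.
Qed.

Lemma D_diag w (z : R * R) : z.1 = z.2 -> D w z = 0.
Proof. by move=> e; rewrite /D e subrr mul0r. Qed.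

Lemma intg_den t : 0 < t -> intg mu (fun x => (x ^+ 2 + t ^+ 2)^-1) /\
  (\int[mu]_x (x ^+ 2 + t ^+ 2)^-1)%R = pi / t.
Proof.
move=> t0; have [ip ep] := poisson_mass t0.
have e x : t^-1 * poisson t x = (x ^+ 2 + t ^+ 2)^-1 by rewrite /poisson mulKf// gt_eqF.
split; first by have := intgZ t^-1 ip; congr (intg _ _); apply/funext => x; exact: e.
by rewrite -(@Ri_eq _ _ _ mu _ _ e) (RiZ _ ip) ep mulrC.
Qed.

Lemma Ri_tensor (f g : R -> R) : intg mu f -> intg mu g ->
  intg m2 (fun z => f z.1 * g z.2) /\
  (\int[m2]_z (f z.1 * g z.2) = (\int[mu]_x f x) * (\int[mu]_x g x))%R.
Proof.
move=> iF ig; have iT := intg_tensor iF ig; split; first exact: iT.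
rewrite (Ri_fubini1 iT).2 /= mulrC -(RiZ _ iF); apply: Ri_eq => x.
by rewrite (RiZ _ ig) mulrC.
Qed.

Lemma reg_poisson t : 0 < t -> reg (poisson t).
Proof.
move=> t0; split; first exact: meas_poisson.
  by exists t^-1 => x; rewrite ger0_norm ?poisson_ge0// poisson_le.
have mD : measurable_fun setT (D (@poisson R t)) by apply: meas_D; exact: meas_poisson.
split => //; have [iI _] := intg_den t0.
have iB := intgZ 4 (intg_tensor iI iI).
apply: (@intg_le _ _ _ m2 _ _ _ iB); first exact: measurable_funX.
move=> z; rewrite ger0_norm ?sqr_ge0//.
have X0 := den_gt0 z.1 t0; have Y0 := den_gt0 z.2 t0.
have [e|ne] := eqVneq z.1 z.2.
  by rewrite (D_diag _ e) expr0n mulr_ge0// mulr_ge0// invr_ge0 ltW.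
rewrite (D_poisson t0 ne) sqrrN -subr_ge0.
set X := _ + _ in X0 *; set Y := z.2 ^+ 2 + _ in Y0 *.
rewrite (_ : _ - _ = (4 * (X * Y) - (t * (z.1 + z.2)) ^+ 2) * (X^-1 ^+ 2 * Y^-1 ^+ 2)); last by field; rewrite !gt_eqF.
apply: mulr_ge0; last by rewrite mulr_ge0 ?sqr_ge0.
rewrite /X /Y; have := sqr_ge0 (z.1 - z.2); have := sqr_ge0 (z.1 * z.2); have := sqr_ge0 (t ^+ 2).
have : 0 <= t ^+ 2 * (z.1 - z.2) ^+ 2 by rewrite mulr_ge0 ?sqr_ge0.
have : 0 <= t ^+ 2 * z.1 ^+ 2 by rewrite mulr_ge0 ?sqr_ge0.
have : 0 <= t ^+ 2 * z.2 ^+ 2 by rewrite mulr_ge0 ?sqr_ge0.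
by move: (z.1) (z.2) => x y; nra.
Qed.

Lemma cs_sum (I : finType) (a b : I -> R) :
  (\sum_i a i * b i) ^+ 2 <= (\sum_i a i ^+ 2) * (\sum_i b i ^+ 2).
Proof.
set A := \sum_i a i ^+ 2; set B := \sum_i b i ^+ 2; set C := \sum_i a i * b i.
have A0 : 0 <= A by apply: sumr_ge0 => i _; exact: sqr_ge0.
have B0 : 0 <= B by apply: sumr_ge0 => i _; exact: sqr_ge0.
have h : 0 <= B * (A * B - C ^+ 2).
  have -> : B * (A * B - C ^+ 2) = \sum_i (a i * B - b i * C) ^+ 2.
    rewrite (eq_bigr (fun i => B ^+ 2 * a i ^+ 2 + ((- (2 * B * C)) * (a i * b i) + C ^+ 2 * b i ^+ 2))).
      by rewrite !big_split/= -!mulr_sumr -/A -/B -/C; ring.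
    by move=> i _; ring.
  by apply: sumr_ge0 => i _; exact: sqr_ge0.
have [B00|Bn] := eqVneq B 0; last first.
  have Bp : 0 < B by rewrite lt_neqAle eq_sym Bn.
  by move: h; rewrite pmulr_rge0// subr_ge0.
have b0 i : b i = 0.
  apply/eqP; rewrite -sqrf_eq0 eq_le sqr_ge0 andbT -B00 /B (bigD1 i)//= lerDl.
  by apply: sumr_ge0 => j _; exact: sqr_ge0.
rewrite /C big1 ?expr0n ?mulr_ge0// => i _; by rewrite b0 mulr0.
Qed.

End RegularFunctions.

Section HarmonicFields.
Context {R : realType} {m : nat}.
Notation mu := (@lebesgue_measure R).
Notation m2 := (mu \x mu)%E.
Implicit Types (U : 'I_m -> R -> R) (c : 'I_m -> R).

Definition harmonic_field U := [/\ unit_field U, forall i, sqi m2 (D (U i)) & harmonic U].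

Definition cut_energy U t := (\int[m2]_z (energy_density U z * cutoff t z.1))%R.
Definition rate_energy U t := (\int[m2]_z (energy_density U z * cutoff_rate t z.1))%R.
Definition sqdist U c x : R := \sum_j (U j x - c j) ^+ 2.
Definition mean_dist U c t := (\int[mu]_x (sqdist U c x * poisson t x))%R.

Lemma reg_U U i : harmonic_field U -> reg (U i).
Proof. by move=> [hU sU _]; split; [exact: hU.1|exists 1 => x; exact: unit_le1|]. Qed.

Lemma energy_densityE U z : energy_density U z = (\sum_j (U j z.1 - U j z.2) ^+ 2) / (z.1 - z.2) ^+ 2.
Proof.
rewrite /energy_density mulr_suml; apply: eq_bigr => j _; rewrite /D exprMn exprVn//.
Qed.

Lemma intg_energy_density_bnd U (p : R -> R) (B : R) : harmonic_field U -> measurable_fun setT p -> (forall x, `|p x| <= B) ->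
  intg m2 (fun z => energy_density U z * p z.1).
Proof. by move=> [_ sU _] mp pB; exact: intg_energy_density1 sU mp pB. Qed.

Lemma intg_cutoff U t : harmonic_field U -> 0 < t -> intg m2 (fun z => energy_density U z * cutoff t z.1).
Proof.
move=> hU t0; apply: (@intg_energy_density_bnd U (cutoff t) 1) => //; first exact: meas_cutoff.
by move=> x; rewrite ger0_norm ?cutoff_ge0// cutoff_le1.
Qed.

Lemma cutoff_rate_bound (t x : R) : 0 < t -> cutoff_rate t x <= t^-1.
Proof. by move=> t0; rewrite -[leRHS]mulr1 ler_pdivlMl// (le_trans (cutoff_rate_cutoff x t0))// cutoff_le1. Qed.

Lemma intg_cutoff_rate U t : harmonic_field U -> 0 < t -> intg m2 (fun z => energy_density U z * cutoff_rate t z.1).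
Proof.
move=> hU t0; apply: (@intg_energy_density_bnd U (cutoff_rate t) t^-1) => //; first exact: meas_cutoff_rate.
by move=> x; rewrite ger0_norm ?cutoff_rate_ge0// cutoff_rate_bound.
Qed.

Lemma sqdist_ge0 U c x : 0 <= sqdist U c x.
Proof. by apply: sumr_ge0 => j _; exact: sqr_ge0. Qed.

Lemma sqdist_bound U c x : unit_field U -> \sum_j c j ^+ 2 <= 1 -> sqdist U c x <= 4.
Proof.
move=> [_ hU] c1; apply: (@le_trans _ _ (\sum_j (2 * U j x ^+ 2 + 2 * c j ^+ 2))).
  by apply: ler_sum => j _; have := sqr_ge0 (U j x + c j); lra.
by rewrite big_split/= -!mulr_sumr hU; lra.
Qed.

Lemma meas_sqdist U c : unit_field U -> measurable_fun setT (sqdist U c).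
Proof.
move=> hU; apply: measurable_sum => j; apply: measurable_funX; apply: measurable_funB => //; exact: hU.1.
Qed.

Lemma intg_mean_dist U c t : unit_field U -> \sum_j c j ^+ 2 <= 1 -> 0 < t ->
  intg mu (fun x => sqdist U c x * poisson t x).
Proof.
move=> hU c1 t0; apply: (@intg_Mb _ _ _ mu (sqdist U c) (poisson t) 4); first exact: meas_sqdist.
  exact: (poisson_mass t0).1.
by move=> x; rewrite ger0_norm ?sqdist_ge0// sqdist_bound.
Qed.

(** The right-hand side of [kernel_young] along a field, integrated once and for all in [kbound_int]. *)
Definition kbound U c t d (z : R * R) : R :=
  d * (energy_density U z * (cutoff_rate t z.1 + cutoff_rate t z.2)) +
  (4 + 72 / d) * ((sqdist U c z.1 + sqdist U c z.2) * (t / ((z.1 ^+ 2 + t ^+ 2) * (z.2 ^+ 2 + t ^+ 2)))).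

Lemma kbound_int U c t d : harmonic_field U -> \sum_j c j ^+ 2 <= 1 -> 0 < t -> 0 < d ->
  intg m2 (kbound U c t d) /\
  (\int[m2]_z kbound U c t d z)%R = 2 * d * rate_energy U t + (4 + 72 / d) * (2 * pi / t * mean_dist U c t).
Proof.
move=> hU c1 t0 d0; have [hu sU _] := hU.
have i1 := intg_cutoff_rate hU t0; have [i2 e2] := intg_swap i1.
have [iI eI] := intg_den t0; have iP := intg_mean_dist hu c1 t0.
have [i3 e3] := Ri_tensor iP iI; have [i4 e4] := Ri_tensor iI iP.
have e z : kbound U c t d z = d * (energy_density U z * cutoff_rate t z.1 + energy_density U (z.2, z.1) * cutoff_rate t z.2) +
   (4 + 72 / d) * (sqdist U c z.1 * poisson t z.1 * (z.2 ^+ 2 + t ^+ 2)^-1 + (z.1 ^+ 2 + t ^+ 2)^-1 * (sqdist U c z.2 * poisson t z.2)).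
  rewrite energy_density_swap /kbound /poisson invfM; ring.
have iA := intgZ d (intgD i1 i2); have iB := intgZ (4 + 72 / d) (intgD i3 i4).
split; first by have := intgD iA iB; congr (intg _ _); apply/funext => z; exact/esym/e.
rewrite (@Ri_eq _ _ _ m2 _ _ e) (RiD iA iB) (RiZ d (intgD i1 i2)) (RiD i1 i2) e2.
rewrite (RiZ _ (intgD i3 i4)) (RiD i3 i4) e3 e4 eI -/(rate_energy U t) -/(mean_dist U c t).
by ring.
Qed.

Lemma kbound_point U c t d A z : harmonic_field U -> 0 < t -> 0 < d ->
  A ^+ 2 <= 8 * ((\sum_j (U j z.1 - U j z.2) ^+ 2) * (sqdist U c z.1 + sqdist U c z.2)) ->
  `|D (poisson t) z * (A / (z.1 - z.2))| <= 2 * kbound U c t d z.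
Proof.
move=> hU t0 d0 HA; set n := \sum_j _ in HA; set S := sqdist U c z.1 + _ in HA.
have n0 : 0 <= n by apply: sumr_ge0 => j _; exact: sqr_ge0.
have S0 : 0 <= S by rewrite addr_ge0 ?sqdist_ge0.
have X0 := den_gt0 z.1 t0; have Y0 := den_gt0 z.2 t0.
have [e|ne] := eqVneq z.1 z.2.
  rewrite (D_diag _ e) mul0r normr0 mulr_ge0// addr_ge0// mulr_ge0 ?(ltW d0)//.
  - by rewrite mulr_ge0 ?energy_density_ge0// addr_ge0 ?cutoff_rate_ge0.
  - by rewrite addr_ge0// divr_ge0// ltW.
  - by rewrite mulr_ge0// divr_ge0 ?(ltW t0)// mulr_ge0 ?(ltW X0) ?(ltW Y0).
have nS : n <= 2 * S.
  rewrite /S /sqdist -big_split/= mulr_sumr; apply: ler_sum => j _; exact: sqrB_le2.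
have q0 : 0 <= 2 * S by rewrite mulr_ge0.
have H2 : (A / 2) ^+ 2 <= n * (2 * S) by rewrite expr_div_n ler_pdivrMr//; lra.
have H := kernel_young t0 d0 ne n0 q0 H2 nS (lexx _).
rewrite (D_poisson t0 ne) /kbound energy_densityE -/n -/S.
rewrite (_ : - _ * _ = - (2 * ((z.1 + z.2) * (A / 2) / (z.1 - z.2)) * (t / ((z.1 ^+ 2 + t ^+ 2) * (z.2 ^+ 2 + t ^+ 2))))); last by field; rewrite subr_eq0 ne !gt_eqF.
rewrite normrN normrM [X in _ * X]ger0_norm; last by rewrite divr_ge0 ?(ltW t0)// mulr_ge0 ?(ltW X0) ?(ltW Y0).
by rewrite normrM ger0_norm// -mulrA; apply: ler_wpM2l.
Qed.

(** The right-hand side of the equation tested with a Poisson kernel. *)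
Definition source U i t := (\int[m2]_z (energy_density U z * (U i z.1 * poisson t z.1)))%R.

Lemma sum_delta (i : 'I_m) (a : 'I_m -> R) : \sum_j a j * (j == i)%:R = a i.
Proof.
by rewrite (bigD1 i)//= eqxx mulr1 big1 ?addr0// => j /negPf ->; rewrite mulr0.
Qed.

Lemma unit_dot U c x : unit_field U -> \sum_j c j ^+ 2 = 1 ->
  1 - \sum_j U j x * c j = 2^-1 * sqdist U c x.
Proof.
move=> [_ hU] c1; rewrite /sqdist [in RHS](eq_bigr (fun j => U j x ^+ 2 + (c j ^+ 2 - 2 * (U j x * c j)))).
  rewrite big_split sumrB/= hU c1 -mulr_sumr. by field.
by move=> j _; ring.
Qed.

(** The field U_i (U - c) - (1 - U.c) e_i.  It is orthogonal to U, and it vanishes where U = c if |c| = 1. *)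
Definition tangent_test U i c j x : R := U i x * (U j x - c j) - (1 - \sum_k U k x * c k) * (j == i)%:R.

Lemma tangent_test_orth U i c x : unit_field U -> \sum_j U j x * tangent_test U i c j x = 0.
Proof.
move=> [_ hU]; rewrite /tangent_test.
rewrite (eq_bigr (fun j => U i x * U j x ^+ 2 - U i x * (U j x * c j) - (U j x * (1 - \sum_k U k x * c k)) * (j == i)%:R)); last by move=> j _; ring.
by rewrite !sumrB sum_delta -!mulr_sumr hU; ring.
Qed.

Lemma tangent_test_pair U i c (z : R * R) : unit_field U ->
  \sum_j (U j z.1 - U j z.2) * (tangent_test U i c j z.1 - tangent_test U i c j z.2) =
  2^-1 * (U i z.1 + U i z.2) * \sum_j (U j z.1 - U j z.2) ^+ 2.
Proof.
move=> [_ hU]; pose a j := U j z.1; pose b j := U j z.2.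
pose s := \sum_k (a k - b k) * c k.
have e1 : \sum_j (a j - b j) ^+ 2 = 2 - 2 * \sum_j a j * b j.
  rewrite (eq_bigr (fun j => a j ^+ 2 + (b j ^+ 2 - 2 * (a j * b j)))); last by move=> j _; ring.
  by rewrite big_split sumrB/= -mulr_sumr !hU; ring.
rewrite [in RHS](eq_bigr (fun j => (a j - b j) ^+ 2))// e1.
have es : \sum_k U k z.1 * c k - \sum_k U k z.2 * c k = s.
  by rewrite -sumrB; apply: eq_bigr => j _; rewrite mulrBl.
rewrite (eq_bigr (fun j => a i * a j ^+ 2 + b i * b j ^+ 2 - (a i + b i) * (a j * b j) - (a i - b i) * ((a j - b j) * c j) + ((a j - b j) * s) * (j == i)%:R)).
  rewrite big_split sum_delta/= !sumrB big_split/= -!mulr_sumr !hU -/s -/(a i) -/(b i); by field.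
by move=> j _; rewrite /tangent_test -es -/(a j) -/(b j) -/(a i) -/(b i); ring.
Qed.

Lemma tangent_test_sqr U i c x : unit_field U -> \sum_j c j ^+ 2 = 1 ->
  \sum_j tangent_test U i c j x ^+ 2 <= 4 * sqdist U c x.
Proof.
move=> hU c1; have ud := unit_dot x hU c1.
have U1 : U i x ^+ 2 <= 1 by rewrite -[leRHS](expr1n _ 2); apply: sqr_bound; exact: unit_le1.
have d0 := sqdist_ge0 U c x; have d4 : sqdist U c x <= 4 by apply: sqdist_bound => //; rewrite c1.
apply: (@le_trans _ _ (\sum_j (2 * (U j x - c j) ^+ 2 + (2 * (2^-1 * sqdist U c x) ^+ 2) * (j == i)%:R))).
  apply: ler_sum => j _; rewrite /tangent_test ud.
  have h : U i x ^+ 2 * (U j x - c j) ^+ 2 <= (U j x - c j) ^+ 2 by rewrite ler_piMl ?sqr_ge0.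
  have := sqr_ge0 (U i x * (U j x - c j) + (2^-1 * sqdist U c x) * (j == i)%:R).
  rewrite -exprMn in h; move: h; move: (U i x * (U j x - c j)) ((U j x - c j) ^+ 2) (2^-1 * sqdist U c x) => a b e h.
  by case: (j == i); rewrite ?mulr1 ?mulr0; nra.
rewrite big_split/= sum_delta -mulr_sumr -/(sqdist U c x); nra.
Qed.

(** Why this tangential field: paired with the increments of U it gives back the energy density times U_i P, the
    integrand of the source.  The error carries a difference of P and two factors that are small when U is near c. *)
Lemma tested U i c t z : unit_field U -> 0 < t ->
  \sum_j D (U j) z * D (fun x => poisson t x * tangent_test U i c j x) z =
  2^-1 * (energy_density U z * (U i z.1 * poisson t z.1) + energy_density U z * (U i z.2 * poisson t z.2))
  - D (poisson t) z * ((4^-1 * ((\sum_j (U j z.1 - U j z.2) ^+ 2) * (U i z.1 - U i z.2)) -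
     \sum_j (U j z.1 - U j z.2) * (2^-1 * (tangent_test U i c j z.1 + tangent_test U i c j z.2))) / (z.1 - z.2)).
Proof.
move=> hU t0; rewrite energy_densityE /D.
set d := (z.1 - z.2)^-1; set p := poisson t z.1; set p' := poisson t z.2.
rewrite (eq_bigr (fun j => d ^+ 2 * (2^-1 * (p + p')) * ((U j z.1 - U j z.2) * (tangent_test U i c j z.1 - tangent_test U i c j z.2)) +
   d ^+ 2 * (p - p') * ((U j z.1 - U j z.2) * (2^-1 * (tangent_test U i c j z.1 + tangent_test U i c j z.2))))); last first.
  by move=> j _; field.
rewrite big_split/= -!mulr_sumr tangent_test_pair// exprVn -/d.
set n := \sum_j _ ^+ 2; set A := \sum_j _; by rewrite -exprVn -/d; field.
Qed.

Lemma tested_bound U i c z : unit_field U -> \sum_j c j ^+ 2 = 1 ->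
  (4^-1 * ((\sum_j (U j z.1 - U j z.2) ^+ 2) * (U i z.1 - U i z.2)) -
     \sum_j (U j z.1 - U j z.2) * (2^-1 * (tangent_test U i c j z.1 + tangent_test U i c j z.2))) ^+ 2 <=
  8 * ((\sum_j (U j z.1 - U j z.2) ^+ 2) * (sqdist U c z.1 + sqdist U c z.2)).
Proof.
move=> hU c1; set n := \sum_j _ ^+ 2; set S := sqdist U c z.1 + _.
have CS := cs_sum (fun j => U j z.1 - U j z.2) (fun j => 2^-1 * (tangent_test U i c j z.1 + tangent_test U i c j z.2)).
rewrite -/n in CS; set A := \sum_j _ in CS *; set q := \sum_j (2^-1 * _) ^+ 2 in CS.
have n0 : 0 <= n by apply: sumr_ge0 => j _; exact: sqr_ge0.
have q2 : q <= 2 * S.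
  have t1 := tangent_test_sqr i z.1 hU c1; have t2 := tangent_test_sqr i z.2 hU c1.
  apply: (@le_trans _ _ (2^-1 * (\sum_j tangent_test U i c j z.1 ^+ 2 + \sum_j tangent_test U i c j z.2 ^+ 2))); last first.
    by rewrite /S; lra.
  rewrite -big_split/= mulr_sumr; apply: ler_sum => j _.
  have := sqr_ge0 (tangent_test U i c j z.1 - tangent_test U i c j z.2); lra.
have nS : n <= 2 * S.
  rewrite /S /sqdist -big_split/= mulr_sumr; apply: ler_sum => j _; exact: sqrB_le2.
have n4 : n <= 4.
  apply: (sqdist_bound (c := fun j => U j z.2)) => //; by rewrite hU.2.
have gn : (U i z.1 - U i z.2) ^+ 2 <= n.
  by rewrite /n (bigD1 i)//= lerDl; apply: sumr_ge0 => j _; exact: sqr_ge0.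
set g := U i z.1 - U i z.2 in gn *.
have S0 : 0 <= S by rewrite addr_ge0 ?sqdist_ge0.
have h1 : A ^+ 2 <= n * (2 * S) by apply: le_trans CS _; apply: ler_wpM2l.
have h2 : (n * g) ^+ 2 <= 16 * (n * S).
  rewrite exprMn; apply: (@le_trans _ _ (n ^+ 2 * n)); first by apply: ler_wpM2l => //; exact: sqr_ge0.
  have : 0 <= n * S by exact: mulr_ge0.
  have : n * n <= n * (2 * S) by exact: ler_wpM2l.
  have : n * n * n <= n * (2 * S) * 4 by apply: ler_pM => //; rewrite ?mulr_ge0// ler_wpM2l.
  by rewrite expr2; nra.
have := sqr_ge0 (4^-1 * (n * g) + A); have := mulr_ge0 n0 S0; nra.
Qed.

(** Tested with P times the tangential field, the equation has right-hand side 0, and by [tested] its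
    left-hand side is the source up to the errors estimated by [kbound_point]. *)
Lemma source_le_mean_dist U i c t : harmonic_field U -> \sum_j c j ^+ 2 = 1 -> 0 < t ->
  `|source U i t| <= 2 * (2 * rate_energy U t + 76 * (2 * pi / t * mean_dist U c t)).
Proof.
move=> hU c1 t0; have [hu sU hE] := hU.
have rU j := reg_U j hU; have rP := reg_poisson t0.
have rT j : reg (fun x => poisson t x * tangent_test U i c j x).
  apply: regM => //; apply: regB.
    by apply: regM => //; apply: regB => //; exact: reg_cst.
  apply: regM; last exact: reg_cst.
  apply: regB; first exact: reg_cst.
  by apply: reg_sum => k; apply: regM => //; exact: reg_cst.
have rq : reg (fun x => U i x * poisson t x) by exact: regM.
have [mq [Bq HBq] _] := rq.
have iq1 : intg m2 (fun z => energy_density U z * (U i z.1 * poisson t z.1)) := intg_energy_density_bnd hU mq HBq.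
have [iq2 eq2] := intg_swap iq1.
have iDD j : intg m2 (fun z => D (U j) z * D (fun x => poisson t x * tangent_test U i c j x) z).
  by apply: sqiM => //; have [] := rT j.
have iS : intg m2 (fun z => \sum_j D (U j) z * D (fun x => poisson t x * tangent_test U i c j x) z) by exact: intg_sum.
have S0 : (\int[m2]_z (\sum_j D (U j) z * D (fun x => poisson t x * tangent_test U i c j x) z))%R = 0.
  rewrite Ri_sum//.
  have iN j : intg m2 (fun z => energy_density U z * (U j z.1 * (poisson t z.1 * tangent_test U i c j z.1))).
    have rN : reg (fun x => U j x * (poisson t x * tangent_test U i c j x)) by exact: regM.
    by have [mN [BN HBN] _] := rN; exact: (intg_energy_density_bnd hU mN HBN).
  rewrite (eq_bigr (fun j => (\int[m2]_z (energy_density U z * (U j z.1 * (poisson t z.1 * tangent_test U i c j z.1))))%R)); last first.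
    by move=> j _; have [mT [BT HBT] sT] := rT j; exact: (hE j _ BT mT HBT sT).
  rewrite -Ri_sum//; rewrite (@Ri_eq _ _ _ m2 _ (fun=> 0)); first by rewrite Rintegral_cst//= mul0r.
  move=> z; rewrite (eq_bigr (fun j => energy_density U z * poisson t z.1 * (U j z.1 * tangent_test U i c j z.1))).
    by rewrite -mulr_sumr tangent_test_orth// mulr0.
  by move=> j _; ring.
pose G z := 2^-1 * (energy_density U z * (U i z.1 * poisson t z.1) + energy_density U (z.2, z.1) * (U i z.2 * poisson t z.2)) -
   \sum_j D (U j) z * D (fun x => poisson t x * tangent_test U i c j x) z.
have iH := intgZ 2^-1 (intgD iq1 iq2).
have iG : intg m2 G by exact: (intgB iH iS).
have eG : source U i t = (\int[m2]_z G z)%R.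
  rewrite /G (RiB iH iS) S0 subr0 (RiZ _ (intgD iq1 iq2)) (RiD iq1 iq2) eq2 -/(source U i t).
  by field.
have c1' : \sum_j c j ^+ 2 <= 1 by rewrite c1.
have [ik ek] := kbound_int hU c1' t0 (ltr01 : 0 < (1:R)).
rewrite eG; apply: (@le_trans _ _ (\int[m2]_z (2 * kbound U c t 1 z))%R); last first.
  by rewrite (RiZ 2 ik) ek mulr1 divr1 -(natrD _ 4 72).
apply: (Ri_abs_le iG (intgZ 2 ik)) => z.
rewrite /G energy_density_swap tested// opprB addrCA subrr addr0.
by apply: kbound_point => //; exact: tested_bound.
Qed.

(** In [source_le_mean_dist] take c = U(zeta) and average over t <= zeta <= 2 t.  There |x - zeta|^2 P(x) <= 8 t, and
    the cutoff rate at zeta is comparable to 1 / t, so the mean of |U - c|^2 is bounded by the rate of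
    energy as well.  The bound is linear in that rate, so it integrates over t without any smallness. *)
Lemma source_le U i t : harmonic_field U -> 0 < t -> `|source U i t| <= (4 + 152 * (2 * pi) * 200) * rate_energy U t.
Proof.
move=> hU t0; have [hu sU hE] := hU; have t0' := ltW t0.
pose K (x : R) : R := \1_(`[t, 2 * t]%classic) x.
have iK : intg mu K by exact: integrable_indic_itv.
have eK : (\int[mu]_x K x)%R = t.
  rewrite /Rintegral integral_indic//= setIT lebesgue_measure_itv/= lte_fin ifT; last by lra.
  by rewrite -EFinD/=; ring.
have K01 x : K x = 0 \/ (K x = 1 /\ t <= x <= 2 * t).
  rewrite /K indicE; case: (boolP (x \in _)); last by left.
  by rewrite inE/= in_itv/=; right.
have K0 x : 0 <= K x by case: (K01 x) => [->|[-> _]].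
pose G (z : R * R) := energy_density U z * (K z.1 * ((z.1 - z.2) ^+ 2 * poisson t z.2)).
have W0 : 0 <= rate_energy U t by apply: Ri_ge0 => z; rewrite mulr_ge0 ?energy_density_ge0 ?cutoff_rate_ge0.
have mG : measurable_fun setT G.
  apply: measurable_funM; first exact: meas_energy_density hu.1.
  apply: measurable_funM; first exact: (measurableT_comp (intg_meas iK) measurable_fst).
  apply: measurable_funM; last exact: (measurableT_comp (meas_poisson t) measurable_snd).
  by apply: measurable_funX; exact: measurable_funB.
have iW := intg_cutoff_rate hU t0.
have bG z : 0 <= G z <= 200 * t ^+ 2 * (energy_density U z * cutoff_rate t z.1).
  have Y0 := den_gt0 z.2 t0; have X0 := den_gt0 z.1 t0.
  have G0 : 0 <= G z.
    by apply: mulr_ge0; [exact: energy_density_ge0|apply: mulr_ge0; [exact: K0|apply: mulr_ge0; [exact: sqr_ge0|exact: poisson_ge0]]].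
  rewrite G0 /G /= [leRHS]mulrCA; apply: ler_wpM2l; first exact: energy_density_ge0.
  case: (K01 z.1) => [->|[-> /andP[h1 h2]]]; first by rewrite mul0r mulr_ge0 ?cutoff_rate_ge0// mulr_ge0 ?sqr_ge0.
  rewrite mul1r; apply: (@le_trans _ _ (8 * t)).
    rewrite /poisson mulrA ler_pdivrMr//.
    have h3 : z.1 ^+ 2 <= 4 * t ^+ 2 by rewrite -subr_ge0 (_ : _ - _ = (2 * t - z.1) * (2 * t + z.1)); [apply: mulr_ge0; lra|ring].
    have h4 : (z.1 - z.2) ^+ 2 <= 8 * (z.2 ^+ 2 + t ^+ 2) by have := sqr_ge0 (z.1 + z.2); have := sqr_ge0 z.2; lra.
    by have := ler_wpM2r t0' h4; lra.
  rewrite /cutoff_rate -subr_ge0 (_ : _ - _ = 8 * t / (z.1 ^+ 2 + t ^+ 2) ^+ 2 * (25 * t ^+ 2 * z.1 ^+ 2 - (z.1 ^+ 2 + t ^+ 2) ^+ 2)); last by field; rewrite gt_eqF.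
  apply: mulr_ge0; first by rewrite divr_ge0 ?sqr_ge0 ?mulr_ge0.
  rewrite (_ : 25 * _ * _ - _ = (5 * t * z.1 - (z.1 ^+ 2 + t ^+ 2)) * (5 * t * z.1 + (z.1 ^+ 2 + t ^+ 2))); last by ring.
  have hx : 0 <= z.1 by lra.
  apply: mulr_ge0; last by rewrite addr_ge0 ?(ltW X0)// !mulr_ge0.
  have : 0 <= (z.1 - t) * (2 * t - z.1) by apply: mulr_ge0; lra.
  have : 0 <= t * z.1 by exact: mulr_ge0.
  nra.
have iG : intg m2 G.
  apply: (@intg_le _ _ _ m2 _ _ mG (intgZ (200 * t ^+ 2) iW)) => z.
  by have /andP[a b] := bG z; rewrite ger0_norm.
have [j1 e1] := Ri_fubini1 iG.
have eG y : (\int[mu]_x G (y, x))%R = K y * mean_dist U (fun j => U j y) t.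
  have c1 : \sum_j U j y ^+ 2 <= 1 by rewrite hu.2.
  rewrite /mean_dist -(RiZ _ (intg_mean_dist hu c1 t0)); apply: Ri_eq => x; rewrite /G /= energy_densityE /=.
  have [->|yx] := eqVneq y x.
    rewrite subrr expr0n /= mul0r mulr0 mulr0 /sqdist big1 ?mul0r ?mulr0// => j _.
    by rewrite subrr expr0n.
  rewrite /sqdist [in RHS](eq_bigr (fun j => (U j y - U j x) ^+ 2)); last by move=> j _; rewrite -sqrrN opprB.
  by field; rewrite subr_eq0.
have le : (\int[mu]_y (K y * `|source U i t|) <= \int[mu]_y ((4 * rate_energy U t) * K y + (152 * (2 * pi / t)) * (\int[mu]_x G (y, x))%R))%R.
  apply: Ri_le.
  - by under eq_fun do rewrite mulrC; exact: intgZ.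
  - by apply: intgD; apply: intgZ.
  move=> y; rewrite eG; have c1 : \sum_j U j y ^+ 2 = 1 by exact: hu.2.
  have := source_le_mean_dist i hU c1 t0; move: (mean_dist _ _ _) => p H.
  have := ler_wpM2l (K0 y) H; move: (rate_energy U t) (2 * pi / t) (K y) => w q k; lra.
move: le; rewrite (RiD (intgZ _ iK) (intgZ _ j1)) (RiZ _ iK) (RiZ _ j1) -e1 eK.
under eq_Rintegral do rewrite mulrC.
rewrite (RiZ _ iK) eK => H.
have gb : (\int[m2]_z G z <= 200 * t ^+ 2 * rate_energy U t)%R.
  rewrite /rate_energy -(RiZ _ iW); apply: Ri_le => //; first exact: intgZ.
  by move=> z; have /andP[_] := bG z.
have pt : 0 <= 152 * (2 * pi / t) by rewrite mulr_ge0// divr_ge0// mulr_ge0// pi_ge0.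
rewrite -(ler_pM2r t0); apply: le_trans H _.
apply: (@le_trans _ _ (4 * rate_energy U t * t + 152 * (2 * pi / t) * (200 * t ^+ 2 * rate_energy U t))).
  by rewrite lerD2l; apply: ler_wpM2l.
by rewrite le_eqVlt; apply/orP; left; apply/eqP; field; rewrite gt_eqF.
Qed.

End HarmonicFields.

(** * The Poisson extension as a flow *)

Section PoissonFlow.
Context {R : realType}.
Notation mu := (@lebesgue_measure R).
Notation m2 := (mu \x mu)%E.

Definition itv_ind (t s : R) (x : R) : R := \1_(`[t, s]%classic) x.

Lemma itv_ind_int t s : t < s -> intg mu (itv_ind t s) /\ (\int[mu]_x itv_ind t s x)%R = s - t.
Proof.
move=> ts; split; first exact: integrable_indic_itv.
by rewrite /Rintegral integral_indic//= setIT lebesgue_measure_itv/= lte_fin ts -EFinD.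
Qed.

Lemma itv_ind_cases t s x : itv_ind t s x = 0 \/ (itv_ind t s x = 1 /\ t <= x <= s).
Proof.
rewrite /itv_ind indicE; case: (boolP (x \in _)); last by left.
by rewrite inE/= in_itv/=; right.
Qed.

Lemma meas_itv_ind t s : measurable_fun setT (itv_ind t s).
Proof. exact: measurable_indic. Qed.

Lemma itv_ind_FTC (f g : R -> R) (t s : R) : t < s -> (forall x : R, t <= x <= s -> is_derive x (1:R) g (f x)) ->
  (forall x : R, t <= x <= s -> {for x, continuous f}) -> measurable_fun setT f ->
  intg mu (fun x => itv_ind t s x * f x) /\ (\int[mu]_x (itv_ind t s x * f x))%R = g s - g t.
Proof.
move=> ts dg cf mf.
have cw : {within `[t, s], continuous f}.
  by apply: continuous_in_subspaceT => x; rewrite inE/= in_itv/=; exact: cf.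
have cg x : t <= x <= s -> {for x, continuous g}.
  by move=> xts; apply: differentiable_continuous; apply/derivable1_diffP; have [] := dg x xts.
have [M [_ HM]] := compact_bounded (continuous_compact cw (@segment_compact _ t s)).
have iK : intg mu (fun x => itv_ind t s x * f x).
  have [ik _] := itv_ind_int ts.
  apply: (@intg_le _ _ _ mu _ (fun x => Num.max 0 (M + 1) * itv_ind t s x)); last 2 first.
  - exact: intgZ.
  - move=> x; case: (itv_ind_cases t s x) => [->|[-> xts]]; first by rewrite mul0r normr0 mulr0.
    rewrite mul1r mulr1 le_max; apply/orP; right; apply: HM; first by rewrite ltrDl.
    by exists x => //=; rewrite in_itv/=.
  by apply: measurable_funM => //; exact: meas_itv_ind.
split => //.
have := @continuous_FTC2 R f g t s ts cw _ _.
have dd : derivable_oo_LRcontinuous g t s.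
  split.
  - by move=> x; rewrite in_itv/= => /andP[a b]; have [] := dg x; rewrite ?(ltW a) ?(ltW b).
  - by apply: cvg_at_right_filter; apply: cg; rewrite lexx (ltW ts).
  - by apply: cvg_at_left_filter; apply: cg; rewrite lexx (ltW ts).
have dE : {in `]t, s[, g^`()%classic =1 f}.
  move=> x; rewrite in_itv/= => /andP[a b]; rewrite derive1E; apply: derive_val.
  by apply: dg; rewrite (ltW a) (ltW b).
move=> /(_ dd dE) H.
rewrite /Rintegral (_ : (\int[mu]_x (itv_ind t s x * f x)%:E)%E = (\int[mu]_(x in `[t, s]) (f x)%:E)%E).
  by rewrite H.
rewrite [RHS]integral_mkcond; apply: eq_integral => x _; rewrite patchE /itv_ind indicE.
by case: ifPn => _; rewrite ?mul1r ?mul0r.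
Qed.

Lemma poisson_diff2 (t h x : R) : 0 < t -> `|diff2 h (poisson t) x| <= 5 * h ^+ 2 / t ^+ 2 * (poisson t (x + h) + poisson t (x - h)).
Proof.
move=> t0; have X0 := den_gt0 x t0; have A0 := den_gt0 (x + h) t0; have B0 := den_gt0 (x - h) t0.
rewrite /diff2 /poisson; set X := _ + _ in X0 *; set A := (x + h) ^+ 2 + _ in A0 *; set B := (x - h) ^+ 2 + _ in B0 *.
have eAB : A + B = 2 * X + 2 * h ^+ 2 by rewrite /A /B /X; ring.
have ePr : 2 * (A * B) - X * (A + B) = h ^+ 2 * ((A + B) - 8 * x ^+ 2) by rewrite /A /B /X; ring.
have e : 2 * (t / X) - t / A - t / B = t * (h ^+ 2 * ((A + B) - 8 * x ^+ 2)) / (X * A * B).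
  by rewrite -ePr; field; rewrite !gt_eqF.
have tX : t ^+ 2 <= X by rewrite /X lerDr sqr_ge0.
have h1 : `|(A + B) - 8 * x ^+ 2| <= 5 * (A + B).
  have : x ^+ 2 <= X by rewrite /X lerDl sqr_ge0.
  have := sqr_ge0 h; have := sqr_ge0 x; rewrite ler_norml => ? ? ?; apply/andP; split; lra.
rewrite e normrM normfV (@gtr0_norm _ (X * A * B)) ?mulr_gt0// normrM (gtr0_norm t0) normrM (ger0_norm (sqr_ge0 h)).
apply: (@le_trans _ _ (t * (h ^+ 2 * (5 * (A + B))) / (X * A * B))).
  apply: ler_wpM2r; first by rewrite invr_ge0 !mulr_ge0 ?ltW.
  by apply: ler_wpM2l; [exact: ltW|apply: ler_wpM2l => //; exact: sqr_ge0].
rewrite -subr_ge0 (_ : _ - _ = 5 * t * h ^+ 2 * (A + B) / (t ^+ 2 * X * A * B) * (X - t ^+ 2)); last first.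
  by field; rewrite !gt_eqF.
apply: mulr_ge0; last by rewrite subr_ge0.
apply: divr_ge0; last by rewrite !mulr_ge0 ?sqr_ge0// ltW.
apply: mulr_ge0; last by rewrite addr_ge0// ltW.
by apply: mulr_ge0; [rewrite mulr_ge0// ltW|exact: sqr_ge0].
Qed.

Definition C_poisson (t : R) : R := 20 * pi / t ^+ 2 + 8 * pi.

Lemma poisson_diff2_L1 (t h : R) : 0 < t -> (\int[mu]_x `|diff2 h (poisson t) x| <= C_poisson t * wt h)%R.
Proof.
move=> t0; have [ip ep] := poisson_mass t0; have w0 := wt_ge0 h; have h0 := sqr_ge0 h.
have p0 := pi_ge0 R; have t2 : 0 < t ^+ 2 by rewrite exprn_gt0.
have q0 : 0 <= 20 * pi / t ^+ 2 :> R by rewrite divr_ge0 ?(ltW t2)// mulr_ge0.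
have [h1|h1] := leP (h ^+ 2) 1.
  have i1 := intg_shift h ip; have i2 := intg_shift (- h) ip.
  apply: (@le_trans _ _ (\int[mu]_x (5 * h ^+ 2 / t ^+ 2 * (poisson t (x + h) + poisson t (x - h))))%R).
    apply: Ri_le; [exact: intg_abs (intg_diff2 h ip)|exact: intgZ (intgD i1 i2)|] => x.
    exact: poisson_diff2.
  rewrite (RiZ _ (intgD i1 i2)) (RiD i1 i2) (Ri_shift h ip) (Ri_shift (- h) ip) ep.
  have := wt_small h1 => hw.
  have : (10 * pi / t ^+ 2) * h ^+ 2 <= (10 * pi / t ^+ 2) * (2 * wt h).
    by apply: ler_wpM2l => //; rewrite divr_ge0 ?(ltW t2)// mulr_ge0.
  have : 0 <= 8 * pi * wt h by apply: mulr_ge0 => //; exact: mulr_ge0.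
  rewrite /C_poisson (_ : 5 * h ^+ 2 / t ^+ 2 * (pi + pi) = (10 * pi / t ^+ 2) * h ^+ 2); last by ring.
  rewrite (_ : 20 * pi / t ^+ 2 = 2 * (10 * pi / t ^+ 2)); last by ring.
  move: (10 * pi / t ^+ 2) => k; lra.
apply: le_trans (diff2_L1 h ip) _.
rewrite (@Ri_eq _ _ _ mu _ (poisson t)); last by move=> x; rewrite ger0_norm ?poisson_ge0.
rewrite ep; have hw := wt_large (ltW h1).
have : 4 * pi * 1 <= 4 * pi * (2 * wt h) :> R by apply: ler_wpM2l => //; rewrite mulr_ge0.
have : 0 <= 20 * pi / t ^+ 2 * wt h by exact: mulr_ge0.
rewrite /C_poisson mulrDl; lra.
Qed.

Lemma poisson_admiss (t : R) : 0 < t -> admiss (poisson t).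
Proof.
move=> t0; split; first exact: (poisson_mass t0).1.
  by exists t^-1 => x; rewrite ger0_norm ?poisson_ge0// poisson_le.
exists (C_poisson t); last by move=> h; exact: poisson_diff2_L1.
have p0 := pi_ge0 R.
by rewrite addr_ge0 ?mulr_ge0// invr_ge0 sqr_ge0.
Qed.

Definition Gx (x t xi : R) : R := expR (- (t * `|xi|)) * cos (x * xi).

Lemma meas_abs : measurable_fun setT (fun x : R => `|x|).
Proof. exact: measurableT_comp. Qed.

Lemma intg_nG (x t : R) : 0 < t -> intg mu (fun xi => `|xi| * Gx x t xi).
Proof.
move=> t0; have t2 : 0 < t / 2 by rewrite divr_gt0.
have [i0 _] := expcos 0 t2.
apply: (@intg_le _ _ _ mu _ (fun xi => 2 / t * (expR (- (t / 2 * `|xi|)) * cos (0 * xi)))).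
- apply: measurable_funM; first exact: meas_abs.
  exact: intg_meas (expcos x t0).1.
- exact: intgZ.
move=> xi; rewrite mul0r cos0 mulr1 normrM normr_id /Gx normrM (ger0_norm (expR_ge0 _)).
apply: (@le_trans _ _ (`|xi| * expR (- (t * `|xi|)))).
  by apply: ler_wpM2l => //; rewrite ler_piMr ?expR_ge0// cos_max.
rewrite (_ : - (t * `|xi|) = - (t / 2 * `|xi|) - (t / 2 * `|xi|)); last by field.
rewrite expRD mulrCA [leRHS]mulrC; apply: ler_wpM2l; first exact: expR_ge0.
rewrite expRN ler_pdivrMr ?expR_gt0// -ler_pdivrMl ?divr_gt0// invf_div.
by apply: le_trans (expR_ge1Dx _); rewrite lerDr.
Qed.

Lemma half_op_poisson (x t : R) : 0 < t -> intg mu (fun h => q2 h * diff2 h (poisson t) x) /\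
  half_op (poisson t) x = c_half / 2 * (\int[mu]_xi (`|xi| * Gx x t xi))%R.
Proof.
move=> t0; have [ic ec] := expcos x t0.
have iG : intg mu (fun xi => 2^-1 * Gx x t xi) by exact: intgZ.
have in_ : intg mu (fun xi => `|xi| * (2^-1 * Gx x t xi)).
  by have := intgZ 2^-1 (intg_nG x t0); congr (intg _ _); apply/funext => xi; ring.
have e h : (\int[mu]_xi (c2 (h * xi) * (2^-1 * Gx x t xi)))%R = diff2 h (poisson t) x.
  have [ip ep] := expcos (x + h) t0; have [im em] := expcos (x - h) t0.
  have := RiB (intgB (intgZ 2 ic) ip) im; rewrite (RiB (intgZ 2 ic) ip) (RiZ 2 ic) ec ep em => H.
  transitivity (2^-1 * (2 * (2 * (t / (x ^+ 2 + t ^+ 2))) - 2 * (t / ((x + h) ^+ 2 + t ^+ 2)) - 2 * (t / ((x - h) ^+ 2 + t ^+ 2)))).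
    rewrite -H -(RiZ _ (intgB (intgB (intgZ 2 ic) ip) im)); apply: Ri_eq => xi.
    rewrite /Gx (mulrDl x h) (mulrDl x (- h)) mulNr cosD cosB /c2; ring.
  by rewrite /diff2 /poisson; field; rewrite !gt_eqF// den_gt0.
have [i1 e1] := swap_q (@meas_q2 R) (@q2_ge0 R) (@int_c2q2 R) iG in_.
have e' h : q2 h * (\int[mu]_xi (c2 (h * xi) * (2^-1 * Gx x t xi)))%R = q2 h * diff2 h (poisson t) x by rewrite e.
split; first by have := i1; congr (intg _ _); apply/funext => h; exact: e'.
rewrite /half_op -(@Ri_eq _ _ _ mu _ _ e') e1 -mulrA; congr (_ * _).
rewrite -(RiZ _ (intg_nG x t0)); apply: Ri_eq => xi; ring.
Qed.

Lemma exp_flow (a t s : R) : t < s ->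
  intg mu (fun y => itv_ind t s y * (a * expR (- (y * a)))) /\
  (\int[mu]_y (itv_ind t s y * (a * expR (- (y * a)))))%R = expR (- (t * a)) - expR (- (s * a)).
Proof.
move=> ts.
have dn (y : R) : is_derive y (1:R) (fun z : R => - (z * a)) (- a).
  have := is_deriveZ (- a : R) (@is_derive_id R R y 1); rewrite scalerRE mulr1.
  by congr (is_derive _ _ _ _); apply/funext => z; rewrite /= scalerRE; ring.
have de (y : R) : is_derive y (1:R) (fun z : R => expR (- (z * a))) (expR (- (y * a)) * - a).
  exact: (@is_derive1_comp R expR _ y _ _ (is_derive_expR _) (dn y)).
have ce (y : R) : {for y, continuous (fun z : R => expR (- (z * a)))}.
  by apply: differentiable_continuous; apply/derivable1_diffP; have [] := de y.
have [] := @itv_ind_FTC (fun y => a * expR (- (y * a))) (fun y => - expR (- (y * a))) t s ts.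
- move=> y _; have := is_deriveN (de y).
  by rewrite mulrN opprK mulrC.
- by move=> y _; apply: cvgM; [exact: cvg_cst|exact: ce].
- by apply: continuous_measurable_fun => y; apply: cvgM; [exact: cvg_cst|exact: ce].
by move=> i e; split => //; rewrite e opprK addrC.
Qed.

(** The Poisson kernels solve d/dt P = - (half_op P) / c_half.  In Fourier variables this is the integral of
    a exp (- a t). *)
Lemma poisson_flow (x t s : R) : 0 < t -> t < s ->
  intg mu (fun y => itv_ind t s y * half_op (poisson y) x) /\
  (\int[mu]_y (itv_ind t s y * half_op (poisson y) x))%R = c_half * (poisson t x - poisson s x).
Proof.
move=> t0 ts; have s0 := lt_trans t0 ts.
pose F (z : R * R) := itv_ind t s z.1 * (`|z.2| * Gx x z.1 z.2).
have mF : measurable_fun setT F.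
  apply: measurable_funM; first exact: (measurableT_comp (meas_itv_ind t s) measurable_fst).
  apply: measurable_funM; first exact: (measurableT_comp meas_abs measurable_snd).
  apply: measurable_funM.
    apply: measurableT_comp => //; apply: measurable_funN; apply: measurable_funM => //.
    exact: (measurableT_comp meas_abs measurable_snd).
  apply: (measurableT_comp (@meas_cos R)); exact: measurable_funM.
have iT := intg_tensor (itv_ind_int ts).1 (intg_nG 0 t0).
have iF : intg m2 F.
  apply: (@intg_le _ _ _ m2 _ _ mF iT) => z; rewrite /F; case: (itv_ind_cases t s z.1) => [->|[-> /andP[h1 h2]]].
    by rewrite !mul0r normr0.
  rewrite !mul1r normrM normr_id; apply: ler_wpM2l => //.
  rewrite /Gx mul0r cos0 mulr1 normrM (ger0_norm (expR_ge0 _)).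
  apply: (@le_trans _ _ (expR (- (z.1 * `|z.2|)))); first by rewrite ler_piMr ?expR_ge0// cos_max.
  by rewrite ler_expR lerN2; apply: ler_wpM2r.
have eF y : c_half / 2 * (\int[mu]_xi F (y, xi))%R = itv_ind t s y * half_op (poisson y) x.
  rewrite /F /=; case: (itv_ind_cases t s y) => [->|[-> /andP[h1 h2]]].
    rewrite mul0r (@Ri_eq _ _ _ mu _ (fun=> 0)); first by rewrite Rintegral_cst//= mul0r mulr0.
    by move=> xi; rewrite mul0r.
  rewrite mul1r (half_op_poisson x (lt_le_trans t0 h1)).2; congr (_ * _).
  by apply: Ri_eq => xi; rewrite mul1r.
have [i1 _] := Ri_fubini1 iF.
split; first by have := intgZ (c_half / 2) i1; congr (intg _ _); apply/funext => y; exact: eF.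
rewrite -(@Ri_eq _ _ _ mu _ _ eF) (RiZ _ i1).
rewrite (Ri_swap iF).
have e xi : (\int[mu]_y F (y, xi))%R = Gx x t xi - Gx x s xi.
  have [ie ee] := exp_flow `|xi| ts.
  transitivity (cos (x * xi) * (\int[mu]_y (itv_ind t s y * (`|xi| * expR (- (y * `|xi|)))))%R).
    by rewrite -(RiZ _ ie); apply: Ri_eq => y; rewrite /F /Gx /=; ring.
  by rewrite ee /Gx; ring.
have [it et] := expcos x t0; have [is_ es] := expcos x s0.
rewrite (@Ri_eq _ _ _ mu _ _ e) /Gx (RiB it is_) et es /poisson; field.
by rewrite !gt_eqF// den_gt0.
Qed.

Lemma cutoff_flow (x t s : R) : 0 < t -> t < s ->
  intg mu (fun y => itv_ind t s y * cutoff_rate y x) /\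
  (\int[mu]_y (itv_ind t s y * cutoff_rate y x))%R = 2^-1 * (cutoff s x - cutoff t x).
Proof.
move=> t0 ts.
have dp (y : R) : t <= y <= s -> is_derive y (1:R) (fun z : R => 2^-1 * cutoff z x) (cutoff_rate y x).
  move=> /andP[ty _]; have y0 : 0 < y by apply: lt_le_trans ty.
  have D0 := den_gt0 x y0; have Dn : x ^+ 2 + y ^+ 2 != 0 by rewrite gt_eqF.
  have d2 : is_derive y (1:R) (fun z : R => z ^+ 2) (2 * y).
    have := is_deriveX 2 (@is_derive_id R R y 1); rewrite scalerRE mulr1 expr1 => H.
    by move: H; congr (is_derive _ _ _ _); apply/funext => z; rewrite fctE.
  have dd : is_derive y (1:R) (fun z : R => x ^+ 2 + z ^+ 2) (2 * y).
    by have := is_deriveD (is_derive_cst (x ^+ 2 : R) y 1) d2; rewrite add0r; apply.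
  have dv := @is_deriveV R (fun z : R => x ^+ 2 + z ^+ 2) y _ _ Dn dd.
  have dm := is_deriveZ (2^-1 : R) (is_deriveM d2 dv).
  by apply: is_derive_eq dm _; rewrite !scalerRE /cutoff_rate; field.
have [] := @itv_ind_FTC (fun y => cutoff_rate y x) (fun y => 2^-1 * cutoff y x) t s ts dp.
- move=> y /andP[ty _]; have y0 : 0 < y by apply: lt_le_trans ty.
  have cx : (y' ^+ 2) @[y' --> y] --> y ^+ 2 by apply: cvgM.
  have cd : (x ^+ 2 + y' ^+ 2) @[y' --> y] --> x ^+ 2 + y ^+ 2 by apply: cvgD => //; exact: cvg_cst.
  apply: cvgM; first by apply: cvgM => //; exact: cvg_cst.
  apply: cvgV; first by rewrite expf_eq0/= gt_eqF// den_gt0.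
  by rewrite expr2; under eq_fun do rewrite expr2; exact: cvgM.
- apply: measurable_funM; first exact: measurable_funM.
  apply: meas_funV; apply: measurable_funX; apply: measurable_funD => //; exact: measurable_funX.
by move=> i e; split => //; rewrite e mulrBr.
Qed.

End PoissonFlow.

Section Flow.
Context {R : realType} {m : nat}.
Notation mu := (@lebesgue_measure R).
Notation m2 := (mu \x mu)%E.
Implicit Types (U : 'I_m -> R -> R).

(** The Poisson extension at height t above the origin; translating U gives the other points. *)
Definition poisson_ext U i t : R := pi^-1 * (\int[mu]_x (U i x * poisson t x))%R.

Lemma intg_poisson_ext U i t : unit_field U -> 0 < t -> intg mu (fun x => U i x * poisson t x).
Proof.
move=> hU t0; apply: (@intg_Mb _ _ _ mu (U i) (poisson t) 1); [exact: hU.1|exact: (poisson_mass t0).1|].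
by move=> x; exact: unit_le1.
Qed.

Lemma source_half_op U i t : harmonic_field U -> 0 < t -> source U i t = (\int[mu]_x (U i x * half_op (poisson t) x))%R.
Proof.
move=> hU t0; have [hu sU hE] := hU; have [mp [B HB] sp] := reg_poisson t0.
rewrite /source -(hE i _ B mp HB sp).
apply: (@pairA R (U i) (poisson t) 1) => //; first exact: hu.1.
- by move=> x; exact: unit_le1.
- exact: poisson_admiss.
- by move=> x; exact: (half_op_poisson x t0).1.
- exact: sqiM.
Qed.

Lemma cut_energy_ge0 U t : 0 < t -> 0 <= cut_energy U t.
Proof. by move=> t0; apply: Ri_ge0 => z; rewrite mulr_ge0 ?energy_density_ge0 ?cutoff_ge0. Qed.

(** By the equation and [poisson_flow] the integral of U_i P has t-derivative - source / c_half. *)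
Lemma source_flow U i t s : harmonic_field U -> 0 < t -> t < s ->
  intg mu (fun y => itv_ind t s y * source U i y) /\
  (\int[mu]_y (itv_ind t s y * source U i y))%R = c_half * ((\int[mu]_x (U i x * poisson t x))%R - (\int[mu]_x (U i x * poisson s x))%R).
Proof.
move=> hU t0 ts; have [hu sU hE] := hU; have s0 := lt_trans t0 ts.
pose A (z : R * R) : R := (\int[mu]_h (q2 h * diff2 h (poisson z.1) z.2))%R.
have mA : measurable_fun setT A.
  apply: (@meas_Ri _ _ _ _ _ mu (fun w : (R * R) * R => q2 w.2 * diff2 w.2 (poisson w.1.1) w.1.2)).
  have m11 : measurable_fun setT (fun w : (R * R) * R => w.1.1) by exact: (measurableT_comp measurable_fst measurable_fst).
  have m12 : measurable_fun setT (fun w : (R * R) * R => w.1.2) by exact: (measurableT_comp measurable_snd measurable_fst).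
  have mK (a : (R * R) * R -> R) : measurable_fun setT a -> measurable_fun setT (fun w : (R * R) * R => poisson w.1.1 (a w)).
    move=> ma; apply: measurable_funM => //; apply: meas_funV; apply: measurable_funD; exact: measurable_funX.
  apply: measurable_funM; first exact: (measurableT_comp (@meas_q2 R) measurable_snd).
  apply: measurable_funB; last by apply: mK; exact: measurable_funB.
  apply: measurable_funB; last by apply: mK; exact: measurable_funD.
  by apply: measurable_funM => //; exact: mK.
pose F (z : R * R) := itv_ind t s z.1 * (U i z.2 * A z).
have mF : measurable_fun setT F.
  apply: measurable_funM; first exact: (measurableT_comp (meas_itv_ind t s) measurable_fst).
  by apply: measurable_funM => //; exact: (measurableT_comp (hu.1 i) measurable_snd).
have L1 y : 0 < y -> intg mu (half_op (poisson y)) /\ (\int[mu]_x `|half_op (poisson y) x| <= C_poisson y * \int[mu]_h (wt h * q2 h))%R.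
  move=> y0; have iy := (poisson_mass y0).1.
  apply: (@intg_wL1 _ q2 (fun z => diff2 z.2 (poisson y) z.1) (C_poisson y)) => //.
  - exact: meas_q2.
  - exact: q2_ge0.
  - exact: intg_wq2.
  - exact: meas_diff2_kernel (intg_meas iy).
  - by move=> h /=; exact: intg_diff2.
  - by move=> h /=; exact: poisson_diff2_L1.
have iUA y : 0 < y -> intg mu (fun x => U i x * half_op (poisson y) x).
  move=> y0; apply: (@intg_Mb _ _ _ mu (U i) (half_op (poisson y)) 1); [exact: hu.1|exact: (L1 y y0).1|].
  by move=> x; exact: unit_le1.
pose W := (\int[mu]_h (wt h * q2 h : R))%R.
have W0 : 0 <= W by apply: Ri_ge0 => h; rewrite mulr_ge0 ?wt_ge0 ?q2_ge0.
have iF : intg m2 F.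
  apply: (@intg_prod1 _ _ _ _ _ mu mu F (fun y => (C_poisson t * W) * itv_ind t s y) mF).
  - move=> y; rewrite /F /=; case: (itv_ind_cases t s y) => [->|[-> /andP[h1 h2]]].
      by under eq_fun do rewrite mul0r; exact: intg0.
    by apply: intgZ; exact: iUA (lt_le_trans t0 h1).
  - by apply: intgZ; exact: (itv_ind_int ts).1.
  - move=> y; rewrite /F /=; case: (itv_ind_cases t s y) => [->|[-> /andP[h1 h2]]].
      rewrite (@Ri_eq _ _ _ mu _ (fun=> 0)); first by rewrite Rintegral_cst//= mul0r mulr0.
      by move=> x; rewrite mul0r normr0.
    have y0 := lt_le_trans t0 h1; have [j1 j2] := L1 y y0; rewrite mulr1.
    apply: (@le_trans _ _ (\int[mu]_x `|half_op (poisson y) x|)%R).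
      apply: Ri_le; [by apply: intg_abs; apply: intgZ; exact: iUA|exact: intg_abs|] => x.
      by rewrite mul1r normrM ler_piMl// unit_le1.
    apply: le_trans j2 _; apply: ler_wpM2r => //; rewrite /C_poisson lerD2r; apply: ler_wpM2l.
      by rewrite mulr_ge0 ?pi_ge0.
    by rewrite lef_pV2 ?posrE ?exprn_gt0//; apply: lerXn2r; rewrite ?nnegrE ?(ltW t0) ?(ltW y0).
have e y : (\int[mu]_x F (y, x))%R = itv_ind t s y * source U i y.
  rewrite /F /=; case: (itv_ind_cases t s y) => [->|[-> /andP[h1 h2]]].
    rewrite (@Ri_eq _ _ _ mu _ (fun=> 0)); first by rewrite Rintegral_cst//= !mul0r.
    by move=> x; rewrite mul0r.
  have y0 := lt_le_trans t0 h1; rewrite mul1r (source_half_op i hU y0); apply: Ri_eq => x.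
  by rewrite mul1r.
have [i1 _] := Ri_fubini1 iF.
split; first by have := i1; congr (intg _ _); apply/funext => y; exact: e.
rewrite -(@Ri_eq _ _ _ mu _ _ e) (Ri_swap iF).
rewrite -(RiB (intg_poisson_ext i hu t0) (intg_poisson_ext i hu s0)) -(RiZ _ (intgB (intg_poisson_ext i hu t0) (intg_poisson_ext i hu s0))).
apply: Ri_eq => x; rewrite /F /= (@Ri_eq _ _ _ mu _ (fun y => U i x * (itv_ind t s y * A (y, x)))); last by move=> y; ring.
have [iK eK] := poisson_flow x t0 ts.
by rewrite (RiZ _ iK) /A /= eK; ring.
Qed.

Lemma rate_energy_flow U t s : harmonic_field U -> 0 < t -> t < s ->
  intg mu (fun y => itv_ind t s y * rate_energy U y) /\
  (\int[mu]_y (itv_ind t s y * rate_energy U y))%R = 2^-1 * (cut_energy U s - cut_energy U t).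
Proof.
move=> hU t0 ts; have [hu sU _] := hU; have s0 := lt_trans t0 ts.
pose G (p : (R * R) * R) : R := energy_density U p.1 * (itv_ind t s p.2 * cutoff_rate p.2 p.1.1).
have iN := intg_energy_density sU.
have m11 : measurable_fun setT (fun p : (R * R) * R => p.1.1) by exact: (measurableT_comp measurable_fst measurable_fst).
have mG : measurable_fun setT G.
  apply: measurable_funM; first exact: (measurableT_comp (intg_meas iN) measurable_fst).
  apply: measurable_funM; first exact: (measurableT_comp (meas_itv_ind t s) measurable_snd).
  apply: measurable_funM; first by apply: measurable_funM => //; exact: measurable_funX.
  by apply: meas_funV; apply: measurable_funX; apply: measurable_funD; exact: measurable_funX.
have k0 z y : 0 <= itv_ind t s y * cutoff_rate y z.
  case: (itv_ind_cases t s y) => [->|[-> /andP[h1 _]]]; first by rewrite mul0r.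
  by rewrite mul1r cutoff_rate_ge0// (lt_le_trans t0).
have eG z : (\int[mu]_y G (z, y))%R = energy_density U z * (2^-1 * (cutoff s z.1 - cutoff t z.1)).
  by rewrite /G /= (RiZ _ (cutoff_flow z.1 t0 ts).1) (cutoff_flow z.1 t0 ts).2.
have iG : intg (@plane R \x mu)%E G.
  refine (@intg_prod1 _ _ _ _ _ (@plane R) mu G (energy_density U) mG _ iN _).
  - by move=> z; rewrite /G /=; apply: intgZ; exact: (cutoff_flow z.1 t0 ts).1.
  - move=> z; rewrite (@Ri_eq _ _ _ mu _ (fun y => G (z, y))); last by move=> y; rewrite ger0_norm// mulr_ge0 ?energy_density_ge0.
    rewrite eG -[leRHS]mulr1; apply: ler_wpM2l; first exact: energy_density_ge0.
    by have := cutoff_le1 z.1 s0; have := cutoff_ge0 z.1 t0; lra.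
have e y : (\int[@plane R]_z G (z, y))%R = itv_ind t s y * rate_energy U y.
  rewrite /G /=; case: (itv_ind_cases t s y) => [->|[-> /andP[h1 _]]].
    rewrite (@Ri_eq _ _ _ (@plane R) _ (fun=> 0)); first by rewrite /Rintegral integral0 mul0r.
    by move=> z; rewrite mul0r mulr0.
  by rewrite mul1r; apply: Ri_eq => z; rewrite mul1r.
have [i2 e2] := Ri_fubini2 iG; have [i1 e1] := Ri_fubini1 iG.
split; first by have := i2; congr (intg _ _); apply/funext => y; exact: e.
rewrite -(@Ri_eq _ _ _ mu _ _ e) -e2 e1.
have := RiZ 2^-1 (intgB (intg_cutoff hU s0) (intg_cutoff hU t0)); rewrite (RiB (intg_cutoff hU s0) (intg_cutoff hU t0)) => <-.
by apply: Ri_eq => z; rewrite eG; ring.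
Qed.

End Flow.

(** * Estimates at a single scale *)

Section PoissonExtension.
Context {R : realType} {m : nat}.
Notation mu := (@lebesgue_measure R).
Notation m2 := (mu \x mu)%E.
Implicit Types (U : 'I_m -> R -> R) (c : 'I_m -> R).

Definition translate (s : R) U : 'I_m -> R -> R := fun i x => U i (x + s).

Lemma D_translate (s : R) (w : R -> R) (z : R * R) :
  D (fun x => w (x + s)) z = D w (z.1 + s, z.2 + s).
Proof. by rewrite /D /=; congr (_ / _); ring. Qed.

Lemma energy_density_translate (s : R) U (z : R * R) : energy_density (translate s U) z = energy_density U (z.1 + s, z.2 + s).
Proof. by apply: eq_bigr => i _; rewrite (D_translate s (U i)). Qed.

Lemma sqi_translate (s : R) (w : R -> R) : measurable_fun setT w -> sqi m2 (D w) -> sqi m2 (D (fun x => w (x + s))).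
Proof.
move=> mw sw; split; first by apply: meas_D; exact: meas_shift.
have [+ _] := intg_diag s sw.2; congr (intg _ _); apply/funext => z.
by rewrite D_translate.
Qed.

Lemma harmonic_field_translate (s : R) U : harmonic_field U -> harmonic_field (translate s U).
Proof.
move=> [hu sU hE]; have hu' : unit_field (translate s U).
  by split => [i|x]; [apply: meas_shift; exact: hu.1|exact: hu.2].
split => //; first by move=> i; apply: sqi_translate => //; exact: hu.1.
move=> k phi B mp HB sp.
pose psi (x : R) := phi (x - s).
have mpsi : measurable_fun setT psi by exact: meas_shift.
have Hpsi x : `|psi x| <= B by exact: HB.
have spsi : sqi m2 (D psi) by exact: (sqi_translate (- s) mp sp).
have eps z : D phi z = D psi (z.1 + s, z.2 + s).
  by rewrite -D_translate /psi; congr (D _ _); apply/funext => x; rewrite addrK.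
have := hE k psi B mpsi Hpsi spsi.
have i1 := sqiM (sU k) spsi; have [_ <-] := intg_diag s i1.
have mU : measurable_fun setT (fun x => U k x * psi x) by apply: measurable_funM => //; exact: hu.1.
have bU x : `|U k x * psi x| <= B.
  rewrite normrM; apply: le_trans (Hpsi x); rewrite ler_piMl// unit_le1//.
have i2 := intg_energy_density1 sU mU bU; have [_ <-] := intg_diag s i2.
move=> H; etransitivity; [|etransitivity; [exact: H|]]; apply: Ri_eq => z.
  by rewrite /translate D_translate eps.
by rewrite energy_density_translate /psi /= addrK.
Qed.

Definition total_energy U := (\int[m2]_z energy_density U z)%R.

Lemma total_energy_ge0 U : 0 <= total_energy U.
Proof. by apply: Ri_ge0 => z; exact: energy_density_ge0. Qed.

Lemma total_energy_translate (s : R) U : harmonic_field U -> total_energy (translate s U) = total_energy U.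
Proof.
move=> [_ sU _]; have [_ e] := intg_diag s (intg_energy_density sU).
by rewrite /total_energy -[RHS]e; apply: Ri_eq => z; rewrite energy_density_translate.
Qed.

Lemma cut_energy_total_energy U (t : R) : harmonic_field U -> 0 < t -> cut_energy U t <= total_energy U.
Proof.
move=> hU t0; have [hu sU _] := hU; apply: Ri_le (intg_cutoff hU t0) (intg_energy_density sU) _ => z.
by rewrite -[leRHS]mulr1; apply: ler_wpM2l; [exact: energy_density_ge0|exact: cutoff_le1].
Qed.

Definition C_flow : R := (@pi R)^-1 * ((@c_half R)^-1 * ((4 + 152 * (2 * pi) * 200) * 2^-1)).

Lemma C_flow_ge0 : 0 <= C_flow.
Proof.
have p0 := pi_gt0 R; have k0 := @c_half_gt0 R.
rewrite /C_flow; apply: mulr_ge0; first by rewrite invr_ge0 ltW.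
by apply: mulr_ge0; [rewrite invr_ge0 ltW|lra].
Qed.

(** At every height the derivative of the extension is at most a constant times the derivative of the energy, by
    [source_le]. *)
Lemma poisson_ext_flow U i (t s : R) : harmonic_field U -> 0 < t -> t < s -> `|poisson_ext U i t - poisson_ext U i s| <= C_flow * (cut_energy U s - cut_energy U t).
Proof.
move=> hU t0 ts; have [iI eI] := source_flow i hU t0 ts; have [iW eW] := rate_energy_flow hU t0 ts.
have p0 := pi_gt0 R; have k0 := @c_half_gt0 R.
pose CI : R := 4 + 152 * (2 * pi) * 200.
have : `|(\int[mu]_y (itv_ind t s y * source U i y))%R| <= (\int[mu]_y (CI * (itv_ind t s y * rate_energy U y)))%R.
  apply: (Ri_abs_le iI (intgZ CI iW)) => y.
  case: (itv_ind_cases t s y) => [->|[-> /andP[h1 _]]]; first by rewrite !mul0r normr0 mulr0.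
  by rewrite !mul1r; apply: source_le => //; exact: lt_le_trans h1.
rewrite (RiZ _ iW) eI eW normrM (gtr0_norm k0) => H.
rewrite /poisson_ext -mulrBr normrM (@gtr0_norm _ (pi^-1)) ?invr_gt0//.
rewrite /C_flow -!(mulrA (pi^-1)) -/CI; apply: ler_wpM2l; first by rewrite invr_ge0 ltW.
rewrite -(ler_pM2l k0); apply: le_trans H _.
rewrite le_eqVlt; apply/orP; left; apply/eqP; field; exact: lt0r_neq0.
Qed.

Lemma cut_energy_mono U (t s : R) : harmonic_field U -> 0 < t -> t <= s -> cut_energy U t <= cut_energy U s.
Proof.
move=> hU t0; rewrite le_eqVlt => /orP[/eqP->//|ts].
have [_ e] := rate_energy_flow hU t0 ts.
have : 0 <= (\int[mu]_y (itv_ind t s y * rate_energy U y))%R.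
  apply: Ri_ge0 => y; case: (itv_ind_cases t s y) => [->|[-> /andP[h1 _]]]; first by rewrite mul0r.
  rewrite mul1r; apply: Ri_ge0 => z; apply: mulr_ge0; first exact: energy_density_ge0.
  by apply: cutoff_rate_ge0; exact: lt_le_trans h1.
rewrite e; lra.
Qed.

Lemma poisson_ext_dist U i (t s : R) : harmonic_field U -> 0 < t -> t <= s -> `|poisson_ext U i t - poisson_ext U i s| <= C_flow * cut_energy U s.
Proof.
move=> hU t0; rewrite le_eqVlt => /orP[/eqP <-|ts].
  by rewrite subrr normr0 mulr_ge0 ?C_flow_ge0 ?cut_energy_ge0.
apply: le_trans (poisson_ext_flow i hU t0 ts) _; apply: ler_wpM2l; first exact: C_flow_ge0.
by have := cut_energy_ge0 U t0; lra.
Qed.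

Lemma pipi : 4 <= (@pi R) ^+ 2 /\ 2 <= (@pi R).
Proof. have := pi_ge2 R; split; nra. Qed.

Lemma pi_poisson_ext U i (t : R) : pi * poisson_ext U i t = (\int[mu]_x (U i x * poisson t x))%R.
Proof. by rewrite /poisson_ext mulVKf// lt0r_neq0// pi_gt0. Qed.

(** 1 - |extension|^2 is half the mean of |U(x) - U(y)|^2 under the product of two Poisson kernels, and
    (x - y)^2 P(x) P(y) is at most twice the sum of the cutoffs at x and y. *)
Lemma poisson_ext_norm U (t : R) : harmonic_field U -> 0 < t -> 1 - \sum_j poisson_ext U j t ^+ 2 <= 2^-1 * cut_energy U t.
Proof.
move=> hU t0; have [hu sU _] := hU; have [ip ep] := poisson_mass t0; have [pp p2] := pipi.
have iN := intg_cutoff hU t0; have [iN' eN] := intg_swap iN.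
have [iP eP] := Ri_tensor ip ip.
have iU j := intg_poisson_ext j hu t0.
have iT j := (Ri_tensor (iU j) (iU j)).
pose G (z : R * R) := 2 * (poisson t z.1 * poisson t z.2) - 2 * \sum_j (U j z.1 * poisson t z.1) * (U j z.2 * poisson t z.2).
have iS : intg m2 (fun z => \sum_j (U j z.1 * poisson t z.1) * (U j z.2 * poisson t z.2)) by apply: intg_sum => j; exact: (iT j).1.
have iG : intg m2 G by apply: intgB; exact: intgZ.
have eG : (\int[m2]_z G z)%R = 2 * pi ^+ 2 * (1 - \sum_j poisson_ext U j t ^+ 2).
  rewrite /G (RiB (intgZ 2 iP) (intgZ 2 iS)) (RiZ _ iP) (RiZ _ iS) eP ep Ri_sum; last by move=> j; exact: (iT j).1.
  rewrite (eq_bigr (fun j => pi ^+ 2 * poisson_ext U j t ^+ 2)); last first.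
    by move=> j _; rewrite (iT j).2 -pi_poisson_ext; ring.
  by rewrite -mulr_sumr; ring.
have : (\int[m2]_z G z <= \int[m2]_z (2 * (energy_density U z * cutoff t z.1 + energy_density U (z.2, z.1) * cutoff t z.2)))%R.
  apply: Ri_le => //; first by apply: intgZ; exact: intgD.
  move=> z; rewrite energy_density_swap -mulrDr.
  have eGz : G z = poisson t z.1 * poisson t z.2 * \sum_j (U j z.1 - U j z.2) ^+ 2.
    rewrite [X in _ = _ * X](eq_bigr (fun j => U j z.1 ^+ 2 + (U j z.2 ^+ 2 - 2 * (U j z.1 * U j z.2)))); last by move=> j _; ring.
    rewrite big_split sumrB/= !hu.2 -mulr_sumr /G.
    rewrite (eq_bigr (fun j => poisson t z.1 * poisson t z.2 * (U j z.1 * U j z.2))); last by move=> j _; ring.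
    by rewrite -mulr_sumr; ring.
  rewrite eGz energy_densityE; set n := \sum_j _.
  have n0 : 0 <= n by apply: sumr_ge0 => j _; exact: sqr_ge0.
  have [zz|zz] := eqVneq z.1 z.2.
    rewrite (_ : n = 0); first by rewrite !(mulr0, mul0r).
    by rewrite /n big1// => j _; rewrite zz subrr expr0n.
  have X0 := den_gt0 z.1 t0; have Y0 := den_gt0 z.2 t0.
  have d0 : 0 < (z.1 - z.2) ^+ 2 by rewrite exprn_even_gt0//= subr_eq0.
  rewrite -subr_ge0 /poisson /cutoff.
  rewrite (_ : _ - _ = n * (t ^+ 2 * (2 * (z.1 ^+ 2 + z.2 ^+ 2 + 2 * t ^+ 2) - (z.1 - z.2) ^+ 2)) /
    ((z.1 - z.2) ^+ 2 * (z.1 ^+ 2 + t ^+ 2) * (z.2 ^+ 2 + t ^+ 2))); last first.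
    by field; rewrite subr_eq0 zz !gt_eqF.
  apply: divr_ge0; last by apply: mulr_ge0; [apply: mulr_ge0; exact: ltW|exact: ltW].
  apply: mulr_ge0 => //; apply: mulr_ge0; first exact: sqr_ge0.
  have := sqr_ge0 (z.1 + z.2); have := sqr_ge0 t; lra.
rewrite (RiZ _ (intgD iN iN')) (RiD iN iN') eN eG -/(cut_energy U t) => H.
have := cut_energy_ge0 U t0; move: H; move: (cut_energy U t) (1 - _) => f a.
by have := pp; nra.
Qed.

Lemma mean_dist_poisson_ext U (t : R) : harmonic_field U -> 0 < t -> mean_dist U (poisson_ext U ^~ t) t = pi * (1 - \sum_j poisson_ext U j t ^+ 2).
Proof.
move=> hU t0; have [hu sU _] := hU; have [ip ep] := poisson_mass t0.
have iU j := intg_poisson_ext j hu t0; set c := poisson_ext U ^~ t.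
have iS : intg mu (fun x => \sum_j c j * (U j x * poisson t x)) by apply: intg_sum => j; exact: intgZ.
have e x : sqdist U c x * poisson t x = (1 + \sum_j c j ^+ 2) * poisson t x - 2 * \sum_j c j * (U j x * poisson t x).
  rewrite /sqdist (eq_bigr (fun j => U j x ^+ 2 + (c j ^+ 2 - 2 * (U j x * c j)))); last by move=> j _; ring.
  rewrite big_split sumrB/= hu.2 -mulr_sumr.
  rewrite [X in _ = _ - 2 * X](eq_bigr (fun j => poisson t x * (U j x * c j))); last by move=> j _; ring.
  by rewrite -mulr_sumr; ring.
rewrite /mean_dist (@Ri_eq _ _ _ mu _ _ e) (RiB (intgZ _ ip) (intgZ 2 iS)) (RiZ _ ip) (RiZ _ iS) ep Ri_sum; last by move=> j; exact: intgZ.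
rewrite [X in _ - 2 * X](eq_bigr (fun j => pi * c j ^+ 2)).
  by rewrite -mulr_sumr /c; ring.
move=> j _; rewrite (RiZ _ (iU j)) -pi_poisson_ext -/(c j); ring.
Qed.

Lemma poisson_ext_le1 U (t : R) : harmonic_field U -> 0 < t -> \sum_j poisson_ext U j t ^+ 2 <= 1.
Proof.
move=> hU t0; have := mean_dist_poisson_ext hU t0 => e; rewrite -subr_ge0 -(pmulr_rge0 _ (pi_gt0 R)) -e.
by apply: Ri_ge0 => x; apply: mulr_ge0; [exact: sqdist_ge0|exact: poisson_ge0].
Qed.

Lemma poisson_shift_le (t h x : R) : 0 < t -> `|h| <= t -> `|poisson t (x - h) - poisson t x| <= 2 * (`|h| / t) * poisson t x.
Proof.
move=> t0 ht; have X0 := den_gt0 x t0; have Y0 := den_gt0 (x - h) t0.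
have e : poisson t (x - h) - poisson t x = h * (2 * (x - h) + h) / ((x - h) ^+ 2 + t ^+ 2) * poisson t x.
  by rewrite /poisson; field; rewrite !gt_eqF.
rewrite e normrM (ger0_norm (poisson_ge0 x t0)); apply: ler_wpM2r; first exact: poisson_ge0.
rewrite [leLHS]normrM normfV (gtr0_norm Y0) normrM ler_pdivrMr//.
rewrite (_ : 2 * _ * _ = `|h| * (2 * ((x - h) ^+ 2 + t ^+ 2) / t)); last by ring.
apply: ler_wpM2l => //; rewrite ler_pdivlMr//.
have h1 : `|2 * (x - h) + h| <= 2 * `|x - h| + `|h| by apply: le_trans (ler_normD _ _) _; rewrite normrM (@ger0_norm _ 2).
have h2 : (x - h) ^+ 2 = `|x - h| ^+ 2 by rewrite real_normK// num_real.
rewrite h2; move: h1 ht (normr_ge0 (x - h)); move: (`|_ + _|) (`|x - h|) (`|h|) => a b k h1 h3 b0.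
have := sqr_ge0 (b - t); nra.
Qed.

(** A shift by h <= t changes P by at most 2 |h| / t times itself; after subtracting the mean of U this is
    applied to U - c, which is small in mean square by [poisson_ext_norm]. *)
Lemma poisson_ext_slide U (t h : R) : harmonic_field U -> 0 < t -> `|h| <= t ->
  \sum_j (poisson_ext (translate h U) j t - poisson_ext U j t) ^+ 2 <= 2 * (`|h| / t) ^+ 2 * cut_energy U t.
Proof.
move=> hU t0 ht; have [hu sU _] := hU; have [ip ep] := poisson_mass t0; have [pp p2] := pipi.
set c := poisson_ext U ^~ t; have c1 : \sum_j c j ^+ 2 <= 1 := poisson_ext_le1 hU t0.
have ips := intg_shift (- h) ip; have eps := Ri_shift (- h) ip.
have iB := intgB ips ip; have iP := intg_mean_dist hu c1 t0.
have p0 := pi_gt0 R.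
have iUs j : intg mu (fun x => U j x * poisson t (x - h)).
  apply: (@intg_Mb _ _ _ mu (U j) _ 1); [exact: hu.1|exact: ips|by move=> x; exact: unit_le1].
have key j : pi * (poisson_ext (translate h U) j t - c j) ^+ 2 <= 4 * (`|h| / t) ^+ 2 * (\int[mu]_x (poisson t x * (U j x - c j) ^+ 2))%R.
  have cj1 : `|c j| <= 1.
    rewrite -(@ler_pXn2r _ 2)// ?nnegrE// expr1n real_normK ?num_real//; apply: le_trans c1.
    by rewrite (bigD1 j)//= lerDl; apply: sumr_ge0 => k _; exact: sqr_ge0.
  have mU : measurable_fun setT (fun x => U j x - c j) by apply: measurable_funB => //; exact: hu.1.
  have bU x : `|U j x - c j| <= 2.
    by apply: le_trans (ler_normB _ _) _; have := unit_le1 j x hu; move: cj1; lra.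
  have e : pi * (poisson_ext (translate h U) j t - c j) = (\int[mu]_x ((U j x - c j) * (poisson t (x - h) - poisson t x)))%R.
    have e1 : (\int[mu]_x (translate h U j x * poisson t x))%R = (\int[mu]_x (U j x * poisson t (x - h)))%R.
      rewrite -(Ri_shift h (iUs j)); apply: Ri_eq => x; by rewrite /translate addrK.
    rewrite (@Ri_eq _ _ _ mu _ (fun x => (U j x * poisson t (x - h) - U j x * poisson t x) - c j * (poisson t (x - h) - poisson t x))); last by move=> x; ring.
    rewrite (RiB (intgB (iUs j) (intg_poisson_ext j hu t0)) (intgZ _ iB)) (RiB (iUs j) (intg_poisson_ext j hu t0)) (RiZ _ iB) (RiB ips ip) eps subrr mulr0 subr0 -e1.
    by rewrite /c mulrBr !pi_poisson_ext.
  have CS := cs_weight (fun x => poisson_ge0 x t0) ip (measurableT_comp (@meas_abs R) mU) (fun x => eq_ind_r (fun a => a <= 2) (bU x) (normr_id _)).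
  rewrite ep in CS.
  have iA : intg mu (fun x => poisson t x * `|U j x - c j|).
    by under eq_fun do rewrite mulrC; apply: (@intg_Mb _ _ _ mu _ (poisson t) 2) => //; [exact: (measurableT_comp (@meas_abs R) mU)|move=> x; rewrite normr_id].
  have iC : intg mu (fun x => (U j x - c j) * (poisson t (x - h) - poisson t x)) by apply: (@intg_Mb _ _ _ mu _ _ 2 mU iB bU).
  have ab : `|pi * (poisson_ext (translate h U) j t - c j)| <= 2 * (`|h| / t) * (\int[mu]_x (poisson t x * `|U j x - c j|))%R.
    rewrite e -(RiZ _ iA); apply: (Ri_abs_le iC (intgZ _ iA)) => x.
    have := ler_wpM2l (normr_ge0 (U j x - c j)) (poisson_shift_le x t0 ht); rewrite normrM => H; apply: le_trans H _.
    by rewrite le_eqVlt; apply/orP; left; apply/eqP; ring.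
  have sq : (\int[mu]_x (poisson t x * `|U j x - c j| ^+ 2))%R = (\int[mu]_x (poisson t x * (U j x - c j) ^+ 2))%R.
    by apply: Ri_eq => x; rewrite real_normK ?num_real.
  rewrite sq in CS; move: CS ab; move: (\int[mu]_x _)%R => J; move: (\int[mu]_x _)%R => I CS ab.
  have ht0 : 0 <= `|h| / t by rewrite divr_ge0// ltW.
  rewrite -(ler_pM2l p0).
  have : `|pi * (poisson_ext (translate h U) j t - c j)| ^+ 2 <= (2 * (`|h| / t) * J) ^+ 2.
    by apply: lerXn2r; rewrite ?nnegrE// (le_trans _ ab).
  rewrite real_normK ?num_real//.
  have := ler_wpM2l (sqr_ge0 (2 * (`|h| / t))) CS; rewrite !exprMn.
  move: ((`|h| / t) ^+ 2) => q; lra.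
have : pi * \sum_j (poisson_ext (translate h U) j t - c j) ^+ 2 <= 4 * (`|h| / t) ^+ 2 * mean_dist U c t.
  rewrite mulr_sumr; apply: le_trans (ler_sum _ (fun j _ => key j)) _.
  rewrite -mulr_sumr -Ri_sum; last first.
    move=> j; have : intg mu (fun x => (U j x - c j) ^+ 2 * poisson t x).
      apply: (@intg_Mb _ _ _ mu _ (poisson t) 4) => //.
        by apply: measurable_funX; apply: measurable_funB => //; exact: hu.1.
      move=> x; rewrite ger0_norm ?sqr_ge0//; apply: le_trans (sqdist_bound x hu c1).
      by rewrite /sqdist (bigD1 j)//= lerDl; apply: sumr_ge0 => k _; exact: sqr_ge0.
    by congr (intg _ _); apply/funext => x; rewrite mulrC.
  rewrite le_eqVlt; apply/orP; left; apply/eqP; congr (_ * _); apply: Ri_eq => x.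
  by rewrite /sqdist mulr_suml; apply: eq_bigr => j _; rewrite mulrC.
rewrite mean_dist_poisson_ext// => H; have N := poisson_ext_norm hU t0; rewrite -(ler_pM2l p0); apply: le_trans H _.
have q0 := sqr_ge0 (`|h| / t); move: N; rewrite -/c; move: (1 - _) (cut_energy U t) => a f N.
have : 4 * (`|h| / t) ^+ 2 * (pi * a) <= 4 * (`|h| / t) ^+ 2 * (pi * (2^-1 * f)).
  by apply: ler_wpM2l; [lra|apply: ler_wpM2l => //; exact: ltW].
lra.
Qed.

Lemma small_arith (e k q : R) : 0 < e -> 0 <= k -> 0 < q -> k * (e / (2 * (k + 1) * q)) * q <= e / 2.
Proof.
move=> e0 k0 q0; have k1 : 0 < k + 1 by lra.
rewrite (_ : _ * q = (e / 2) * (k / (k + 1))); last by field; rewrite !gt_eqF.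
by rewrite ler_piMr ?(ltW (divr_gt0 e0 _))// ltW// ltr_pdivrMr// mul1r ltrDl.
Qed.

(** Without integrability: an infinite integral has real value 0 on both sides. *)
Lemma RiZ_ge0 (k : R) (f : R -> R) : 0 <= k -> measurable_fun setT f -> (forall x, 0 <= f x) ->
  (\int[mu]_x (k * f x))%R = k * (\int[mu]_x f x)%R.
Proof.
move=> k0 mf f0; rewrite /Rintegral; under eq_integral do rewrite EFinM.
rewrite ge0_integralZl//; last 2 first.
- exact/measurable_EFinP.
- by move=> x _; rewrite lee_fin.
have : (0 <= \int[mu]_x (f x)%:E)%E by apply: integral_ge0 => x _; rewrite lee_fin.
case: (\int[mu]_x _)%E => [r| |] //= _.
move: k0; rewrite le_eqVlt => /orP[/eqP <-|k0]; first by rewrite mul0e mul0r.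
by rewrite gt0_muley ?lte_fin//= mulr0.
Qed.

(** F(x, S) is the integral of the marginal of the energy density against a cutoff at x.  The marginal
    exceeds a high level only by an integrable function of small integral, and below the level the cutoff contributes
    its mass, a multiple of S. *)
Lemma cut_energy_small U (e : R) : harmonic_field U -> 0 < e -> exists2 S : R, 0 < S & forall x, cut_energy (translate x U) S <= e.
Proof.
move=> hU e0; have [hu sU _] := hU; have iN := intg_energy_density sU.
have [iM eM] := Ri_fubini1 iN.
pose M x : R := (\int[mu]_y energy_density U (x, y))%R.
have M0 x : 0 <= M x by apply: Ri_ge0 => y; exact: energy_density_ge0.
have mM : measurable_fun setT M := intg_meas iM.
have mn n : measurable_fun setT (fun x => Num.min (M x) n%:R) by exact: measurable_minr.
have in_ n : intg mu (fun x => Num.min (M x) n%:R).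
  apply: (@intg_le _ _ _ mu _ M (mn n) iM) => x; rewrite ger0_norm ?ge_min ?lexx//.
  by rewrite le_min M0 /=.
have [_ C] : intg mu (fun=> 0) /\ (\int[mu]_x (M x - Num.min (M x) n%:R))%R @[n --> \oo] --> (\int[mu]_(x in setT) 0)%R.
  apply: (@Ri_dct _ _ _ mu _ _ M) => //.
  - by move=> n; apply: (measurable_funB mM (mn n)).
  - apply: aeW => x; apply/cvgE => d d0; exists (Num.truncn (M x)).+1 => n hn.
    rewrite min_l ?subrr ?subr0 ?normr0 ?ltW//.
    by apply: lt_le_trans (truncnS_gt _) _; rewrite ler_nat.
  - move=> n x; rewrite ger0_norm ?subr_ge0 ?ge_min ?lexx//.
    by rewrite lerBlDr lerDl le_min M0/=.
rewrite /Rintegral integral0/= in C.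
have e2 : 0 < e / 2 by rewrite divr_gt0.
have [n Hn] := cvg0_le C e2; have {}Hn := Hn n (leqnn n).
have p0 := pi_gt0 R; have n0 : 0 < n%:R + 1 :> R by rewrite ltr_pwDr.
(* At this scale n times the mass of the cutoff is at most e / 2. *)
pose S := e / (2 * (n%:R + 1) * pi); have S0 : 0 < S by rewrite divr_gt0// !mulr_gt0.
exists S => // x0.
have [ip ep] := poisson_mass S0; have ips := intg_shift (- x0) ip; have eps := Ri_shift (- x0) ip.
have mph : measurable_fun setT (fun x : R => cutoff S (x - x0)) by apply: meas_shift; exact: meas_cutoff.
have bph x : `|cutoff S (x - x0)| <= 1 by rewrite ger0_norm ?cutoff_ge0// cutoff_le1.
have iF := intg_energy_density_bnd hU mph bph.
have e1 : cut_energy (translate x0 U) S = (\int[m2]_z (energy_density U z * cutoff S (z.1 - x0)))%R.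
  have [_ <-] := intg_diag x0 iF; apply: Ri_eq => z; by rewrite energy_density_translate /= addrK.
have [iR eR] := Ri_fubini1 iF.
have iMB := intgB iM (in_ n).
rewrite e1 eR; apply: (@le_trans _ _ (\int[mu]_x ((M x - Num.min (M x) n%:R) + (n%:R * S) * poisson S (x - x0)))%R).
  apply: Ri_le => //; first by apply: intgD => //; exact: intgZ.
  move=> x.
  have -> : (\int[mu]_y (energy_density U (x, y) * cutoff S ((x, y).1 - x0)))%R = cutoff S (x - x0) * M x.
    rewrite /= /M -RiZ_ge0 ?cutoff_ge0//.
    - by apply: Ri_eq => y; rewrite mulrC.
    - exact: (measurableT_comp (intg_meas iN) (pair1_measurable x)).
    - by move=> y; exact: energy_density_ge0.
  have h0 := cutoff_ge0 (x - x0) S0; have h1 := cutoff_le1 (x - x0) S0.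
  have a1 : Num.min (M x) n%:R <= M x by rewrite ge_min lexx.
  have a2 : Num.min (M x) n%:R <= n%:R :> R by rewrite ge_min lexx orbT.
  rewrite -mulrA -cutoffE; move: h0 h1 a1 a2; move: (cutoff _ _) (M x) (Num.min _ _) => p a b h0 h1 a1 a2.
  have : p * (a - b) <= a - b by rewrite ler_piMl// subr_ge0.
  have := ler_wpM2l h0 a2; lra.
rewrite (RiD iMB (intgZ _ ips)) (RiZ _ ips) eps ep.
have : n%:R * S * pi <= e / 2.
  exact: small_arith.
by move=> hp; rewrite [leRHS]splitr; exact: lerD Hn hp.
Qed.

Lemma decay_bound U c (z : R * R) : unit_field U ->
  (\sum_j (U j z.1 - U j z.2) * c j) ^+ 2 <=
  8 * ((\sum_j (U j z.1 - U j z.2) ^+ 2) * (sqdist U c z.1 + sqdist U c z.2)).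
Proof.
move=> hu; set n := \sum_j _ ^+ 2.
have n0 : 0 <= n by apply: sumr_ge0 => j _; exact: sqr_ge0.

(* c may be replaced by c - (U(x) + U(y)) / 2, because |U(x)| = |U(y)|. *)
have -> : \sum_j (U j z.1 - U j z.2) * c j = \sum_j (U j z.1 - U j z.2) * (c j - 2^-1 * (U j z.1 + U j z.2)).
  rewrite [RHS](eq_bigr (fun j => (U j z.1 - U j z.2) * c j - 2^-1 * (U j z.1 ^+ 2 - U j z.2 ^+ 2))); last by move=> j _; field.
  by rewrite sumrB -mulr_sumr sumrB !hu.2 subrr mulr0 subr0.
apply: le_trans (cs_sum _ _) _; rewrite -/n mulrCA; apply: ler_wpM2l => //.
rewrite /sqdist -big_split/= mulr_sumr; apply: ler_sum => j _.
move: (U j z.1) (U j z.2) (c j) => a b k.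
have := sqr_ge0 (a - b); have := sqr_ge0 (a - k); have := sqr_ge0 (b - k); nra.
Qed.

Lemma decay_in (a p s : R) : 0 <= a -> 0 <= p -> 2^-1 <= s -> 2^-1 * p - 3 / 2 * a <= p * s.
Proof. move=> a0 p0 s0; have := ler_wpM2l p0 s0; lra. Qed.

Lemma decay_out (a p s : R) : 0 <= p -> -1 <= s -> p <= a -> 2^-1 * p - 3 / 2 * a <= p * s.
Proof. move=> p0 s1 pa; have := ler_wpM2l p0 s1; lra. Qed.

Lemma decay_end (w p f ee q : R) : w <= f -> 2^-1 * f - 3 / 2 * q * ee <= 4^-1 * w + 4624 * p ->
  f <= 18496 * p + 6 * q * ee.
Proof. lra. Qed.

Lemma sqr_le1_geN1 (s : R) : s ^+ 2 <= 1 -> -1 <= s.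
Proof. nra. Qed.

(** Test the equation for U.c with the cutoff.  Where U.c >= 1/2 the right-hand side dominates half the
    energy, and further out the cutoff is at most (t / S0)^2.  The left-hand side is estimated by [kbound_point], whose
    first term is absorbed because t cutoff_rate <= cutoff. *)
Lemma cut_energy_decay U c (t S0 : R) : harmonic_field U -> \sum_j c j ^+ 2 <= 1 -> 0 < t -> 0 < S0 ->
  {ae mu, forall x, `|x| <= S0 -> 2^-1 <= \sum_j U j x * c j} ->
  cut_energy U t <= 18496 * pi * mean_dist U c t + 6 * (t ^+ 2 / S0 ^+ 2) * total_energy U.
Proof.
move=> hU c1 t0 S00 Hc; have [hu sU hE] := hU.
have rP := reg_poisson t0; have sq0 : 0 <= t ^+ 2 / S0 ^+ 2 by rewrite divr_ge0 ?sqr_ge0.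
have rh : reg (cutoff t).
  have -> : cutoff t = (fun x => t * poisson t x) by apply/funext => x; exact: cutoffE.
  exact: regZ.
have [mh [B HB] sh] := rh.
have d16 : 0 < 16^-1 :> R by rewrite invr_gt0.
have [ik ek] := kbound_int hU c1 t0 d16.
have iDD j : intg m2 (fun z => c j * (D (U j) z * D (cutoff t) z)) by apply: intgZ; exact: sqiM.
have mUh j : measurable_fun setT (fun x => U j x * cutoff t x) by apply: measurable_funM => //; exact: hu.1.
have bUh j x : `|U j x * cutoff t x| <= 1.
  rewrite normrM -[leRHS]mulr1; apply: ler_pM => //; first exact: unit_le1.
  by rewrite ger0_norm ?cutoff_ge0// cutoff_le1.
have iN j : intg m2 (fun z => energy_density U z * (U j z.1 * cutoff t z.1)) := intg_energy_density1 sU (mUh j) (bUh j).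
have iNc j : intg m2 (fun z => c j * (energy_density U z * (U j z.1 * cutoff t z.1))) by exact: intgZ.
have iSD : intg m2 (fun z => \sum_j c j * (D (U j) z * D (cutoff t) z)) by exact: intg_sum.
have iSN : intg m2 (fun z => \sum_j c j * (energy_density U z * (U j z.1 * cutoff t z.1))) by exact: intg_sum.
have eq1 : (\int[m2]_z (\sum_j c j * (energy_density U z * (U j z.1 * cutoff t z.1))) = \int[m2]_z (\sum_j c j * (D (U j) z * D (cutoff t) z)))%R.
  rewrite !Ri_sum//; apply: eq_bigr => j _.
  rewrite (RiZ _ (iN j)) (RiZ _ (sqiM (sU j) sh)); congr (_ * _).
  exact/esym/(hE j _ B mh HB sh).
have up : (\int[m2]_z (\sum_j c j * (D (U j) z * D (cutoff t) z)) <= \int[m2]_z (t * (2 * kbound U c t 16^-1 z)))%R.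
  have iK := intgZ t (intgZ 2 ik).
  apply: (Ri_le iSD iK) => z; apply: le_trans (ler_norm _) _.
  have -> : \sum_j c j * (D (U j) z * D (cutoff t) z) = t * (D (poisson t) z * ((\sum_j (U j z.1 - U j z.2) * c j) / (z.1 - z.2))).
    rewrite mulr_suml !mulr_sumr; apply: eq_bigr => j _; rewrite /D !cutoffE; ring.
  rewrite normrM (gtr0_norm t0); apply: ler_wpM2l; first exact: ltW.
  by apply: kbound_point => //; exact: decay_bound.
rewrite (RiZ _ (intgZ 2 ik)) (RiZ _ ik) ek in up.
have ih := intg_cutoff hU t0; have iNN := intg_energy_density sU.
have lo : (\int[m2]_z (2^-1 * (energy_density U z * cutoff t z.1) - (3 / 2 * (t ^+ 2 / S0 ^+ 2)) * energy_density U z) <= \int[m2]_z (\sum_j c j * (energy_density U z * (U j z.1 * cutoff t z.1))))%R.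
  apply: Ri_ae_le => //; first by apply: intgB; exact: intgZ.
  have Hz := ae_fst Hc.
  apply: (@filterS _ _ (ae_filter_ringOfSetsType (@plane R)) _ _ _ Hz) => z hz.
  have -> : \sum_j c j * (energy_density U z * (U j z.1 * cutoff t z.1)) = energy_density U z * (cutoff t z.1 * \sum_j U j z.1 * c j).
    by rewrite !mulr_sumr; apply: eq_bigr => j _; ring.
  have -> : 2^-1 * (energy_density U z * cutoff t z.1) - (3 / 2 * (t ^+ 2 / S0 ^+ 2)) * energy_density U z = energy_density U z * (2^-1 * cutoff t z.1 - 3 / 2 * (t ^+ 2 / S0 ^+ 2)) by ring.
  apply: ler_wpM2l; first exact: energy_density_ge0.
  have h0 := cutoff_ge0 z.1 t0.
  have [zS|zS] := leP `|z.1| S0.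
    exact: (decay_in sq0 h0 (hz zS)).
  have ps : cutoff t z.1 <= t ^+ 2 / S0 ^+ 2.
    rewrite /cutoff; apply: ler_wpM2l; first exact: sqr_ge0.
    rewrite lef_pV2 ?posrE ?den_gt0 ?exprn_gt0//.
    have : S0 ^+ 2 <= `|z.1| ^+ 2 by apply: lerXn2r; rewrite ?nnegrE ?(ltW S00) ?(ltW zS).
    by rewrite real_normK ?num_real// => H; apply: le_trans H _; rewrite lerDl sqr_ge0.
  have s1 : -1 <= \sum_j U j z.1 * c j.
    have := cs_sum (U ^~ z.1) c; rewrite hu.2 mul1r => cs.
    exact: sqr_le1_geN1 (le_trans cs c1).
  exact: (decay_out h0 s1 ps).
rewrite (RiB (intgZ _ ih) (intgZ _ iNN)) (RiZ _ ih) (RiZ _ iNN) eq1 -/(cut_energy U t) -/(total_energy U) in lo.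
have wF : t * rate_energy U t <= cut_energy U t.
  have iw := intg_cutoff_rate hU t0; rewrite /rate_energy -(RiZ _ iw); apply: Ri_le => //; first exact: intgZ.
  by move=> z; rewrite mulrCA; apply: ler_wpM2l; [exact: energy_density_ge0|exact: cutoff_rate_cutoff].
have H := le_trans lo up.
have e : t * (2 * (2 * 16^-1 * rate_energy U t + (4 + 72 / 16^-1) * (2 * pi / t * mean_dist U c t))) = 4^-1 * (t * rate_energy U t) + 4624 * (pi * mean_dist U c t).
  by rewrite invrK; move: (rate_energy _ _) (mean_dist _ _ _) (pi : R) => w p q; field; rewrite gt_eqF.
rewrite e in H; rewrite -!(mulrA 18496).
exact: (decay_end wF H).
Qed.

End PoissonExtension.

(** * The continuous representative *)

Section Trace.
Context {R : realType} {m : nat}.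
Notation mu := (@lebesgue_measure R).
Notation m2 := (mu \x mu)%E.
Variable U : 'I_m -> R -> R.
Hypothesis hU : harmonic_field U.

Definition ext_at (x t : R) (i : 'I_m) : R := poisson_ext (translate x U) i t.
Definition energy_at (x t : R) : R := cut_energy (translate x U) t.

Lemma energy_at_ge0 (x t : R) : 0 < t -> 0 <= energy_at x t.
Proof. exact: cut_energy_ge0. Qed.

Lemma energy_at_mono (x t s : R) : 0 < t -> t <= s -> energy_at x t <= energy_at x s.
Proof. exact: (cut_energy_mono (harmonic_field_translate x hU)). Qed.

Lemma energy_at_le (x t : R) : 0 < t -> energy_at x t <= total_energy U.
Proof. by move=> t0; rewrite -(total_energy_translate x hU); exact: (cut_energy_total_energy (harmonic_field_translate x hU)). Qed.

Lemma ext_at_dist (x t s : R) i : 0 < t -> t <= s -> `|ext_at x t i - ext_at x s i| <= @C_flow R * energy_at x s.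
Proof. exact: (poisson_ext_dist _ (harmonic_field_translate x hU)). Qed.

Lemma ext_at_norm (x t : R) : 0 < t -> 1 - \sum_j ext_at x t j ^+ 2 <= 2^-1 * energy_at x t.
Proof. exact: (poisson_ext_norm (harmonic_field_translate x hU)). Qed.

Lemma ext_at_le1 (x t : R) : 0 < t -> \sum_j ext_at x t j ^+ 2 <= 1.
Proof. exact: (poisson_ext_le1 (harmonic_field_translate x hU)). Qed.

Lemma translate_translate (h x : R) : translate h (translate x U) = translate (x + h) U.
Proof. by apply/funext => i; apply/funext => y; rewrite /translate; congr (U i _); ring. Qed.

Lemma ext_at_slide (x h t : R) : 0 < t -> `|h| <= t ->
  \sum_j (ext_at (x + h) t j - ext_at x t j) ^+ 2 <= 2 * (`|h| / t) ^+ 2 * energy_at x t.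
Proof. by move=> t0 ht; have := poisson_ext_slide (harmonic_field_translate x hU) t0 ht; rewrite translate_translate. Qed.

Definition height (n : nat) : R := n.+1%:R^-1.

Lemma height_gt0 n : 0 < height n. Proof. by rewrite invr_gt0. Qed.

Lemma height_small (e : R) : 0 < e -> exists N, forall n, (N <= n)%N -> height n <= e.
Proof.
move=> e0; exists (Num.truncn e^-1) => n hn; rewrite /height -[leRHS]invrK lef_pV2 ?posrE ?invr_gt0//.
by apply: le_trans (ltW (truncnS_gt _)) _; rewrite ler_nat ltnS.
Qed.

Lemma height_le n k : (n <= k)%N -> height k <= height n.
Proof. by move=> nk; rewrite lef_pV2 ?posrE// ler_nat ltnS. Qed.

(** The energy is nondecreasing in the height, and by [poisson_ext_flow] so is the extension plus C_flow times the energy;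
    both are bounded. *)
Lemma ext_at_cvg (x : R) i : cvgn (fun n => ext_at x (height n) i).
Proof.
have hx := harmonic_field_translate x hU.
have C0 := @C_flow_ge0 R.
have cF : cvgn (fun n => @C_flow R * energy_at x (height n)).
  apply: nonincreasing_is_cvgn => [n k nk|].
    by apply: ler_wpM2l => //; apply: energy_at_mono (height_gt0 _) (height_le nk).
  by exists 0 => _ [n _ <-]; rewrite mulr_ge0// energy_at_ge0// height_gt0.
have cG : cvgn (fun n => ext_at x (height n) i + @C_flow R * energy_at x (height n)).
  apply: nonincreasing_is_cvgn => [n k nk|].
    have := height_le nk; rewrite le_eqVlt => /orP[/eqP -> //|lt].
    have := poisson_ext_flow i hx (height_gt0 k) lt; rewrite ler_norml => /andP[_].
    rewrite -/(ext_at x (height k) i) -/(ext_at x (height n) i) -/(energy_at x (height k)) -/(energy_at x (height n)) mulrBr.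
    move: (@C_flow R * _) (@C_flow R * _) (ext_at _ _ _) (ext_at _ _ _) => a b c d; lra.
  exists (-1) => _ [n _ <-].
  have h1 : 0 <= @C_flow R * energy_at x (height n) by rewrite mulr_ge0// energy_at_ge0// height_gt0.
  have h2 : ext_at x (height n) i ^+ 2 <= 1.
    apply: le_trans (ext_at_le1 x (height_gt0 n)).
    by rewrite (bigD1 i)//= lerDl; apply: sumr_ge0 => k _; exact: sqr_ge0.
  by have := sqr_le1_geN1 h2; lra.
rewrite (_ : (fun n => ext_at x (height n) i) = (fun n => ext_at x (height n) i + @C_flow R * energy_at x (height n)) - (fun n => @C_flow R * energy_at x (height n))).
  exact: is_cvgB.
by apply/funext => n; rewrite fctE /= addrK.
Qed.

(** The continuous representative, as the limit of the extension at heights 1 / (n + 1). *)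
Definition bdry (x : R) (i : 'I_m) : R := limn (fun n => ext_at x (height n) i).

Lemma bdry_cvg (x : R) i : ext_at x (height n) i @[n --> \oo] --> bdry x i.
Proof. exact: ext_at_cvg. Qed.

Lemma bdry_dist (x s : R) i : 0 < s -> `|bdry x i - ext_at x s i| <= @C_flow R * energy_at x s.
Proof.
move=> s0; apply/ler_addgt0Pr => e e0.
have /cvgE/(_ e e0)[N HN] := @bdry_cvg x i; have [M HM] := height_small s0.
have h1 := HN (N + M)%N (leq_addr _ _); have h2 := ext_at_dist x i (height_gt0 (N + M)) (HM _ (leq_addl _ _)).
have := ler_normD (bdry x i - ext_at x (height (N + M)) i) (ext_at x (height (N + M)) i - ext_at x s i).
rewrite addrA subrK distrC in h1 *; move: h1 h2; lra.
Qed.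

Lemma ae_sqr0 (g : R -> R) : sqi mu g -> (\int[mu]_x g x ^+ 2 <= 0)%R -> {ae mu, forall x, g x = 0}.
Proof.
move=> [mg ig] H.
have mE : measurable_fun setT (EFin \o (fun x => g x ^+ 2)) by apply/measurable_EFinP; exact: intg_meas ig.
have /(ae_eq_integral_abs mu measurableT mE) : (\int[mu]_(x in setT) `|(g x ^+ 2)%:E| = 0)%E.
  transitivity (\int[mu]_x (g x ^+ 2)%:E)%E.
    by apply: eq_integral => x _; rewrite /= ger0_norm ?sqr_ge0.
  rewrite (RiE ig); congr EFin; apply/eqP; rewrite eq_le H /=.
  by apply: Ri_ge0 => x; exact: sqr_ge0.
move=> Hae; apply: (@filterS _ _ (ae_filter_ringOfSetsType mu) _ _ _ Hae) => x /(_ I) /= [].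
by move=> /eqP; rewrite sqrf_eq0 => /eqP.
Qed.

(** Cauchy-Schwarz in the Poisson mean, and y^2 P(y) <= t. *)
Lemma poisson_L2 (t : R) i : 0 < t ->
  sqi mu (fun x => ext_at x t i - U i x) /\
  (\int[mu]_x (ext_at x t i - U i x) ^+ 2 <= t * \int[m2]_z (D (U i) z ^+ 2))%R.
Proof.
move=> t0; have [hu sU _] := hU; have [ip ep] := poisson_mass t0; have [pp p2] := @pipi R.
pose F (z : R * R) := poisson t z.2 * (U i (z.2 + z.1) - U i z.1) ^+ 2.
have [iS eS] := intg_shear (sU i).2.
have m1 : measurable_fun setT (fun z : R * R => U i z.1) by exact: (measurableT_comp (hu.1 i) measurable_fst).
have m12 : measurable_fun setT (fun z : R * R => U i (z.2 + z.1)).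
  by apply: (measurableT_comp (hu.1 i)); exact: measurable_funD.
have mF : measurable_fun setT F.
  apply: measurable_funM; first exact: (measurableT_comp (meas_poisson t) measurable_snd).
  by apply: measurable_funX; exact: measurable_funB.
have F0 z : 0 <= F z by apply: mulr_ge0; [exact: poisson_ge0|exact: sqr_ge0].
have bF z : F z <= t * D (U i) (z.1, z.1 + z.2) ^+ 2.
  rewrite /F /D /poisson /= (addrC z.2) (_ : z.1 - (z.1 + z.2) = - z.2); last by ring.
  have Y0 := den_gt0 z.2 t0.
  have [->|z20] := eqVneq z.2 0.
    by rewrite addr0 subrr expr0n mulr0 mulr_ge0 ?sqr_ge0 ?(ltW t0).
  have sq : 0 < z.2 ^+ 2 by rewrite exprn_even_gt0.
  rewrite -subr_ge0 (_ : _ - _ = t * ((U i z.1 - U i (z.1 + z.2)) ^+ 2 * t ^+ 2) / (z.2 ^+ 2 * (z.2 ^+ 2 + t ^+ 2))); last first.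
    by field; rewrite z20 gt_eqF.
  apply: divr_ge0; last by apply: mulr_ge0; exact: ltW.
  by apply: mulr_ge0; [exact: ltW|apply: mulr_ge0; exact: sqr_ge0].
have iF : intg m2 F.
  by apply: (@intg_le _ _ _ m2 _ _ mF (intgZ t iS)) => z; rewrite ger0_norm.
have [iM eM] := Ri_fubini1 iF.
have mP : measurable_fun setT (fun x => ext_at x t i).
  apply: measurable_funM => //.
  apply: (@meas_Ri _ _ _ _ _ mu (fun z : R * R => U i (z.2 + z.1) * poisson t z.2)).
  by apply: measurable_funM => //; exact: (measurableT_comp (meas_poisson t) measurable_snd).
have mG : measurable_fun setT (fun x => ext_at x t i - U i x) by apply: measurable_funB => //; exact: hu.1.
have pw x : (ext_at x t i - U i x) ^+ 2 <= (\int[mu]_y F (x, y))%R.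
  have mU : measurable_fun setT (fun y : R => U i (y + x) - U i x).
    by apply: measurable_funB => //; apply: meas_shift; exact: hu.1.
  have bU y : `|U i (y + x) - U i x| <= 2.
    by apply: le_trans (ler_normB _ _) _; have := unit_le1 i (y + x) hu; have := unit_le1 i x hu; lra.
  have := cs_weight (fun y => poisson_ge0 y t0) ip mU bU; rewrite ep.
  have -> : (\int[mu]_y (poisson t y * (U i (y + x) - U i x)))%R = pi * (ext_at x t i - U i x).
    have [hux _ _] := harmonic_field_translate x hU; have ix := intg_poisson_ext i hux t0.
    transitivity (\int[mu]_y (translate x U i y * poisson t y - U i x * poisson t y))%R; first by apply: Ri_eq => y; rewrite /translate; ring.
    by rewrite (RiB ix (intgZ _ ip)) (RiZ _ ip) ep mulrBr (pi_poisson_ext (translate x U)) (mulrC pi).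
  rewrite -/(F (x, _)) exprMn => H.
  have H' : pi ^+ 2 * (ext_at x t i - U i x) ^+ 2 <= pi * (\int[mu]_y F (x, y))%R by exact: H.
  have I0 : 0 <= (\int[mu]_y F (x, y))%R by apply: Ri_ge0 => y; exact: F0.
  move: H' I0; move: (_ - _) (\int[mu]_y _)%R => a b.
  have := sqr_ge0 a; move: pp p2; move: (pi : R) => p *.
  have : p * (p * a ^+ 2) <= p * b by lra.
  by rewrite ler_pM2l; nra.
have ig : intg mu (fun x => (ext_at x t i - U i x) ^+ 2).
  apply: (@intg_le _ _ _ mu _ _ _ iM); first exact: measurable_funX.
  by move=> x; rewrite ger0_norm ?sqr_ge0.
split; first by split.
apply: le_trans (Ri_le ig iM pw) _.
rewrite -eM -eS -(RiZ _ iS); apply: Ri_le => //; exact: intgZ.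
Qed.

Lemma bdry_ae : {ae mu, forall x, forall i, U i x = bdry x i}.
Proof.
have [hu sU _] := hU.
apply: (@filter_forall _ _ _ _ (ae_filter_ringOfSetsType mu)) => i.
pose g x := bdry x i - U i x.
have mP n : measurable_fun setT (fun x => ext_at x (height n) i - U i x) := (poisson_L2 i (height_gt0 n)).1.1.
have cg x : ext_at x (height n) i - U i x @[n --> \oo] --> g x.
  by apply: cvgB; [exact: bdry_cvg|exact: cvg_cst].
have mg : measurable_fun setT g by apply: (measurable_fun_cvg mP) => x _; exact: cg.
pose G := (\int[m2]_z (D (U i) z ^+ 2))%R.
have G0 : 0 <= G by apply: Ri_ge0 => z; exact: sqr_ge0.
have s0 : sqi mu (fun=> 0 : R) by split => //; under eq_fun do rewrite expr0n; exact: intg0.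
have key e : 0 < e -> sqi mu g /\ (\int[mu]_x g x ^+ 2 <= e)%R.
  move=> e0; have G1 : 0 < G + 1 by lra.
  have [N HN] := height_small (divr_gt0 e0 G1).
  have [] := @weak_cvg _ _ _ mu (fun=> 0) (fun n x => ext_at x (height (n + N)) i - U i x) g e s0.
  - by move=> n; exact: (poisson_L2 i (height_gt0 _)).1.
  - exact: mg.
  - by apply: aeW => x; have := cg x; rewrite -(cvg_shiftn N).
  - move=> n; apply: le_trans (poisson_L2 i (height_gt0 _)).2 _.
    apply: (@le_trans _ _ (e / (G + 1) * G)); first by apply: ler_wpM2r => //; apply: HN; exact: leq_addl.
    by rewrite mulrAC ler_pdivrMr// ler_pM2l// lerDl.
  by [].
have [sg _] := key 1 ltr01.
have H0 : (\int[mu]_x g x ^+ 2 <= 0)%R.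
  by apply/ler_addgt0Pr => e e0; rewrite add0r; exact: (key e e0).2.
have H := ae_sqr0 sg H0.
apply: (@filterS _ _ (ae_filter_ringOfSetsType mu) _ _ _ H) => x /eqP.
by rewrite subr_eq0 => /eqP.
Qed.

End Trace.

(** * Decay of the energy and Hoelder continuity *)

Section Profile.
Context {R : realType}.

(** The growth, in units of T, of the bound for |U(x + z) - c|^2 when c is the extension at height T: quadratic
    inside by [poisson_ext_slide], and like a square root outside because the decay of the energy is known above scale T. *)
Definition growth (w : R) : R := if `|w| <= 1 then w ^+ 2 else Num.sqrt `|w|.

Lemma growth_in (x T : R) : 0 < T -> `|x| <= T -> growth (x / T) = (x / T) ^+ 2.
Proof. by move=> T0 xT; rewrite /growth normrM normfV (gtr0_norm T0) ler_pdivrMr// mul1r xT. Qed.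

Lemma growth_out (x T : R) : 0 < T -> T < `|x| -> growth (x / T) = Num.sqrt (`|x| / T).
Proof. by move=> T0 xT; rewrite /growth normrM normfV (gtr0_norm T0) ler_pdivrMr// mul1r leNgt xT. Qed.

Lemma sqr_le_sqrt (y : R) : 0 <= y -> y <= 1 -> y ^+ 2 <= Num.sqrt y.
Proof.
move=> y0 y1; have s0 := sqrtr_ge0 y; have ss := sqr_sqrtr y0.
have s1 : Num.sqrt y <= 1 by rewrite -(@ler_pXn2r _ 2)// ?nnegrE// ss expr1n.
rewrite -[X in X ^+ 2]ss -exprM -[leRHS]expr1; exact: ler_wiXn2l.
Qed.

(** The mean of this profile at scale r is of order r / T. *)
Lemma growth_kap (r T x : R) : 0 < r -> 0 < T -> growth (x / T) * poisson r x <= 2 * (r / T ^+ 2) * kap (x / T).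
Proof.
move=> r0 T0; have X0 := den_gt0 x r0; have T2 : 0 < T ^+ 2 by rewrite exprn_gt0.
set w := x / T; have ex : x = w * T by rewrite /w divfK// gt_eqF.
have rX : x ^+ 2 * poisson r x <= r.
  rewrite /poisson mulrCA -[leRHS]mulr1; apply: ler_wpM2l; first exact: ltW.
  by rewrite ler_pdivrMr// mul1r lerDl sqr_ge0.
have k0 : 0 <= r / T ^+ 2 by rewrite divr_ge0// ltW.
have p0 := poisson_ge0 x r0.
have s0 := sqrtr_ge0 `|w|; have ss : Num.sqrt `|w| ^+ 2 = `|w| by rewrite sqr_sqrtr.
have rX' : w ^+ 2 * poisson r x <= r / T ^+ 2.
  by rewrite ler_pdivlMr// mulrAC -exprMn -ex.
rewrite /growth /kap; case: ifP => w1.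
  have [w0|w0] := eqVneq w 0.
    rewrite w0 expr0n/= mul0r; apply: mulr_ge0; first exact: mulr_ge0.
    by rewrite invr_ge0 mulr_ge0 ?sqrtr_ge0// addr_ge0.
  have a0 : 0 < `|w| by rewrite normr_gt0.
  apply: le_trans rX' _; rewrite (mulrC 2) -mulrA ler_pMr ?divr_gt0// ler_pdivlMr ?mul1r ?mulr_gt0 ?sqrtr_gt0 ?addr_gt0//.
  move: ss s0 w1 a0; move: (`|w|) (Num.sqrt _) => a s ss s0 a1 a0.
  have s1 : s <= 1 by nra.
  nra.
have a1 : 1 < `|w| by rewrite ltNge w1.
have sp : 0 < Num.sqrt `|w| by rewrite sqrtr_gt0; lra.
rewrite ler_pdivlMr ?mulr_gt0 ?addr_gt0//; last by lra.
have e : w ^+ 2 = `|w| ^+ 2 by rewrite real_normK ?num_real.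
rewrite e in rX'.
move: ss s0 a1 sp rX' k0 p0; move: (`|w|) (Num.sqrt _) (r / _) (poisson _ _) => a s k p ss s0 a1 sp h k0 p0.
have : s * p * (s * (1 + a)) = (a * p) * (1 + a) by rewrite -ss; ring.
move=> ->; have : 0 <= p * a * (a - 1) by rewrite !mulr_ge0//; lra.
lra.
Qed.

End Profile.

(** The constant of [cut_energy_decay]. *)
Definition C_decay {R : realType} : R := 18496 * pi.

Lemma C_decay_ge0 {R : realType} : 0 <= @C_decay R.
Proof. by apply: mulr_ge0; [exact: ler0n|exact: pi_ge0]. Qed.

Lemma tail_bound (R : realType) (E S r L : R) : 0 < S -> 0 < r -> r <= S -> 0 <= E ->
  12 * E <= L * Num.sqrt S -> 6 * (r ^+ 2 / S ^+ 2) * E <= 2^-1 * (L * Num.sqrt r).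
Proof.
move=> S0 r0 rS E0 hL.
have y0 : 0 <= r / S by rewrite divr_ge0 ?(ltW r0) ?(ltW S0).
have y1 : r / S <= 1 by rewrite ler_pdivrMr// mul1r.
have es : Num.sqrt r = Num.sqrt S * Num.sqrt (r / S).
  by rewrite -sqrtrM ?(ltW S0)// mulrCA divff ?gt_eqF// mulr1.
have yy := sqr_le_sqrt y0 y1.
rewrite -expr_div_n es.
have h1 := ler_wpM2r (sqrtr_ge0 (r / S)) hL.
have h2 := ler_wpM2l E0 yy.
move: h1 h2; move: (_ ^+ 2) (Num.sqrt (r / S)) (Num.sqrt S) => y s t h1 h2; lra.
Qed.

Lemma improve_end (R : realType) (A ps l q k e p c f tl : R) : 0 <= A -> 0 <= l -> 0 <= q ->
  ps <= l * (2 * k * e * p + c * q ^+ 2) -> A * (2 * k * p) * e <= 4^-1 * q -> A * c * q <= 4^-1 ->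
  tl <= 2^-1 * (l * q) -> f <= A * ps + tl -> f <= l * q.
Proof.
move=> A0 l0 q0 hps h1 h2 ht hf.
have a1 := ler_wpM2l A0 hps; have a2 := ler_wpM2l l0 h1.
have a3 := ler_wpM2l (mulr_ge0 l0 q0) h2; lra.
Qed.

Lemma deviation_end (R : realType) (k E l s1 s2 f2 g2 g a : R) : s1 <= 2 * (k * f2 + 2 * g) -> s2 <= k * g2 ->
  k * f2 <= k * (E * l) -> k * g2 <= k * (E * l) -> g <= l -> 0 <= a ->
  2 * (s1 + s2) <= a + (6 * k * E + 8) * l.
Proof. lra. Qed.

Lemma choose_constants (R : realType) (A B k : R) : 0 <= A -> 0 <= B -> 9 <= k ->
  exists q e : R, [/\ 0 < q < 1, A * q <= 4^-1, 0 < e, e * k <= 1 & B * e <= 4^-1 * q].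
Proof.
move=> A0 B0 k9; pose q : R := (2 + 4 * A)^-1.
have q0 : 0 < q by rewrite invr_gt0; lra.
have q1 : q < 1 by rewrite invf_lt1; lra.
have hq : A * q <= 4^-1 by rewrite /q ler_pdivrMr; lra.
have dk : 0 < k by lra.
have dB : 0 < 4 * B + 1 by lra.
exists q, (q / (k * (4 * B + 1))); split; rewrite ?q0 ?q1//.
- by rewrite divr_gt0// mulr_gt0.
- rewrite (_ : _ * k = q / (4 * B + 1)); last by field; rewrite !gt_eqF.
  by rewrite ler_pdivrMr//; lra.
rewrite (_ : B * _ = (4^-1 * q) * (4 * B / (k * (4 * B + 1)))); last by field; rewrite !gt_eqF.
rewrite ler_piMr ?mulr_ge0 ?(ltW q0)// ler_pdivrMr ?mulr_gt0// mul1r; nra.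
Qed.

Section Decay.
Context {R : realType} {m : nat}.
Notation mu := (@lebesgue_measure R).
Notation m2 := (mu \x mu)%E.
Variable U : 'I_m -> R -> R.
Hypothesis hU : harmonic_field U.

Notation F := (energy_at U).
Notation P := (ext_at U).
Notation v := (bdry U).
Definition C_osc : R := m%:R * @C_flow R ^+ 2.
Definition C_holder : R := 6 * C_osc * total_energy U + 8.
Definition mass_kap : R := (\int[mu]_x kap x)%R.

Lemma C_osc_ge0 : 0 <= C_osc.
Proof. by rewrite mulr_ge0 ?sqr_ge0. Qed.

Lemma C_holder_ge8 : 8 <= C_holder.
Proof. by rewrite lerDr mulr_ge0 ?total_energy_ge0// mulr_ge0// C_osc_ge0. Qed.

Lemma mass_kap_ge0 : 0 <= mass_kap.
Proof. by apply: Ri_ge0 => x; rewrite kap_ge0. Qed.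

Lemma sum_sq_le (a : 'I_m -> R) (b : R) : (forall i, `|a i| <= @C_flow R * b) -> \sum_i a i ^+ 2 <= C_osc * b ^+ 2.
Proof.
move=> H; apply: (@le_trans _ _ (\sum_(i < m) (@C_flow R * b) ^+ 2)).
  by apply: ler_sum => i _; apply: sqr_bound.
by rewrite sumr_const card_ord /C_osc exprMn -[leLHS]mulr_natl mulrA.
Qed.

Lemma sum_sq_tri (a b c : 'I_m -> R) :
  \sum_i (a i - c i) ^+ 2 <= 2 * (\sum_i (a i - b i) ^+ 2 + \sum_i (b i - c i) ^+ 2).
Proof.
rewrite -big_split/= mulr_sumr; apply: ler_sum => i _.
by have := sqr_ge0 (a i - b i - (b i - c i)); lra.
Qed.

Lemma bdry_near (x h t : R) : 0 < t -> `|h| <= t ->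
  \sum_i (v (x + h) i - P x t i) ^+ 2 <= 2 * (C_osc * F (x + h) t ^+ 2 + 2 * (`|h| / t) ^+ 2 * F x t).
Proof.
move=> t0 ht; apply: le_trans (sum_sq_tri _ (P (x + h) t) _) _.
apply: ler_wpM2l => //; apply: lerD; last exact: (ext_at_slide hU x t0 ht).
by apply: sum_sq_le => i; exact: (bdry_dist hU).
Qed.

Lemma ext_at_near (x t s : R) : 0 < t -> t <= s -> \sum_i (P x s i - P x t i) ^+ 2 <= C_osc * F x s ^+ 2.
Proof. by move=> t0 ts; apply: sum_sq_le => i; rewrite distrC; exact: (ext_at_dist hU). Qed.

Section Step.
Variables (e S0 L : R).
Hypotheses (S00 : 0 < S0) (L0 : 0 <= L) (Fe0 : forall x, F x S0 <= e).

Lemma energy_at_eps (x r : R) : 0 < r -> r <= S0 -> F x r <= e.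
Proof. by move=> r0 rS; apply: le_trans (Fe0 x); exact: (energy_at_mono hU). Qed.

(** U(x + z) is compared with the extension above x + z at height max (T, |z|), then with the extension above x
    at that height, and then with c. *)
Lemma deviation (x T z : R) : 0 < T -> T <= S0 -> (forall y r, T <= r -> F y r <= L * Num.sqrt r) ->
  \sum_i (v (x + z) i - P x T i) ^+ 2 <= (L * Num.sqrt T) * (2 * C_osc * e + C_holder * growth (z / T)).
Proof.
move=> T0 TS HT; have K0 := C_osc_ge0; have E0 := total_energy_ge0 U; have c9 := C_holder_ge8.
have e0 : 0 <= e by apply: le_trans (Fe0 0); exact: energy_at_ge0.
have sq (y r a : R) : 0 < r -> F y r <= a -> T <= r -> F y r ^+ 2 <= a * (L * Num.sqrt r).
  by move=> r0 ha Tr; rewrite expr2; apply: ler_pM; rewrite ?energy_at_ge0//; exact: HT.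
have s0 := sqrtr_ge0 T; have LT0 : 0 <= L * Num.sqrt T by exact: mulr_ge0.
have [zT|zT] := leP `|z| T.
  rewrite growth_in//.
  apply: le_trans (bdry_near x T0 zT) _.
  have h1 := sq (x + z) T e T0 (energy_at_eps _ T0 TS) (lexx _).
  have h2 := HT x T (lexx _).
  (* |z| <= T: both the deviation of U from its extension and the shift are taken at height T. *)
  have ew : (`|z| / T) ^+ 2 = (z / T) ^+ 2 by rewrite !exprMn real_normK ?num_real.
  rewrite ew; have w0 := sqr_ge0 (z / T).
  have := ler_wpM2l K0 h1; have := ler_wpM2l w0 h2.
  have : 0 <= (L * Num.sqrt T) * ((z / T) ^+ 2 * (C_holder - 4)).
    by apply: mulr_ge0 => //; apply: mulr_ge0 => //; lra.
  move: (L * _) ((z / T) ^+ 2) (F _ _) (F _ _) => l w f g; nra.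
(* |z| > T: pass through the extension above x at height |z|. *)
have z0 : 0 < `|z| := lt_trans T0 zT.
rewrite growth_out//.
apply: le_trans (sum_sq_tri _ (P x `|z|) _) _.
have h1 := bdry_near x z0 (lexx _); have h2 := ext_at_near x T0 (ltW zT).
rewrite divff ?gt_eqF// expr1n mulr1 in h1.
have h3 := sq (x + z) `|z| (total_energy U) z0 (energy_at_le hU _ z0) (ltW zT).
have h4 := sq x `|z| (total_energy U) z0 (energy_at_le hU _ z0) (ltW zT).
have h5 := HT x `|z| (ltW zT).
have es : Num.sqrt `|z| = Num.sqrt T * Num.sqrt (`|z| / T).
  by rewrite -sqrtrM ?(ltW T0)// mulrCA divff ?gt_eqF// mulr1.
have a0 : 0 <= L * Num.sqrt T * (2 * C_osc * e) by apply: mulr_ge0 => //; apply: mulr_ge0 => //; exact: mulr_ge0.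
have h3' := ler_wpM2l K0 h3; have h4' := ler_wpM2l K0 h4.
have -> : L * Num.sqrt T * (2 * C_osc * e + C_holder * Num.sqrt (`|z| / T)) = L * Num.sqrt T * (2 * C_osc * e) + C_holder * (L * Num.sqrt `|z|).
  by rewrite es; ring.
exact: (deviation_end h1 h2 h3' h4' h5 a0).
Qed.

(** U is within a multiple of e of the extension at height S0, hence of c, and |c|^2 >= 1 - e / 2. *)
Lemma half_dot (x T z : R) : 0 < T -> T <= S0 -> e * (6 * C_osc + 9) <= 1 -> `|z| <= S0 -> \sum_i v (x + z) i ^+ 2 = 1 ->
  2^-1 <= \sum_i v (x + z) i * P x T i.
Proof.
move=> T0 TS he zS v1; have K0 := C_osc_ge0.
have e0 : 0 <= e by apply: le_trans (Fe0 0); exact: energy_at_ge0.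
have h1 := bdry_near x S00 zS; have h2 := ext_at_near x T0 TS.
have h3 := sum_sq_tri (v (x + z)) (P x S0) (P x T).
have n1 := ext_at_norm hU x T0; have fT := energy_at_eps x T0 TS.
have sq y : F y S0 ^+ 2 <= e * e by rewrite expr2; apply: ler_pM; rewrite ?energy_at_ge0.
have w1 : (`|z| / S0) ^+ 2 <= 1.
  rewrite -[leRHS](expr1n _ 2); apply: lerXn2r; rewrite ?nnegrE ?divr_ge0 ?(ltW S00)//.
  by rewrite ler_pdivrMr// mul1r.
have h4 : (`|z| / S0) ^+ 2 * F x S0 <= e.
  by rewrite -[leRHS]mul1r; apply: ler_pM; rewrite ?sqr_ge0 ?energy_at_ge0.
have d : \sum_i (v (x + z) i - P x T i) ^+ 2 = 1 + \sum_i P x T i ^+ 2 - 2 * \sum_i v (x + z) i * P x T i.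
  transitivity (\sum_i v (x + z) i ^+ 2 + \sum_i P x T i ^+ 2 - 2 * \sum_i v (x + z) i * P x T i); last by rewrite v1.
  rewrite mulr_sumr -big_split -sumrB; apply: eq_bigr => i _ /=; ring.
rewrite d in h3.
have h5 := ler_wpM2l K0 (sq (x + z)); have h6 := ler_wpM2l K0 (sq x).
rewrite -mulrA in h1.
move: h1 h2 h3 n1 fT h4 h5 h6.
move: (\sum_i _) (\sum_i _) (\sum_i _) (\sum_i _) (_ * F x S0) (F x T) (F x S0 ^+ 2) (F (x + z) S0 ^+ 2) => a b c d' w f g k.
have K1 : e <= 1 by nra.
have : C_osc * (e * e) <= C_osc * e by apply: ler_wpM2l => //; nra.
nra.
Qed.

(** From scales above T down to r = q^2 T.  By [cut_energy_decay] the energy at scale r is at most the Poisson mean of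
    |U - c|^2, which by [deviation] and [growth_kap] is at most L sqrt T times C (e + q^2); the target is
    L sqrt r = q L sqrt T, so small q, and then small e, win. *)
Lemma improve (x T q r : R) : 0 < q -> q < 1 -> 0 < T -> T <= S0 -> r = q ^+ 2 * T ->
  (forall y r, T <= r -> F y r <= L * Num.sqrt r) ->
  e * (6 * C_osc + 9) <= 1 -> C_decay * (2 * C_osc * pi) * e <= 4^-1 * q ->
  C_decay * (2 * C_holder * mass_kap) * q <= 4^-1 -> 12 * total_energy U <= L * Num.sqrt S0 ->
  F x r <= L * Num.sqrt r.
Proof.
move=> q0 q1 T0 TS er HT he1 he2 hq hL.
have r0 : 0 < r by rewrite er mulr_gt0// exprn_gt0.
have hx := harmonic_field_translate x hU; have [hux _ _] := hx.
have c1 := ext_at_le1 hU x T0.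
have [ip ep] := poisson_mass r0; have p0 := pi_gt0 R.
have vae : {ae mu, forall z, forall i, translate x U i z = v (x + z) i}.
  have H := bdry_ae hx; apply: (@filterS _ _ (ae_filter_ringOfSetsType mu) _ _ _ H) => z Hz i.
  by rewrite Hz /bdry; congr (limn _); apply/funext => n; rewrite /ext_at translate_translate.
have H8 : cut_energy (translate x U) r <= C_decay * mean_dist (translate x U) (P x T) r + 6 * (r ^+ 2 / S0 ^+ 2) * total_energy (translate x U).
  apply: cut_energy_decay => //.
  apply: (@filterS _ _ (ae_filter_ringOfSetsType mu) _ _ _ vae) => z Hz zS.
  have v1 : \sum_i v (x + z) i ^+ 2 = 1.
    by rewrite -(hux.2 z); apply: eq_bigr => i _; rewrite Hz.
  have := half_dot T0 TS he1 zS v1.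
  by rewrite (eq_bigr (fun j => translate x U j z * P x T j))// => i _; rewrite Hz.
have T2 : 0 < T ^+ 2 by rewrite exprn_gt0.
have Ti : T^-1 != 0 by rewrite invr_eq0 gt_eqF.
have ik := intg_scale Ti (@intg_kap R); have ek := Ri_scale Ti (@intg_kap R).
have LT0 : 0 <= L * Num.sqrt T by rewrite mulr_ge0// sqrtr_ge0.
have hPS : mean_dist (translate x U) (P x T) r <= L * Num.sqrt T * (2 * C_osc * e * pi + 2 * C_holder * mass_kap * q ^+ 2).
  have iB := intgZ (L * Num.sqrt T * C_holder * (2 * (r / T ^+ 2))) ik.
  have iA := intgZ (L * Num.sqrt T * (2 * C_osc * e)) ip.
  apply: (@le_trans _ _ (\int[mu]_z (L * Num.sqrt T * (2 * C_osc * e) * poisson r z + L * Num.sqrt T * C_holder * (2 * (r / T ^+ 2)) * kap (T^-1 * z)))%R).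
    apply: Ri_ae_le; [exact: intg_mean_dist|exact: intgD|].
    apply: (@filterS _ _ (ae_filter_ringOfSetsType mu) _ _ _ vae) => z Hz.
    have -> : sqdist (translate x U) (P x T) z = \sum_i (v (x + z) i - P x T i) ^+ 2.
      by apply: eq_bigr => i _; rewrite Hz.
    have d := deviation x z T0 TS HT; have g := growth_kap z r0 T0.
    have pk0 := poisson_ge0 z r0; rewrite (mulrC T^-1).
    apply: le_trans (ler_wpM2r pk0 d) _.
    have c9 : 0 <= L * Num.sqrt T * C_holder by rewrite mulr_ge0//; apply: le_trans C_holder_ge8.
    have := ler_wpM2l c9 g.
    rewrite (_ : L * Num.sqrt T * (2 * C_osc * e + C_holder * growth (z / T)) * poisson r z = L * Num.sqrt T * (2 * C_osc * e) * poisson r z + L * Num.sqrt T * C_holder * (growth (z / T) * poisson r z)); last by ring.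
    by rewrite lerD2l !mulrA.
  rewrite (RiD iA iB) (RiZ _ ip) (RiZ _ ik) ep ek -/mass_kap gtr0_norm ?invr_gt0// invrK.
  rewrite le_eqVlt; apply/orP; left; apply/eqP; rewrite er; move: (pi : R) mass_kap C_holder C_osc (L * _) => p i c k l.
  by field; rewrite gt_eqF.
have sr : Num.sqrt r = q * Num.sqrt T by rewrite er sqrtrM ?sqr_ge0// sqrtr_sqr gtr0_norm.
have rS : r <= S0.
  apply: le_trans TS; rewrite er -[leRHS]mul1r; apply: ler_wpM2r; first exact: ltW.
  by rewrite expr_le1// ltW.
have tail : 6 * (r ^+ 2 / S0 ^+ 2) * total_energy (translate x U) <= 2^-1 * (L * Num.sqrt T * q).
  by have := tail_bound S00 r0 rS (total_energy_ge0 U) hL; rewrite (total_energy_translate x hU) sr (mulrC q) (mulrA L).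
rewrite sr mulrCA mulrC.
exact: (improve_end C_decay_ge0 LT0 (ltW q0) hPS he2 hq tail H8).
Qed.

End Step.

Lemma power_decay : exists2 L : R, 0 <= L & forall x r : R, 0 < r -> F x r <= L * Num.sqrt r.
Proof.
have K0 := C_osc_ge0; have E0 := total_energy_ge0 U; have c9 := C_holder_ge8; have I0 := mass_kap_ge0; have p0 := pi_gt0 R.
pose A : R := C_decay * (2 * C_holder * mass_kap); pose B : R := C_decay * (2 * C_osc * pi).
have A0 : 0 <= A by rewrite /A; do 2 (apply: mulr_ge0; rewrite ?C_decay_ge0//); apply: mulr_ge0 => //; apply: le_trans c9.
have B0 : 0 <= B by rewrite /B; apply: mulr_ge0; rewrite ?C_decay_ge0//; apply: mulr_ge0; [exact: mulr_ge0|exact: ltW].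
have k9 : 9 <= 6 * C_osc + 9 by rewrite lerDr mulr_ge0.
have [q [e [/andP[q0 q1] hq e0 he1 he2]]] := choose_constants A0 B0 k9.
(* S0 is the scale below which the energy is at most e; the iteration starts at q^2 S0. *)
have [S0 S00 HS] := cut_energy_small hU e0.
have s0 : 0 < Num.sqrt S0 by rewrite sqrtr_gt0.
pose L : R := 12 * total_energy U / (q * Num.sqrt S0).
have L0 : 0 <= L by rewrite divr_ge0 ?mulr_ge0 ?(ltW q0) ?(ltW s0).
exists L => //.
have LS : L * (q * Num.sqrt S0) = 12 * total_energy U by rewrite /L divfK// mulf_neq0 ?gt_eqF.
have hL : 12 * total_energy U <= L * Num.sqrt S0.
  rewrite -LS; apply: ler_wpM2l => //; rewrite -[leRHS]mul1r; apply: ler_wpM2r; exact: ltW.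
have H n : forall x r : R, (q ^+ 2) ^+ n * (q ^+ 2 * S0) <= r -> F x r <= L * Num.sqrt r.
  elim: n => [|n IH] x r.
    rewrite expr0 mul1r => hr; have qS : 0 < q ^+ 2 * S0 by rewrite mulr_gt0// exprn_gt0.
    apply: le_trans (energy_at_le hU x (lt_le_trans qS hr)) _.
    apply: (@le_trans _ _ (L * (q * Num.sqrt S0))); first by rewrite LS; lra.
    apply: ler_wpM2l => //.
    have -> : q * Num.sqrt S0 = Num.sqrt (q ^+ 2 * S0) by rewrite sqrtrM ?sqr_ge0// sqrtr_sqr gtr0_norm.
    exact: ler_wsqrtr.
  move=> hr; have [h|h] := leP ((q ^+ 2) ^+ n * (q ^+ 2 * S0)) r; first exact: IH.
  have q2 : 0 < q ^+ 2 by rewrite exprn_gt0.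
  have T1 : (q ^+ 2) ^+ n * (q ^+ 2 * S0) <= r / q ^+ 2.
    by rewrite ler_pdivlMr//; apply: le_trans hr; rewrite mulrAC -exprSr lexx.
  have T0 : 0 < r / q ^+ 2.
    by apply: lt_le_trans T1; rewrite !mulr_gt0// exprn_gt0.
  have TS : r / q ^+ 2 <= S0.
    rewrite ler_pdivrMr//; apply: le_trans (ltW h) _; rewrite mulrC -[leRHS]mulr1 (mulrC S0).
    apply: ler_wpM2l; first by rewrite mulr_ge0 ?(ltW q2) ?(ltW S00).
    by apply: exprn_ile1; rewrite ?(ltW q2)// expr_le1// ltW.
  apply: (@improve e S0 L S00 L0 HS x (r / q ^+ 2) q r) => //.
    by rewrite mulrCA divff ?mulr1// gt_eqF.
  by move=> y r' hr'; apply: IH; exact: le_trans hr'.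
move=> x r r0.
have q2 : 0 < q ^+ 2 by rewrite exprn_gt0.
have q21 : `|q ^+ 2| < 1 by rewrite gtr0_norm// expr_lt1// ltW.
have qS : 0 < q ^+ 2 * S0 by rewrite mulr_gt0.
have [N HN] := cvg0_le (cvg_expr q21) (divr_gt0 r0 qS).
by apply: (H N); rewrite -ler_pdivlMr//; exact: HN.
Qed.

Lemma bdry_sphere (x : R) : \sum_i v x i ^+ 2 = 1.
Proof.
have H1 : \sum_i ext_at U x (@height R n) i ^+ 2 @[n --> \oo] --> \sum_i v x i ^+ 2.
  apply: cvg_sumR => i; have c := @bdry_cvg _ _ _ hU x i.
  by under eq_fun do rewrite expr2; rewrite expr2; apply: cvgM.
have H2 : \sum_i ext_at U x (@height R n) i ^+ 2 @[n --> \oo] --> (1 : R).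
  apply/cvgE => e e0; have [S S0 HS] := cut_energy_small hU e0; have [N HN] := height_small S0.
  exists N => n hn; have t0 := @height_gt0 R n.
  have h1 := ext_at_le1 hU x t0; have h2 := ext_at_norm hU x t0.
  have h3 := energy_at_mono hU x t0 (HN n hn); have h4 := HS x.
  rewrite distrC ger0_norm ?subr_ge0//; apply: le_trans h2 _.
  rewrite -/(energy_at U x S) in h4; lra.
exact: cvg_unique H1 H2.
Qed.

(** Both values are compared with the extension above one of the points at the height of their distance. *)
Lemma bdry_holder : exists2 C : R, 0 <= C & forall x y : R, \sum_i (v x i - v y i) ^+ 2 <= C * Num.sqrt `|x - y|.
Proof.
have [L L0 HL] := power_decay; have c9 := C_holder_ge8; have K0 := C_osc_ge0.
exists (C_holder * L); first by rewrite mulr_ge0//; lra.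
move=> x y; have [->|xy] := eqVneq x y.
  rewrite big1 ?mulr_ge0 ?sqrtr_ge0//; first by lra.
  by move=> i _; rewrite subrr expr0n.
have t0 : 0 < `|x - y| by rewrite normr_gt0 subr_eq0.
have h1 := bdry_near y t0 (lexx _); rewrite (addrC y) subrK divff ?gt_eqF// expr1n mulr1 in h1.
have sq z : F z `|x - y| ^+ 2 <= total_energy U * (L * Num.sqrt `|x - y|).
  by rewrite expr2; apply: ler_pM; rewrite ?energy_at_ge0 ?(energy_at_le hU) ?HL.
have h2 : \sum_i (P y `|x - y| i - v y i) ^+ 2 <= C_osc * F y `|x - y| ^+ 2.
  by apply: sum_sq_le => i; rewrite distrC; exact: (bdry_dist hU).
apply: le_trans (sum_sq_tri _ (P y `|x - y|) _) _.
have h3 := ler_wpM2l K0 (sq x); have h4 := ler_wpM2l K0 (sq y); have h5 := HL y _ t0.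
rewrite -mulrA /C_holder; move: h1 h2 h3 h4 h5; move: (L * _) (\sum_i _) (\sum_i _) (F _ _) (F _ _) => l a b f g *.
lra.
Qed.

End Decay.

Section Conversions.
Context {R : realType}.

Lemma quarter_power (x : R) : 0 <= x -> Num.sqrt (Num.sqrt x) = x `^ 4^-1.
Proof.
move=> x0; rewrite -!powR12_sqrt ?sqrtr_ge0//.
  by rewrite -powRrM; congr (_ `^ _); field.
by rewrite powR12_sqrt// sqrtr_ge0.
Qed.

End Conversions.

Theorem theorem6p2 (R : realType) (m : nat) (hm : (1 <= m)%N)
    (u : R -> 'rV[R]_m) (hu : weak_half_harmonic u) :
  exists alpha : R, 0 < alpha < 1 /\
    exists v : R -> 'rV[R]_m,
      holder_sphere alpha v /\
      {ae (@lebesgue_measure R), forall x, u x = v x}.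
Proof.
have [U [hUu sU hE ae1]] := weak_harmonic_field hm hu.
have hU : harmonic_field U by split.
exists 4^-1; split; first by rewrite invr_gt0 invf_lt1//; apply/andP; split; lra.
exists (fun x => \row_i bdry U x i); split; last first.
  have ae2 := bdry_ae hU.
  apply: (@filterS2 _ _ (ae_filter_ringOfSetsType lebesgue_measure) _ _ _ _ ae1 ae2) => x h1 h2.
  by apply/rowP => i; rewrite mxE h1 h2.
split.
  move=> x; rewrite /sphere /= /enorm (eq_bigr (fun i => bdry U x i ^+ 2)); last by move=> i _; rewrite mxE.
  by rewrite (bdry_sphere hU) sqrtr1.
have [C C0 HC] := bdry_holder hU.
exists (Num.sqrt C) => x y; rewrite /enorm -quarter_power// -sqrtrM//.
rewrite ler_sqrt ?mulr_ge0 ?sqrtr_ge0//.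
by apply: le_trans (HC x y); rewrite (eq_bigr (fun i => (bdry U x i - bdry U y i) ^+ 2))// => i _; rewrite !mxE.
Qed.
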